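(* Let $\varsigma>0$ and let $\mathcal W:\mathbb R^{dr}\to[0,1]$ satisfy $\mathrm{supp}(\mathcal W)\subset[0,1]^{dr}$ and $|\mathcal W(x)-\mathcal W(x')|\le\frac1\varsigma|x-x'|_\infty$ for all $x,x'$. Assume: (a) (sub-Gaussian noise) there is $C_\varepsilon>0$ with $\mathbb E[|\varepsilon_{1j}|^k]^{1/k}\le C_\varepsilon\sqrt k$ for all $k\in\mathbb N$ and $j\in\{1,\dots,d\}$; (b) (encoder-decoder structure and smoothness) $f_0=f_{dec}\circ g_{enc,1}\circ g_{enc,0}$ satisfies the encoder-decoder assumption and the smoothness assumption of the context, with parameters $\tilde d, D, t_{dec},t_{enc,0},t_{enc,1}$, $\beta_{dec},\beta_{enc,0},\beta_{enc,1}\ge1$, $K\ge1$; (c) (functional dependence) $X_i=J(\varepsilon_i,\varepsilon_{i-1},\dots)$ and, with $L_{\mathcal G}=2dr\big(\frac2\varsigma+\frac{\mathrm{Lip}+K}{F}\big)$, $(\Delta(k))_{k\in\mathbb N_0}$ is a decreasing sequence of real numbers such that for some $\theta\in(0,1]$, $L_{\mathcal G}\cdot\sup_{l=1,\dots,r}\delta^X_{2\theta}(k-l)^\theta\le\Delta(k)$ for all $k\in\mathbb N_0$; $\Lambda^{dep}$ is the function associated with $\Delta$ in the context. Then there exists a constant $\mathbb C_L>0$ independent of $n$ such that the following holds. If $\mathrm{Lip}\ge\mathbb C_L$ and, for each $n$, $N\in\{1,\dots,n\}$ and the network parameters $L,L_1,p,s,F$ (with $N,L,L_1,p,s$ possibly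 depending on $n$) satisfy (i) $K\le F$; (ii) $\{\log_2(4(t_{enc,0}\vee\beta_{enc,0}))+\log_2(4(t_{enc,1}\vee\beta_{enc,1}))\}\log_2(n)\le L_1$ and $L_1+\log_2(4(t_{dec}\vee\beta_{dec}))\log_2(n)\le L\lesssim\log_2(n)$; (iii) $N\lesssim\min_{i\in\{1,\dots,L\}\setminus\{L_1\}}p_i$; (iv) $s\asymp N\log_2(n)$, then $$\mathbb E D(\hat f^{net,lip})\lesssim\Lambda^{dep}\Big(\frac{N\log(n)^3}{n}\Big)+N^{-2A},\qquad A:=\min\Big\{\frac{\beta_{dec}}{t_{dec}},\frac{\beta_{enc,0}}{t_{enc,0}},\frac{\beta_{enc,1}}{t_{enc,1}}\Big\}.$$
   Context: Notation: $x_n\lesssim y_n$ means $x_n\le Cy_n$ for all $n$ with a constant $C>0$ independent of $n$; $x_n\asymp y_n$ means $x_n\lesssim y_n$ and $y_n\lesssim x_n$. $|\cdot|_2$ is the Euclidean norm, $|\cdot|_\infty$ the maximum norm of the entries of a vector or matrix, $|\cdot|_0$ the number of nonzero entries. For $f:\mathbb R^{t}\to\mathbb R^d$, $\|f\|_\infty:=\sup_x|f(x)|_\infty$. $\|Z\|_q:=\mathbb E[|Z|^q]^{1/q}$ for a random variable $Z$ and $q>0$. $a\vee b=\max\{a,b\}$. Model: $d,r\in\mathbb N$ are fixed. $(X_i)_{i\in\mathbb Z}$ is a stationary $\mathbb R^d$-valued process with $X_i=f_0(\mathbb X_{i-1})+\varepsilon_i$, where $\mathbb X_{i-1}:=(X_{i-1},\dots,X_{i-r})\in\mathbb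 R^{dr}$, $f_0:\mathbb R^{dr}\to\mathbb R^d$ is measurable, and $\varepsilon_i=(\varepsilon_{i1},\dots,\varepsilon_{id})$, $i\in\mathbb Z$, are i.i.d. with $\mathbb E\varepsilon_i=0$, $\varepsilon_i$ independent of $(X_j)_{j<i}$. One observes $X_1,\dots,X_n$, $n>r$. Prediction error: for deterministic measurable $f:\mathbb R^{dr}\to\mathbb R^d$, $D(f):=\frac1d\mathbb E[|f(\mathbb X_r)-f_0(\mathbb X_r)|_2^2\,\mathcal W(\mathbb X_r)]$; for a random (data-dependent) $\hat f$, $D(\hat f)$ is $D(f)$ evaluated at $f=\hat f$. Empirical counterpart: $\hat R_n(f):=\frac1n\sum_{i=r+1}^n\frac1d|X_i-f(\mathbb X_{i-1})|_2^2\,\mathcal W(\mathbb X_{i-1})$. Encoder-decoder assumption: $f_0=f_{dec}\circ f_{enc}$, $f_{enc}=g_{enc,1}\circ g_{enc,0}$, with $\tilde d\in\{1,\dots,d\}$, $D\in\mathbb N$ (the integer $D$ is not to be confused with $D(f)$), $g_{enc,0}:\mathbb R^{dr}\to\mathbb R^D$, $g_{enc,1}:\mathbb R^D\to\mathbb R^{\tilde d}$, $f_{dec}:\mathbb R^{\tilde d}\to\mathbb R^d$; each component of $g_{enc,0}$, $g_{enc,1}$, $f_{dec}$ depends on at most $t_{enc,0}\in\{1,\dots,dr\}$, $t_{enc,1}\in\{1,\dots,D\}$, $t_{dec}\in\{1,\dots,\tilde d\}$ arguments respectively. Hölder balls: with $\lfloor\beta\rfloor:=\max\{k\in\mathbb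 N_0:k<\beta\}$, $C^\beta(P,K)$ is the set of $f:P\to\mathbb R$ whose partial derivatives up to order $\lfloor\beta\rfloor$ exist with $\sum_{|\alpha|<\beta}\|\partial^\alpha f\|_\infty+\sum_{|\alpha|=\lfloor\beta\rfloor}\sup_{x\ne y\in P}\frac{|\partial^\alpha f(x)-\partial^\alpha f(y)|}{|x-y|_\infty^{\beta-\lfloor\beta\rfloor}}\le K$. Vector-valued functions belong to it componentwise. Smoothness assumption: $g_{enc,0}\in C^{\beta_{enc,0}}([0,1]^{dr},K)$ with $g_{enc,0}([0,1]^{dr})\subset[0,1]^D$; $g_{enc,1}\in C^{\beta_{enc,1}}([0,1]^D,K)$ with $g_{enc,1}([0,1]^D)\subset[0,1]^{\tilde d}$; $f_{dec}\in C^{\beta_{dec}}([0,1]^{\tilde d},K)$. Networks: $\sigma(x)=\max\{x,0\}$, and $\sigma_v(x)=(\sigma(x_1-v_1),\dots,\sigma(x_m-v_m))'$ for $v\in\mathbb R^m$. For $L\in\mathbb N_0$ (number of hidden layers) and $p=(p_0,\dots,p_{L+1})\in\mathbb N^{L+2}$ (widths), a network with architecture $(L,p)$ is $f(x)=W^{(L)}\sigma_{v^{(L)}}W^{(L-1)}\sigma_{v^{(L-1)}}\cdots W^{(1)}\sigma_{v^{(1)}}W^{(0)}x$ with $W^{(i)}\in\mathbb R^{p_{i+1}\times p_i}$, $v^{(i)}\in\mathbb R^{p_i}$ (and $v^{(0)}:=0$). Here $p_0=dr$, $p_{L+1}=d$. For $L_1\in\{1,\dots,L\}$, $s\in\mathbb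 N$, $F>0$, $\mathcal F(L,L_1,p,s,F)$ is the set of such $f$ with all $|W^{(j)}|_\infty\vee|v^{(j)}|_\infty\le1$, $p_{L_1}=\tilde d$, $\sum_{j=0}^L(|W^{(j)}|_0+|v^{(j)}|_0)\le s$, and $\|f\|_\infty\le F$. For $\mathrm{Lip}>0$, $\mathcal F(L,L_1,p,s,F,\mathrm{Lip}):=\{f\in\mathcal F(L,L_1,p,s,F):\|f\|_{Lip}\le\mathrm{Lip}\}$, $\|f\|_{Lip}:=\sup_{x\neq x'}\frac{|f(x)-f(x')|_\infty}{|x-x'|_\infty}$. The estimator is any (measurable) minimizer $\hat f^{net,lip}\in\arg\min_{f\in\mathcal F(L,L_1,p,s,F,\mathrm{Lip})}\hat R_n(f)$. The quantities $F,\mathrm{Lip}$ do not depend on $n$. Functional dependence measure: $J:(\mathbb R^d)^{\mathbb N_0}\to\mathbb R^d$ is measurable and $X_i=J(\varepsilon_i,\varepsilon_{i-1},\dots)$. With $\varepsilon_{i-k}^*$ a copy of $\varepsilon_{i-k}$ independent of $(\varepsilon_j)_{j\in\mathbb Z}$, $X_i^{*(i-k)}:=J(\varepsilon_i,\dots,\varepsilon_{i-k+1},\varepsilon_{i-k}^*,\varepsilon_{i-k-1},\dots)$ and $\delta_q^X(k):=\sup_{j=1,\dots,d}\|X_{ij}-X_{ij}^{*(i-k)}\|_q$ for $k\ge0$, $\delta_q^X(k):=0$ for $k<0$. For $x\ge0$, $\tilde V(x):=x^{1/2}+\sum_{j=0}^\infty\min\{x^{1/2},\Delta(j)\}$; $\bar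 y(x)\in[0,\infty)$ is a number such that $\tilde V(\sqrt x\,\bar y(x))\le\bar y(x)$, and $\Lambda^{dep}(x):=\sqrt x\,\bar y(x)$.
   Formalization: The number ȳ(x) is required to be strictly positive for x>0; as literally defined ȳ(x)=0 is always allowed (Ṽ(0)=0), which would make Λ^dep vanish and give the false bound E D ≲ N^{-2A}. *)

(* Defs.v *)
From HB Require Import structures.
From mathcomp Require Import all_boot all_order all_algebra.
From mathcomp Require Import all_classical all_reals all_analysis.

Set Implicit Arguments.
Unset Strict Implicit.
Unset Printing Implicit Defensive.

Import Order.TTheory GRing.Theory Num.Theory.
Import numFieldNormedType.Exports.

Local Open Scope classical_set_scope.
Local Open Scope ring_scope.

(* Points of R^m are column vectors. The norm `|x| of MathComp-Analysis on
   'M[R]_(m, n) is the maximum norm of the entries. *)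

Section deterministic.
Context {R : realType}.

Definition log2 (x : R) : R := ln x / ln 2.

Definition norm2 m (x : 'cV[R]_m) : R := Num.sqrt (\sum_(j < m) x j 0 ^+ 2).

Definition norm0 m n (A : 'M[R]_(m, n)) : nat :=
  #|[pred ij : 'I_m * 'I_n | A ij.1 ij.2 != 0]|.

Definition sup_norm m n (f : 'cV[R]_m -> 'cV[R]_n) : \bar R :=
  ereal_sup [set `|f x|%:E | x in setT].

Definition lip_norm m n (f : 'cV[R]_m -> 'cV[R]_n) : \bar R :=
  ereal_sup [set (`|f x.1 - f x.2| / `|x.1 - x.2|)%:E
            | x in [set x : 'cV[R]_m * 'cV[R]_m | x.1 != x.2]].

(* x_n <~ y_n for the sample sizes n > n0. *)
Definition lesssim (n0 : nat) (x y : nat -> \bar R) : Prop :=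
  exists2 C : R, 0 < C &
    forall n : nat, (n0 < n)%N -> (x n <= C%:E * y n)%E.

Definition cube m : set 'cV[R]_m := [set x | forall j, 0 <= x j 0 <= 1].
Arguments cube m%_N _ : clear implicits.

Definition depends_on_at_most m (t : nat) (f : 'cV[R]_m -> R) : Prop :=
  exists2 S : {set 'I_m}, (#|S| <= t)%N &
    forall x y : 'cV[R]_m, (forall i, i \in S -> x i 0 = y i 0) -> f x = f y.

(* The largest natural number strictly below b (for b > 0). *)
Definition hfloor (b : R) : nat := \max_(k < (Num.truncn b).+1 | k%:R < b) k.

(* l is the j-th partial derivative at x of f regarded as a function on P only;
   at the boundary of the cube the difference quotient is one-sided. *)
Definition is_partial_on m (P : set 'cV[R]_m) (j : 'I_m) (f : 'cV[R]_m -> R)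
    (x : 'cV[R]_m) (l : R) : Prop :=
  (fun h : R => h^-1 * (f (x + h *: delta_mx j 0) - f x))
    @ within [set h : R | h != 0 /\ P (x + h *: delta_mx j 0)] (nbhs (0 : R))
    --> l.

Definition mi_order m (a : {ffun 'I_m -> nat}) : nat := (\sum_(i < m) a i)%N.

Definition mi_incr m (a : {ffun 'I_m -> nat}) (j : 'I_m) : {ffun 'I_m -> nat} :=
  [ffun i => (a i + (i == j))%N].

(* Df a is the partial derivative of f with multi-index a, for |a| <= k; being
   indexed by multi-indices, it does not depend on the order of
   differentiation. *)
Definition is_partials m (P : set 'cV[R]_m) (k : nat) (f : 'cV[R]_m -> R)
    (Df : {ffun 'I_m -> nat} -> 'cV[R]_m -> R) : Prop :=
  (forall x, P x -> Df [ffun=> 0%N] x = f x) /\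
  (forall a j, (mi_order a < k)%N -> forall x, P x ->
     is_partial_on P j (Df a) x (Df (mi_incr a j) x)).

Definition mi_val m k (a : {ffun 'I_m -> 'I_k}) : {ffun 'I_m -> nat} :=
  [ffun i => nat_of_ord (a i)].

(* The entries of a multi-index of order < b are at most hfloor b, so the sums
   below run over all multi-indices of the indicated orders. *)
Definition holder_norm m (P : set 'cV[R]_m) (b : R)
    (Df : {ffun 'I_m -> nat} -> 'cV[R]_m -> R) : \bar R :=
  (\sum_(a : {ffun 'I_m -> 'I_(hfloor b).+1} | ((mi_order (mi_val a))%:R < b)%R)
     ereal_sup [set `|Df (mi_val a) x|%:E | x in P]
   + \sum_(a : {ffun 'I_m -> 'I_(hfloor b).+1} | mi_order (mi_val a) == hfloor b)
     ereal_sup [set (`|Df (mi_val a) x.1 - Df (mi_val a) x.2|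
                       / `|x.1 - x.2| `^ (b - (hfloor b)%:R))%:E
               | x in [set x | [/\ P x.1, P x.2 & x.1 != x.2]]])%E.

Definition holder_ball m (P : set 'cV[R]_m) (b K : R) : set ('cV[R]_m -> R) :=
  [set f | exists2 Df, is_partials P (hfloor b) f Df
                     & (holder_norm P b Df <= K%:E)%E].

Definition holder_ball_vec m n (P : set 'cV[R]_m) (b K : R) :
    set ('cV[R]_m -> 'cV[R]_n) :=
  [set f | forall j, holder_ball P b K (fun x => f x j 0)].

Definition shift_relu m (v x : 'cV[R]_m) : 'cV[R]_m :=
  \col_i Num.max (x i 0 - v i 0) 0.

Fixpoint net_eval (p : nat -> nat) (Wt : forall i, 'M[R]_(p i.+1, p i))
    (v : forall i, 'cV[R]_(p i)) (x : 'cV[R]_(p 0%N)) (k : nat) :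
    'cV[R]_(p k.+1) :=
  match k with
  | 0%N => Wt 0%N *m x
  | k'.+1 => Wt k'.+1 *m shift_relu (v k'.+1) (net_eval Wt v x k')
  end.

(* F(L, L1, p, s, F) for maps R^m -> R^n with encoding dimension dt; only
   p 0, ..., p L.+1 and the weights and shifts of the layers 0, ..., L matter. *)
Definition network_class m n (dt L L1 : nat) (p : nat -> nat) (s : nat) (F : R) :
    set ('cV[R]_m -> 'cV[R]_n) :=
  [set f | exists (em : m = p 0%N) (en : p L.+1 = n)
      (Wt : forall i, 'M[R]_(p i.+1, p i)) (v : forall i, 'cV[R]_(p i)),
    (forall x, f x =
      castmx (en, erefl) (net_eval Wt v (castmx (em, erefl) x) L)) /\
    [/\ v 0%N = 0,
        forall j, (j <= L)%N -> Num.max `|Wt j| `|v j| <= 1,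
        p L1 = dt,
        (\sum_(j < L.+1) (norm0 (Wt j) + norm0 (v j)) <= s)%N &
        (sup_norm f <= F%:E)%E]].

Definition network_class_lip m n (dt L L1 : nat) (p : nat -> nat) (s : nat)
    (F Lip : R) : set ('cV[R]_m -> 'cV[R]_n) :=
  network_class dt L L1 p s F `&` [set f | (lip_norm f <= Lip%:E)%E].

Record encoder_decoder d r dt D (tdec tenc0 tenc1 : nat)
    (bdec benc0 benc1 K : R) (f0 : 'cV[R]_(r * d) -> 'cV[R]_d)
    (g0 : 'cV[R]_(r * d) -> 'cV[R]_D) (g1 : 'cV[R]_D -> 'cV[R]_dt)
    (fdec : 'cV[R]_dt -> 'cV[R]_d) : Prop := EncoderDecoder {
  ed_dt : (1 <= dt <= d)%N;
  ed_tenc0 : (1 <= tenc0 <= d * r)%N;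
  ed_tenc1 : (1 <= tenc1 <= D)%N;
  ed_tdec : (1 <= tdec <= dt)%N;
  ed_comp : f0 = fdec \o (g1 \o g0);
  ed_dep0 : forall j, depends_on_at_most tenc0 (fun x => g0 x j 0);
  ed_dep1 : forall j, depends_on_at_most tenc1 (fun x => g1 x j 0);
  ed_dep2 : forall j, depends_on_at_most tdec (fun x => fdec x j 0);
  ed_smooth0 : holder_ball_vec (cube (r * d)) benc0 K g0;
  ed_smooth1 : holder_ball_vec (cube D) benc1 K g1;
  ed_smooth2 : holder_ball_vec (cube dt) bdec K fdec;
  ed_image0 : g0 @` cube (r * d) `<=` cube D;
  ed_image1 : g1 @` cube D `<=` cube dt
}.

(* The sigma-algebra on S generated by a family of real coordinates. *)
Definition coord_sigma (I S : Type) (c : I -> S -> R) : set (set S) :=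
  <<s \bigcup_i preimage_set_system setT (c i) measurable >>.

Definition vec_sigma m : set (set 'cV[R]_m) :=
  coord_sigma (fun (j : 'I_m) (x : 'cV[R]_m) => x j 0).
Arguments vec_sigma m%_N _ : clear implicits.

Definition mx_sigma m n : set (set 'M[R]_(m, n)) :=
  coord_sigma (fun (ij : 'I_m * 'I_n) (A : 'M[R]_(m, n)) => A ij.1 ij.2).
Arguments mx_sigma m%_N n%_N _ : clear implicits.

Definition fam_sigma (I : Type) m : set (set (I -> 'cV[R]_m)) :=
  coord_sigma (fun (kj : I * 'I_m) (u : I -> 'cV[R]_m) => u kj.1 kj.2 0).
Arguments fam_sigma I%_type m%_N _ : clear implicits.

Definition measurable_to_vec (S : Type) (G : set (set S)) n (f : S -> 'cV[R]_n) :
    Prop :=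
  forall B, vec_sigma n B -> G (f @^-1` B).

(* (x_i, x_(i-1), ..., x_(i-r+1)) as a vector of R^(rd). *)
Definition lag d r (x : int -> 'cV[R]_d) (i : int) : 'cV[R]_(r * d) :=
  (mxvec (\matrix_(l < r, j < d) x (i - l%:Z) j 0))^T.

Definition sample d n (x : int -> 'cV[R]_d) : 'M[R]_(n, d) :=
  \matrix_(i < n, j < d) x (i.+1)%:Z j 0.

Definition emp_risk d r (Wf : 'cV[R]_(r * d) -> R) (n : nat)
    (x : int -> 'cV[R]_d) (f : 'cV[R]_(r * d) -> 'cV[R]_d) : R :=
  n%:R^-1 * \sum_(r.+1 <= i < n.+1)
    (d%:R^-1 * norm2 (x i%:Z - f (lag r x (i%:Z - 1))) ^+ 2
       * Wf (lag r x (i%:Z - 1))).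

Definition Vtilde (Delta : nat -> R) (x : R) : \bar R :=
  ((Num.sqrt x)%:E
   + \sum_(0 <= j <oo) (Num.min (Num.sqrt x) (Delta j))%:E)%E.

(* Since Vtilde Delta 0 = 0, the inequality alone is always solved by
   ybar x = 0; at x > 0 a positive solution is meant. *)
Definition dep_solution (Delta : nat -> R) (ybar : R -> R) : Prop :=
  forall x, 0 <= x ->
    [/\ 0 <= ybar x, 0 < x -> 0 < ybar x &
        (Vtilde Delta (Num.sqrt x * ybar x) <= (ybar x)%:E)%E].

Definition Lambda_dep (ybar : R -> R) (x : R) : R := Num.sqrt x * ybar x.

End deterministic.

Arguments cube {R} m%_N _.
Arguments vec_sigma {R} m%_N _.
Arguments mx_sigma {R} m%_N n%_N _.
Arguments fam_sigma {R} I%_type m%_N _.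

Section probabilistic.
Context {R : realType} {disp : measure_display} {T : measurableType disp}.
Variable P : probability T R.

Definition random_vector m (Y : T -> 'cV[R]_m) : Prop :=
  forall j, measurable_fun setT (fun w => Y w j 0).

Definition sigma_gen S (G : set (set S)) (Y : T -> S) : set (set T) :=
  preimage_set_system setT Y G.

Definition mutually_independent (I : eqType) (E : I -> set (set T)) : Prop :=
  forall (J : seq I) (A : I -> set T), uniq J ->
    (forall i, i \in J -> E i (A i)) ->
    P (\bigcap_(i in [set` J]) A i) = (\prod_(i <- J) P (A i))%E.

Definition independent2 (E1 E2 : set (set T)) : Prop :=
  forall A B, E1 A -> E2 B -> P (A `&` B) = (P A * P B)%E.

Definition same_law S (G : set (set S)) (Y Z : T -> S) : Prop :=
  forall A, G A -> P (Y @^-1` A) = P (Z @^-1` A).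

Definition stationary d (X : int -> T -> 'cV[R]_d) : Prop :=
  forall h : int,
    same_law (fam_sigma int d) (fun w i => X (i + h) w) (fun w i => X i w).

Record ar_model d r (X eps : int -> T -> 'cV[R]_d)
    (f0 : 'cV[R]_(r * d) -> 'cV[R]_d) : Prop := ArModel {
  ar_X_meas : forall i, random_vector (X i);
  ar_eps_meas : forall i, random_vector (eps i);
  ar_f0_meas : measurable_to_vec (vec_sigma (r * d)) f0;
  ar_stationary : stationary X;
  ar_recursion : forall i,
    {ae P, forall w, X i w = f0 (lag r (X ^~ w) (i - 1)) + eps i w};
  ar_eps_ident : forall i, same_law (vec_sigma d) (eps i) (eps 0);
  ar_eps_indep :
    mutually_independent (fun i => sigma_gen (vec_sigma d) (eps i));
  ar_eps_int : forall i j, P.-integrable setT (fun w => (eps i w j 0)%:E);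
  ar_eps_mean : forall i j, ('E_P[fun w => eps i w j 0%R] = 0)%E;
  ar_eps_past : forall i,
    independent2 (sigma_gen (vec_sigma d) (eps i))
      (sigma_gen (fam_sigma nat d) (fun w k => X (i - k.+1%:Z) w))
}.

Definition sub_gaussian d (eps : int -> T -> 'cV[R]_d) (Ce : R) : Prop :=
  forall (k : nat) (j : 'I_d), (0 < k)%N ->
    (Lnorm P k%:R%:E (fun w => (eps 1%R w j 0%R)%:E) <= (Ce * Num.sqrt k%:R)%:E)%E.

Definition causal_representation d (J : (nat -> 'cV[R]_d) -> 'cV[R]_d)
    (X eps : int -> T -> 'cV[R]_d) : Prop :=
  measurable_to_vec (fam_sigma nat d) J /\
  forall i, {ae P, forall w, X i w = J (fun l => eps (i - l%:Z) w)}.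

Definition innovation_copy d (eps eps' : int -> T -> 'cV[R]_d) : Prop :=
  forall i, [/\ random_vector (eps' i),
    same_law (vec_sigma d) (eps' i) (eps i) &
    independent2 (sigma_gen (vec_sigma d) (eps' i))
      (sigma_gen (fam_sigma int d) (fun w j => eps j w))].

(* X_i^{*(i-k)} *)
Definition coupled d (J : (nat -> 'cV[R]_d) -> 'cV[R]_d)
    (eps eps' : int -> T -> 'cV[R]_d) (i : int) (k : nat) (w : T) : 'cV[R]_d :=
  J (fun l => if l == k then eps' (i - l%:Z) w else eps (i - l%:Z) w).

(* By stationarity the value does not depend on the time i; i = 0 is used. *)
Definition fun_dep d (J : (nat -> 'cV[R]_d) -> 'cV[R]_d)
    (X eps eps' : int -> T -> 'cV[R]_d) (q : R) (k : int) : \bar R :=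
  match k with
  | Posz k => \big[maxe/0%E]_(j < d)
      Lnorm P q%:E
        (fun w => (X 0 w j 0 - coupled J eps eps' 0 k w j 0)%:E)
  | Negz _ => 0%E
  end.

Definition pred_error d r (X : int -> T -> 'cV[R]_d)
    (f0 : 'cV[R]_(r * d) -> 'cV[R]_d) (Wf : 'cV[R]_(r * d) -> R)
    (f : 'cV[R]_(r * d) -> 'cV[R]_d) : \bar R :=
  ((d%:R^-1)%:E * 'E_P[fun w =>
     (norm2 (f (lag r (X ^~ w) r%:Z) - f0 (lag r (X ^~ w) r%:Z)) ^+ 2
        * Wf (lag r (X ^~ w) r%:Z))%R])%E.

(* fhat n maps the observations X_1, ..., X_n to a minimizer of the empirical
   risk over cls n, for every n > r. *)
Definition erm_estimator d r (X : int -> T -> 'cV[R]_d)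
    (Wf : 'cV[R]_(r * d) -> R)
    (cls : nat -> set ('cV[R]_(r * d) -> 'cV[R]_d))
    (fhat : forall n, 'M[R]_(n, d) -> 'cV[R]_(r * d) -> 'cV[R]_d) : Prop :=
  forall n, (r < n)%N ->
    (forall x, measurable_to_vec (mx_sigma n d) (fun A => fhat n A x)) /\
    (forall w, let f := fhat n (sample n (X ^~ w)) in
       cls n f /\
       forall g, cls n g ->
         emp_risk Wf n (X ^~ w) f <= emp_risk Wf n (X ^~ w) g).

End probabilistic.

(* Main.v *)
(* Approximation. The square is approximated by sums of iterated tent functions,
   products by binary trees of such squares. On a grid of M^t cells a Hoelder
   function of t variables is close to the sum over the nodes of a hat function
   times the Taylor polynomial at the node; a ReLU network of depth O(log n) with
   O(M^t) units per layer computes it up to 1/n. As the hat functions sum to one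
   and the Taylor polynomials are close to each other where the hats overlap, the
   network is Lipschitz with a constant that does not depend on the grid. With
   M^t of the order of N for each of the three stages, their composition is
   within N^(-A) + 1/n of f0 on the cube.

   Stochastic part. The class has a 1/n-covering of log-cardinality
   H = O(N ln(n)^3). The basic inequality for the minimizer bounds the empirical
   error by the approximation error, a noise term and a covering term. The noise
   term is an exponential supermartingale. For the deviation of the empirical
   from the true error, each summand is truncated to its last q innovations: the
   truncated summands are independent along residue classes mod q, which costs
   q H, and the remainder is a sum over j >= q of martingale differences of size
   Delta(j), which costs sqrt (n H) times the sum of these Delta(j). For q the
   least j with Delta(j) < sqrt (Lambda(x)), x = N ln(n)^3 / n, the inequality defining
   ybar bounds both contributions, divided by n, by a multiple of Lambda(x).

   All expectations of suprema are taken over measurable upper envelopes, and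
   the process is represented on the space of sequences of innovations, where
   conditioning is integration over resampled coordinates. *)

From HB Require Import structures.
Require Import Defs.
From mathcomp Require Import all_boot all_order all_algebra.
From mathcomp Require Import all_classical all_reals all_analysis.
From mathcomp Require Import measurable_realfun.
From mathcomp Require Import ring lra zify.

Set Implicit Arguments.
Unset Strict Implicit.
Unset Printing Implicit Defensive.

Import Order.TTheory GRing.Theory Num.Theory.
Import numFieldNormedType.Exports.

Local Open Scope classical_set_scope.
Local Open Scope ring_scope.

(** The dependence coefficients give the effect of one innovation small second moments but no small
    sup bound. What rescues the supremum over the covering is that [F] and [Lip] are fixed: the
    losses of the whole class are dominated by one distance between states of the process
    ([trunc_dist]). Their quadratic variations thus have a common majorant, which is subtracted
    inside the exponential and of which only the mean enters; [exp (x - x^2) <= 1 + x + x^2], valid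
    for every real [x], makes this work with increments that are not small. A rate linear in
    [H / n], instead of its square root, comes from comparing half of the true error with the
    empirical one: for losses in [[0, 1]] the bound [exp (- y) <= 1 - y / 2] replaces a variance
    bound. The fixed [Lip] also shapes the approximation. The hat functions have slopes of the order
    of the grid, so the local error must be at most the mesh size, which is where smoothness at
    least 1 enters, and the approximate products must have an error of small slope, not only of
    small size. As all weights are at most one in modulus, large factors are produced by summing
    copies of a unit. *)

Definition coord_gen {R : realType} (I S : Type) (c : I -> S -> R) : set (set S) :=
  \bigcup_i preimage_set_system setT (c i) measurable.

(** * Sequences of innovations *)

Section coord_type.
Context {R : realType} (I : Type) (S : pointedType) (c : I -> S -> R).

Lemma measurable_coord i : measurable_fun setT (c i : g_sigma_algebraType (coord_gen c) -> R).
Proof.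
move=> _ B mB; rewrite setTI; apply: sub_sigma_algebra.
by exists i => //; exists B => //; rewrite setTI.
Qed.

Lemma measurable_into_coord disp (T : measurableType disp) (f : T -> g_sigma_algebraType (coord_gen c)) :
  (forall i, measurable_fun setT (fun x => c i (f x))) -> measurable_fun setT f.
Proof.
move=> fP; apply: (@measurability _ _ T (g_sigma_algebraType (coord_gen c)) setT f
  (coord_gen c)) => //.
move=> _ [B [i _ [A mA <-]] <-]; rewrite !setTI.
have := fP i measurableT _ mA; rewrite setTI; exact.
Qed.

End coord_type.

(** Aliases that carry the sigma-algebra generated by the coordinates. The measurable sets of [vecT]
    are those of [vec_sigma] by conversion, so the hypotheses of the model apply to them as they
    stand. *)
Definition vecT (R : realType) (d : nat) : Type := 'cV[R]_d.
Definition seqT (R : realType) (d : nat) : Type := int -> 'cV[R]_d.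

Definition vec_coord (R : realType) d (j : 'I_d) (x : 'cV[R]_d) : R := x j 0.
Definition seq_coord (R : realType) d (i : int * 'I_d) (u : int -> 'cV[R]_d) : R :=
  u i.1 i.2 0.

HB.instance Definition _ (R : realType) d :=
  Measurable.copy (vecT R d) (g_sigma_algebraType (coord_gen (@vec_coord R d))).
HB.instance Definition _ (R : realType) d :=
  Measurable.copy (seqT R d) (g_sigma_algebraType (coord_gen (@seq_coord R d))).

Section innovations.
Context {R : realType} {d : nat}.

Local Notation vecT := (vecT R d).
Local Notation seqT := (seqT R d).

Lemma measurable_proj l : measurable_fun setT (fun u : seqT => u l : vecT).
Proof.
apply: measurable_into_coord => j.
exact: (measurable_coord (c := @seq_coord R d) (l, j)).
Qed.

Lemma measurable_into_seq disp (T : measurableType disp) (f : T -> seqT) :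
  (forall l, measurable_fun setT (fun x => f x l : vecT)) -> measurable_fun setT f.
Proof.
move=> fP; apply: measurable_into_coord => -[l j] /=.
apply: (@measurableT_comp _ _ _ _ _ _ (fun x : vecT => x j 0) _ (fun x => f x l)) => //.
exact: (measurable_coord (c := @vec_coord R d) j).
Qed.

Definition cyl (B : int -> set 'cV[R]_d) : set (int -> 'cV[R]_d) :=
  [set u | forall l, B l (u l)].

(** A pi-system that generates the sigma-algebra of [seqT]; invariance of the law under mixing and
    under shifts only has to be checked on it. *)
Definition cyls : set (set (int -> 'cV[R]_d)) :=
  [set E | exists s : seq int, exists2 B : int -> set 'cV[R]_d,
     (forall l, vec_sigma d (B l)) /\ (forall l, l \notin s -> B l = setT) &
     E = cyl B].

Lemma cylsI : setI_closed cyls.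
Proof.
move=> _ _ [s [B [mB sB] ->]] [t [C [mC tC] ->]].
exists (s ++ t); exists (fun l => B l `&` C l).
  split=> [l|l]; first exact: (@measurableI _ vecT _ _ (mB l) (mC l)).
  by rewrite mem_cat negb_or => /andP[/sB-> /tC->]; rewrite setTI.
apply/seteqP; split=> u /=; first by move=> [uB uC] l; split.
by move=> uBC; split=> l; case: (uBC l).
Qed.

Lemma cyl_bigcap (s : seq int) B : (forall l, l \notin s -> B l = setT) ->
  cyl B = \bigcap_(l in [set` s]) ((fun u : int -> 'cV[R]_d => u l) @^-1` B l).
Proof.
move=> sB; apply/seteqP; split=> u /= uB; first by move=> l _; exact: uB.
by move=> l; have [ls|/sB->//] := boolP (l \in s); exact: uB.
Qed.

Lemma measurable_cyls : cyls `<=` @measurable _ seqT.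
Proof.
move=> _ [s [B [mB sB] ->]]; rewrite (cyl_bigcap sB).
apply: fin_bigcap_measurable => //= l _.
rewrite -[X in measurable X]setTI; exact: (measurable_proj l measurableT (mB l)).
Qed.

Lemma measurable_seqTE : @measurable _ seqT = <<s cyls >>.
Proof.
apply/seteqP; split.
  apply: smallest_sub; first exact: smallest_sigma_algebra.
  move=> _ [[l j] _ [B mB <-]]; rewrite setTI; apply: sub_sigma_algebra.
  exists [:: l]; exists (fun k => if k == l then (fun x : 'cV[R]_d => x j 0) @^-1` B else setT).
    split=> k; last by rewrite inE => /negbTE->.
    case: ifP => _; last exact: (@measurableT _ vecT).
    have := measurable_coord (c := @vec_coord R d) j measurableT mB.
    by rewrite setTI.
  apply/seteqP; split=> u /=; first by move=> uB k; case: eqP => // ->.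
  by move=> /(_ l); rewrite eqxx.
apply: smallest_sub; last exact: measurable_cyls.
exact: sigma_algebra_measurable.
Qed.

Lemma seq_measure_unique (m1 m2 : {measure set seqT -> \bar R}) :
  (m1 setT < +oo)%E -> (forall E, cyls E -> m1 E = m2 E) ->
  forall E, measurable E -> m1 E = m2 E.
Proof.
move=> m1T m12 E; rewrite measurable_seqTE.
apply: (@g_sigma_algebra_measure_unique _ _ seqT cyls measurable_cyls (fun=> setT)) => //.
- move=> _; exists [::]; exists (fun=> setT); first by split=> // l; exact: (@measurableT _ vecT).
  by apply/seteqP; split.
- by apply/seteqP; split=> // u _; exists 0%N.
- exact: cylsI.
Qed.

(** One operation for two purposes: with [A] a half-line, integration in [v] is conditioning on the
    innovations in [A]; with [A] the complement of a point, it is the coupling that replaces a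
    single innovation. *)
Definition mix (A : int -> bool) (u v : int -> 'cV[R]_d) : int -> 'cV[R]_d :=
  fun l => if A l then u l else v l.

Lemma measurable_mix A disp (T : measurableType disp) (f g : T -> seqT) :
  measurable_fun setT f -> measurable_fun setT g ->
  measurable_fun setT (fun x => mix A (f x) (g x) : seqT).
Proof.
move=> mf mg; apply: measurable_into_seq => l; rewrite /mix.
by case: (A l); exact: (measurableT_comp (measurable_proj l)).
Qed.

Definition shift (h : int) (u : int -> 'cV[R]_d) : int -> 'cV[R]_d :=
  fun l => u (l + h).

Lemma measurable_shift h : measurable_fun setT (shift h : seqT -> seqT).
Proof. by apply: measurable_into_seq => l; exact: measurable_proj. Qed.

(** [nu] is a mere set function: total mass one and the product formula on cylinders are all that
    the uniqueness argument consumes. *)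
Definition iid_law (mu : probability seqT R) (nu : set 'cV[R]_d -> \bar R) :=
  nu setT = 1%E /\
  forall (s : seq int) B, (forall l, vec_sigma d (B l)) ->
    (forall l, l \notin s -> B l = setT) -> uniq s ->
    mu (cyl B) = (\prod_(l <- s) nu (B l))%E.

Definition mfun_of d1 d2 (T1 : measurableType d1) (T2 : measurableType d2)
    (f : T1 -> T2) (mf : measurable_fun setT f) : {mfun T1 >-> T2} :=
  HB.pack f (isMeasurableFun.Build _ _ _ _ f mf).

Lemma ge0_integral_image d1 d2 (T1 : measurableType d1) (T2 : measurableType d2)
    (m1 : {measure set T1 -> \bar R}) (m2 : {measure set T2 -> \bar R})
    (f : T1 -> T2) (F : T2 -> \bar R) : measurable_fun setT f ->
  (forall E, measurable E -> m1 (f @^-1` E) = m2 E) ->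
  measurable_fun setT F -> (forall u, 0 <= F u)%E ->
  (\int[m2]_x F x = \int[m1]_x F (f x))%E.
Proof.
move=> mf fE mF F0.
rewrite (@eq_measure_integral _ _ _ setT (pushforward m1 (mfun_of mf))); last first.
  by move=> E mE _; apply/esym; exact: fE.
by rewrite ge0_integral_pushforward//= preimage_setT.
Qed.

Lemma product_probabilityT d1 d2 (T1 : measurableType d1) (T2 : measurableType d2)
  (P1 : probability T1 R) (P2 : probability T2 R) : (P1 \x P2)%E setT = 1%E.
Proof.
transitivity (P1 setT * P2 setT)%E; first by rewrite -product_measure1E// setXTT.
by rewrite (probability_setT P1) (probability_setT P2) mul1e.
Qed.

Section iid.
Variables (mu : probability seqT R) (nu : set 'cV[R]_d -> \bar R).
Hypothesis muP : iid_law mu nu.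

Let seqTT := (seqT * seqT)%type.

Lemma measurable_mix2 A : measurable_fun setT (fun z : seqTT => mix A z.1 z.2 : seqT).
Proof. exact: measurable_mix. Qed.

(** Splicing two independent copies of an i.i.d. sequence reproduces its law: a cylinder splits into
    its constraints on [A], imposed on the first copy, and the remaining ones, imposed on the
    second. *)
Lemma pushforward_mix A E : measurable E ->
  pushforward (mu \x mu)%E (fun z : seqTT => mix A z.1 z.2 : seqT) E = mu E.
Proof.
pose f : {mfun seqTT >-> seqT} := mfun_of (measurable_mix2 A).
apply: (@seq_measure_unique (pushforward (mu \x mu)%E f) mu).
  by rewrite [X in (X < _)%E](product_probabilityT mu mu) ltry.
move=> _ [s0 [B [mB s0B] ->]].
pose s := undup s0.
have sB l : l \notin s -> B l = setT by rewrite mem_undup; exact: s0B.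
have us : uniq s by exact: undup_uniq.
pose BA l := if A l then B l else setT.
pose BC l := if A l then setT else B l.
have mBA l : vec_sigma d (BA l).
  by rewrite /BA; case: ifP => // _; exact: (@measurableT _ vecT).
have mBC l : vec_sigma d (BC l).
  by rewrite /BC; case: ifP => // _; exact: (@measurableT _ vecT).
have sBA l : l \notin s -> BA l = setT by move=> /sB; rewrite /BA => ->; case: ifP.
have sBC l : l \notin s -> BC l = setT by move=> /sB; rewrite /BC => ->; case: ifP.
transitivity ((mu \x mu)%E (cyl BA `*` cyl BC)).
  congr ((mu \x mu)%E _).
  apply/seteqP; split=> -[u v] /=.
    by move=> uvB; split=> l; have := uvB l; rewrite /mix /BA /BC; case: ifP.
  by move=> [uB vB] l; have := uB l; have := vB l; rewrite /mix /BA /BC; case: ifP.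
transitivity (mu (cyl BA) * mu (cyl BC))%E.
  apply: product_measure1E; apply: measurable_cyls.
  - by exists s; exists BA.
  - by exists s; exists BC.
case: muP => nuT muE.
transitivity (\prod_(l <- s) (nu (BA l) * nu (BC l)))%E.
  by rewrite big_split/= (muE s BA)// (muE s BC).
transitivity (\prod_(l <- s) nu (B l))%E; last by apply/esym/muE.
apply: eq_bigr => l _; rewrite /BA /BC; case: ifP => _.
  by rewrite nuT mule1.
by rewrite nuT mul1e.
Qed.

Local Open Scope ereal_scope.

Lemma integral_mix A (F : seqT -> \bar R) : measurable_fun [set: seqT] F ->
  (forall u, 0 <= F u) ->
  \int[mu]_u F u = \int[mu]_u \int[mu]_v F (mix A u v).
Proof.
move=> mF F0.
rewrite (ge0_integral_image (measurable_mix2 A) (pushforward_mix A) mF F0).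
rewrite fubini_tonelli1//.
exact: (measurableT_comp mF (measurable_mix2 A)).
Qed.

Lemma pushforward_shift h E : measurable E ->
  pushforward mu (shift h : seqT -> seqT) E = mu E.
Proof.
pose f : {mfun seqT >-> seqT} := mfun_of (measurable_shift h).
apply: (@seq_measure_unique (pushforward mu f) mu).
  by change (mu setT < +oo); rewrite probability_setT ltry.
move=> _ [s0 [B [mB s0B] ->]].
pose s := undup s0.
have sB l : l \notin s -> B l = setT by rewrite mem_undup; exact: s0B.
have us : uniq s by exact: undup_uniq.
transitivity (mu (cyl (fun l => B (l - h)%R))).
  congr (mu _).
  apply/seteqP; split=> u /= uB l; first by have := uB (l - h)%R; rewrite /shift subrK.
  by have := uB (l + h)%R; rewrite /shift addrK.
case: muP => nuT muE.
rewrite (muE [seq l + h | l <- s]%R); first last.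
- by rewrite map_inj_uniq//; exact: addIr.
- by move=> l ls; apply: sB; apply: contra ls => ls; apply/mapP; exists (l - h)%R => //; rewrite subrK.
- by move=> l; exact: mB.
transitivity (\prod_(l <- s) nu (B l)); last by apply/esym/muE.
by rewrite big_map; apply: eq_bigr => l _; rewrite addrK.
Qed.

Lemma integral_shift h (F : seqT -> \bar R) : measurable_fun [set: seqT] F ->
  (forall u, 0 <= F u) -> \int[mu]_u F u = \int[mu]_u F (shift h u).
Proof.
move=> mF F0.
exact: (ge0_integral_image (measurable_shift h) (pushforward_shift h)).
Qed.

End iid.
End innovations.

(** * Maximal inequalities by resampling *)

Section bounded_functions.
Context {R : realType} {disp : measure_display} {T : measurableType disp}.
Variable mu : probability T R.

(** For bounded measurable functions the real-valued integral is linear and monotone without side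
    conditions; the losses and their conditional means all belong to this class. *)
Definition bdm (f : T -> R) :=
  measurable_fun setT f /\ exists M, forall x, `|f x| <= M.

Lemma bdm_integrable f : bdm f -> mu.-integrable setT (EFin \o f).
Proof.
move=> [mf [M fM]]; apply: (@measurable_bounded_integrable _ _ _ mu) => //.
  by rewrite [X in (X < _)%E](probability_setT mu) ltry.
exists M; split; first exact: num_real.
by move=> x Mx t _ /=; rewrite (le_trans (fM t))// ltW.
Qed.

Lemma bdm_cst c : bdm (fun=> c).
Proof. by split => //; exists `|c|. Qed.

Lemma bdmD f g : bdm f -> bdm g -> bdm (fun x => f x + g x).
Proof.
move=> [mf [M fM]] [mg [N gN]]; split; first exact: measurable_funD.
by exists (M + N) => x; rewrite (le_trans (ler_normD _ _))// lerD.
Qed.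

Lemma bdmM f g : bdm f -> bdm g -> bdm (fun x => f x * g x).
Proof.
move=> [mf [M fM]] [mg [N gN]]; split; first exact: measurable_funM.
by exists (M * N) => x; rewrite normrM ler_pM.
Qed.

Lemma bdmN f : bdm f -> bdm (fun x => - f x).
Proof.
move=> [mf [M fM]]; split; first exact: measurableT_comp.
by exists M => x; rewrite normrN.
Qed.

Lemma bdmB f g : bdm f -> bdm g -> bdm (fun x => f x - g x).
Proof. by move=> bf bg; apply: bdmD => //; exact: bdmN. Qed.

Lemma bdmZ c f : bdm f -> bdm (fun x => c * f x).
Proof. by apply: bdmM; exact: bdm_cst. Qed.

Lemma bdm_sqr f : bdm f -> bdm (fun x => f x ^+ 2).
Proof. by move=> bf; under eq_fun do rewrite expr2; exact: bdmM. Qed.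

Lemma bdm_sum (I : Type) (s : seq I) (f : I -> T -> R) :
  (forall i, bdm (f i)) -> bdm (fun x => \sum_(i <- s) f i x).
Proof.
move=> bf; elim: s => [|i s IH].
  by under eq_fun do rewrite big_nil; exact: bdm_cst.
by under eq_fun do rewrite big_cons; exact: bdmD.
Qed.

Lemma EFin_Rint f : bdm f -> (\int[mu]_x f x)%:E = (\int[mu]_x (f x)%:E)%E.
Proof.
move=> bf; rewrite /Rintegral fineK//; apply: integrable_fin_num => //.
exact: bdm_integrable.
Qed.

Lemma Rint_cst c : \int[mu]_x c = c.
Proof. by rewrite Rintegral_cst// [X in fine X](probability_setT mu)/= mulr1. Qed.

Lemma RintD f g : bdm f -> bdm g ->
  \int[mu]_x (f x + g x) = \int[mu]_x f x + \int[mu]_x g x.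
Proof. by move=> bf bg; apply: RintegralD => //; exact: bdm_integrable. Qed.

Lemma RintB f g : bdm f -> bdm g ->
  \int[mu]_x (f x - g x) = \int[mu]_x f x - \int[mu]_x g x.
Proof. by move=> bf bg; apply: RintegralB => //; exact: bdm_integrable. Qed.

Lemma RintZ c f : bdm f -> \int[mu]_x (c * f x) = c * \int[mu]_x f x.
Proof. by move=> bf; apply: RintegralZl => //; exact: bdm_integrable. Qed.

Lemma Rint_le f g : bdm f -> bdm g -> (forall x, f x <= g x) ->
  \int[mu]_x f x <= \int[mu]_x g x.
Proof. by move=> bf bg fg; apply: le_Rintegral => //; exact: bdm_integrable. Qed.

Lemma Rint_norm_le f M : bdm f -> (forall x, `|f x| <= M :> R) -> `|\int[mu]_x f x| <= M.
Proof.
move=> bf fM; rewrite ler_norml; apply/andP; split.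
- rewrite -(Rint_cst (- M)); apply: Rint_le => //; first exact: bdm_cst.
  by move=> x; have := fM x; rewrite ler_norml => /andP[].
- rewrite -[leRHS](Rint_cst M); apply: Rint_le => //; first exact: bdm_cst.
  by move=> x; have := fM x; rewrite ler_norml => /andP[].
Qed.

(** Jensen for the square: integrate [2 c f <= f^2 + c^2] with [c] the mean of [f]. *)
Lemma Rint_sqr_le f h : bdm f -> bdm h -> (forall x, f x ^+ 2 <= h x) ->
  (\int[mu]_x f x) ^+ 2 <= \int[mu]_x h x.
Proof.
move=> bf bh fh; set c := \int[mu]_x f x.
have : \int[mu]_x ((2 * c) * f x) <= \int[mu]_x (h x + c ^+ 2).
  apply: Rint_le; [exact: bdmZ|by apply: bdmD => //; exact: bdm_cst|].
  move=> x; have := fh x; have := sqr_ge0 (f x - c); nra.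
rewrite RintZ// RintD//; last exact: bdm_cst.
by rewrite Rint_cst -/c; nra.
Qed.

End bounded_functions.

Section bounded_fubini.
Context {R : realType} {d1 d2 : measure_display}.
Context {T1 : measurableType d1} {T2 : measurableType d2}.
Variable mu : probability T2 R.

Lemma bdm_slice (G : T1 * T2 -> R) u : bdm G -> bdm (fun v => G (u, v)).
Proof.
move=> [mG [M GM]]; split; last by exists M.
by apply: (measurableT_comp mG); exact: measurable_pair1.
Qed.

Lemma bdm_Rint (G : T1 * T2 -> R) : bdm G -> bdm (fun u => \int[mu]_v G (u, v)).
Proof.
move=> /[dup] bG [mG [M GM]]; split; last first.
  exists M => u; apply: Rint_norm_le => //; exact: bdm_slice.
(* Adding [M] makes the integrand nonnegative, so that measurability of the partial integral follows
   from Tonelli. *)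
rewrite (_ : (fun u => _) = (fun u => fine (\int[mu]_v (G (u, v) + M)%:E)%E - M)).
  apply: measurable_funB => //; apply: measurableT_comp => //.
  apply: (@measurable_fun_fubini_tonelli_F _ _ _ _ _ mu (fun z => (G z + M)%:E)).
    by apply/measurable_EFinP; apply: measurable_funD.
  by move=> z; rewrite lee_fin -lerBlDr sub0r lerNl; have := GM z; rewrite ler_norml; lra.
apply/funext => u.
rewrite -EFin_Rint/=; last by apply: bdmD; [exact: bdm_slice|exact: bdm_cst].
rewrite RintD ?Rint_cst ?addrK//; [exact: bdm_slice|exact: bdm_cst].
Qed.

End bounded_fubini.

Section mixing.
Context {R : realType} {disp : measure_display} {Om : measurableType disp}.
Variables (mu : probability Om R) (V : Type) (co : Om -> int -> V).
Variable mix : (int -> bool) -> Om -> Om -> Om.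
Hypothesis co_inj : forall u v, (forall l, co u l = co v l) -> u = v.
Hypothesis co_mix : forall A u v l, co (mix A u v) l = if A l then co u l else co v l.
Hypothesis measurable_mix :
  forall A, measurable_fun setT (fun z : Om * Om => mix A z.1 z.2).
Hypothesis integral_mix : forall A (F : Om -> \bar R), measurable_fun setT F ->
  (forall u, 0 <= F u)%E ->
  (\int[mu]_u F u = \int[mu]_u \int[mu]_v F (mix A u v))%E.

(** Pointwise substitute for measurability with respect to the sigma-algebra of the coordinates in
    [A]. *)
Definition dep_on (A : int -> bool) (S : Type) (F : Om -> S) :=
  forall u v, (forall l, A l -> co u l = co v l) -> F u = F v.

Lemma dep_on_mix A S (F : Om -> S) u v : dep_on A F -> F (mix A u v) = F u.
Proof. by move=> dF; apply: dF => l Al; rewrite co_mix Al. Qed.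

Lemma measurable_mixr A u : measurable_fun setT (mix A u).
Proof.
exact: (measurableT_comp (measurable_mix A) (measurable_pair1 u)).
Qed.

Lemma bdm_mixr A u (F : Om -> R) : bdm F -> bdm (fun v => F (mix A u v)).
Proof.
move=> [mF [M FM]]; split; last by exists M.
exact: (measurableT_comp mF (measurable_mixr A u)).
Qed.

Lemma bdm_mix2 A (F : Om -> R) : bdm F -> bdm (fun z : Om * Om => F (mix A z.1 z.2)).
Proof.
move=> [mF [M FM]]; split; last by exists M.
exact: (measurableT_comp mF (measurable_mix A)).
Qed.

(* For independent coordinates this is a version of the conditional expectation
   of F given the coordinates in A, defined everywhere. *)
Definition cexp A (F : Om -> R) (u : Om) : R := \int[mu]_v F (mix A u v).

Lemma bdm_cexp A (F : Om -> R) : bdm F -> bdm (cexp A F).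
Proof. by move=> bF; apply: (bdm_Rint mu (G := fun z => F (mix A z.1 z.2))); exact: bdm_mix2. Qed.

Lemma cexp_dep A (F : Om -> R) : dep_on A (cexp A F).
Proof.
move=> u v uv; congr (Rintegral _ _ _); apply/funext => x; congr F.
by apply: co_inj => l; rewrite !co_mix; case: ifP => // /uv.
Qed.

Lemma cexp_norm_le A F M u : bdm F -> (forall x, `|F x| <= M :> R) -> `|cexp A F u| <= M.
Proof. by move=> bF FM; apply: Rint_norm_le => //; exact: bdm_mixr. Qed.

Lemma cexp_ge0 A F u : bdm F -> (forall x, 0 <= F x) -> 0 <= cexp A F u.
Proof. by move=> bF FM; apply: Rintegral_ge0. Qed.

Lemma Rint_mix A (F : Om -> R) : bdm F -> \int[mu]_u F u = \int[mu]_u cexp A F u.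
Proof.
move=> /[dup] bF [mF [M FM]].
have F0 u : 0 <= F u + M by have := FM u; rewrite ler_norml; lra.
have bFM : bdm (fun u => F u + M) by apply: bdmD => //; exact: bdm_cst.
have : (\int[mu]_u (F u + M)%:E = \int[mu]_u \int[mu]_v (F (mix A u v) + M)%:E)%E.
  apply: (@integral_mix A (fun u => (F u + M)%:E)) => //.
    by apply/measurable_EFinP; case: bFM.
rewrite -EFin_Rint//.
under eq_integral => u _.
  rewrite -EFin_Rint; last exact: (@bdm_mixr A u (fun x => F x + M)).
  rewrite RintD ?Rint_cst; last 2 first.
    exact: bdm_mixr.
    exact: bdm_cst.
  over.
rewrite -EFin_Rint/=; last by apply: bdmD; [exact: bdm_cexp|exact: bdm_cst].
rewrite !RintD//; try exact: bdm_cst; last exact: bdm_cexp.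
by move=> [] /addIr.
Qed.

(** Tower property: both sides evaluate [F] at the splice of [u] on [B], one copy on [A] minus [B]
    and a second copy outside [A]. *)
Lemma cexp_cexp (A B : int -> bool) (F : Om -> R) u : (forall l, B l -> A l) -> bdm F ->
  cexp B (cexp A F) u = cexp B F u.
Proof.
move=> BA bF; rewrite {3}/cexp (Rint_mix A); last exact: bdm_mixr.
congr (Rintegral _ _ _); apply/funext => v; congr (Rintegral _ _ _).
apply/funext => x; congr F; apply: co_inj => l; rewrite !co_mix.
by case: ifP => Al; case: ifP => // /BA; rewrite Al.
Qed.

Lemma Rint_cexp A (F : Om -> R) : bdm F -> \int[mu]_u cexp A F u = \int[mu]_u F u.
Proof. by move=> bF; rewrite -Rint_mix. Qed.

(** Supermartingale argument: given the coordinates in [A k] all earlier summands are fixed and the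
    last factor has mean at most one, so it can be peeled off. No order among the sets [A m] is
    assumed, which lets the lemma run forwards in time, backwards in time and along residue
    classes. *)
Lemma exp_chain k (Z : nat -> Om -> R) (A : nat -> int -> bool) :
  (forall m, (m < k)%N -> measurable_fun setT (Z m)) ->
  (forall m m', (m' < m < k)%N -> dep_on (A m) (Z m')) ->
  (forall m u, (m < k)%N -> \int[mu]_v (expR (Z m (mix (A m) u v)))%:E <= 1)%E ->
  (\int[mu]_u (expR (\sum_(m < k) Z m u))%:E <= 1)%E.
Proof.
elim: k => [|k IH] mZ dZ iZ.
  under eq_integral do rewrite big_ord0 expR0.
  by rewrite integral_cst// [X in (_ * X)%E](probability_setT mu) mul1e.
have mS : measurable_fun setT (fun u => \sum_(m < k) Z m u).
  by apply: measurable_sum => m; apply: mZ; rewrite (ltn_trans (ltn_ord m)).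
have mE : measurable_fun setT (fun u => (expR (\sum_(m < k.+1) Z m u))%:E).
  apply/measurable_EFinP; apply: measurableT_comp => //.
  by apply: measurable_sum => m; apply: mZ.
rewrite (integral_mix (A k) mE); last by move=> u; rewrite lee_fin expR_ge0.
apply: le_trans (IH _ _ _); last 3 first.
- by move=> m mk; apply: mZ; rewrite ltnW.
- by move=> m m' /andP[m'm mk]; apply: dZ; rewrite m'm ltnW.
- by move=> m u mk; apply: iZ; rewrite ltnW.
apply: ge0_le_integral => //.
- by move=> u _; apply: integral_ge0 => v _; rewrite lee_fin expR_ge0.
- apply: (@measurable_fun_fubini_tonelli_F _ _ _ _ _ mu
    (fun z => (expR (\sum_(m < k.+1) Z m (mix (A k) z.1 z.2)))%:E)).
    exact: (measurableT_comp mE (measurable_mix (A k))).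
  by move=> z; rewrite lee_fin expR_ge0.
- by apply/measurable_EFinP; apply: measurableT_comp.
move=> u _.
under eq_integral => v _.
  rewrite big_ord_recr/= expRD.
  rewrite (eq_bigr (fun m : 'I_k => Z m u)); last first.
    by move=> m _; apply: dep_on_mix; apply: dZ; rewrite ltn_ord leqnn.
  rewrite EFinM; over.
rewrite ge0_integralZl//; last first.
  apply/measurable_EFinP; apply: measurableT_comp => //.
  by apply: (measurableT_comp (mZ k (ltnSn k))); exact: measurable_mixr.
by rewrite -[leRHS]mule1 lee_pmul2l// ?lte_fin ?expR_gt0// iZ.
Qed.

(** By [z <= ln K + expR (z - ln K)] the maximum is at most [ln K] plus the average of the
    exponentials. This envelope is measurable, and the average has mean at most one. *)
Lemma exp_max (I : finType) (Z : I -> Om -> R) : (0 < #|I|)%N ->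
  (forall i, measurable_fun setT (Z i)) ->
  (forall i, \int[mu]_u (expR (Z i u))%:E <= 1)%E ->
  exists W : Om -> R, [/\ measurable_fun setT W, forall u, 0 <= W u,
    (\int[mu]_u (W u)%:E <= (1 + ln #|I|%:R)%:E)%E & forall i u, Z i u <= W u].
Proof.
move=> I0 mZ iZ; set K : R := #|I|%:R.
have K1 : 1 <= K by rewrite /K ler1n.
have K0 : 0 < K by rewrite (lt_le_trans _ K1).
exists (fun u => ln K + K^-1 * \sum_i expR (Z i u)); split.
- apply: measurable_funD => //; apply: measurable_funM => //.
  by apply: measurable_sum => i; apply: measurableT_comp.
- move=> u; rewrite addr_ge0// ?ln_ge0// mulr_ge0//; first by rewrite invr_ge0 ltW.
  by rewrite sumr_ge0// => i _; rewrite expR_ge0.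
- under eq_integral do rewrite EFinD EFinM.
  rewrite ge0_integralD//; last 3 first.
  + by move=> u _; rewrite lee_fin ln_ge0.
  + move=> u _; rewrite -EFinM lee_fin mulr_ge0//; first by rewrite invr_ge0 ltW.
    by rewrite sumr_ge0// => i _; rewrite expR_ge0.
  + apply/measurable_EFinP; apply: measurable_funM => //.
    by apply: measurable_sum => i; apply: measurableT_comp.
  rewrite integral_cst// [X in (_ * X)%E](probability_setT mu) mule1 addrC EFinD leeD//.
  rewrite ge0_integralZl//; last 3 first.
  + by apply/measurable_EFinP; apply: measurable_sum => i; apply: measurableT_comp.
  + by move=> u _; rewrite lee_fin sumr_ge0// => i _; rewrite expR_ge0.
  + by rewrite lee_fin invr_ge0 ltW.
  under eq_integral do rewrite -sumEFin.
  rewrite ge0_integral_sum//; last first.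
    by move=> i; apply/measurable_EFinP; apply: measurableT_comp.
  apply: (@le_trans _ _ (K^-1%:E * K%:E)%E); last by rewrite -EFinM mulVf// gt_eqF.
  apply: lee_wpmul2l; first by rewrite lee_fin invr_ge0 ltW.
  rewrite /K -sum1_card natr_sum -sumEFin; apply: lee_sum => i _; exact: iZ.
move=> i u.
apply: (@le_trans _ _ (ln K + expR (Z i u - ln K))).
  by have := expR_ge1Dx (Z i u - ln K); lra.
rewrite lerD2l expRD expRN lnK ?posrE// mulrC ler_pM2l ?invr_gt0//.
by rewrite (bigD1 i)//= lerDl sumr_ge0// => j _; rewrite expR_ge0.
Qed.

(* Bounds the expectation of a supremum that need not be measurable. *)
Definition max_bound (I : Type) (F : I -> Om -> R) (beta : R) :=
  exists W : Om -> R, [/\ measurable_fun setT W, forall u, 0 <= W u,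
    (\int[mu]_u (W u)%:E <= beta%:E)%E & forall i u, F i u <= W u].

Lemma max_bound_le (I : Type) (F G : I -> Om -> R) b c :
  max_bound F b -> b <= c -> (forall i u, G i u <= F i u) -> max_bound G c.
Proof.
move=> [W [mW W0 iW FW]] bc GF; exists W; split => //.
  by rewrite (le_trans iW)// lee_fin.
by move=> i u; rewrite (le_trans (GF i u)).
Qed.

Lemma max_boundD (I : Type) (F G : I -> Om -> R) b c :
  max_bound F b -> max_bound G c -> max_bound (fun i u => F i u + G i u) (b + c).
Proof.
move=> [W [mW W0 iW FW]] [X [mX X0 iX GX]]; exists (fun u => W u + X u); split.
- exact: measurable_funD.
- by move=> u; rewrite addr_ge0.
- under eq_integral do rewrite EFinD.
  rewrite ge0_integralD//; try (by move=> u _; rewrite lee_fin);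
    try exact/measurable_EFinP.
  by rewrite EFinD leeD.
- by move=> i u; rewrite lerD.
Qed.

Lemma max_bound0 (I : Type) : max_bound (fun (_ : I) _ => 0) 0.
Proof.
exists (fun=> 0); split => //.
by rewrite integral0.
Qed.

Lemma max_bound_sum (I J : Type) (s : seq J) (F : J -> I -> Om -> R) b :
  (forall j, max_bound (F j) (b j)) ->
  max_bound (fun i u => \sum_(j <- s) F j i u) (\sum_(j <- s) b j).
Proof.
move=> bF; elim: s => [|j s IH].
  apply: (max_bound_le (max_bound0 I)); first by rewrite big_nil.
  by move=> i u; rewrite big_nil.
rewrite big_cons; apply: (max_bound_le (max_boundD (bF j) IH)) => // i u.
by rewrite big_cons.
Qed.

Lemma max_boundZ (I : Type) (F : I -> Om -> R) b c : 0 <= c ->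
  max_bound F b -> max_bound (fun i u => c * F i u) (c * b).
Proof.
move=> c0 [W [mW W0 iW FW]]; exists (fun u => c * W u); split.
- exact: measurable_funM.
- by move=> u; rewrite mulr_ge0.
- under eq_integral do rewrite EFinM.
  rewrite ge0_integralZl//; try (by move=> u _; rewrite lee_fin);
    try exact/measurable_EFinP.
  by rewrite EFinM lee_wpmul2l// lee_fin.
- by move=> i u; rewrite ler_wpM2l.
Qed.

Lemma max_bound_fun (I : Type) (W : Om -> R) b : bdm W -> (forall u, 0 <= W u) ->
  \int[mu]_u W u <= b -> max_bound (fun (_ : I) u => W u) b.
Proof.
move=> bW W0 Wb; exists W; split => //; first by case: bW.
by rewrite -EFin_Rint// lee_fin.
Qed.

Lemma max_bound_exp (I : finType) (Z : I -> Om -> R) : (0 < #|I|)%N ->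
  (forall i, measurable_fun setT (Z i)) ->
  (forall i, \int[mu]_u (expR (Z i u))%:E <= 1)%E ->
  max_bound Z (1 + ln #|I|%:R).
Proof. by move=> I0 mZ iZ; exact: exp_max. Qed.

(** There is no bound on [x], which leaves the parameter [la] of the martingale part unrestricted.
    The inverse [expR (x^2 - x)] is at least [1 - x + x^2], and [(1 + x + x^2) (1 - x + x^2) = 1 +
    x^2 + x^4]. *)
Lemma expR_sub_sqr_le (x w : R) : x ^+ 2 <= w -> expR (x - w) <= 1 + x + w.
Proof.
move=> xw; apply: (@le_trans _ _ (expR (x - x ^+ 2))); first by rewrite ler_expR; lra.
apply: (@le_trans _ _ (1 + x + x ^+ 2)); last by lra.
have e1 := expR_ge1Dx (x ^+ 2 - x).
have E : expR (x - x ^+ 2) * expR (x ^+ 2 - x) = 1.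
  by rewrite -expRD (_ : _ + _ = 0) ?expR0//; ring.
have p := expR_gt0 (x - x ^+ 2).
have q := expR_gt0 (x ^+ 2 - x).
have : 1 <= (1 + x + x ^+ 2) * (1 + (x ^+ 2 - x)).
  have -> : (1 + x + x ^+ 2) * (1 + (x ^+ 2 - x)) = 1 + x ^+ 2 + x ^+ 4 by ring.
  by rewrite -addrA lerDl addr_ge0 ?sqr_ge0// exprn_even_ge0.
move=> h; rewrite -[leLHS]mul1r.
have : (1 + x + x ^+ 2) * (1 + (x ^+ 2 - x)) <= (1 + x + x ^+ 2) * expR (x ^+ 2 - x).
  by rewrite ler_pM2l//; nra.
move=> /(le_trans h) h2.
have := ler_wpM2r (ltW p) h2.
by rewrite -mulrA [expR (x ^+ 2 - x) * _]mulrC E mulr1.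
Qed.

Section martingale_step.
Variables (a : int) (g : Om -> R) (Bf : Om -> Om -> R).
Hypothesis bg : bdm g.
Hypothesis bB : bdm (fun z : Om * Om => Bf z.1 z.2).
Hypothesis gB : forall u v, `|g u - g v| <= Bf u v.

Definition resample (u v : Om) : Om := mix (fun l => l != a) u v.

Definition step_var (u : Om) : R := \int[mu]_v (Bf u (resample u v) ^+ 2).

Let A (l : int) := a <= l.
Let A' (l : int) := a < l.

(** Conditioning is on the innovations from [a] on and after [a]: the filtration is that of the
    future, and the martingale runs backwards in time. *)
Definition step_dif (u : Om) : R := cexp A g u - cexp A' g u.

Lemma bdm_resample : bdm (fun z : Om * Om => Bf z.1 (resample z.1 z.2) ^+ 2).
Proof.
apply: bdm_sqr; case: bB => mB [M BM]; split; last by exists M => z; exact: (BM (z.1, _)).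
apply: (measurableT_comp (f := fun z : Om * Om => Bf z.1 z.2)
  (g := fun z : Om * Om => (z.1, resample z.1 z.2))) => //.
by apply: measurable_fun_pair => //; exact: measurable_mix.
Qed.

Lemma bdm_step_var : bdm step_var.
Proof. by apply: (bdm_Rint mu (G := fun z => Bf z.1 (resample z.1 z.2) ^+ 2)); exact: bdm_resample. Qed.

Lemma bdm_step_dif : bdm step_dif.
Proof. by apply: bdmB; exact: bdm_cexp. Qed.

Lemma step_dif_sqr u : step_dif u ^+ 2 <= cexp A step_var u.
Proof.
have mixE v : mix A' u v = resample (mix A u v) v.
  apply: co_inj => l; rewrite !co_mix /A /A' lt_def.
  by case: (eqVneq l a) => [->|]//=; rewrite ?andbF//; case: ifP.
rewrite /step_dif /cexp -RintB; [|exact: bdm_mixr..].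
pose Phi v := Bf (mix A u v) (resample (mix A u v) v) ^+ 2.
have bPhi : bdm Phi.
  have [mB [M BM]] := bdm_resample; split; last first.
    by exists M => v; have := BM (mix A u v, v).
  apply: (measurableT_comp (f := fun z : Om * Om => Bf z.1 (resample z.1 z.2) ^+ 2)
    (g := fun v => (mix A u v, v))) => //.
  by apply: measurable_fun_pair => //; exact: measurable_mixr.
apply: (@le_trans _ _ (\int[mu]_v Phi v)).
  apply: Rint_sqr_le => //; first by apply: bdmB; exact: bdm_mixr.
  move=> v; rewrite mixE /Phi -[leLHS]real_normK ?num_real// lerXn2r ?nnegrE//.
  by rewrite (le_trans _ (gB _ _)).
(* [mix A u v] reads [v] only before [a], and the resampling reads it only at [a]; the two roles of
   [v] can therefore be given to independent copies. *)
rewrite (Rint_mix (fun l => l != a) bPhi) le_eqVlt; apply/orP; left; apply/eqP.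
congr (Rintegral _ _ _); apply/funext => v; congr (Rintegral _ _ _).
apply/funext => x; rewrite /Phi.
have -> : mix A u (mix (fun l => l != a) v x) = mix A u v.
  apply: co_inj => l; rewrite !co_mix /A; case: ifP => //.
  by case: eqVneq => // ->; rewrite lexx.
congr (Bf _ _ ^+ 2); apply: co_inj => l; rewrite /resample !co_mix.
by case: eqVneq.
Qed.

(** With [W] the averaged [step_var], [expR_sub_sqr_le] bounds the conditional mean of
    [expR (la * D - la^2 * W)] by one plus [la^2] times the conditional mean of [W]; this explains
    the second, predictable compensator. Both compensators come from [Bf] and not from the function
    [g]. *)
Lemma step_exp (la : R) u :
  (\int[mu]_v (expR ((fun w => la * step_dif w
     - la ^+ 2 * (cexp A step_var w + cexp A' (cexp A step_var) w))
     (mix A' u v)))%:E <= 1)%E.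
Proof.
set Wv := cexp A step_var.
have bW : bdm Wv by apply: bdm_cexp; exact: bdm_step_var.
have W0 w : 0 <= Wv w.
  by rewrite /Wv (le_trans _ (step_dif_sqr w))// sqr_ge0.
have cE v : cexp A' Wv (mix A' u v) = cexp A' Wv u.
  by apply: dep_on_mix; exact: cexp_dep.
set w0 := cexp A' Wv u.
have bD' : bdm (fun v => step_dif (mix A' u v)).
  by apply: (bdm_mixr A' u); exact: bdm_step_dif.
have bW' : bdm (fun v => Wv (mix A' u v)) by exact: bdm_mixr.
pose h v := 1 + la * step_dif (mix A' u v) + la ^+ 2 * Wv (mix A' u v).
have bh : bdm h.
  apply: bdmD; last by apply: bdmZ.
  by apply: bdmD; [exact: bdm_cst|exact: bdmZ].
have dif0 : \int[mu]_v step_dif (mix A' u v) = 0.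
  rewrite /step_dif RintB; [|by apply: bdm_mixr; exact: bdm_cexp..].
  rewrite -[X in X - _]/(cexp A' (cexp A g) u) -[X in _ - X]/(cexp A' (cexp A' g) u).
  by rewrite !cexp_cexp ?subrr// => l; exact: ltW.
have ih : \int[mu]_v h v = 1 + la ^+ 2 * w0.
  rewrite /h RintD//; [|by apply: bdmD; [exact: bdm_cst|exact: bdmZ]|exact: bdmZ].
  by rewrite RintD ?Rint_cst ?RintZ ?dif0 ?mulr0 ?addr0//; [exact: bdm_cst|exact: bdmZ].
apply: (@le_trans _ _ (\int[mu]_v ((expR (- (la ^+ 2 * w0)))%:E * (h v)%:E))%E).
  apply: ge0_le_integral => //.
  - apply/measurable_EFinP; apply: measurableT_comp => //.
    have [mD _] := bD'; have [mW' _] := bW'.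
    have [mE _] := bdm_mixr A' u (bdm_cexp A' bW).
    apply: (measurable_funB (measurable_funM (measurable_cst _) mD)).
    exact: (measurable_funM (measurable_cst _) (measurable_funD mW' mE)).
  - by apply/measurable_EFinP; apply: measurable_funM => //; case: bh.
  move=> v _; rewrite -EFinM lee_fin.
  rewrite (_ : la * _ - _ = - (la ^+ 2 * w0) +
    (la * step_dif (mix A' u v) - la ^+ 2 * Wv (mix A' u v))); last first.
    by rewrite cE -/w0; ring.
  rewrite expRD ler_pM2l ?expR_gt0// /h; apply: expR_sub_sqr_le.
  by rewrite exprMn ler_wpM2l ?sqr_ge0// step_dif_sqr.
under eq_integral do rewrite -EFinM.
rewrite -EFin_Rint; last exact: bdmZ.
rewrite lee_fin RintZ// ih expRN mulrC ler_pdivrMr ?expR_gt0// mul1r.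
exact: expR_ge1Dx.
Qed.

Lemma Rint_step_var : \int[mu]_u cexp A step_var u = \int[mu]_u step_var u.
Proof. by rewrite Rint_cexp//; exact: bdm_step_var. Qed.

End martingale_step.

(** * Uniform deviation bounds for finite families *)

Section families.
Variables (I : finType) (k : nat) (T0 : int) (M : R) (G : nat -> I -> Om -> R) (e : I -> R).
Hypothesis I0 : (0 < #|I|)%N.
Hypothesis M0 : 0 < M.
Hypothesis mG : forall t c, measurable_fun setT (G t c).
Hypothesis G0M : forall t c u, 0 <= G t c u <= M.
Hypothesis depG : forall t c, dep_on (fun l => l <= T0 + t%:Z) (G t c).
Hypothesis eG : forall t c, \int[mu]_u G t c u = e c.

Let H : R := 1 + ln #|I|%:R.

Let bG t c : bdm (G t c).
Proof.
split => //; exists M => u; have /andP[? ?] := G0M t c u.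
by rewrite ger0_norm.
Qed.

Let H0 : 0 < H.
Proof. by rewrite /H ltr_pwDl// ln_ge0// ler1n. Qed.

(* G t c averaged over everything except the last j innovations. *)
Definition trunc_cexp (j t : nat) (c : I) : Om -> R :=
  cexp (fun l => T0 + t%:Z + 1 - j%:Z <= l) (G t c).

Let bY j t c : bdm (trunc_cexp j t c).
Proof. exact: bdm_cexp. Qed.

Let Y0M j t c u : 0 <= trunc_cexp j t c u <= M.
Proof.
apply/andP; split; first by apply: cexp_ge0 => // x; have /andP[] := G0M t c x.
rewrite (le_trans (ler_norm _))// cexp_norm_le// => x.
by have /andP[? ?] := G0M t c x; rewrite ger0_norm.
Qed.

Let dep_onS (A B : int -> bool) S (F : Om -> S) : (forall l, A l -> B l) ->
  dep_on A F -> dep_on B F.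
Proof. by move=> AB dF u v uv; apply: dF => l /AB/uv. Qed.

Let Ydep j t c : dep_on (fun l => l <= T0 + t%:Z) (trunc_cexp j t c).
Proof.
move=> u v uv; congr (Rintegral _ _ _); apply/funext => x; apply: depG => l lt.
by rewrite !co_mix; case: ifP => // _; exact: uv.
Qed.

(** Origin of the factor in [e c / 2]: giving up half of the mean, one obtains an exponential moment
    of at most one with no variance term left over. *)
Lemma expRN_le_half (y : R) : 0 <= y <= 1 -> expR (- y) <= 1 - y / 2.
Proof.
move=> /andP[y0 y1]; rewrite expRN -div1r ler_pdivrMr ?expR_gt0//.
apply: (@le_trans _ _ ((1 - y / 2) * (1 + y))); first by nra.
by rewrite ler_wpM2l ?expR_ge1Dx//; lra.
Qed.

(* Truncations at distance q along one residue class are independent. *)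
Lemma block_max q b : (0 < q)%N ->
  max_bound (fun c u => \sum_(t < k | (t %% q == b)%N) (e c / 2 - trunc_cexp q t c u)) (M * H).
Proof.
move=> q0.
pose Z c t u := if (t %% q == b)%N then M^-1 * (e c / 2 - trunc_cexp q t c u) else 0.
have mZ c t : measurable_fun setT (Z c t).
  rewrite /Z; case: (_ == _) => //; apply: measurable_funM => //.
  by apply: measurable_funB => //; case: (bY q t c).
have : max_bound (fun c u => \sum_(t < k) Z c t u) H.
  apply: max_bound_exp => // [c|c].
    by apply: measurable_sum => t.
  (* At a time [t] of the class the conditioning is on everything before the window of [q]
     innovations that ends at [T0 + t]. Other times carry a zero summand and condition on
     everything. *)
  apply: (@exp_chain k (Z c) (fun t l =>
    if (t %% q == b)%N then l < T0 + t%:Z + 1 - q%:Z else true)) => //.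
  - move=> m m' /andP[m'm mk].
    case: eqP => mb; last by move=> u v uv; congr (Z _ _ _); apply: co_inj => l; exact: uv.
    rewrite /Z; case: eqP => // m'b u v uv; congr (_ * (_ - _)).
    apply: Ydep => l lm'; apply: uv.
    have qm : (m' + q <= m)%N.
      have := divn_eq m q; have := divn_eq m' q; rewrite mb m'b => E1 E2.
      have lt : (m' %/ q < m %/ q)%N.
        rewrite ltnNge; apply/negP => le; have := leq_mul2r q (m %/ q) (m' %/ q).
        by rewrite le orbT; lia.
      have := leq_mul2r q (m' %/ q).+1 (m %/ q); rewrite lt orbT mulSn; lia.
    by lia.
  - move=> m u mk; rewrite /Z; case: eqP => mb; last first.
      by under eq_integral do rewrite expR0; rewrite integral_cst// [X in (_ * X)%E](probability_setT mu) mul1e.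
    under eq_integral => v _.
      rewrite (_ : trunc_cexp q m c _ = trunc_cexp q m c v); last first.
        by apply: cexp_dep => l lm; rewrite co_mix; case: ifP => //; lia.
      over.
    have bh : bdm (fun v => 1 - (M^-1 / 2) * trunc_cexp q m c v).
      by apply: bdmB; [exact: bdm_cst|exact: bdmZ].
    apply: (@le_trans _ _ (\int[mu]_v ((expR (M^-1 * (e c / 2)))%:E *
        (1 - (M^-1 / 2) * trunc_cexp q m c v)%:E))%E).
      apply: ge0_le_integral => //.
      - apply/measurable_EFinP; apply: measurableT_comp => //.
        apply: measurable_funM => //; apply: measurable_funB => //.
        by case: (bY q m c).
      - by apply/measurable_EFinP; apply: measurable_funM => //; case: bh.
      move=> v _; rewrite -EFinM lee_fin mulrBr expRD ler_pM2l ?expR_gt0//.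
      have /andP[y0 yM] := Y0M q m c v.
      apply: (le_trans (expRN_le_half _)); last by rewrite mulrAC.
      by rewrite mulr_ge0 ?invr_ge0 ?(ltW M0)//= mulrC ler_pdivrMr// mul1r.
    under eq_integral do rewrite -EFinM.
    rewrite -EFin_Rint; last exact: bdmZ.
    rewrite RintZ// RintB; [|exact: bdm_cst|exact: bdmZ].
    rewrite Rint_cst RintZ// Rint_cexp// eG lee_fin.
    apply: (@le_trans _ _ (expR (M^-1 * (e c / 2)) * expR (- (M^-1 * (e c / 2))))).
      rewrite ler_pM2l ?expR_gt0//; apply: le_trans (expR_ge1Dx _).
      by rewrite lerD2l lerN2 mulrA mulrAC.
    by rewrite -expRD subrr expR0.
move=> /(max_boundZ (ltW M0)) h; apply: (max_bound_le h) => // c u.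
rewrite mulr_sumr big_mkcond/=; apply: ler_sum => t _; rewrite /Z.
by case: ifP => _; rewrite ?mulr0// mulrA mulfV ?mul1r// gt_eqF.
Qed.

Section with_coupling.
Variable Bf : nat -> Om -> Om -> R.
Hypothesis bB : forall t, bdm (fun z : Om * Om => Bf t z.1 z.2).
Hypothesis GB : forall t c u v, `|G t c u - G t c v| <= Bf t u v.

(** The compensators depend on [t] and [Bf] only. The maximum over [I] does not reach them, and
    their means, at most [s2] each, give the second term. *)
Lemma martingale_max j s2 la : 0 < la ->
  (forall t, \int[mu]_u step_var (T0 + t%:Z - j%:Z) (Bf t) u <= s2) ->
  max_bound (fun c u => \sum_(t < k) (trunc_cexp j t c u - trunc_cexp j.+1 t c u))
    (H / la + 2 * la * k%:R * s2).
Proof.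
move=> la0 hs2.
pose a t : int := T0 + t%:Z - j%:Z.
pose D t c := step_dif (a t) (G t c).
have DE t c u : trunc_cexp j t c u - trunc_cexp j.+1 t c u = - D t c u.
  rewrite /D /step_dif /trunc_cexp opprB.
  have -> : (fun l => T0 + t%:Z + 1 - j%:Z <= l) = (fun l => a t < l).
    by apply/funext => l; rewrite /a; apply/idP/idP; lia.
  have -> // : (fun l => T0 + t%:Z + 1 - j.+1%:Z <= l) = (fun l => a t <= l).
  by apply/funext => l; rewrite /a; apply/idP/idP; lia.
pose Wt t := cexp (fun l => a t <= l) (step_var (a t) (Bf t)).
pose Et t := cexp (fun l => a t < l) (Wt t).
have bW t : bdm (Wt t) by apply: bdm_cexp; exact: bdm_step_var.
have bE t : bdm (Et t) by exact: bdm_cexp.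
have bD t c : bdm (D t c) by exact: bdm_step_dif.
have W0 t u : 0 <= Wt t u.
  have /card_gt0P [c _] := I0.
  rewrite /Wt (le_trans _ (step_dif_sqr (a t) (bG t c) (bB t) (GB t c) u))//.
  exact: sqr_ge0.
have E0 t u : 0 <= Et t u by apply: cexp_ge0.
(* The increment of the truncations is [- D], whence the parameter [- la]. *)
pose Z t c u := - la * D t c u - (- la) ^+ 2 * (Wt t u + Et t u).
have mZ t c : measurable_fun setT (Z t c).
  have [mD _] := bD t c; have [mW _] := bW t; have [mE _] := bE t.
  apply: measurable_funB; apply: measurable_funM => //; exact: measurable_funD.
have Zdep t c : dep_on (fun l => a t <= l) (Z t c).
  move=> u v uv; rewrite /Z /D /step_dif.
  rewrite (cexp_dep (G t c) uv) (cexp_dep _ uv : Wt t u = Wt t v).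
  have uv' l : a t < l -> co u l = co v l by move=> /ltW; exact: uv.
  by rewrite (cexp_dep (G t c) uv') (cexp_dep _ uv' : Et t u = Et t v).
have : max_bound (fun c u => \sum_(t < k) Z t c u) H.
  apply: max_bound_exp => // c; first by apply: measurable_sum => t.
  (* [Z t] is a function of the innovations from [a t] on, so the chain has to run from the latest
     time to the earliest. *)
  under eq_integral do rewrite (reindex_inj rev_ord_inj)/=.
  apply: (@exp_chain k (fun m => Z (k - m.+1)%N c) (fun m l => a (k - m.+1)%N < l)).
  - by move=> m _; exact: mZ.
  - move=> m m' /andP[m'm mk]; apply: dep_onS (Zdep _ _) => l.
    by rewrite /a; lia.
  - move=> m u _.
    exact: (step_exp (a (k - m.+1)%N) (bG (k - m.+1)%N c) (bB (k - m.+1)%N)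
      (GB (k - m.+1)%N c) (- la) u).
move=> /(max_boundZ (c := la^-1)) h.
have ila : 0 <= la^-1 by rewrite invr_ge0 ltW.
have {h} h := h ila.
have h2 : max_bound (fun (c : I) u => \sum_(t < k) la * (Wt t u + Et t u)) (2 * la * k%:R * s2).
  apply: (@max_bound_le _ (fun (c : I) u => \sum_(t < k) la * (Wt t u + Et t u))
     _ (\sum_(t < k) 2 * la * s2)) => //.
    apply: max_bound_sum => t; apply: max_bound_fun.
    - by apply: bdmZ; apply: bdmD; [exact: bW|exact: bE].
    - by move=> u; apply: mulr_ge0; [exact: ltW|apply: addr_ge0; [exact: W0|exact: E0]].
    - have iW : \int[mu]_u Wt t u = \int[mu]_u step_var (a t) (Bf t) u.
        by apply: Rint_step_var; exact: bB.
      have iE : \int[mu]_u Et t u = \int[mu]_u Wt t u by apply: Rint_cexp; exact: bW.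
      rewrite RintZ; last by apply: bdmD; [exact: bW|exact: bE].
      rewrite RintD; [|exact: bW|exact: bE].
      rewrite iE iW (_ : 2 * la * s2 = la * (s2 + s2)); last by ring.
      rewrite (ler_pM2l la0); exact: (lerD (hs2 t) (hs2 t)).
  by rewrite sumr_const card_ord -[X in X <= _]mulr_natr mulrAC.
apply: (max_bound_le (max_boundD h h2)).
  by rewrite mulrC.
move=> c u; rewrite mulr_sumr -big_split/=; apply: ler_sum => t _.
rewrite DE /Z sqrrN mulrBr mulrA mulrN mulVf ?gt_eqF// mulN1r expr2 !mulrA mulVf ?gt_eqF// mul1r.
by rewrite subrK.
Qed.

(* lambda = sqrt (H / k) / s_j balances the two terms of [martingale_max];
   eta keeps it finite when s_j = 0. *)
Lemma coupling_max q (s : nat -> R) S : (0 < q)%N -> (0 < k)%N ->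
  (forall j, 0 <= s j) ->
  (forall t j, \int[mu]_u step_var (T0 + t%:Z - j%:Z) (Bf t) u <= s j ^+ 2) ->
  (forall n, \sum_(j < n) s (q + j)%N <= S) ->
  (forall t c eps, 0 < eps -> exists J0, forall J, (J0 <= J)%N ->
     \int[mu]_u `|G t c u - trunc_cexp J t c u| <= eps) ->
  max_bound (fun c u => \sum_(t < k) (e c / 2 - G t c u))
    (q%:R * (M * H) + 3 * Num.sqrt (k%:R * H) * S + 2).
Proof.
move=> q0 k0 s0 hs hS dens.
have kR : 0 < k%:R :> R by rewrite ltr0n.
have IR : 0 < #|I|%:R :> R by rewrite ltr0n.
(* The telescoping sum is cut at a finite level. With this tolerance the remainders of all times and
   all members have total mean at most one; the contribution of [eta] is at most one as well, which
   gives the constant 2. *)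
pose eps : R := (k%:R * #|I|%:R)^-1.
have eps0 : 0 < eps by rewrite invr_gt0 mulr_gt0.
have [J0 hJ0] : exists J0 : nat, forall (t : 'I_k) c J, (J0 <= J)%N ->
    \int[mu]_u `|G t c u - trunc_cexp J t c u| <= eps.
  have /choice[f hf] : forall z : 'I_k * I, exists J0 : nat, forall J, (J0 <= J)%N ->
    \int[mu]_u `|G z.1 z.2 u - trunc_cexp J z.1 z.2 u| <= eps.
    by move=> z; exact: dens.
  exists (\max_z f z) => t c J hJ; apply: (hf (t, c)).
  by rewrite (leq_trans _ hJ)//; exact: leq_bigmax.
pose n := J0.
pose rt : R := Num.sqrt (k%:R * H).
have rt0 : 0 < rt by rewrite sqrtr_gt0 mulr_gt0.
have rt2 : rt ^+ 2 = k%:R * H by rewrite sqr_sqrtr// ltW// mulr_gt0.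
(* Summed over the [n] levels, [3 * rt * eta] stays below one. *)
pose eta : R := (3 * rt * n.+1%:R)^-1.
have eta0 : 0 < eta by rewrite invr_gt0 !mulr_gt0.
have h1 : max_bound (fun c u => \sum_(t < k) (e c / 2 - trunc_cexp q t c u)) (q%:R * (M * H)).
  apply: (max_bound_le (max_bound_sum (index_enum 'I_q) (fun b : 'I_q => block_max b q0))).
    by rewrite sumr_const card_ord mulr_natl.
  move=> c u.
  rewrite (partition_big (fun t : 'I_k => Ordinal (ltn_pmod t q0)) predT)//=.
have h2 : max_bound (fun c u => \sum_(j < n) \sum_(t < k)
    (trunc_cexp (q + j) t c u - trunc_cexp (q + j).+1 t c u)) (3 * rt * S + 1).
  apply: (@max_bound_le _ _ _ (\sum_(j < n) 3 * rt * (s (q + j)%N + eta))).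
  - apply: (max_bound_sum (index_enum 'I_n) (F := fun j c u => \sum_(t < k)
      (trunc_cexp (q + j) t c u - trunc_cexp (q + j).+1 t c u))) => j.
    pose sj := s (q + j)%N + eta.
    have sj0 : 0 < sj by rewrite ltr_wpDl.
    pose la := rt / (k%:R * sj).
    have la0 : 0 < la by rewrite divr_gt0// mulr_gt0.
    apply: (max_bound_le (@martingale_max (q + j) (s (q + j)%N ^+ 2) la la0 _)) => //.
    have HE : H = rt ^+ 2 / k%:R by rewrite rt2 mulrAC mulfV ?mul1r// gt_eqF.
    have -> : H / la = rt * sj.
      by rewrite HE /la; field; rewrite !gt_eqF.
    have -> : 2 * la * k%:R * s (q + j)%N ^+ 2 = 2 * rt * (s (q + j)%N ^+ 2 / sj).
      by rewrite /la; field; rewrite !gt_eqF.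
    have : s (q + j)%N ^+ 2 / sj <= sj.
      rewrite ler_pdivrMr// -expr2 lerXn2r ?nnegrE//; first exact: ltW.
      by rewrite /sj lerDl ltW.
    move=> h; have := ler_wpM2l (ltW rt0) h; rewrite -/sj; nra.
  - under eq_bigr do rewrite mulrDr.
    rewrite big_split/= -mulr_sumr lerD//.
      by apply: ler_wpM2l; [rewrite mulr_ge0// ltW|exact: hS].
    have -> : 3 * rt * eta = n.+1%:R^-1.
      by rewrite /eta invfM mulrA mulfV ?mul1r// gt_eqF// mulr_gt0.
    by rewrite sumr_const card_ord -[X in X <= _]mulr_natl ler_pdivrMr// mul1r ler_nat.
  - by [].
have h3 : max_bound (fun c u => \sum_(t < k) (trunc_cexp (q + n) t c u - G t c u)) 1.
  apply: (@max_bound_le _ (fun _ u => \sum_(z : 'I_k * I) `|G z.1 z.2 u - trunc_cexp (q + n) z.1 z.2 u|)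
    _ (\sum_(z : 'I_k * I) eps)).
  - apply: max_bound_sum => -[t c]; apply: max_bound_fun.
    + have bd : bdm (fun u => G t c u - trunc_cexp (q + n) t c u) by exact: bdmB.
      case: bd => mf [N fN]; split; last by exists N => u; rewrite normr_id.
      exact: measurableT_comp.
    + by move=> u; exact: normr_ge0.
    + by apply: hJ0; rewrite leq_addl.
  - rewrite sumr_const card_prod card_ord -mulr_natl natrM mulfV//.
    by rewrite gt_eqF// mulr_gt0.
  - move=> c u.
    rewrite -(pair_bigA _ (fun (t : 'I_k) c => `|G t c u - trunc_cexp (q + n) t c u|))/=.
    apply: ler_sum => t _; rewrite (bigD1 c)//=.
    apply: ler_wpDr; first by rewrite sumr_ge0.
    by rewrite distrC ler_norm.
apply: (max_bound_le (max_boundD (max_boundD h1 h2) h3)).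
  by rewrite -/rt; lra.
move=> c u; rewrite exchange_big/= -!big_split/=; apply: ler_sum => t _.
have -> : \sum_(j < n) (trunc_cexp (q + j) t c u - trunc_cexp (q + j).+1 t c u) =
    trunc_cexp q t c u - trunc_cexp (q + n) t c u.
  elim: (n) => [|m IH]; first by rewrite big_ord0 addn0 subrr.
  by rewrite big_ord_recr/= IH addnS; ring.
by lra.
Qed.

End with_coupling.
End families.
End mixing.

(** * ReLU approximation of products *)

Section sawtooth.
Context {R : realType}.
Implicit Types u v x y : R.

Definition relu x : R := Num.max x 0.

Lemma relu_id x : 0 <= x -> relu x = x.
Proof. by move=> x0; rewrite /relu; apply/max_idPl. Qed.

Lemma relu_0 x : x <= 0 -> relu x = 0.
Proof. by move=> x0; rewrite /relu; apply/max_idPr. Qed.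

Lemma relu_ge0 x : 0 <= relu x.
Proof. by rewrite /relu le_max lexx orbT. Qed.

Lemma relu_lip x y : `|relu x - relu y| <= `|x - y|.
Proof.
have [x0|x0] := leP 0 x; have [y0|y0] := leP 0 y;
  rewrite ?(relu_id x0) ?(relu_id y0) ?(relu_0 (ltW x0)) ?(relu_0 (ltW y0)) //.
- by rewrite subr0 !ger0_norm//; lra.
- have xy : x - y <= 0 by lra.
  by rewrite sub0r normrN (ger0_norm y0) (ler0_norm xy); lra.
- by rewrite subr0 normr0.
Qed.

Definition tent u : R := Num.min (2 * u) (2 - 2 * u).

Lemma tent_l u : u <= 1 / 2 -> tent u = 2 * u.
Proof. by move=> h; rewrite /tent; apply/min_idPl; lra. Qed.

Lemma tent_r u : 1 / 2 <= u -> tent u = 2 - 2 * u.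
Proof. by move=> h; rewrite /tent; apply/min_idPr; lra. Qed.

Lemma tent01 u : 0 <= u <= 1 -> 0 <= tent u <= 1.
Proof.
move=> h; have [h'|/ltW h'] := leP u (1 / 2); first by rewrite (tent_l h'); lra.
by rewrite (tent_r h'); lra.
Qed.

Lemma tent_lip u v : `|tent u - tent v| <= 2 * `|u - v|.
Proof.
have [h|/ltW h] := leP u (1 / 2); have [h'|/ltW h'] := leP v (1 / 2);
  rewrite ?(tent_l h) ?(tent_r h) ?(tent_l h') ?(tent_r h').
- by rewrite -mulrBr normrM ger0_norm.
- have uv : u - v <= 0 by lra.
  by rewrite (ler0_norm uv) ler_norml; lra.
- have uv : 0 <= u - v by lra.
  by rewrite (ger0_norm uv) ler_norml; lra.
- rewrite (_ : 2 - 2 * u - (2 - 2 * v) = 2 * (v - u)); last by ring.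
  by rewrite normrM ger0_norm// (distrC v).
Qed.

Definition saw k u : R := iter k tent u.

Lemma saw01 k u : 0 <= u <= 1 -> 0 <= saw k u <= 1.
Proof. by move=> h; elim: k => //= k IH; exact: tent01. Qed.

Lemma saw_lip k u v : `|saw k u - saw k v| <= 2 ^+ k * `|u - v|.
Proof.
elim: k => [|k IH]; first by rewrite mul1r.
by rewrite (le_trans (tent_lip _ _))// exprS -mulrA ler_pM2l.
Qed.

(* Piecewise linear interpolation of the square at the multiples of 2^-m. *)
Definition sq m u : R := u - \sum_(i < m) saw i.+1 u / 4 ^+ i.+1.

Lemma sqS m u : sq m.+1 u = sq m u - saw m.+1 u / 4 ^+ m.+1.
Proof. by rewrite /sq big_ord_recr/= opprD addrA. Qed.

(** The closed form of the error shows its size, of order [4^-m], and, since [saw m] has slopes of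
    size [2^m], its Lipschitz constant of order [2^-m]. *)
Lemma sqE m u : 0 <= u <= 1 -> sq m u = u ^+ 2 + saw m u * (1 - saw m u) / 4 ^+ m.
Proof.
move=> u01; elim: m => [|m IH].
  by rewrite /sq big_ord0 /saw/= expr0; field.
rewrite sqS IH; have := saw01 m u01; rewrite /saw iterS -/(saw m u) => t01.
have p4 : 4 ^+ m != 0 :> R by rewrite expf_neq0//; lra.
rewrite [4 ^+ m.+1]exprS; have [h|/ltW h] := leP (saw m u) (1 / 2).
  by rewrite (tent_l h); field.
by rewrite (tent_r h); field.
Qed.

Lemma sq_rec m u : 0 <= u <= 1 ->
  sq m.+1 u = u ^+ 2 + (sq m (tent u) - tent u ^+ 2) / 4.
Proof.
move=> u01; rewrite !sqE ?tent01// /saw iterSr.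
have p4 : 4 ^+ m != 0 :> R by rewrite expf_neq0//; lra.
by rewrite [4 ^+ m.+1]exprS; field.
Qed.

(** Monotonicity makes [mult] nonnegative. It rests on the self-similarity [sq_rec] on either side
    of 1/2; on the right half [sq m.+1 u = 2 u - 1 + sq m (2 - 2 u) / 4], so the upper bound 2 on
    the slope must be part of the induction. *)
Lemma sq_mono m u v : 0 <= u -> u <= v -> v <= 1 ->
  0 <= sq m v - sq m u <= 2 * (v - u).
Proof.
elim: m u v => [|m IH] u v u0 uv v1; first by rewrite /sq !big_ord0; lra.
have lo a b : 0 <= a -> a <= b -> b <= 1 / 2 ->
    0 <= sq m.+1 b - sq m.+1 a <= 2 * (b - a).
  move=> a0 ab b1; rewrite !sq_rec; [|lra..].
  rewrite !tent_l; [|lra..].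
  by have /andP[] := IH (2 * a) (2 * b) ltac:(lra) ltac:(lra) ltac:(lra); nra.
have hi a b : 1 / 2 <= a -> a <= b -> b <= 1 ->
    0 <= sq m.+1 b - sq m.+1 a <= 2 * (b - a).
  move=> a0 ab b1; rewrite !sq_rec; [|lra..].
  rewrite !tent_r; [|lra..].
  by have /andP[] := IH (2 - 2 * b) (2 - 2 * a) ltac:(lra) ltac:(lra) ltac:(lra); nra.
have [v2|v2] := leP v (1 / 2); first exact: lo.
have [u2|u2] := leP u (1 / 2); last by apply: hi => //; exact: ltW.
have /andP[? ?] := lo u (1 / 2) u0 u2 (lexx _).
have /andP[? ?] := hi (1 / 2) v (lexx _) (ltW v2) v1.
by lra.
Qed.

Lemma sq01 m u : 0 <= u <= 1 -> 0 <= sq m u <= 1.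
Proof.
move=> u01; have s0 : sq m 0 = 0.
  rewrite sqE ?lexx ?ler01// (_ : saw m 0 = 0) ?mul0r ?expr0n ?addr0//.
  by elim: m => //= m ->; rewrite tent_l; lra.
have s1 : sq m 1 = 1.
  rewrite sqE ?lexx ?ler01//; case: m {s0} => [|m].
    by rewrite /saw/=; field.
  rewrite (_ : saw m.+1 1 = 0) ?mul0r ?mul0r ?expr1n ?addr0//.
  elim: m => [|m IH]; first by rewrite /saw/= tent_r; lra.
  by rewrite /saw iterS -/(saw m.+1 1) IH tent_l; lra.
have /andP[u0 u1] := u01.
have /andP[? _] := sq_mono m (lexx 0) u0 u1.
have /andP[? _] := sq_mono m u0 u1 (lexx 1).
by lra.
Qed.

(** Polarization. If one factor is zero the two squares coincide and the approximate product
    vanishes exactly; this keeps each term of the network local to the support of its hat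
    functions. *)
Definition mult m x y : R := sq m ((x + y) / 2) - sq m (`|x - y| / 2).

Definition sqerr m u : R := saw m u * (1 - saw m u) / 4 ^+ m.

Let unit_args x y : 0 <= x <= 1 -> 0 <= y <= 1 ->
  (0 <= (x + y) / 2 <= 1) * (0 <= `|x - y| / 2 <= 1) * (`|x - y| / 2 <= (x + y) / 2).
Proof.
move=> x01 y01; do ![split]; first by lra.
  by have := normr_ge0 (x - y); have [] := ler0P (x - y); lra.
by have [] := ler0P (x - y); lra.
Qed.

Lemma multE m x y : 0 <= x <= 1 -> 0 <= y <= 1 ->
  mult m x y = x * y + sqerr m ((x + y) / 2) - sqerr m (`|x - y| / 2).
Proof.
move=> x01 y01; rewrite /mult !sqE ?(unit_args x01 y01)// /sqerr.
rewrite [(`|_| / 2) ^+ 2]expr_div_n -normrX ger0_norm ?sqr_ge0//.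
by field.
Qed.

Lemma mult01 m x y : 0 <= x <= 1 -> 0 <= y <= 1 -> 0 <= mult m x y <= 1.
Proof.
move=> x01 y01; have [[a01 b01] ba] := unit_args x01 y01.
have /andP[b0 b1] := b01; have /andP[a0 a1] := a01.
have /andP[? _] := sq_mono m b0 ba a1.
have := sq01 m a01; have := sq01 m b01; rewrite /mult; lra.
Qed.

Lemma mult0l m y : 0 <= y -> mult m 0 y = 0.
Proof. by move=> y0; rewrite /mult add0r sub0r normrN ger0_norm// subrr. Qed.

Lemma mult0r m x : 0 <= x -> mult m x 0 = 0.
Proof. by move=> y0; rewrite /mult addr0 subr0 ger0_norm// subrr. Qed.

Let p4 m : 0 < 4 ^+ m :> R. Proof. by rewrite exprn_gt0. Qed.

Lemma sqerr_bound m u : 0 <= u <= 1 -> 0 <= sqerr m u <= (4 ^+ m)^-1.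
Proof.
move=> /(saw01 m) /andP[t0 t1]; rewrite /sqerr; apply/andP; split.
  by rewrite divr_ge0 ?mulr_ge0 ?subr_ge0// ltW.
by rewrite ler_piMl ?invr_ge0 ?(ltW (p4 m))//; nra.
Qed.

Lemma sqerr_lip m u v : 0 <= u <= 1 -> 0 <= v <= 1 ->
  `|sqerr m u - sqerr m v| <= (2 ^+ m)^-1 * `|u - v|.
Proof.
move=> u01 v01; rewrite /sqerr -mulrBl normrM [X in _ * X]ger0_norm ?invr_ge0 ?(ltW (p4 m))//.
have -> : saw m u * (1 - saw m u) - saw m v * (1 - saw m v) =
  (saw m u - saw m v) * (1 - saw m u - saw m v) by ring.
have := saw01 m u01; have := saw01 m v01 => /andP[? ?] /andP[? ?].
rewrite normrM ler_pdivrMr//.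
apply: (@le_trans _ _ (`|saw m u - saw m v| * 1)).
  by rewrite ler_wpM2l// ler_norml; lra.
rewrite mulr1 (le_trans (saw_lip _ _ _))// mulrAC ler_wpM2r//.
have p2 : 2 ^+ m != 0 :> R by rewrite expf_neq0.
by rewrite (_ : 4 = 2 * 2 :> R) ?exprMn ?mulrA ?mulVf ?mul1r//; ring.
Qed.

Lemma mult_err m x y : 0 <= x <= 1 -> 0 <= y <= 1 ->
  `|mult m x y - x * y| <= (4 ^+ m)^-1.
Proof.
move=> x01 y01; have [[a01 b01] _] := unit_args x01 y01.
rewrite multE//; have /andP[? ?] := sqerr_bound m a01; have /andP[? ?] := sqerr_bound m b01.
by rewrite ler_norml; lra.
Qed.

(** A small error is not enough, its slope has to be small too: the factors multiplied later have
    slopes up to the grid size [M], and the factor [2^-m] compensates for them as soon as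
    [M <= 2 ^ m]. *)
Lemma mult_err_lip m x y x' y' :
  0 <= x <= 1 -> 0 <= y <= 1 -> 0 <= x' <= 1 -> 0 <= y' <= 1 ->
  `|(mult m x y - x * y) - (mult m x' y' - x' * y')| <=
    (2 ^+ m)^-1 * (`|x - x'| + `|y - y'|).
Proof.
move=> x01 y01 x01' y01'; have [[a01 b01] _] := unit_args x01 y01.
have [[a01' b01'] _] := unit_args x01' y01'.
rewrite !multE//.
have -> : x * y + sqerr m ((x + y) / 2) - sqerr m (`|x - y| / 2) - x * y -
  (x' * y' + sqerr m ((x' + y') / 2) - sqerr m (`|x' - y'| / 2) - x' * y') =
  (sqerr m ((x + y) / 2) - sqerr m ((x' + y') / 2)) +
  (sqerr m (`|x' - y'| / 2) - sqerr m (`|x - y| / 2)) by ring.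
rewrite (le_trans (ler_normD _ _))//.
have h1 := sqerr_lip m a01 a01'; have h2 := sqerr_lip m b01' b01.
apply: (le_trans (lerD h1 h2)); rewrite -mulrDr ler_wpM2l ?invr_ge0 ?exprn_ge0//.
rewrite -!mulrBl !normrM (@ger0_norm _ 2^-1)//.
have h3 : `|x + y - (x' + y')| <= `|x - x'| + `|y - y'|.
  by rewrite (_ : _ - _ = (x - x') + (y - y')) ?ler_normD//; ring.
have h4 : `| `|x' - y'| - `|x - y| | <= `|x - x'| + `|y - y'|.
  rewrite (le_trans (ler_dist_dist _ _))//.
  rewrite (_ : _ - _ = - (x - x') + (y - y')); last by ring.
  by rewrite (le_trans (ler_normD _ _))// normrN.
lra.
Qed.

Fixpoint prodt m q (f : nat -> R) : R :=
  if q is q'.+1 then mult m (prodt m q' f) (prodt m q' (fun i => f (2 ^ q' + i)%N))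
  else f 0%N.

Definition prode q (f : nat -> R) : R := \prod_(i < 2 ^ q) f i.

Lemma prodeS q f : prode q.+1 f = prode q f * prode q (fun i => f (2 ^ q + i)%N).
Proof.
by rewrite /prode -!(big_mkord predT) expnS mul2n -addnn (big_cat_nat (n := 2 ^ q)) ?leq_addr//=
  -{2}[(2 ^ q)%N]addn0 addnC big_addn addnK; congr (_ * _); rewrite !big_mkord; apply: eq_bigr => i _; rewrite addnC.
Qed.

Lemma prodt01 m q f : (forall i, 0 <= f i <= 1) -> 0 <= prodt m q f <= 1.
Proof. by elim: q f => [|q IH] f f01 //=; apply: mult01; apply: IH. Qed.

Lemma prode01 q f : (forall i, 0 <= f i <= 1) -> 0 <= prode q f <= 1.
Proof.
move=> f01; apply/andP; split; first by apply: prodr_ge0 => i _; case/andP: (f01 i).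
by apply: prodr_ile1 => i _; exact: f01.
Qed.

Lemma prodt_eq0 m q f i : (forall i, 0 <= f i <= 1) -> (i < 2 ^ q)%N -> f i = 0 ->
  prodt m q f = 0.
Proof.
elim: q f i => [|q IH] f i f01.
  by rewrite expn0 ltnS leqn0 => /eqP ->.
move=> iq fi0 /=; have [iq'|iq'] := ltnP i (2 ^ q).
  rewrite (IH _ i)// mult0l//.
  by have /andP[] := prodt01 m q (fun j => f01 (2 ^ q + j)%N).
rewrite [X in mult _ _ X](IH _ (i - 2 ^ q)%N)//.
- by rewrite mult0r//; have /andP[] := prodt01 m q f01.
- by rewrite ltn_subLR// addnn -mul2n -expnS.
- by rewrite subnKC.
Qed.

Lemma prodt_err m q f : (forall i, 0 <= f i <= 1) ->
  `|prodt m q f - prode q f| <= (2 ^+ q) / 4 ^+ m - (4 ^+ m)^-1.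
Proof.
elim: q f => [|q IH] f f01.
  by rewrite /prode expn0 big_ord1 subrr normr0 expr0 mul1r subrr.
rewrite prodeS /=; set f' := fun i => _.
have f01' i : 0 <= f' i <= 1 by exact: f01.
have := IH f f01; have := IH f' f01'.
have := mult_err m (prodt01 m q f01) (prodt01 m q f01').
have := prodt01 m q f01; have := prode01 q f01'.
set a := prodt m q f; set b := prodt m q f'; set a0 := prode q f; set b0 := prode q f'.
move=> b001 a01 h1 h2 h3; rewrite exprS.
have -> : mult m a b - a0 * b0 = (mult m a b - a * b) + a * (b - b0) + (a - a0) * b0 by ring.
have h4 : `|a * (b - b0)| <= `|b - b0|.
  by rewrite normrM ler_piMl// ler_norml; lra.
have h5 : `|(a - a0) * b0| <= `|a - a0|.
  by rewrite normrM ler_piMr// ler_norml; lra.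
have := ler_normD (mult m a b - a * b + a * (b - b0)) ((a - a0) * b0).
have := ler_normD (mult m a b - a * b) (a * (b - b0)).
lra.
Qed.

Lemma prode_lip q f g de : (forall i, 0 <= f i <= 1) -> (forall i, 0 <= g i <= 1) ->
  (forall i, `|f i - g i| <= de) -> `|prode q f - prode q g| <= 2 ^+ q * de.
Proof.
elim: q f g => [|q IH] f g f01 g01 fg.
  by rewrite /prode expn0 !big_ord1 expr0 mul1r.
rewrite !prodeS; set f' := fun i => f _; set g' := fun i => g _.
have h1 := IH f g f01 g01 fg.
have h2 : `|prode q f' - prode q g'| <= 2 ^+ q * de by apply: IH => i; rewrite ?f01 ?g01 ?fg.
have a01 : 0 <= prode q f' <= 1 by apply: prode01 => i; exact: f01.
have b01 := prode01 q g01.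
have -> : prode q f * prode q f' - prode q g * prode q g' =
  (prode q f - prode q g) * prode q f' + prode q g * (prode q f' - prode q g') by ring.
have h4 : `|(prode q f - prode q g) * prode q f'| <= `|prode q f - prode q g|.
  by rewrite normrM ler_piMr// ler_norml; lra.
have h5 : `|prode q g * (prode q f' - prode q g')| <= `|prode q f' - prode q g'|.
  by rewrite normrM ler_piMl// ler_norml; lra.
rewrite exprS (le_trans (ler_normD _ _))//; lra.
Qed.

Lemma prodt_err_lip q : exists2 c : R, 0 <= c &
  forall m f g de, 0 <= de -> (forall i, 0 <= f i <= 1) -> (forall i, 0 <= g i <= 1) ->
  (forall i, `|f i - g i| <= de) ->
  `|(prodt m q f - prode q f) - (prodt m q g - prode q g)| <= c / 2 ^+ m * de.
Proof.
elim: q => [|q [c c0 IH]].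
  exists 0 => // m f g de de0 _ _ _.
  by rewrite /prode expn0 !big_ord1 !subrr normr0 mul0r mul0r.
pose Q : R := 2 ^+ q.
have Q0 : 0 <= Q by rewrite exprn_ge0.
exists (2 * (Q + c) + 2 * c + Q * (Q + c) + Q * Q).
  by rewrite !addr_ge0// ?mulr_ge0// ?addr_ge0.
move=> m f g de de0 f01 g01 fg; rewrite !prodeS /=.
set f' := fun i => f _; set g' := fun i => g _.
have f01' i : 0 <= f' i <= 1 by exact: f01.
have g01' i : 0 <= g' i <= 1 by exact: g01.
have fg' i : `|f' i - g' i| <= de by exact: fg.
have := IH m f g de de0 f01 g01 fg; have := IH m f' g' de de0 f01' g01' fg'.
have := mult_err_lip m (prodt01 m q f01) (prodt01 m q f01') (prodt01 m q g01) (prodt01 m q g01').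
have := prodt_err m q g01; have := prodt_err m q g01'.
have := prode_lip q f01 g01 fg; have := prode_lip q f01' g01' fg'.
have := prodt01 m q f01'; have := prode01 q f01.
have := prodt01 m q g01'; have := prode01 q g01.
rewrite -/Q.
set a := prodt m q f; set b := prodt m q f'; set a0 := prode q f; set b0 := prode q f'.
set x := prodt m q g; set y := prodt m q g'; set x0 := prode q g; set y0 := prode q g'.
set e2 := (2 ^+ m)^-1; set e4 := (4 ^+ m)^-1.
have e20 : 0 < e2 by rewrite invr_gt0 exprn_gt0.
have e21 : e2 <= 1.
  by rewrite invf_le1 ?exprn_gt0// exprn_ege1// ler1n.
have e4E : e4 = e2 * e2.
  by rewrite /e4 /e2 -invfM -exprMn; congr (_ ^+ _)^-1; ring.
move=> x001 y01 a001 b01 hb0 ha0 hy hx hm hb ha.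
have aa : `|a - x| <= (Q + c) * de.
  rewrite (_ : a - x = (a0 - x0) + ((a - a0) - (x - x0))); last by ring.
  rewrite (le_trans (ler_normD _ _))// mulrDl lerD// (le_trans ha)//.
  by rewrite ler_wpM2r// ler_piMr.
have bb : `|b - y| <= (Q + c) * de.
  rewrite (_ : b - y = (b0 - y0) + ((b - b0) - (y - y0))); last by ring.
  rewrite (le_trans (ler_normD _ _))// mulrDl lerD// (le_trans hb)//.
  by rewrite ler_wpM2r// ler_piMr.
have hx' : `|x - x0| <= Q * e2.
  rewrite (le_trans hx)// e4E; have : e2 * e2 <= e2 by rewrite ler_piMl// ltW.
  by nra.
have hy' : `|y - y0| <= Q * e2.
  rewrite (le_trans hy)// e4E; have : e2 * e2 <= e2 by rewrite ler_piMl// ltW.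
  by nra.
(* Every term is the product of bounded factors, a quantity of order [e2] and a variation of order
   [de]. *)
have -> : mult m a b - a0 * b0 - (mult m x y - x0 * y0) =
  ((mult m a b - a * b) - (mult m x y - x * y)) +
  ((a - a0) - (x - x0)) * b + (x - x0) * (b - y) +
  a0 * ((b - b0) - (y - y0)) + (a0 - x0) * (y - y0) by ring.
have t1 : `|((a - a0) - (x - x0)) * b| <= c * e2 * de.
  by rewrite normrM (le_trans _ ha)// ler_piMr// ler_norml; lra.
have t2 : `|(x - x0) * (b - y)| <= Q * e2 * ((Q + c) * de) by rewrite normrM ler_pM.
have t3 : `|a0 * ((b - b0) - (y - y0))| <= c * e2 * de.
  by rewrite normrM (le_trans _ hb)// ler_piMl// ler_norml; lra.
have t4 : `|(a0 - x0) * (y - y0)| <= Q * de * (Q * e2) by rewrite normrM ler_pM.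
have t0 : `|mult m a b - a * b - (mult m x y - x * y)| <= e2 * ((Q + c) * de + (Q + c) * de).
  by rewrite (le_trans hm)// ler_pM2l// lerD.
have -> : (2 * (Q + c) + 2 * c + Q * (Q + c) + Q * Q) * e2 * de =
  e2 * ((Q + c) * de + (Q + c) * de) + c * e2 * de + Q * e2 * ((Q + c) * de) +
  c * e2 * de + Q * de * (Q * e2) by ring.
apply: le_trans (lerD (lerD (lerD (lerD t0 t1) t2) t3) t4).
apply: (le_trans (ler_normD _ _)); rewrite lerD2r.
apply: (le_trans (ler_normD _ _)); rewrite lerD2r.
apply: (le_trans (ler_normD _ _)); rewrite lerD2r.
exact: ler_normD.
Qed.

End sawtooth.

(** * Calculus of layers and networks *)

Section layers.
Context {R : realType} {V : Type}.
Implicit Types (hs gs ms : seq (V -> R)) (f g : V -> R).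

Local Notation "hs ``_ j" := (nth (fun=> 0) hs j) (at level 3, j at level 2, left associativity, format "hs ``_ j").

(* The cost B counts, for every unit, its nonzero weights, its shift and the
   unit itself, so that it bounds both the sparsity and the width. *)
Definition layer (B : nat) hs gs := exists W : nat -> nat -> R, exists v : nat -> R,
  [/\ forall i j, `|W i j| <= 1, forall i, `|v i| <= 1,
    (\sum_(i < size gs) ((\sum_(j < size hs) (W i j != 0%R)) + 2) <= B)%N &
    forall i, (i < size gs)%N -> forall x,
      gs``_i x = relu (\sum_(j < size hs) W i j * hs``_j x - v i)].

Lemma layer_le B B' hs gs : (B <= B')%N -> layer B hs gs -> layer B' hs gs.
Proof. by move=> BB [W [v [? ? cB ?]]]; exists W, v; split => //; exact: leq_trans BB. Qed.

Lemma layer_nil hs : layer 0 hs [::].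
Proof.
exists (fun _ _ => 0), (fun=> 0); split => //= [_ _|_|]; rewrite ?normr0//.
by rewrite big_ord0.
Qed.

Lemma layer_cat B1 B2 hs gs1 gs2 : layer B1 hs gs1 -> layer B2 hs gs2 ->
  layer (B1 + B2) hs (gs1 ++ gs2).
Proof.
move=> [W [v [W1 v1 cB fE]]] [X [w [X1 w1 cC gE]]].
exists (fun i => if (i < size gs1)%N then W i else X (i - size gs1)%N),
  (fun i => if (i < size gs1)%N then v i else w (i - size gs1)%N); split.
- by move=> i j; case: ifP.
- by move=> i; case: ifP.
- rewrite size_cat big_split_ord/=; apply: leq_add.
    by under eq_bigr do rewrite ltn_ord.
  by under eq_bigr do rewrite ltnNge leq_addr/= addKn.
- move=> i; rewrite size_cat nth_cat => isz x; case: ifP => hi; first exact: fE.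
  by apply: gE; rewrite ltn_subLR// leqNgt hi.
Qed.

Lemma layer_wl B hs hs' gs : layer B hs gs -> layer B (hs ++ hs') gs.
Proof.
move=> [W [v [W1 v1 cB fE]]].
exists (fun i j => if (j < size hs)%N then W i j else 0), v; split => //.
- by move=> i j; case: ifP => // _; rewrite normr0.
- apply: leq_trans cB; apply: leq_sum => i _; rewrite leq_add2r size_cat big_split_ord/=.
  rewrite [X in (_ + X)%N]big1 ?addn0; last by move=> j _; rewrite ltnNge leq_addr/= eqxx.
  by apply: leq_sum => j _; rewrite ltn_ord.
- move=> i isz x; rewrite fE//; congr (relu (_ - _)).
  rewrite size_cat big_split_ord/= [X in _ = _ + X]big1 ?addr0.
    by apply: eq_bigr => j _; rewrite ltn_ord nth_cat ltn_ord.
  by move=> j _; rewrite ltnNge leq_addr/= mul0r.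
Qed.

Lemma layer_wr B hs hs' gs : layer B hs gs -> layer B (hs' ++ hs) gs.
Proof.
move=> [W [v [W1 v1 cB fE]]].
exists (fun i j => if (j < size hs')%N then 0 else W i (j - size hs')%N), v; split => //.
- by move=> i j; case: ifP => // _; rewrite normr0.
- apply: leq_trans cB; apply: leq_sum => i _; rewrite leq_add2r size_cat big_split_ord/=.
  rewrite [X in (X + _)%N]big1 ?add0n; last by move=> j _; rewrite ltn_ord eqxx.
  by apply: leq_sum => j _; rewrite ltnNge leq_addr/= addKn.
- move=> i isz x; rewrite fE//; congr (relu (_ - _)).
  rewrite size_cat big_split_ord/= [X in _ = X + _]big1 ?add0r.
    by apply: eq_bigr => j _; rewrite ltnNge leq_addr/= addKn nth_cat ltnNge leq_addr/= addKn.
  by move=> j _; rewrite ltn_ord mul0r.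
Qed.

Lemma layer_par B1 B2 hs1 hs2 gs1 gs2 : layer B1 hs1 gs1 -> layer B2 hs2 gs2 ->
  layer (B1 + B2) (hs1 ++ hs2) (gs1 ++ gs2).
Proof. by move=> h1 h2; apply: layer_cat; [exact: layer_wl|exact: layer_wr]. Qed.

Lemma layer_size B hs gs : layer B hs gs -> (2 * size gs <= B)%N.
Proof.
move=> [W [v [_ _ cB _]]]; apply: leq_trans cB.
rewrite mulnC -[X in (X * _)%N]card_ord -sum_nat_const.
by apply: leq_sum => i _; rewrite leq_addl.
Qed.

Lemma layer1 hs (w : nat -> R) (c : R) g : (forall j, `|w j| <= 1) -> `|c| <= 1 ->
  (forall x, g x = relu (\sum_(j < size hs) w j * hs``_j x - c)) ->
  layer (size hs + 2) hs [:: g].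
Proof.
move=> w1 c1 gE; exists (fun=> w), (fun=> c); split => //=.
  rewrite big_ord1 leq_add2r.
  rewrite -[leqRHS]mul1n -[X in (_ * X)%N]card_ord mulnC -sum_nat_const.
  by apply: leq_sum => j _; case: (_ != _).
by move=> [|i]// _ x; exact: gE.
Qed.

Lemma layer_copy hs j : (j < size hs)%N -> (forall x, 0 <= hs``_j x) ->
  layer 3 hs [:: hs``_j].
Proof.
move=> jhs h0; exists (fun _ i => (i == j)%:R), (fun=> 0); split => //=.
- by move=> _ i; case: (_ == _); rewrite ?normr1// normr0.
- by rewrite normr0.
- rewrite big_ord1 (bigD1 (Ordinal jhs))//= eqxx oner_neq0 big1 ?addn0//.
  move=> i; rewrite -(inj_eq val_inj)/= => /negbTE ->.
  by rewrite eqxx.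
- move=> [|//] _ x; rewrite (bigD1 (Ordinal jhs))//= eqxx mul1r big1 ?addr0 ?subr0 ?relu_id//.
  by move=> i; rewrite -(inj_eq val_inj)/= => /negbTE ->; rewrite mul0r.
Qed.

Lemma layer_cst hs (c : R) : 0 <= c <= 1 -> layer 2 hs [:: fun=> c].
Proof.
move=> /andP[c0 c1]; exists (fun _ _ => 0), (fun=> - c); split => //=.
- by move=> _ _; rewrite normr0.
- by move=> _; rewrite normrN ger0_norm.
- by rewrite big_ord1 big1// => j _; rewrite eqxx.
- move=> [|//] _ x; rewrite big1 ?add0r ?opprK ?relu_id//.
  by move=> j _; rewrite mul0r.
Qed.

Lemma layer_map (T : Type) (s : seq T) c hs (g : T -> V -> R) :
  (forall t, layer c hs [:: g t]) -> layer (c * size s) hs (map g s).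
Proof.
move=> hg; elim: s => [|t s IH] /=; first by rewrite muln0; exact: layer_nil.
by rewrite mulnS -cat1s; apply: layer_cat.
Qed.

Lemma layer_flatten (T : Type) (s : seq T) c (h g : T -> seq (V -> R)) :
  (forall t, layer c (h t) (g t)) ->
  layer (c * size s) (flatten (map h s)) (flatten (map g s)).
Proof.
move=> hg; elim: s => [|t s IH] /=; first by rewrite muln0; exact: layer_nil.
by rewrite mulnS; apply: layer_par.
Qed.

(** The units of every layer are functions of the input of the whole network, not of the preceding
    layer. Composition is then concatenation of chains, and parallel networks are concatenated
    lists. *)
Fixpoint net (k B : nat) hs gs : Prop :=
  if k is k'.+1 then exists2 ms, net k' B hs ms & layer B ms gs else gs = hs.

Lemma net1 B hs gs : layer B hs gs -> net 1 B hs gs.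
Proof. by move=> h; exists hs. Qed.

Lemma net_le k B B' hs gs : (B <= B')%N -> net k B hs gs -> net k B' hs gs.
Proof.
move=> BB; elim: k gs => // k IH gs [ms /IH h hm]; exists ms => //.
exact: layer_le hm.
Qed.

Lemma net_comp k l B hs ms gs : net k B hs ms -> net l B ms gs -> net (k + l) B hs gs.
Proof.
move=> h1; elim: l gs => [|l IH] gs; first by rewrite addn0 => ->.
by move=> [ms' /IH h2 h3]; rewrite addnS; exists ms'.
Qed.

Lemma net_par k B1 B2 hs1 hs2 gs1 gs2 : net k B1 hs1 gs1 -> net k B2 hs2 gs2 ->
  net k (B1 + B2) (hs1 ++ hs2) (gs1 ++ gs2).
Proof.
elim: k gs1 gs2 => [|k IH] gs1 gs2 /=; first by move=> -> ->.
move=> [ms1 h1 l1] [ms2 h2 l2]; exists (ms1 ++ ms2); first exact: IH.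
exact: layer_par.
Qed.

Lemma net_flatten (T : Type) (s : seq T) k c (h g : T -> seq (V -> R)) :
  (forall t, net k c (h t) (g t)) ->
  net k (c * size s) (flatten (map h s)) (flatten (map g s)).
Proof.
move=> hg; elim: s => [|t s IH] /=.
  elim: k {hg} => // k IH; exists [::] => //=; rewrite muln0; exact: layer_nil.
by rewrite mulnS; apply: net_par.
Qed.

Lemma layer_id hs : (forall i x, 0 <= hs``_i x) -> layer (3 * size hs) hs hs.
Proof.
elim: hs => [|h hs IH] h0; first exact: layer_nil.
rewrite /= mulnS -[h :: hs]/([:: h] ++ hs); apply: layer_par.
  by apply: (@layer_copy [:: h] 0) => // x; exact: (h0 0%N).
by apply: IH => i x; exact: (h0 i.+1).
Qed.

(** Identity layers preserve units exactly when these are nonnegative; this is how a network meets a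
    prescribed depth. *)
Lemma net_pad k l B hs gs : (k <= l)%N -> (3 * size gs <= B)%N ->
  (forall i x, 0 <= gs``_i x) -> net k B hs gs -> net l B hs gs.
Proof.
move=> /subnKC <- cB g0 h; apply: net_comp h _.
elim: (l - k)%N => // j IH; exists gs => //.
exact: (layer_le cB (layer_id g0)).
Qed.

End layers.

Section product_network.
Context {R : realType} {V : Type}.

Local Notation F3 a b c := (nth (0 : R) [:: a; b; c]).

Lemma seq_norm_le1 (s : seq R) : all (fun a => `|a| <= 1) s -> forall j, `|nth 0 s j| <= 1.
Proof.
move=> /all_nthP h j; have [js|js] := ltnP j (size s); first exact: h.
by rewrite nth_default// normr0.
Qed.

(* The state after k + 1 layers: the k-th tooth is the difference of the first
   two units, the third one accumulates the square. *)
Lemma net_sq m (f1 f2 : V -> R) : (forall x, 0 <= f1 x + f2 x <= 1) ->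
  net m.+1 15 [:: f1; f2] [:: fun x => sq m (f1 x + f2 x)].
Proof.
move=> f01; pose u x := f1 x + f2 x.
(* The teeth are stored after division by [4 ^+ k]: the recursion [rS] has weights at most one,
   whereas the tent itself has slope 2. *)
pose r k x := saw k (u x) / 4 ^+ k.
have rS k x : r k.+1 x = r k x / 2 - relu (r k x - (4 ^+ k)^-1 / 2).
  rewrite /r /saw iterS -/(saw k _).
  have /andP[t0 t1] := saw01 k (f01 x); rewrite -/(u x) in t0 t1.
  have p4 : 0 < (4 ^+ k)^-1 :> R by rewrite invr_gt0 exprn_gt0.
  rewrite exprS invfM; set t := saw k _ in t0 t1 *; set e := (4 ^+ k)^-1 in p4 *.
  have [h|/ltW h] := leP t (1 / 2).
    by rewrite (tent_l h) relu_0; [field|nra].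
  by rewrite (tent_r h) relu_id; [field|nra].
pose A k x := relu (r k x / 2).
pose Bk k x := relu (r k x - (4 ^+ k)^-1 / 2).
pose C k x := relu (sq k (u x)).
have AB k x : A k x - Bk k x = r k.+1 x.
  rewrite rS /A relu_id// /r !divr_ge0 ?exprn_ge0//.
  by have /andP[] := saw01 k (f01 x).
have CE k x : C k x = sq k (u x) by rewrite /C relu_id//; case/andP: (sq01 k (f01 x)).
have r0 x : r 0%N x = u x by rewrite /r expr0 divr1.
have p4 k : 0 < (4 ^+ k : R)^-1 <= 1.
  by rewrite invr_gt0 exprn_gt0//= invf_le1 ?exprn_gt0// exprn_ege1// ler1n.
have step0 : layer 15 [:: f1; f2] [:: A 0%N; Bk 0%N; C 0%N].
  rewrite -[[:: A _; _; _]]/([:: A 0%N] ++ [:: Bk 0%N] ++ [:: C 0%N]).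
  apply: (@layer_le _ _ (4 + (4 + 4))) => //.
  apply: layer_cat; last apply: layer_cat.
  - apply: (@layer1 _ _ [:: f1; f2] (nth 0 [:: 1 / 2; 1 / 2]) 0).
    + by apply: seq_norm_le1; rewrite /= !ger0_norm; lra.
    + by rewrite normr0.
    + by move=> x; rewrite /A r0 /= big_ord_recl big_ord1/= subr0; congr relu; rewrite /u; field.
  - apply: (@layer1 _ _ [:: f1; f2] (nth 0 [:: 1; 1]) (1 / 2)).
    + by apply: seq_norm_le1; rewrite /= !ger0_norm; lra.
    + by rewrite ger0_norm; lra.
    + by move=> x; rewrite /Bk r0 /= big_ord_recl big_ord1/= expr0 invr1 !mul1r.
  - apply: (@layer1 _ _ [:: f1; f2] (nth 0 [:: 1; 1]) 0).
    + by apply: seq_norm_le1; rewrite /= !ger0_norm; lra.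
    + by rewrite normr0.
    + by move=> x; rewrite /C /= big_ord_recl big_ord1/= subr0 !mul1r /sq big_ord0 subr0.
have step k : layer 15 [:: A k; Bk k; C k] [:: A k.+1; Bk k.+1; C k.+1].
  rewrite -[[:: A k.+1; _; _]]/([:: A k.+1] ++ [:: Bk k.+1] ++ [:: C k.+1]).
  apply: (@layer_le _ _ (5 + (5 + 5))) => //.
  apply: layer_cat; last apply: layer_cat.
  - apply: (@layer1 _ _ [:: A k; Bk k; C k] (nth 0 [:: 1 / 2; - (1 / 2)]) 0).
    + by apply: seq_norm_le1; rewrite /= normrN !ger0_norm; lra.
    + by rewrite normr0.
    + move=> x; rewrite {1}/A -AB /= 2!big_ord_recl big_ord1/= subr0; congr relu.
      by rewrite mul0r; field.
  - apply: (@layer1 _ _ [:: A k; Bk k; C k] (nth 0 [:: 1; - 1]) ((4 ^+ k.+1)^-1 / 2)).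
    + by apply: seq_norm_le1; rewrite /= normrN !ger0_norm; lra.
    + by have := p4 k.+1; move: ((4 ^+ k.+1 : R)^-1) => e /andP[? ?]; rewrite ger0_norm; lra.
    + move=> x; rewrite {1}/Bk -AB /= 2!big_ord_recl big_ord1/=; congr relu.
      by rewrite mul0r; field; rewrite expf_neq0//; lra.
  - apply: (@layer1 _ _ [:: A k; Bk k; C k] (nth 0 [:: - 1; 1; 1]) 0).
    + by apply: seq_norm_le1; rewrite /= normrN !ger0_norm; lra.
    + by rewrite normr0.
    + move=> x; rewrite {1}/C sqS -/(r k.+1 x) -AB /= 2!big_ord_recl big_ord1/= CE; congr relu.
      by ring.
have st k : net k.+1 15 [:: f1; f2] [:: A k; Bk k; C k].
  by elim: k => [|k IH]; [exact: net1|exists [:: A k; Bk k; C k]].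
rewrite (_ : (fun x => _) = C m); last by apply/funext => x; rewrite CE.
case: m => [|m].
  exists [:: f1; f2] => //; apply: (@layer_le _ _ 4) => //.
  apply: (@layer1 _ _ [:: f1; f2] (nth 0 [:: 1; 1]) 0).
  - by apply: seq_norm_le1; rewrite /= !ger0_norm; lra.
  - by rewrite normr0.
  - by move=> x; rewrite /C /= big_ord_recl big_ord1/= subr0 !mul1r /sq big_ord0 subr0.
exists [:: A m; Bk m; C m]; first exact: st.
apply: (@layer_le _ _ 5) => //.
apply: (@layer1 _ _ [:: A m; Bk m; C m] (nth 0 [:: - 1; 1; 1]) 0).
- by apply: seq_norm_le1; rewrite /= normrN !ger0_norm; lra.
- by rewrite normr0.
- move=> x; rewrite {1}/C sqS -/(r m.+1 x) -AB /= 2!big_ord_recl big_ord1/= CE; congr relu.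
  by ring.
Qed.

Lemma net_mult m (f g : V -> R) : (forall x, 0 <= f x <= 1) -> (forall x, 0 <= g x <= 1) ->
  net (m + 3) 40 [:: f; g] [:: fun x => mult m (f x) (g x)].
Proof.
move=> f01 g01.
(* The absolute value is the sum of two units, which is why [net_sq] squares a sum of two functions;
   [h2] fills the second place for the other square. *)
pose h1 x := relu ((f x + g x) / 2); pose h2 (x : V) : R := 0.
pose h3 x := relu ((f x - g x) / 2); pose h4 x := relu ((g x - f x) / 2).
have h34 x : h3 x + h4 x = `|f x - g x| / 2.
  rewrite /h3 /h4; have [h|h] := ler0P (f x - g x).
    by rewrite relu_0 ?relu_id; lra.
  by rewrite relu_id ?relu_0; lra.
have h12 x : h1 x + h2 x = (f x + g x) / 2.
  by rewrite /h1 /h2 addr0 relu_id//; have := f01 x; have := g01 x; lra.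
have n0 : layer 40 [:: f; g] [:: h1; h2; h3; h4].
  rewrite -[[:: h1; h2; h3; h4]]/([:: h1] ++ [:: h2] ++ [:: h3] ++ [:: h4]).
  apply: (@layer_le _ _ (4 + (2 + (4 + 4)))) => //.
  apply: layer_cat; last apply: layer_cat; last apply: layer_cat.
  - apply: (@layer1 _ _ [:: f; g] (nth 0 [:: 1 / 2; 1 / 2]) 0).
    + by apply: seq_norm_le1; rewrite /= !ger0_norm; lra.
    + by rewrite normr0.
    + by move=> x; rewrite /h1 /= big_ord_recl big_ord1/= subr0; congr relu; field.
  - by apply: layer_cst; rewrite lexx ler01.
  - apply: (@layer1 _ _ [:: f; g] (nth 0 [:: 1 / 2; - (1 / 2)]) 0).
    + by apply: seq_norm_le1; rewrite /= normrN !ger0_norm; lra.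
    + by rewrite normr0.
    + by move=> x; rewrite /h3 /= big_ord_recl big_ord1/= subr0; congr relu; field.
  - apply: (@layer1 _ _ [:: f; g] (nth 0 [:: - (1 / 2); 1 / 2]) 0).
    + by apply: seq_norm_le1; rewrite /= normrN !ger0_norm; lra.
    + by rewrite normr0.
    + by move=> x; rewrite /h4 /= big_ord_recl big_ord1/= subr0; congr relu; field.
have sq1 : net m.+1 15 [:: h1; h2] [:: fun x => sq m (h1 x + h2 x)].
  by apply: net_sq => x; rewrite h12; have := f01 x; have := g01 x; lra.
have sq2 : net m.+1 15 [:: h3; h4] [:: fun x => sq m (h3 x + h4 x)].
  apply: net_sq => x; rewrite h34; have := f01 x; have := g01 x.
  by have [] := ler0P (f x - g x); lra.
have last : layer 40 [:: fun x => sq m (h1 x + h2 x); fun x => sq m (h3 x + h4 x)]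
    [:: fun x => mult m (f x) (g x)].
  apply: (@layer_le _ _ 4) => //.
  apply: (@layer1 _ _ _ (nth 0 [:: 1; - 1]) 0).
  - by apply: seq_norm_le1; rewrite /= normrN !ger0_norm; lra.
  - by rewrite normr0.
  - move=> x; rewrite /= big_ord_recl big_ord1/= subr0 mul1r mulN1r h12 h34 relu_id//.
    by have /andP[] := mult01 m (f01 x) (g01 x).
rewrite (_ : (m + 3)%N = (1 + m.+1 + 1)%N); last by lia.
apply: net_comp (net1 last); apply: net_comp (net1 n0) _.
by apply: (net_le _ (net_par sq1 sq2)).
Qed.

Lemma net_prodt m q (g : nat -> V -> R) : (forall i x, 0 <= g i x <= 1) ->
  net (q * (m + 3)) (40 * 2 ^ q) [seq g i | i <- iota 0 (2 ^ q)]
    [:: fun x => prodt m q (fun i => g i x)].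
Proof.
elim: q g => [|q IH] g g01 //.
have s1 := IH g g01.
have s2 := IH (fun i => g (2 ^ q + i)%N) (fun i => g01 (2 ^ q + i)%N).
rewrite mulSnr; apply: net_comp; last first.
  apply: net_le (net_mult m _ _) => //=; last 2 first.
  - by move=> x; apply: (prodt01 m q) => i; exact: g01.
  - by move=> x; apply: (prodt01 m q (f := fun i => g (2 ^ q + i)%N x)) => i; exact: g01.
  - by rewrite -[leqLHS]muln1 leq_mul2l expn_gt0.
have -> : [seq g i | i <- iota 0 (2 ^ q.+1)] =
    [seq g i | i <- iota 0 (2 ^ q)] ++ [seq g (2 ^ q + i)%N | i <- iota 0 (2 ^ q)].
  rewrite expnS mul2n -addnn iotaD map_cat add0n; congr (_ ++ _).
  by rewrite -{1}[(2 ^ q)%N]addn0 iotaDl -map_comp.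
have -> : (40 * 2 ^ q.+1 = 40 * 2 ^ q + 40 * 2 ^ q)%N by rewrite expnS; lia.
exact: (net_par s1 s2).
Qed.

End product_network.

Section matrix_norm.
Context {R : realType}.

Lemma mx_entry_le m n (A : 'M[R]_(m, n)) i j : `|A i j| <= `|A|.
Proof.
rewrite [leRHS]/Num.Def.normr/= mx_normrE.
exact: (le_bigmax _ (fun ij : 'I_m * 'I_n => `|A ij.1 ij.2|) (i, j)).
Qed.

Lemma mx_norm_le m n (A : 'M[R]_(m, n)) c : 0 <= c ->
  (forall i j, `|A i j| <= c) -> `|A| <= c.
Proof.
move=> c0 Ac; rewrite [leLHS]/Num.Def.normr/= mx_normrE.
by apply: bigmax_le => // ij _.
Qed.

Lemma cV_entry_le m (x y : 'cV[R]_m) i : `|x i 0 - y i 0| <= `|x - y|.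
Proof. by have := mx_entry_le (x - y) i 0; rewrite !mxE. Qed.

End matrix_norm.

(** * Local polynomials on a grid *)

Section hats.
Context {R : realType}.

Definition hat (M l : nat) (y : R) : R := relu (1 - `|M%:R * y - l%:R|).

Lemma hat01 M l y : 0 <= hat M l y <= 1.
Proof.
rewrite /hat relu_ge0/=; have [h|h] := leP 0 (1 - `|M%:R * y - l%:R|).
  by rewrite relu_id//; have := normr_ge0 (M%:R * y - l%:R); lra.
by rewrite relu_0 ?ler01// ltW.
Qed.

Lemma hat_lip M l x y : `|hat M l x - hat M l y| <= M%:R * `|x - y|.
Proof.
rewrite (le_trans (relu_lip _ _))//.
rewrite (_ : 1 - _ - (1 - _) = `|M%:R * y - l%:R| - `|M%:R * x - l%:R|); last by ring.
rewrite (le_trans (ler_dist_dist _ _))// (_ : _ - _ = M%:R * (y - x)); last by ring.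
by rewrite normrM ger0_norm// distrC.
Qed.

Lemma hat_sum M y : 0 <= y <= 1 -> \sum_(l < M.+1) hat M l y = 1.
Proof.
move=> y01; rewrite /hat; have : 0 <= M%:R * y <= M%:R.
  by have : 0 <= M%:R :> R by []; nra.
move: (M%:R * y) => z; elim: M => [|M IH] z0M.
  have -> : z = 0 by apply/eqP; rewrite eq_le; move: z0M; rewrite andbC.
  by rewrite big_ord1 subrr normr0 subr0 relu_id.
rewrite big_ord_recr/=; have [zM|zM] := leP z M%:R.
  rewrite IH; last by lra.
  have z1 : z - M.+1%:R <= 0 by rewrite -natr1; lra.
  by rewrite (ler0_norm z1) -natr1 relu_0 ?addr0//; lra.
rewrite big_ord_recr/= big1 ?add0r; last first.
  move=> l _; rewrite relu_0//.
  have lM : l.+1%:R <= M%:R :> R by rewrite ler_nat.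
  rewrite -natr1 in lM; have zl : 0 <= z - l%:R by lra.
  by rewrite (ger0_norm zl); lra.
rewrite -natr1 in z0M; have z1 : z - M.+1%:R <= 0 by rewrite -natr1; lra.
have z2 : 0 <= z - M%:R by lra.
by rewrite (ler0_norm z1) (ger0_norm z2) -natr1 !relu_id; lra.
Qed.

Lemma hat_count M y : (\sum_(l < M.+1) (hat M l y != 0%R) <= 2)%N.
Proof.
rewrite /hat; move: (M%:R * y) => z; elim: M => [|M IH].
  by rewrite big_ord1; case: (_ != _).
rewrite big_ord_recr/=; have [zM|zM] := leP z M%:R.
  have z1 : z - M.+1%:R <= 0 by rewrite -natr1; lra.
  rewrite (ler0_norm z1) -natr1 (@relu_0 _ (1 - _)) ?eqxx ?addn0//; lra.
rewrite big_ord_recr/= big1 ?add0n; last first.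
  move=> l _; rewrite relu_0 ?eqxx//.
  have lM : l.+1%:R <= M%:R :> R by rewrite ler_nat.
  rewrite -natr1 in lM; have zl : 0 <= z - l%:R by lra.
  by rewrite (ger0_norm zl); lra.
by case: (_ != _); case: (_ != _).
Qed.

(** Taylor polynomials are centred at the left end [l.-1 / M] of the support (at 0 if [l = 0]). On
    the support the increments are then nonnegative, hence single ReLU units with values in
    [[0, 1]], the range that the product trees require. *)
Lemma hat_supp M l y : (0 < M)%N -> 0 <= y -> hat M l y != 0 ->
  0 <= y - l.-1%:R / M%:R <= 2 / M%:R.
Proof.
move=> M0 y0 h; have MR : 0 < M%:R :> R by rewrite ltr0n.
have {h} h : `|M%:R * y - l%:R| < 1.
  rewrite ltNge; apply/negP => h'; move/negP: h; apply; apply/eqP.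
  by rewrite /hat relu_0//; lra.
rewrite ltr_norml in h.
have yE : y = M%:R * y / M%:R by rewrite mulrAC mulfV ?mul1r// gt_eqF.
have -> : y - l.-1%:R / M%:R = (M%:R * y - l.-1%:R) / M%:R by rewrite {1}yE -mulrBl.
have My0 : 0 <= M%:R * y by rewrite mulr_ge0// ltW.
case: l h => [|l] /= h.
  apply/andP; split; first by rewrite divr_ge0 ?subr0// ltW.
  by rewrite ler_pM2r ?invr_gt0//; lra.
rewrite -natr1 in h; apply/andP; split; first by apply: divr_ge0; [lra|exact: ltW].
by rewrite ler_pM2r ?invr_gt0//; lra.
Qed.

End hats.

Section local_polynomials.
Context {R : realType}.

Lemma prod_seq01 (T : Type) (s : seq T) (F : T -> R) : (forall t, 0 <= F t <= 1) ->
  0 <= \prod_(t <- s) F t <= 1.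
Proof.
move=> F01; elim: s => [|t s IH]; first by rewrite big_nil ler01 lexx.
by rewrite big_cons; have := F01 t; nra.
Qed.

Lemma prod_seq_lip (T : Type) (s : seq T) (F G : T -> R) de :
  (forall t, 0 <= F t <= 1) -> (forall t, 0 <= G t <= 1) ->
  (forall t, `|F t - G t| <= de) ->
  `|\prod_(t <- s) F t - \prod_(t <- s) G t| <= (size s)%:R * de.
Proof.
move=> F01 G01 FG; elim: s => [|t s IH].
  by rewrite !big_nil subrr normr0 mul0r.
rewrite !big_cons.
have p01 := prod_seq01 s F01; have q01 := prod_seq01 s G01.
rewrite (_ : _ - _ = (F t - G t) * \prod_(t <- s) F t
  + G t * (\prod_(t <- s) F t - \prod_(t <- s) G t)); last by ring.
have -> : (size (t :: s))%:R * de = de + (size s)%:R * de by rewrite /= -natr1; ring.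
rewrite (le_trans (ler_normD _ _))// !normrM lerD//; last first.
  by apply: le_trans IH; rewrite ler_piMl//; have := G01 t; rewrite ler_norml; lra.
by apply: le_trans (FG t); rewrite ler_piMr//; rewrite ler_norml; lra.
Qed.

Lemma prode_nth q (s : seq R) : (size s <= 2 ^ q)%N ->
  prode q (nth 1 s) = \prod_(x <- s) x.
Proof.
move=> sq; rewrite /prode -(big_mkord predT) (big_cat_nat (n := size s))//=.
rewrite [X in _ * X]big_nat_cond [X in _ * X]big1 ?mulr1; last first.
  by move=> i /andP[/andP[si _] _]; rewrite nth_default.
by rewrite [RHS](big_nth 1).
Qed.

Variables (m k q : nat) (C C2 : R).
Hypothesis C0 : 0 <= C.
Hypothesis C20 : 0 <= C2.

Local Notation idx := {ffun 'I_m -> 'I_k.+1}.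

Section fixed_grid.
Variables (M mm : nat) (S : {set 'I_m}).
Hypothesis M0 : (0 < M)%N.
Hypothesis Mmm : (M <= 2 ^ mm)%N.
Hypothesis Sq : (#|S| + k <= 2 ^ q)%N.

Local Notation node := {ffun 'I_m -> 'I_M.+1}.

Variable c : node -> idx -> R.
Hypothesis cC : forall l a, `|c l a| <= C.

Definition wfac (l : node) (j : 'I_m) (x : 'cV[R]_m) : R :=
  if j \in S then relu (x j 0 - (l j).-1%:R / M%:R) else 0.

Definition fval (l : node) (x : 'cV[R]_m) (t : 'I_m + 'I_m) : R :=
  match t with inl i => hat M (l i) (x i 0) | inr j => wfac l j x end.

(** The factors of one term: a hat for each relevant coordinate and [a j] copies of the increment in
    coordinate [j]. There are at most [#|S| + k] of them, and [facs] fills the tree of [2 ^ q]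
    leaves up with ones. *)
Definition tags (a : idx) : seq ('I_m + 'I_m) :=
  [seq inl i | i <- enum S] ++ flatten [seq nseq (a j) (inr j) | j <- enum 'I_m].

Definition facs (l : node) (a : idx) (x : 'cV[R]_m) : nat -> R :=
  nth 1 [seq fval l x t | t <- tags a].

Definition phi (l : node) (x : 'cV[R]_m) : R := \prod_(i in S) hat M (l i) (x i 0).

Definition mono (l : node) (a : idx) (x : 'cV[R]_m) : R := \prod_j wfac l j x ^+ a j.

Definition lowdeg : pred idx := [pred a | (mi_order (mi_val a) <= k)%N].

(** Nodes are zero outside [S]: the grid lives on the relevant coordinates, and its size is governed
    by [#|S|] instead of [m]. *)
Definition nodes : {pred node} := pffun_on ord0 (mem S) predT.

Definition locpoly (l : node) (x : 'cV[R]_m) : R := \sum_(a | lowdeg a) c l a * mono l a x.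

Definition netpoly (x : 'cV[R]_m) : R :=
  \sum_(l in nodes) \sum_(a | lowdeg a) c l a * prodt mm q (facs l a x).

Lemma wfac01 l j x : cube m x -> 0 <= wfac l j x <= 1.
Proof.
move=> xc; rewrite /wfac; case: ifP => _; last by rewrite lexx ler01.
rewrite relu_ge0/=; have /andP[x0 x1] := xc j.
have h : 0 <= (l j).-1%:R / M%:R :> R by rewrite divr_ge0.
have [h'|h'] := leP 0 (x j 0 - (l j).-1%:R / M%:R); first by rewrite relu_id//; lra.
by rewrite relu_0 ?ltW// ltr01.
Qed.

Lemma fval01 l x t : cube m x -> 0 <= fval l x t <= 1.
Proof. by case: t => [i _|j]; [exact: hat01|exact: wfac01]. Qed.

Lemma fval_lip l x y t : cube m x -> cube m y ->
  `|fval l x t - fval l y t| <= M%:R * `|x - y|.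
Proof.
move=> xc yc; have M1 : 1 <= M%:R :> R by rewrite ler1n.
case: t => [i|j] /=.
  rewrite (le_trans (hat_lip _ _ _ _))// ler_wpM2l//; exact: cV_entry_le.
apply: (@le_trans _ _ `|x - y|); last by rewrite ler_peMl.
rewrite /wfac; case: ifP => _; last by rewrite subrr normr0.
rewrite (le_trans (relu_lip _ _))//.
rewrite (_ : _ - _ - (_ - _) = x j 0 - y j 0); last by ring.
exact: cV_entry_le.
Qed.

Lemma size_tags a : lowdeg a -> (size (tags a) <= 2 ^ q)%N.
Proof.
move=> /= ak; rewrite /tags size_cat size_map -cardE size_flatten /shape -map_comp.
apply: leq_trans Sq; rewrite leq_add2l.
under eq_map do rewrite /= size_nseq.
rewrite sumnE big_map big_enum/=; have <- : mi_order (mi_val a) = (\sum_(j in 'I_m) a j)%N.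
  by apply: eq_bigr => j _; rewrite ffunE.
exact: ak.
Qed.

Lemma facs01 l a x i : cube m x -> 0 <= facs l a x i <= 1.
Proof.
move=> xc; rewrite /facs; have [h|h] := ltnP i (size (tags a)); last first.
  by rewrite nth_default ?size_map// lexx ler01.
case: (tags a) h => // t0 s h; rewrite (nth_map t0)//; exact: fval01.
Qed.

Lemma facs_lip l a x y i : cube m x -> cube m y ->
  `|facs l a x i - facs l a y i| <= M%:R * `|x - y|.
Proof.
move=> xc yc; rewrite /facs; have [h|h] := ltnP i (size (tags a)); last first.
  by rewrite !nth_default ?size_map// subrr normr0 mulr_ge0.
case: (tags a) h => // t0 s h; rewrite !(nth_map t0)//; exact: fval_lip.
Qed.

Lemma prode_facs l a x : lowdeg a -> prode q (facs l a x) = phi l x * mono l a x.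
Proof.
move=> ak; rewrite /facs prode_nth ?size_map ?size_tags// big_map big_cat/= big_map.
rewrite big_enum/=; congr (_ * _).
rewrite big_flatten/= big_map big_enum/=; apply: eq_bigr => j _.
elim: (nat_of_ord (a j)) => [|n IH]; first by rewrite big_nil expr0.
by rewrite /= big_cons IH exprS.
Qed.

Lemma phi01 l x : 0 <= phi l x <= 1.
Proof.
rewrite /phi -big_enum/=; apply: prod_seq01 => i; exact: hat01.
Qed.

Lemma mono_lip l a x y : lowdeg a -> cube m x -> cube m y ->
  `|mono l a x - mono l a y| <= k%:R * `|x - y|.
Proof.
move=> ak xc yc.
pose s := flatten [seq nseq (a j) j | j <- enum 'I_m].
have sE z : mono l a z = \prod_(j <- s) wfac l j z.
  rewrite big_flatten/= big_map big_enum/=; apply: eq_bigr => j _.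
  elim: (nat_of_ord (a j)) => [|n IH]; first by rewrite big_nil expr0.
  by rewrite /= big_cons -IH exprS.
rewrite !sE; apply: (le_trans (prod_seq_lip s (de := `|x - y|) _ _ _)).
- by move=> j; exact: wfac01.
- by move=> j; exact: wfac01.
- move=> j; rewrite /wfac; case: ifP => _; last by rewrite subrr normr0.
  rewrite (le_trans (relu_lip _ _))//.
  rewrite (_ : _ - _ - (_ - _) = x j 0 - y j 0); last by ring.
  exact: cV_entry_le.
rewrite ler_wpM2r// ler_nat /s size_flatten /shape -map_comp.
under eq_map do rewrite /= size_nseq.
rewrite sumnE big_map big_enum/=; have <- : mi_order (mi_val a) = (\sum_(j in 'I_m) a j)%N.
  by apply: eq_bigr => j _; rewrite ffunE.
exact: ak.
Qed.

Lemma phi_lip l x y : `|phi l x - phi l y| <= m%:R * (M%:R * `|x - y|).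
Proof.
rewrite /phi -!big_enum/=; apply: (le_trans (prod_seq_lip (enum S) (de := M%:R * `|x - y|) _ _ _)).
- by move=> i; exact: hat01.
- by move=> i; exact: hat01.
- by move=> i; rewrite (le_trans (hat_lip _ _ _ _))// ler_wpM2l// cV_entry_le.
rewrite ler_wpM2r ?mulr_ge0// ler_nat -cardE.
by apply: leq_trans (max_card _) _; rewrite card_ord.
Qed.

Lemma phi_sum x : cube m x -> \sum_(l in nodes) phi l x = 1.
Proof.
move=> xc; rewrite /phi /nodes -(big_distr_big ord0 (mem S) predT (fun i (j : 'I_M.+1) => hat M j (x i 0)))/=.
rewrite big1// => i _.
exact: hat_sum (xc i).
Qed.

(** At most two hats per coordinate are active at a point. Sums over the nodes therefore cost a
    factor that does not depend on [M]. *)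
Lemma phi_count x : \sum_(l in nodes) (phi l x != 0)%:R <= 2 ^+ m :> R.
Proof.
have phiE l : (phi l x != 0)%:R = \prod_(i in S) (hat M (l i) (x i 0) != 0)%:R :> R.
  apply/esym; rewrite /phi; have [h|/forallPn[i]] := boolP [forall i, (i \in S) ==> (hat M (l i) (x i 0) != 0)].
    rewrite big1; last by move=> i iS; move/forallP: h => /(_ i); rewrite iS/= => ->.
    rewrite (_ : _ != 0)//; apply/prodf_neq0 => i iS.
    by move/forallP: h => /(_ i); rewrite iS.
  rewrite negb_imply negbK => /andP[iS /eqP i0].
  by rewrite (bigD1 i)//= [X in _ = (X != _)%:R](bigD1 i)//= i0 eqxx !mul0r eqxx.
under eq_bigr do rewrite phiE.
rewrite /nodes -(big_distr_big ord0 (mem S) predT (fun i (j : 'I_M.+1) => (hat M j (x i 0) != 0)%:R))/=.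
apply: (@le_trans _ _ (\prod_(i in S) 2)).
  apply: ler_prod => i _; rewrite sumr_ge0//= -natr_sum (ler_nat _ _ 2); exact: hat_count.
by rewrite prodr_const ler_weXn2l// ?ler1n// (leq_trans (max_card _))// card_ord.
Qed.

Lemma prodt_facs0 l a x : cube m x -> lowdeg a -> phi l x = 0 ->
  prodt mm q (facs l a x) = 0.
Proof.
move=> xc ak /eqP; rewrite /phi => /prodf_eq0[i iS /eqP hi].
apply: (@prodt_eq0 _ _ _ _ (index i (enum S))).
- by move=> j; exact: facs01.
- apply: leq_trans (size_tags ak); rewrite /tags size_cat size_map ltn_addr//.
  by rewrite index_mem mem_enum.
- have iS' : (index i (enum S) < size (enum S))%N by rewrite index_mem mem_enum.
  rewrite /facs (nth_map (inl i)); last by rewrite /tags size_cat size_map ltn_addr.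
  by rewrite /tags nth_cat size_map iS' (nth_map i)//= nth_index ?mem_enum.
Qed.

Variables (g : 'cV[R]_m -> R) (e : R).
Hypothesis e0 : 0 <= e.
Hypothesis eM : e * M%:R <= C2.
Hypothesis g_lip : forall x y, cube m x -> cube m y -> `|g x - g y| <= C * `|x - y|.
Hypothesis g_loc : forall l x, l \in nodes -> cube m x -> phi l x != 0 ->
  `|locpoly l x - g x| <= e.

Let G : R := #|idx|%:R.

Let sum_lowdeg (F : idx -> R) b : 0 <= b -> (forall a, lowdeg a -> `|F a| <= b) ->
  `|\sum_(a | lowdeg a) F a| <= G * b.
Proof.
move=> b0 Fb; rewrite (le_trans (ler_norm_sum _ _ _))//.
apply: (@le_trans _ _ (\sum_(a | lowdeg a) b)); first exact: ler_sum.
rewrite sumr_const -[X in X <= _]mulr_natl ler_wpM2r// ler_nat; exact: max_card.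
Qed.

Let exact_poly (x : 'cV[R]_m) : R := \sum_(l in nodes) phi l x * locpoly l x.

Lemma netpoly_err x : cube m x ->
  `|netpoly x - g x| <= 2 ^+ m * (G * (C * (2 ^+ q / 4 ^+ mm))) + e.
Proof.
move=> xc.
have -> : netpoly x - g x = (netpoly x - exact_poly x) + (exact_poly x - g x) by ring.
rewrite (le_trans (ler_normD _ _))// lerD//.
  have b0 : 0 <= C * (2 ^+ q / 4 ^+ mm) by rewrite mulr_ge0// divr_ge0// exprn_ge0.
  apply: (@le_trans _ _ (\sum_(l in nodes) (phi l x != 0)%:R * (G * (C * (2 ^+ q / 4 ^+ mm))))); last first.
    by rewrite -mulr_suml ler_wpM2r ?phi_count// mulr_ge0// /G.
  rewrite /netpoly /exact_poly -sumrB (le_trans (ler_norm_sum _ _ _))//.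
  apply: ler_sum => l _; rewrite /locpoly mulr_sumr -sumrB.
  have [p0|p0] := eqVneq (phi l x) 0.
    rewrite mul0r big1 ?normr0// => a ak.
    by rewrite prodt_facs0// p0 mulr0 mul0r subrr.
  rewrite mul1r; apply: sum_lowdeg => // a ak.
  have -> : c l a * prodt mm q (facs l a x) - phi l x * (c l a * mono l a x) =
      c l a * (prodt mm q (facs l a x) - prode q (facs l a x)).
    by rewrite prode_facs//; ring.
  rewrite normrM ler_pM//.
  rewrite (le_trans (prodt_err mm q (fun i => facs01 l a i xc)))// gerBl//.
rewrite -[g x]mul1r -(phi_sum xc) mulr_suml /exact_poly -sumrB.
rewrite (le_trans (ler_norm_sum _ _ _))//.
apply: (@le_trans _ _ (\sum_(l in nodes) phi l x * e)); last by rewrite -mulr_suml phi_sum// mul1r.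
apply: ler_sum => l ln; rewrite -mulrBr normrM.
have /andP[p0 _] := phi01 l x; rewrite (ger0_norm p0).
have [->|pn] := eqVneq (phi l x) 0; first by rewrite !mul0r.
by rewrite ler_wpM2l// g_loc.
Qed.

Lemma locpoly_lip l x y : cube m x -> cube m y ->
  `|locpoly l x - locpoly l y| <= G * (C * (k%:R * `|x - y|)).
Proof.
move=> xc yc; rewrite /locpoly -sumrB; apply: sum_lowdeg.
  by rewrite !mulr_ge0.
by move=> a ak; rewrite -mulrBr normrM ler_pM// mono_lip.
Qed.

(* The g y-part of phi P drops out because the hat products sum to one, so a
   node contributes P - g times the (large) variation of phi only where P is
   close to g. *)
Lemma exact_poly_lip x y : cube m x -> cube m y ->
  `|exact_poly x - exact_poly y| <=
    (2 * 2 ^+ m) * (G * (C * k%:R) + C2 * m%:R + C) * `|x - y|.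
Proof.
move=> xc yc; set L := G * _ + _ + _.
have G0 : 0 <= G by rewrite /G.
have -> : exact_poly x - exact_poly y = \sum_(l in nodes)
    (phi l x * locpoly l x - phi l y * locpoly l y - g y * (phi l x - phi l y)).
  by rewrite !sumrB -mulr_sumr sumrB !phi_sum// subrr mulr0 subr0.
rewrite (le_trans (ler_norm_sum _ _ _))//.
apply: (@le_trans _ _ (\sum_(l in nodes) ((phi l x != 0)%:R + (phi l y != 0)%:R) * (L * `|x - y|))); last first.
  rewrite -mulr_suml -mulrA ler_wpM2r//; last first.
    by rewrite big_split/=; have := phi_count x; have := phi_count y; lra.
  by rewrite mulr_ge0// /L !addr_ge0// !mulr_ge0.
apply: ler_sum => l ln.
have dphi := phi_lip l x y.
have /andP[px0 px1] := phi01 l x; have /andP[py0 py1] := phi01 l y.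
have eD (z : 'cV[R]_m) : `|locpoly l z - g z| <= e ->
    `|(locpoly l z - g z) * (phi l x - phi l y)| <= C2 * m%:R * `|x - y|.
  move=> ez; rewrite normrM (le_trans (ler_pM _ _ ez dphi))//.
  have -> : e * (m%:R * (M%:R * `|x - y|)) = (e * M%:R) * (m%:R * `|x - y|) by ring.
  by rewrite -[leRHS]mulrA ler_wpM2r// mulr_ge0.
(* The local error bound is available only where the hat product is nonzero. If it vanishes at [y],
   the decomposition is made around [x] instead, and the Lipschitz bound of [g] takes over. *)
have [hy|hy] := eqVneq (phi l y) 0; last first.
  have -> : phi l x * locpoly l x - phi l y * locpoly l y - g y * (phi l x - phi l y) =
    phi l x * (locpoly l x - locpoly l y) + (locpoly l y - g y) * (phi l x - phi l y) by ring.
  rewrite (le_trans (ler_normD _ _))//.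
  apply: (@le_trans _ _ (G * (C * (k%:R * `|x - y|)) + C2 * m%:R * `|x - y|)).
    apply: lerD; last by apply: eD; exact: g_loc.
    by rewrite normrM (ger0_norm px0) (le_trans _ (locpoly_lip l xc yc))// ler_piMl.
  apply: (@le_trans _ _ (1 * (L * `|x - y|))); last first.
    by rewrite ler_wpM2r ?lerDr// mulr_ge0// /L !addr_ge0// !mulr_ge0.
  have -> : 1 * (L * `|x - y|) = G * (C * (k%:R * `|x - y|)) + C2 * m%:R * `|x - y| + C * `|x - y|.
    by rewrite /L; ring.
  by rewrite lerDl mulr_ge0.
have [hx|hx] := eqVneq (phi l x) 0.
  by rewrite hx hy !mul0r !subrr mulr0 subr0 normr0 addr0 mul0r.
have -> : phi l x * locpoly l x - phi l y * locpoly l y - g y * (phi l x - phi l y) =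
  phi l x * (g x - g y) + (locpoly l x - g x) * (phi l x - phi l y) by rewrite hy; ring.
rewrite (le_trans (ler_normD _ _))// addr0 mul1r.
apply: (@le_trans _ _ (C * `|x - y| + C2 * m%:R * `|x - y|)).
  apply: lerD; last by apply: eD; exact: g_loc.
  by rewrite normrM (ger0_norm px0) (le_trans _ (g_lip xc yc))// ler_piMl.
have -> : L * `|x - y| = C * `|x - y| + C2 * m%:R * `|x - y| + G * (C * k%:R) * `|x - y|.
  by rewrite /L; ring.
by rewrite lerDl !mulr_ge0.
Qed.

Lemma netpoly_lip cq : 0 <= cq ->
  (forall mm (f h : nat -> R) de, 0 <= de -> (forall i, 0 <= f i <= 1) -> (forall i, 0 <= h i <= 1) ->
   (forall i, `|f i - h i| <= de) ->
  `|(prodt mm q f - prode q f) - (prodt mm q h - prode q h)| <= cq / 2 ^+ mm * de) ->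
  forall x y, cube m x -> cube m y -> `|netpoly x - netpoly y| <=
    ((2 * 2 ^+ m) * (G * (C * cq)) + (2 * 2 ^+ m) * (G * (C * k%:R) + C2 * m%:R + C)) * `|x - y|.
Proof.
move=> cq0 hcq x y xc yc.
have G0 : 0 <= G by rewrite /G.
have -> : netpoly x - netpoly y = ((netpoly x - exact_poly x) - (netpoly y - exact_poly y)) +
  (exact_poly x - exact_poly y) by ring.
rewrite (le_trans (ler_normD _ _))// mulrDl lerD//; last exact: exact_poly_lip.
have errE z : netpoly z - exact_poly z = \sum_(l in nodes) \sum_(a | lowdeg a)
    c l a * (prodt mm q (facs l a z) - prode q (facs l a z)).
  rewrite /netpoly /exact_poly -sumrB; apply: eq_bigr => l _.
  rewrite /locpoly mulr_sumr -sumrB; apply: eq_bigr => a ak.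
  by rewrite prode_facs//; ring.
rewrite !errE -sumrB (le_trans (ler_norm_sum _ _ _))//.
apply: (@le_trans _ _ (\sum_(l in nodes) ((phi l x != 0)%:R + (phi l y != 0)%:R) * (G * (C * cq) * `|x - y|))); last first.
  rewrite -mulr_suml -[leRHS]mulrA ler_wpM2r//; last first.
    by rewrite big_split/=; have := phi_count x; have := phi_count y; lra.
  by rewrite !mulr_ge0.
apply: ler_sum => l ln; rewrite -sumrB.
have hb : `|\sum_(a | lowdeg a)
   (c l a * (prodt mm q (facs l a x) - prode q (facs l a x)) -
    c l a * (prodt mm q (facs l a y) - prode q (facs l a y)))| <= G * (C * cq) * `|x - y|.
  rewrite -mulrA; apply: sum_lowdeg; first by rewrite !mulr_ge0.
  move=> a ak; rewrite -mulrBr normrM -mulrA ler_pM//.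
  apply: (le_trans (hcq mm (facs l a x) (facs l a y) (M%:R * `|x - y|) _ _ _ _)).
  - by rewrite mulr_ge0.
  - by move=> i; exact: facs01.
  - by move=> i; exact: facs01.
  - by move=> i; exact: facs_lip.
  rewrite -mulrA ler_wpM2l// mulrA ler_piMl// mulrC ler_pdivrMr ?exprn_gt0// mul1r.
  by rewrite -natrX ler_nat.
have r0 : 0 <= G * (C * cq) * `|x - y| by rewrite !mulr_ge0.
have [hx|hx] := eqVneq (phi l x) 0; last first.
  by rewrite (le_trans hb)// mulrDl mul1r lerDl mulr_ge0.
have [hy|hy] := eqVneq (phi l y) 0; last by rewrite (le_trans hb)// add0r mul1r.
rewrite big1 ?normr0 ?addr0 ?mul0r// => a ak.
by rewrite !prodt_facs0// !prode_facs// hx hy !mul0r !subrr.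
Qed.

End fixed_grid.
End local_polynomials.

(** * The network of one stage *)

Section more_layers.
Context {R : realType} {V : Type}.
Implicit Types (hs gs : seq (V -> R)) (f g : V -> R).

Definition unit_of f hs := exists2 j, (j < size hs)%N & nth (fun=> 0) hs j = f.

Lemma unit_of_catl f hs hs' : unit_of f hs -> unit_of f (hs ++ hs').
Proof.
move=> [j jhs <-]; exists j; first by rewrite size_cat ltn_addr.
by rewrite nth_cat jhs.
Qed.

Lemma unit_of_catr f hs hs' : unit_of f hs -> unit_of f (hs' ++ hs).
Proof.
move=> [j jhs <-]; exists (size hs' + j)%N; first by rewrite size_cat ltn_add2l.
by rewrite nth_cat ltnNge leq_addr/= addKn.
Qed.

Lemma unit_of_flatten (T : eqType) (s : seq T) (h : T -> seq (V -> R)) t f :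
  t \in s -> unit_of f (h t) -> unit_of f (flatten (map h s)).
Proof.
elim: s => //= a s IH; rewrite inE => /orP[/eqP <- ft|ts ft].
  exact: unit_of_catl.
by apply: unit_of_catr; exact: IH.
Qed.

Lemma unit_of_map (T : eqType) (s : seq T) (h : T -> V -> R) t :
  t \in s -> unit_of (h t) (map h s).
Proof.
by move=> ts; exists (index t s); rewrite ?size_map ?index_mem// (nth_map t) ?index_mem// nth_index.
Qed.

Lemma layer_unit hs f (a c : R) : unit_of f hs -> `|a| <= 1 -> `|c| <= 1 ->
  layer 3 hs [:: fun x => relu (a * f x - c)].
Proof.
move=> [j jhs <-] a1 c1; exists (fun _ i => if i == j then a else 0), (fun=> c); split => //=.
- by move=> _ i; case: ifP; rewrite // normr0.
- rewrite big_ord1 (bigD1 (Ordinal jhs))//= eqxx big1 ?addn0.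
    by case: (_ != _).
  by move=> i; rewrite -(inj_eq val_inj)/= => /negbTE ->; rewrite eqxx.
- move=> [|//] _ x; rewrite (bigD1 (Ordinal jhs))//= eqxx big1 ?addr0//.
  by move=> i; rewrite -(inj_eq val_inj)/= => /negbTE ->; rewrite mul0r.
Qed.

Lemma layer_unit_copy hs f : unit_of f hs -> (forall x, 0 <= f x) -> layer 3 hs [:: f].
Proof. by move=> [j jhs <-] f0; exact: layer_copy. Qed.

Lemma layer_nseq n c hs f : layer c hs [:: f] -> layer (c * n) hs (nseq n f).
Proof.
move=> hf; elim: n => [|n IH]; first by rewrite muln0; exact: layer_nil.
by rewrite mulnS /= -cat1s; exact: layer_cat.
Qed.

Lemma layer_flatten_same (T : Type) (s : seq T) c hs (g : T -> seq (V -> R)) :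
  (forall t, layer c hs (g t)) -> layer (c * size s) hs (flatten (map g s)).
Proof.
move=> hg; elim: s => [|t s IH] /=; first by rewrite muln0; exact: layer_nil.
by rewrite mulnS; exact: layer_cat.
Qed.

Lemma net_cat k B1 B2 hs gs1 gs2 : net k.+1 B1 hs gs1 -> net k.+1 B2 hs gs2 ->
  net k.+1 (B1 + B2) hs (gs1 ++ gs2).
Proof.
elim: k gs1 gs2 => [|k IH] gs1 gs2 [ms1 h1 l1] [ms2 h2 l2].
  move: h1 h2 l1 l2 => /= -> -> l1 l2; exists hs => //; exact: layer_cat.
by exists (ms1 ++ ms2); [exact: IH|exact: layer_par].
Qed.

Lemma net_map (T : Type) (s : seq T) k c hs (g : T -> V -> R) :
  (forall t, net k.+1 c hs [:: g t]) -> net k.+1 (c * size s) hs (map g s).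
Proof.
move=> hg; elim: s => [|t s IH] /=.
  rewrite muln0 => {hg}; elim: k => [|k IH]; first by exists hs => //; exact: layer_nil.
  by exists [::] => //; exact: layer_nil.
by rewrite mulnS -cat1s; exact: net_cat.
Qed.

Lemma sum_nseq n (f : V -> R) (w : nat -> R) hs' x :
  \sum_(j < size (nseq n f ++ hs')) w j * nth (fun=> 0) (nseq n f ++ hs') j x =
  (\sum_(j < n) w j) * f x + \sum_(j < size hs') w (n + j)%N * nth (fun=> 0) hs' j x.
Proof.
rewrite size_cat size_nseq big_split_ord/= mulr_suml; congr (_ + _); apply: eq_bigr => j _.
  by rewrite nth_cat size_nseq ltn_ord nth_nseq ltn_ord.
by rewrite nth_cat size_nseq ltnNge leq_addr/= addKn.
Qed.

End more_layers.

(** Projection onto [[0, 1]]. In front of a stage it extends the Lipschitz bound from the cube to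
    the whole space and brings the input, which may be only an approximate output of the stage
    before, back into the domain. *)
Definition clip {R : realType} (y : R) : R := relu y - relu (y - 1).

Section clip.
Context {R : realType}.

Lemma clip01 (y : R) : 0 <= clip y <= 1.
Proof.
rewrite /clip; have [h|h] := leP y 0; first by rewrite !relu_0; lra.
have [h'|h'] := leP y 1; first by rewrite relu_id ?relu_0; lra.
by rewrite !relu_id; lra.
Qed.

Lemma clip_id (y : R) : 0 <= y <= 1 -> clip y = y.
Proof. by move=> h; rewrite /clip relu_id ?relu_0; lra. Qed.

Lemma clip_lip (x y : R) : `|clip x - clip y| <= `|x - y|.
Proof.
rewrite /clip /relu /Num.max.
by do ![case: ifP => ?]; rewrite ler_norml; have [] := ler0P (x - y); lra.
Qed.

Definition cvec m (x : 'cV[R]_m) : 'cV[R]_m := \col_j clip (x j 0).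

Lemma cvec_cube m (x : 'cV[R]_m) : cube m (cvec x).
Proof. by move=> j; rewrite mxE clip01. Qed.

Lemma cvec_id m (x : 'cV[R]_m) : cube m x -> cvec x = x.
Proof. by move=> xc; apply/colP => j; rewrite mxE clip_id//; exact: xc. Qed.

Lemma cvec_lip m (x y : 'cV[R]_m) : `|cvec x - cvec y| <= `|x - y|.
Proof.
apply: mx_norm_le => // i j; rewrite (ord1 j) !mxE.
by rewrite (le_trans (clip_lip _ _))// cV_entry_le.
Qed.

End clip.

Section stage_network.
Context {R : realType} {V : Type}.
Variables (m k q M mm nC : nat) (S : {set 'I_m}) (C : R).
Hypothesis M0 : (0 < M)%N.
Hypothesis S0 : (0 < #|S|)%N.
Hypothesis C0 : 0 < C.
Hypothesis CnC : C <= nC%:R.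
Hypothesis Sq : (#|S| + k <= 2 ^ q)%N.

Local Notation idx := {ffun 'I_m -> 'I_k.+1}.
Local Notation node := {ffun 'I_m -> 'I_M.+1}.

Variable c : node -> idx -> R.
Hypothesis cC : forall l a, `|c l a| <= C.
Variable xs : V -> 'cV[R]_m.

Let hs : seq (V -> R) := [seq (fun v => xs v j 0) | j <- enum 'I_m].
Let cc j (v : V) : R := clip (xs v j 0).
Let U j (v : V) : R := M%:R * cc j v.
Let Pl j (l : 'I_M.+1) (v : V) : R := relu (U j v - l%:R).
Let Ql j (l : 'I_M.+1) (v : V) : R := relu (l%:R - U j v).
Let w j (l : 'I_M.+1) (v : V) : R := relu (cc j v - l.-1%:R / M%:R).
Let ht j (l : 'I_M.+1) (v : V) : R := hat M l (cc j v).

Let cc0 j v : 0 <= cc j v. Proof. by case/andP: (clip01 (xs v j 0)). Qed.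

Let list2 : seq (V -> R) := flatten [seq [:: cc j] | j <- enum 'I_m].
Let list6 : seq (V -> R) :=
  flatten [seq flatten [seq [:: ht j l; w j l] | l <- enum 'I_M.+1] | j <- enum 'I_m].

Let terms := [seq (l, a) | l <- enum (@nodes m M S), a <- enum (@lowdeg m k)].

Let cost : nat := (50 * m * M.+1 + 40 * 2 ^ q * size terms + (size terms + 2) * nC + nC + 2)%N.

Let MR : 0 < M%:R :> R. Proof. by rewrite ltr0n. Qed.

Let layers12 : net 2 (10 * m) hs list2.
Proof.
pose ms := flatten [seq [:: (fun v => relu (xs v j 0)); (fun v => relu (xs v j 0 - 1))] | j <- enum 'I_m].
exists ms; first apply: net1.
  apply: (@layer_le _ _ (6 * size (enum 'I_m))); first by rewrite size_enum_ord leq_mul2r orbT.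
  apply: layer_flatten_same => j.
  have uj : unit_of (fun v => xs v j 0) hs.
    by apply: (unit_of_map (fun j v => xs v j 0)); rewrite mem_enum.
  apply: (@layer_cat _ _ 3 3 _ [:: _] [:: _]).
    have := @layer_unit _ _ _ _ 1 0 uj; rewrite normr1 normr0 => /(_ (lexx _) ler01).
    by under eq_fun do rewrite mul1r subr0.
  have := @layer_unit _ _ _ _ 1 1 uj; rewrite normr1 => /(_ (lexx _) (lexx _)).
  by under eq_fun do rewrite mul1r.
apply: (@layer_le _ _ (4 * size (enum 'I_m))); first by rewrite size_enum_ord leq_mul2r orbT.
apply: layer_flatten => j.
apply: (@layer1 _ _ _ (nth 0 [:: 1; - 1]) 0).
- by apply: seq_norm_le1; rewrite /= normrN !normr1 !lexx.
- by rewrite normr0.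
- move=> v; rewrite big_ord_recl big_ord1/= subr0 mul1r mulN1r -/(clip _) relu_id//.
  exact: cc0.
Qed.

(** Multiplication by [M] is a sum of [M] copies with weight one. The constant [M] is built as well
    because the thresholds [l] of the hats are too large for a shift; the next layer obtains them
    with the weight [l / M] on this unit. *)
Let layers34 : net 2 (20 * m * M.+1) list2 (flatten [seq [:: U j; fun=> M%:R; cc j] | j <- enum 'I_m]).
Proof.
exists (flatten [seq nseq M (cc j) ++ nseq M (fun=> 1) ++ [:: cc j] | j <- enum 'I_m]); first apply: net1.
  apply: (@layer_le _ _ ((3 * M + (2 * M + 3)) * size (enum 'I_m))).
    by rewrite size_enum_ord; nia.
  apply: layer_flatten => j.
  have cp : layer 3 [:: cc j] [:: cc j] by exact: (@layer_copy _ _ [:: cc j] 0 erefl (cc0 j)).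
  apply: layer_cat; first exact: layer_nseq.
  apply: layer_cat => //; apply: layer_nseq.
  by apply: layer_cst; rewrite ler01 lexx.
apply: (@layer_le _ _ (((M + (M + 1) + 2) + ((M + (M + 1) + 2) + 3)) * size (enum 'I_m))).
  by rewrite size_enum_ord; nia.
apply: layer_flatten => j.
set b := _ ++ _.
have sb : size b = (M + (M + 1))%N by rewrite !size_cat !size_nseq.
rewrite -[[:: U j; _; _]]/([:: U j] ++ [:: fun=> M%:R] ++ [:: cc j]).
apply: layer_cat; last apply: layer_cat.
- rewrite -sb; apply: (@layer1 _ _ b (fun i => if (i < M)%N then 1 else 0) 0).
  + by move=> i; case: ifP; rewrite ?normr1 ?normr0.
  + by rewrite normr0.
  + move=> v; rewrite [X in relu (X - _)](sum_nseq M (cc j) (fun i => if (i < M)%N then 1 else 0) _ v).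
    rewrite [X in _ + X - _]big1 ?addr0; last first.
      by move=> i _; rewrite ltnNge leq_addr/= mul0r.
    under eq_bigr do rewrite ltn_ord.
    by rewrite sumr_const card_ord subr0 relu_id// mulr_ge0.
- rewrite -sb; apply: (@layer1 _ _ b (fun i => if (M <= i < M + M)%N then 1 else 0) 0).
  + by move=> i; case: ifP; rewrite ?normr1 ?normr0.
  + by rewrite normr0.
  + move=> v.
    rewrite [X in relu (X - _)](sum_nseq M (cc j) (fun i => if (M <= i < M + M)%N then 1 else 0) _ v).
    rewrite [X in relu (_ + X - _)](sum_nseq M (fun=> 1)
      (fun i => if (M <= M + i < M + M)%N then 1 else 0) [:: cc j] v) /= big_ord1/=.
    rewrite [X in relu (X * _ + _ - _)]big1; last first.
      by move=> i _; case: ifP => // /andP[h _]; have := leq_ltn_trans h (ltn_ord i); rewrite ltnn.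
    under eq_bigr => i _ do rewrite leq_addr/= ltn_add2l ltn_ord.
    rewrite addn0 ltnn andbF /= !mul0r add0r addr0 subr0 mulr1 sumr_const card_ord.
    by rewrite relu_id.
- apply: layer_unit_copy => //; exists (M + M)%N; first by rewrite sb; lia.
  by rewrite /b nth_cat size_nseq ltnNge leq_addr/= addKn nth_cat size_nseq ltnn subnn.
Qed.

Let layers56 : net 2 (25 * m * M.+1) (flatten [seq [:: U j; fun=> M%:R; cc j] | j <- enum 'I_m]) list6.
Proof.
exists (flatten [seq flatten [seq [:: Pl j l; Ql j l; w j l] | l <- enum 'I_M.+1] | j <- enum 'I_m]); first apply: net1.
  apply: (@layer_le _ _ ((15 * size (enum 'I_M.+1)) * size (enum 'I_m))).
    by rewrite !size_enum_ord; nia.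
  apply: layer_flatten => j; apply: layer_flatten_same => l.
  have lM : 0 <= (l%:R / M%:R : R) <= 1.
    by rewrite divr_ge0//= ler_pdivrMr// mul1r ler_nat -ltnS.
  have lM' : 0 <= (l.-1%:R / M%:R : R) <= 1.
    rewrite divr_ge0//= ler_pdivrMr// mul1r ler_nat.
    by apply: leq_trans (leq_pred _) _; rewrite -ltnS.
  rewrite -[[:: Pl j l; _; _]]/([:: Pl j l] ++ [:: Ql j l] ++ [:: w j l]).
  apply: (@layer_le _ _ (5 + (5 + 5))) => //.
  apply: layer_cat; last apply: layer_cat.
  - apply: (@layer1 _ _ [:: U j; _; cc j] (nth 0 [:: 1; - (l%:R / M%:R)]) 0).
    + by apply: seq_norm_le1; rewrite /= normrN normr1 lexx ger0_norm; case/andP: lM => // _ ->.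
    + by rewrite normr0.
    + move=> v; rewrite /= 2!big_ord_recl big_ord1/= subr0; congr relu.
      by field; rewrite gt_eqF.
  - apply: (@layer1 _ _ [:: U j; _; cc j] (nth 0 [:: - 1; l%:R / M%:R]) 0).
    + by apply: seq_norm_le1; rewrite /= normrN normr1 lexx ger0_norm; case/andP: lM => // _ ->.
    + by rewrite normr0.
    + move=> v; rewrite /= 2!big_ord_recl big_ord1/= subr0; congr relu.
      by field; rewrite gt_eqF.
  - apply: (@layer1 _ _ [:: U j; _; cc j] (nth 0 [:: 0; 0; 1]) (l.-1%:R / M%:R)).
    + by apply: seq_norm_le1; rewrite /= normr1 normr0 lexx ler01.
    + by rewrite ger0_norm; case/andP: lM'.
    + by move=> v; rewrite /= 2!big_ord_recl big_ord1/= !mul0r !add0r mul1r.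
apply: (@layer_le _ _ ((8 * size (enum 'I_M.+1)) * size (enum 'I_m))).
  by rewrite !size_enum_ord; nia.
apply: layer_flatten => j; apply: layer_flatten => l.
apply: (@layer_cat _ _ 5 3 _ [:: _] [:: _]).
  apply: (@layer1 _ _ [:: Pl j l; Ql j l; w j l] (nth 0 [:: - 1; - 1]) (- 1)).
  - by apply: seq_norm_le1; rewrite /= normrN normr1 lexx.
  - by rewrite normrN normr1.
  - move=> v; rewrite /= 2!big_ord_recl big_ord1/= /ht /hat -/(U j v); congr relu.
    rewrite /Pl /Ql; have [h|h] := ler0P (U j v - l%:R).
      by rewrite relu_0 ?relu_id; lra.
    by rewrite relu_id ?relu_0; lra.
by apply: (@layer_copy _ _ [:: Pl j l; Ql j l; w j l] 2) => // v; exact: relu_ge0.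
Qed.

Let fac (t : node * idx) i (v : V) : R := facs S t.1 t.2 (cvec (xs v)) i.

Let fac01 t i v : 0 <= fac t i v <= 1.
Proof. by apply: facs01 => //; exact: cvec_cube. Qed.

Let layer7 : layer (3 * 2 ^ q * size terms) list6
  (flatten [seq [seq fac t i | i <- iota 0 (2 ^ q)] | t <- terms]).
Proof.
apply: layer_flatten_same => t; rewrite -[in (3 * _)%N](size_iota 0 (2 ^ q)).
apply: layer_map => i.
have [h|h] := ltnP i (size (tags S t.2)); last first.
  rewrite (_ : fac t i = fun=> 1); last first.
    by apply/funext => v; rewrite /fac /facs nth_default// size_map.
  by apply: (@layer_le _ _ 2) => //; apply: layer_cst; rewrite ler01 lexx.
have t0 : ('I_m + 'I_m)%type by case: (tags S t.2) h => [|z s].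
have -> : fac t i = fun v => fval S t.1 (cvec (xs v)) (nth t0 (tags S t.2) i).
  by apply/funext => v; rewrite /fac /facs (nth_map t0).
case: (nth _ _ _) => [j|j] /=.
  rewrite (_ : (fun v => _) = ht j (t.1 j)); last by apply/funext => v; rewrite mxE.
  apply: layer_unit_copy; last by move=> v; case/andP: (hat01 M (t.1 j) (cc j v)).
  apply: (unit_of_flatten (mem_enum _ j)); apply: (unit_of_flatten (mem_enum _ (t.1 j))).
  by exists 0%N.
have [jS|jS] := boolP (j \in S); last first.
  rewrite (_ : (fun v => _) = fun=> 0); last by apply/funext => v; rewrite /wfac (negbTE jS).
  by apply: (@layer_le _ _ 2) => //; apply: layer_cst; rewrite ler01 lexx.
rewrite (_ : (fun v => _) = w j (t.1 j)); last by apply/funext => v; rewrite /wfac jS mxE.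
apply: layer_unit_copy; last by move=> v; exact: relu_ge0.
apply: (unit_of_flatten (mem_enum _ j)); apply: (unit_of_flatten (mem_enum _ (t.1 j))).
by exists 1%N.
Qed.

Let out (v : V) : R := relu (netpoly q mm S c (cvec (xs v))).

(** Division by [C] turns the Taylor coefficients into admissible weights; the [nC] copies serve to
    multiply by [C] again in the next layer. *)
Let layer9 : layer ((size terms + 2) * nC)
  (flatten [seq [:: fun v => prodt mm q (fun i => fac t i v)] | t <- terms])
  (nseq nC (fun v => out v / C)).
Proof.
apply: layer_nseq.
set L := flatten _.
have LE : L = [seq (fun v => prodt mm q (fun i => fac t i v)) | t <- terms].
  by rewrite /L; elim: terms => //= t s ->.
have sL : size L = size terms by rewrite LE size_map.
rewrite -sL; apply: (@layer1 _ _ L (nth 0 [seq c t.1 t.2 / C | t <- terms]) 0).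
- apply: seq_norm_le1; apply/allP => _ /mapP[t _ ->].
  by rewrite normrM (@gtr0_norm _ C^-1) ?invr_gt0// ler_pdivrMr// mul1r.
- by rewrite normr0.
- move=> v; rewrite subr0 /out.
  have -> : \sum_(j < size L) nth 0 [seq c t.1 t.2 / C | t <- terms] j * nth (fun=> 0) L j v
    = C^-1 * netpoly q mm S c (cvec (xs v)).
    transitivity (\sum_(t <- terms) c t.1 t.2 / C * prodt mm q (fun i => fac t i v)).
      pose t0 : node * idx := ([ffun=> ord0], [ffun=> ord0]).
      rewrite (big_nth t0) big_mkord sL; apply: eq_bigr => j _.
      by rewrite LE (nth_map t0)// (nth_map t0).
    rewrite /terms big_allpairs_dep/= big_enum/= /netpoly mulr_sumr.
    apply: eq_bigr => l _; rewrite big_enum/= mulr_sumr; apply: eq_bigr => a _.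
    by rewrite /fac/=; ring.
  have [h|h] := leP 0 (netpoly q mm S c (cvec (xs v))).
    by rewrite !relu_id// ?mulr_ge0 ?invr_ge0 ?(ltW C0)// mulrC.
  by rewrite !relu_0 ?mul0r ?(ltW h)// mulr_ge0_le0 ?invr_ge0 ?ltW.
Qed.

Let layer10 : layer (nC + 2) (nseq nC (fun v => out v / C)) [:: out].
Proof.
have nC0 : 0 < nC%:R :> R by exact: lt_le_trans CnC.
rewrite -[in X in layer X](size_nseq nC (fun v => out v / C)).
rewrite -{2}[nseq nC _]cats0 -[in X in layer X](cats0 (nseq nC _)).
apply: (@layer1 _ _ _ (fun=> C / nC%:R) 0).
- have h0 : 0 <= C / nC%:R by apply: divr_ge0; exact: ltW.
  by move=> _; rewrite (ger0_norm h0) ler_pdivrMr// mul1r.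
- by rewrite normr0.
- move=> v; rewrite [X in relu (X - _)](sum_nseq nC (fun v => out v / C) (fun=> C / nC%:R) [::] v) /= big_ord0 addr0 subr0 sumr_const card_ord.
  rewrite (_ : C / nC%:R *+ nC = C); last by rewrite -[LHS]mulr_natr divfK// gt_eqF.
  by rewrite mulrC divfK ?gt_eqF// [RHS]relu_id// /out relu_ge0.
Qed.

Lemma stage_net_cost : net (q * (mm + 3) + 9) cost hs [:: out].
Proof.
have c1 : (10 * m <= cost)%N by rewrite /cost; nia.
have c2 : (20 * m * M.+1 <= cost)%N by rewrite /cost; nia.
have c3 : (25 * m * M.+1 <= cost)%N by rewrite /cost; nia.
have c4 : (3 * 2 ^ q * size terms <= cost)%N by rewrite /cost; nia.
have c5 : (40 * 2 ^ q * size terms <= cost)%N by rewrite /cost; nia.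
have c6 : ((size terms + 2) * nC <= cost)%N by rewrite /cost; nia.
have c7 : (nC + 2 <= cost)%N by rewrite /cost; nia.
(* The nine layers besides the trees: two each for clipping, scaling and hats, one that lists the
   factors, two for the linear combination. *)
rewrite (_ : (q * (mm + 3) + 9)%N = (2 + (2 + (2 + (1 + (q * (mm + 3) + (1 + 1))))))%N); last by lia.
apply: (net_comp (net_le c1 layers12)).
apply: (net_comp (net_le c2 layers34)).
apply: (net_comp (net_le c3 layers56)).
apply: (net_comp (net_le c4 (net1 layer7))).
apply: net_comp (net_comp (net_le c6 (net1 layer9)) (net_le c7 (net1 layer10))).
apply: (net_le c5); apply: net_flatten => t.
by apply: net_prodt => i v; exact: fac01.
Qed.

Lemma stage_net : net (q * (mm + 3) + 9)
  ((50 * m + 42 * 2 ^ q * k.+1 ^ m * nC.+1) * M.+1 ^ #|S| + 3 * nC + 2)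
  [seq (fun v => xs v j 0) | j <- enum 'I_m]
  [:: fun v => relu (netpoly q mm S c (cvec (xs v)))].
Proof.
apply: net_le stage_net_cost; rewrite /cost.
have tE : (size terms <= M.+1 ^ #|S| * k.+1 ^ m)%N.
  rewrite /terms size_allpairs -!cardE leq_mul//.
    by rewrite /nodes card_pffun_on card_ord.
  by rewrite (leq_trans (max_card _))// card_ffun !card_ord.
have ME : (M.+1 <= M.+1 ^ #|S|)%N by rewrite -{1}[M.+1]expn1 leq_pexp2l.
have Q1 : (0 < 2 ^ q)%N by rewrite expn_gt0.
set Q := (2 ^ q)%N in Q1 *; set T := size terms in tE *.
set X := (M.+1 ^ #|S|)%N in ME tE *; set Y := (k.+1 ^ m)%N in tE *; set M' := M.+1 in ME *.
pose Z := (Q * (X * Y))%N.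
have h1 : (50 * m * M' <= 50 * m * X)%N by rewrite leq_mul2l ME orbT.
have h2 : (40 * Q * T <= 40 * Z)%N by rewrite -mulnA !leq_mul2l tE !orbT.
have h3 : (T * nC <= Z * nC)%N by rewrite leq_mul2r (leq_trans tE) ?orbT// leq_pmull.
have -> : ((50 * m + 42 * Q * Y * nC.+1) * X = 50 * m * X + 42 * (Z * nC) + 42 * Z)%N.
  by rewrite /Z; ring.
rewrite mulnDl.
lia.
Qed.

End stage_network.

(** * Taylor expansion in Hoelder balls *)

Section mean_value.
Context {R : realType}.

(* One-sided differentiability at the end points is enough; the set of points
   where the estimate holds is closed and open to the right. *)
Lemma mean_value_le (phi dphi : R -> R) lo hi B : lo <= hi ->
  (forall s, lo <= s <= hi -> `|dphi s| <= B) ->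
  (forall s, lo <= s <= hi -> forall eps, 0 < eps -> exists2 de, 0 < de &
     forall h, `|h| < de -> lo <= s + h <= hi ->
       `|phi (s + h) - phi s - h * dphi s| <= eps * `|h|) ->
  `|phi hi - phi lo| <= B * (hi - lo).
Proof.
move=> lohi dB dphiP; apply/ler_addgt0Pr => eps0 eps00.
pose eps := eps0 / (hi - lo + 1).
have eps_gt0 : 0 < eps by rewrite divr_gt0//; lra.
pose c := B + eps.
have step s : lo <= s <= hi -> exists2 de, 0 < de &
    forall h, `|h| < de -> lo <= s + h <= hi -> `|phi (s + h) - phi s| <= c * `|h|.
  move=> hs; have [de de0 H] := dphiP s hs _ eps_gt0; exists de => // h hde hh.
  have h1 := H h hde hh.
  rewrite (_ : _ - _ = (phi (s + h) - phi s - h * dphi s) + h * dphi s); last by ring.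
  rewrite (le_trans (ler_normD _ _))// /c mulrDl addrC lerD// normrM mulrC ler_wpM2r//.
  exact: dB.
pose A := [set s | lo <= s <= hi /\ `|phi s - phi lo| <= c * (s - lo)].
have Alo : A lo by split; [rewrite lexx|rewrite !subrr normr0 mulr0].
have hsA : has_sup A by split; [exists lo|exists hi => s [/andP[]]].
pose s := sup A.
have slo : lo <= s by apply: (ub_le_sup (proj2 hsA)).
have shi : s <= hi by apply: (sup_le_ub (proj1 hsA)) => t [/andP[]].
have sI : lo <= s <= hi by rewrite slo.
have [de de0 H] := step s sI.
have As : A s.
  split => //; have [t At ts] := sup_adherent de0 hsA.
  have tle : t <= s by apply: (ub_le_sup (proj2 hsA)).
  case: At => tI tphi.
  have := H (t - s); rewrite (_ : s + (t - s) = t) => [H1|]; last by ring.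
  have ht : `|t - s| < de by rewrite ler0_norm; [rewrite -/s in ts; lra|lra].
  have {}H1 := H1 ht tI; rewrite (@ler0_norm _ (t - s)) in H1; last by lra.
  rewrite (_ : phi s - phi lo = - (phi t - phi s) + (phi t - phi lo)); last by ring.
  rewrite (le_trans (ler_normD _ _))// normrN; lra.
have sE : s = hi.
  apply/eqP; rewrite eq_le shi/= leNgt; apply/negP => shi'.
  pose h := Num.min (de / 2) (hi - s).
  have h0 : 0 < h by rewrite lt_min; apply/andP; split; lra.
  have hde : `|h| < de.
    by rewrite gtr0_norm//; apply: (@le_lt_trans _ _ (de / 2)); [rewrite ge_min lexx|lra].
  have hhi : h <= hi - s by rewrite ge_min lexx orbT.
  have hI : lo <= s + h <= hi by lra.
  have : A (s + h).
    split => //; have := H h hde hI; rewrite (gtr0_norm h0) => h1.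
    rewrite (_ : phi (s + h) - phi lo = (phi (s + h) - phi s) + (phi s - phi lo)); last by ring.
    by rewrite (le_trans (ler_normD _ _))//; case: As; lra.
  by move=> /(ub_le_sup (proj2 hsA)); rewrite -/s; lra.
case: As => _; rewrite sE => h; apply: (le_trans h).
rewrite /c mulrDl lerD2l /eps mulrAC ler_pdivrMr; last by lra.
by rewrite ler_wpM2l//; lra.
Qed.

End mean_value.

Section holder_taylor.
Context {R : realType}.

Lemma hfloor_bounds (b : R) : 0 < b -> (hfloor b)%:R < b <= (hfloor b).+1%:R.
Proof.
move=> b0; have /andP[tb bt] := truncn_itv (ltW b0).
set t := Num.truncn b in tb bt *.
have hle : forall k : nat, (k%:R < b) -> (k <= hfloor b)%N.
  move=> k kb; have kt : (k < t.+1)%N by rewrite -(ltr_nat R) (lt_trans kb).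
  exact: (leq_bigmax_cond (Ordinal kt : 'I_t.+1)).
apply/andP; split.
  rewrite /hfloor; apply: (big_ind (fun k : nat => k%:R < b)) => //.
  by move=> x y xb yb; rewrite /maxn; case: ifP.
by rewrite leNgt; apply/negP => /hle; rewrite ltnn.
Qed.

(** The partial derivative without quotient, so that [h = 0] is no exception; increments that leave
    the cube are ignored, as in [is_partial_on]. *)
Definition pdiff m (j : 'I_m) (F : 'cV[R]_m -> R) (x : 'cV[R]_m) (l : R) :=
  forall eps, 0 < eps -> exists2 de, 0 < de & forall h, `|h| < de ->
    cube m (x + h *: delta_mx j 0) ->
    `|F (x + h *: delta_mx j 0) - F x - h * l| <= eps * `|h|.

Lemma is_partial_on_pdiff m (j : 'I_m) F x l :
  is_partial_on (cube m) j F x l -> pdiff j F x l.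
Proof.
move=> /cvgrPdist_le H eps /H; rewrite /within/= => /nbhs_ballP[de /= de0 hde].
exists de => // h hd hP.
have [->|h0] := eqVneq h 0; first by rewrite scale0r addr0 mul0r subrr subr0 normr0 mulr0.
have := hde h; rewrite /ball/= sub0r normrN => /(_ hd) /(_ (conj h0 hP)) hh.
rewrite -(@ler_pM2l _ `|h^-1|) ?normr_gt0 ?invr_eq0//.
rewrite -normrM mulrA [_ * eps]mulrC -mulrA -[X in _ <= eps * X]normrM mulVf// normr1 mulr1.
by apply: le_trans hh; rewrite distrC mulrBr mulrA mulVf// mul1r.
Qed.

Lemma pdiffB m (j : 'I_m) F G x l l' : pdiff j F x l -> pdiff j G x l' ->
  pdiff j (fun y => F y - G y) x (l - l').
Proof.
move=> HF HG eps eps0; have e2 : 0 < eps / 2 by lra.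
have [de de0 h1] := HF _ e2; have [de' de'0 h2] := HG _ e2.
exists (Num.min de de'); first by rewrite lt_min de0.
move=> h; rewrite lt_min => /andP[hd hd'] hc.
have := h1 h hd hc; have := h2 h hd' hc.
set a := F _; set b := G _ => q1 q2.
rewrite (_ : _ - _ = (a - F x - h * l) - (b - G x - h * l')); last by ring.
by rewrite (le_trans (ler_normB _ _))//; lra.
Qed.

(* Q j integrates P j along the j-th coordinate, at points whose later
   coordinates agree with those of the base point a. *)
Lemma path_le m (F : 'cV[R]_m -> R) (dF P Q : 'I_m -> 'cV[R]_m -> R) (a x : 'cV[R]_m) (B : R) :
  cube m a -> cube m x ->
  (forall j y, cube m y -> pdiff j F y (dF j y)) ->
  (forall (j : 'I_m) (y : 'cV[R]_m), cube m y -> (forall l : 'I_m, (j < l)%N -> y l 0 = a l 0) ->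
     pdiff j (Q j) y (P j y)) ->
  (forall (j : 'I_m) (y : 'cV[R]_m), (forall l : 'I_m, (j <= l)%N -> y l 0 = a l 0) -> Q j y = 0) ->
  (forall (j : 'I_m) (y z : 'cV[R]_m), (forall l : 'I_m, (l <= j)%N -> y l 0 = z l 0) -> Q j y = Q j z) ->
  (forall j y, cube m y -> `|y - a| <= `|x - a| -> `|dF j y - P j y| <= B) ->
  `|F x - F a - \sum_j Q j x| <= m%:R * B * `|x - a|.
Proof.
move=> ac xc dFP QP Q0 Qx dFB.
(* Staircase from [a] to [x]. Along its edge in direction [j] the function [F - Q j] has derivative
   [dF j - P j], and [Q j] is zero at the start of that edge, so each edge contributes one mean
   value estimate. *)
pose z (i : nat) : 'cV[R]_m := \col_l (if (l < i)%N then x l 0 else a l 0).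
have zc i : cube m (z i) by move=> l; rewrite mxE; case: ifP.
have zm : z m = x by apply/colP => l; rewrite mxE ltn_ord.
have z0 : z 0%N = a by apply/colP => l; rewrite mxE.
suff H i : (i <= m)%N -> `|F (z i) - F a - \sum_(j < m | (j < i)%N) Q j x| <= i%:R * B * `|x - a|.
  have := H m (leqnn m); rewrite zm; congr (`|_ - _| <= _).
  by apply: eq_bigl => j; rewrite ltn_ord.
elim: i => [|i IH] im.
  by rewrite z0 subrr sub0r big1 ?oppr0 ?normr0 ?mul0r// => j; rewrite ltn0.
pose j := Ordinal im.
rewrite (bigD1 j)/=; last by rewrite ltnS.
rewrite (eq_bigl (fun l : 'I_m => (l < i)%N)); last first.
  by move=> l; rewrite -val_eqE /= ltnS [(l <= i)%N]leq_eqVlt; case: eqVneq => [->|] /=; rewrite ?ltnn ?andbT.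
have Qzx : Q j (z i.+1) = Q j x by apply: Qx => l lj; rewrite mxE ltnS lj.
have Qz0 : Q j (z i) = 0 by apply: Q0 => l jl; rewrite mxE ltnNge jl.
set sq := \sum_(l < m | _) _.
have -> : F (z i.+1) - F a - (Q j x + sq) = ((F (z i.+1) - Q j (z i.+1)) - (F (z i) - Q j (z i)))
  + (F (z i) - F a - sq) by rewrite Qzx Qz0; ring.
rewrite (le_trans (ler_normD _ _))// -natr1 !mulrDl mul1r addrC lerD//; first by apply: IH; exact: ltnW.
pose w (s : R) : 'cV[R]_m := z i + (s - a j 0) *: delta_mx j 0.
have wE s l : w s l 0 = if (l < i)%N then x l 0 else if l == j then s else a l 0.
  rewrite !mxE; have [->|lj] := eqVneq l j.
    by rewrite ltnn eqxx/= mulr1 addrC subrK.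
  by rewrite /= mulr0 addr0.
have wa : w (a j 0) = z i by rewrite /w subrr scale0r addr0.
have wx : w (x j 0) = z i.+1.
  apply/colP => l; rewrite wE mxE [(l < i.+1)%N]ltnS [(l <= i)%N]leq_eqVlt.
  have [->|lj] := eqVneq l j; first by rewrite /= eqxx ltnn.
  by rewrite (_ : (l : nat) == i = false)//; apply/negbTE; rewrite -val_eqE in lj.
have ws s h : w s + h *: delta_mx j 0 = w (s + h).
  by rewrite /w -addrA -scalerDl; congr (_ + _ *: _); ring.
have wcube s : 0 <= s <= 1 -> cube m (w s).
  by move=> s01 l; rewrite wE; case: ifP => _; [exact: xc|case: ifP => _ //; exact: ac].
have wle s : `|s - a j 0| <= `|x - a| -> `|w s - a| <= `|x - a|.
  move=> h; apply: mx_norm_le => // l u; rewrite (ord1 u) [X in `|X|]mxE wE [X in _ + X]mxE.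
  case: ifP => _; first exact: cV_entry_le.
  by case: eqP => [->//|_]; rewrite subrr normr0.
have B0 : 0 <= B by rewrite (le_trans _ (dFB j a ac _))// subrr normr0.
have key lo hi : lo <= hi -> 0 <= lo -> hi <= 1 ->
    (forall s, lo <= s <= hi -> `|s - a j 0| <= `|x - a|) ->
    `|(F (w hi) - Q j (w hi)) - (F (w lo) - Q j (w lo))| <= B * (hi - lo).
  move=> lohi lo0 hi1 hle.
  apply: (@mean_value_le _ (fun s => F (w s) - Q j (w s)) (fun s => dF j (w s) - P j (w s))) => //.
    by move=> s hs; apply: dFB; [apply: wcube; lra|apply/wle/hle].
  move=> s hs eps eps0; have wsc : cube m (w s) by apply: wcube; lra.
  have HQ : pdiff j (Q j) (w s) (P j (w s)).
    apply: QP => // l jl; rewrite wE ltnNge ltnW//=.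
    by case: eqP => // lj; rewrite lj ltnn in jl.
  have [de de0 H] := pdiffB (dFP j (w s) wsc) HQ eps0.
  exists de => // h hde hh; have := H h hde; rewrite ws; apply.
  by apply: wcube; lra.
have := xc j; have := ac j => a01 x01; have dxa := cV_entry_le x a j.
rewrite -wx -wa; have [ax|xa] := leP (a j 0) (x j 0).
  apply: (le_trans (key _ _ ax _ _ _)); [lra|lra| |].
    move=> s hs; apply: le_trans dxa; rewrite !ger0_norm; lra.
  by rewrite ler_wpM2l//; apply: le_trans dxa; exact: ler_norm.
rewrite distrC; apply: (le_trans (key _ _ (ltW xa) _ _ _)); [lra|lra| |].
  move=> s hs; apply: le_trans dxa; rewrite !ler0_norm; lra.
by rewrite ler_wpM2l//; apply: le_trans dxa; rewrite distrC; exact: ler_norm.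
Qed.

Lemma pow_diff (u h : R) n : `|u| <= 1 -> `|u + h| <= 1 ->
  `|(u + h) ^+ n.+1 - u ^+ n.+1 - n.+1%:R * h * u ^+ n| <= n.+1%:R ^+ 2 * h ^+ 2.
Proof.
move=> u1 uh1; elim: n => [|n IH].
  have -> : (u + h) ^+ 1 - u ^+ 1 - 1 * h * u ^+ 0 = 0 by ring.
  by rewrite normr0 mulr_ge0// ?sqr_ge0.
have -> : (u + h) ^+ n.+2 - u ^+ n.+2 - n.+2%:R * h * u ^+ n.+1 =
  (u + h) * ((u + h) ^+ n.+1 - u ^+ n.+1 - n.+1%:R * h * u ^+ n) + n.+1%:R * h ^+ 2 * u ^+ n.
  by rewrite -natr1 !exprS; ring.
apply: (le_trans (ler_normD _ _)).
have h1 : `|(u + h) * ((u + h) ^+ n.+1 - u ^+ n.+1 - n.+1%:R * h * u ^+ n)| <= n.+1%:R ^+ 2 * h ^+ 2.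
  rewrite normrM; by apply: le_trans IH; rewrite ler_piMl.
have h2 : `|n.+1%:R * h ^+ 2 * u ^+ n| <= n.+1%:R * h ^+ 2.
  have h0 : 0 <= n.+1%:R * h ^+ 2 by apply: mulr_ge0 => //; exact: sqr_ge0.
  rewrite normrM (ger0_norm h0); apply: ler_piMr => //.
  by rewrite normrX; apply: exprn_ile1.
apply: le_trans (lerD h1 h2) _; rewrite -mulrDl ler_wpM2r ?sqr_ge0//.
by rewrite -[n.+2%:R]natr1; have : 0 <= n.+1%:R :> R by []; nra.
Qed.

Section local_class.
Variables (m k : nat) (a : 'cV[R]_m).
Hypothesis ac : cube m a.
Local Notation idx := {ffun 'I_m -> 'I_k.+1}.

(** Taylor polynomials up to the exact values of their coefficients: the network construction uses
    only a uniform bound on them and the degree. *)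
Definition locp (j : nat) (B : R) (P : 'cV[R]_m -> R) := exists c : idx -> R,
  [/\ forall g, `|c g| <= B, forall g, (j < mi_order (mi_val g))%N -> c g = 0 &
      forall x, P x = \sum_g c g * \prod_l (x l 0 - a l 0) ^+ g l].

Lemma locpD j B B' P P' : locp j B P -> locp j B' P' ->
  locp j (B + B') (fun x => P x + P' x).
Proof.
move=> [c [cB cj cE]] [c' [cB' cj' cE']]; exists (fun g => c g + c' g); split.
- by move=> g; rewrite (le_trans (ler_normD _ _))// lerD.
- by move=> g h; rewrite cj// cj'// addr0.
- by move=> x; rewrite cE cE' -big_split/=; apply: eq_bigr => g _; rewrite mulrDl.
Qed.

Lemma locp_le j B B' P : B <= B' -> locp j B P -> locp j B' P.
Proof. by move=> BB [c [cB ? ?]]; exists c; split => // g; exact: le_trans (cB g) BB. Qed.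

Lemma locp_monomial j (e : 'I_m -> nat) (b : R) : (\sum_l e l <= j)%N -> (j <= k)%N ->
  locp j `|b| (fun x => b * \prod_l (x l 0 - a l 0) ^+ e l).
Proof.
move=> ej jk; have ek l : (e l < k.+1)%N.
  by rewrite ltnS (leq_trans _ jk)// (leq_trans _ ej)// (bigD1 l)//= leq_addr.
pose g0 : idx := [ffun l => Ordinal (ek l)].
exists (fun g => if g == g0 then b else 0); split.
- by move=> g; case: ifP; rewrite ?normr0.
- move=> g; case: eqP => // ->; rewrite ltnNge => /negP[]; apply: leq_trans ej.
  by apply: leq_sum => l _; rewrite !ffunE.
- move=> x; rewrite (bigD1 g0)//= eqxx [X in _ + X]big1 ?addr0; last first.
    by move=> g /negbTE ->; rewrite mul0r.
  by congr (_ * _); apply: eq_bigr => l _; rewrite ffunE.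
Qed.

Lemma locp0 j : locp j 0 (fun=> 0).
Proof.
exists (fun=> 0); split => // [g|x]; first by rewrite normr0.
by rewrite big1// => g _; rewrite mul0r.
Qed.

Lemma locp_sum j (I : finType) (B : R) (P : I -> 'cV[R]_m -> R) :
  (forall i, locp j B (P i)) -> locp j (#|I|%:R * B) (fun x => \sum_i P i x).
Proof.
move=> hP; rewrite cardE.
suff : forall s : seq I, locp j ((size s)%:R * B) (fun x => \sum_(i <- s) P i x).
  by move=> /(_ (enum I)) [c [? ? E]]; exists c; split => // x; rewrite -E big_enum.
elim=> [|i s IH].
  have [c [? ? E]] := locp0 j; exists c; rewrite mul0r; split => // x.
  by rewrite -E big_nil.
have [c [cB ? E]] := locpD (hP i) IH; exists c; split => //.
  by move=> g; rewrite /= -natr1 mulrDl mul1r addrC.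
by move=> x; rewrite big_cons E.
Qed.

(** Primitive in direction [i] of the polynomial with coefficients [c], without the monomials that
    contain a later coordinate. These vanish on the edge of the staircase in question, and without
    them the primitive does not depend on later coordinates, as [path_le] demands. *)
Definition integ (i : 'I_m) (c : idx -> R) (x : 'cV[R]_m) : R :=
  \sum_(g : idx) (if [forall l : 'I_m, (i < l)%N ==> (g l == ord0)] then c g / (g i).+1%:R else 0)
    * \prod_l (x l 0 - a l 0) ^+ (g l + (l == i)).

Lemma integ_locp j i c B : (j < k)%N -> (forall g, `|c g| <= B) ->
  (forall g, (j < mi_order (mi_val g))%N -> c g = 0) ->
  locp j.+1 (#|idx|%:R * B) (integ i c).
Proof.
move=> jk cB cj; apply: locp_sum => g.
set b := if _ then _ else _.
have bB : `|b| <= B.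
  have B0 : 0 <= B := le_trans (normr_ge0 _) (cB g).
  rewrite /b; case: ifP; rewrite ?normr0// => _; rewrite normrM normfV [`|_.+1%:R|]ger0_norm//.
  by rewrite ler_pdivrMr// (le_trans (cB g))// ler_peMr// ler1n.
have [gj|gj] := leqP (mi_order (mi_val g)) j; last first.
  have b0 : b = 0 by rewrite /b cj// mul0r if_same.
  have := locp_le _ (locp0 j.+1); move=> /(_ B); rewrite (le_trans (normr_ge0 _) bB) => /(_ isT)[c' [? ? E]].
  by exists c'; split => // x; rewrite -E b0 mul0r.
apply: (locp_le bB); apply: locp_monomial => //.
rewrite big_split/= -[j.+1]addn1; apply: leq_add; last first.
  by rewrite (bigD1 i)//= eqxx big1 ?addn0// => l /negbTE ->.
by apply: leq_trans gj; apply: leq_sum => l _; rewrite ffunE.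
Qed.

Lemma integ_eq (i : 'I_m) c (y z : 'cV[R]_m) : (forall l : 'I_m, (l <= i)%N -> y l 0 = z l 0) ->
  integ i c y = integ i c z.
Proof.
move=> yz; apply: eq_bigr => g _; case: ifP => [/forallP h|]; last by rewrite !mul0r.
congr (_ * _); apply: eq_bigr => l _; have [li|li] := leqP l i; first by rewrite yz.
have /implyP/(_ li)/eqP -> := h l.
by rewrite (_ : l == i = false)//; apply/negbTE; rewrite -val_eqE/= neq_ltn li orbT.
Qed.

Lemma integ0 (i : 'I_m) c (y : 'cV[R]_m) : (forall l : 'I_m, (i <= l)%N -> y l 0 = a l 0) -> integ i c y = 0.
Proof.
move=> ya; rewrite /integ big1// => g _; rewrite (bigD1 i)//= ya// subrr eqxx addn1.
by rewrite expr0n mul0r mulr0.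
Qed.

Lemma pdiff_integ (i : 'I_m) (c : idx -> R) (y : 'cV[R]_m) : cube m y -> (forall l : 'I_m, (i < l)%N -> y l 0 = a l 0) ->
  pdiff i (integ i c) y (\sum_g c g * \prod_l (y l 0 - a l 0) ^+ g l).
Proof.
move=> yc ya eps eps0.
pose D : R := 1 + \sum_g `|c g| * k.+1%:R ^+ 2.
have D0 : 0 < D.
  by rewrite /D (lt_le_trans ltr01)// lerDl sumr_ge0// => g _; rewrite mulr_ge0// sqr_ge0.
exists (eps / D); first by rewrite divr_gt0.
move=> h hd hc; pose u := y i 0 - a i 0.
have u1 : `|u| <= 1.
  by rewrite /u ler_norml; have := yc i; have := ac i; lra.
have uh1 : `|u + h| <= 1.
  have := hc i; rewrite !mxE eqxx mulr1 => hi; rewrite /u ler_norml; have := ac i; lra.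
have prodE (e : 'I_m -> nat) (v : 'cV[R]_m) : (forall l, l != i -> v l 0 = y l 0) ->
    \prod_l (v l 0 - a l 0) ^+ e l =
    (v i 0 - a i 0) ^+ e i * \prod_(l | l != i) (y l 0 - a l 0) ^+ e l.
  by move=> vy; rewrite (bigD1 i)//=; congr (_ * _); apply: eq_bigr => l li; rewrite vy.
have vE l : l != i -> (y + h *: delta_mx i 0) l 0 = y l 0.
  by move=> li; rewrite !mxE (negbTE li)/= mulr0 addr0.
rewrite /integ mulr_sumr -!sumrB (le_trans (ler_norm_sum _ _ _))//.
apply: (@le_trans _ _ (\sum_g `|c g| * k.+1%:R ^+ 2 * h ^+ 2)); last first.
  rewrite -mulr_suml (@le_trans _ _ (D * h ^+ 2))//.
    by rewrite ler_wpM2r ?sqr_ge0// /D lerDr.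
  have -> : h ^+ 2 = `|h| * `|h| by rewrite -normrM -expr2 ger0_norm// sqr_ge0.
  rewrite mulrA; apply: ler_wpM2r => //; rewrite mulrC -ler_pdivlMr//; exact: ltW.
apply: ler_sum => g _.
rewrite !(prodE _ _ vE) !(prodE _ _ (fun l _ => erefl)) !mxE !eqxx/= mulr1 addn1.
rewrite (_ : y i 0 + h - a i 0 = u + h) -/u; last by rewrite /u; ring.
have Er : \prod_(l | l != i) (y l 0 - a l 0) ^+ (g l + (l == i)) = \prod_(l | l != i) (y l 0 - a l 0) ^+ g l.
  by apply: eq_bigr => l /negbTE ->; rewrite addn0.
rewrite Er; set r := \prod_(l | l != i) _.
have r1 : `|r| <= 1.
  rewrite /r normr_prod; apply: prodr_ile1 => l _; rewrite normr_ge0/= normrX exprn_ile1//.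
  by rewrite ler_norml; have := yc l; have := ac l; lra.
case: ifP => [_|/negbT/forallPn[l]]; last first.
  rewrite negb_imply => /andP[il gl].
  have -> : r = 0.
    rewrite /r (bigD1 l)/=; last by rewrite -val_eqE/= neq_ltn il orbT.
    by rewrite ya// subrr expr0n -(inj_eq val_inj)/= in gl *; rewrite (negbTE gl) mul0r.
  by rewrite !(mulr0, subrr, normr0) mulr_ge0 ?sqr_ge0// mulr_ge0 ?sqr_ge0.
have g0 : (g i).+1%:R != 0 :> R by rewrite pnatr_eq0.
have -> : c g / (g i).+1%:R * ((u + h) ^+ (g i).+1 * r) - c g / (g i).+1%:R * (u ^+ (g i).+1 * r)
   - h * (c g * (u ^+ g i * r)) =
  c g * (r * (((u + h) ^+ (g i).+1 - u ^+ (g i).+1 - (g i).+1%:R * h * u ^+ g i) / (g i).+1%:R)).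
  by field.
rewrite -[leRHS]mulrA [leLHS]normrM; apply: ler_wpM2l => //; rewrite normrM.
apply: (@le_trans _ _ ((g i).+1%:R ^+ 2 * h ^+ 2)); last first.
  by rewrite ler_wpM2r ?sqr_ge0// lerXn2r ?nnegrE// ler_nat.
apply: le_trans (pow_diff (g i) u1 uh1).
rewrite -[leRHS]mul1r ler_pM// normrM ler_piMr// normfV ger0_norm// invf_le1// ler1n.
done.
Qed.

End local_class.

Fixpoint taylor_cst (m k : nat) (K : R) (j : nat) : R :=
  if j is j'.+1 then K + m%:R * (#|{ffun 'I_m -> 'I_k.+1}|%:R * taylor_cst m k K j') else K.

Lemma taylor_cst_ge0 m k (K : R) j : 0 <= K -> 0 <= taylor_cst m k K j.
Proof. by move=> K0; elim: j => //= j IH; rewrite addr_ge0// !mulr_ge0. Qed.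

Lemma mi_order_incr m (al : {ffun 'I_m -> nat}) i : mi_order (mi_incr al i) = (mi_order al).+1.
Proof.
rewrite /mi_order; under eq_bigr do rewrite ffunE.
rewrite big_split/= -addn1; congr (_ + _)%N.
by rewrite (bigD1 i)//= eqxx big1 ?addn0// => l /negbTE ->.
Qed.

(** Induction from the top derivatives downwards: polynomial approximations of the first partial
    derivatives of [Df al] are integrated along a staircase by [path_le]. Each integration
    contributes a factor [m] and one power of the distance to the error. *)
Lemma taylor m (k : nat) (a : 'cV[R]_m) (Df : {ffun 'I_m -> nat} -> 'cV[R]_m -> R) (K s : R) :
  cube m a -> 0 <= s -> 0 <= K ->
  (forall al j, (mi_order al < k)%N -> forall x, cube m x ->
     is_partial_on (cube m) j (Df al) x (Df (mi_incr al j) x)) ->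
  (forall al, (mi_order al <= k)%N -> `|Df al a| <= K) ->
  (forall al x, mi_order al = k -> cube m x -> `|Df al x - Df al a| <= K * `|x - a| `^ s) ->
  forall j al, (mi_order al + j = k)%N -> exists2 P, locp k a j (taylor_cst m k K j) P &
    forall x, cube m x -> `|Df al x - P x| <= m%:R ^+ j * K * (`|x - a| ^+ j * `|x - a| `^ s).
Proof.
move=> ac s0 K0 Dpart DK Dtop.
have cst_locp j b : (j <= k)%N -> locp k a j `|b| (fun=> b).
  move=> jk; have [|c [cB cj cE]] := @locp_monomial _ _ a j (fun=> 0%N) b _ jk.
    by rewrite big1.
  exists c; split => // x; rewrite -cE big1 ?mulr1// => l _; by rewrite expr0.
elim=> [|j IH] al alk.
  exists (fun=> Df al a); first by apply: (@locp_le _ _ _ _ `|Df al a|); [apply: DK; lia|exact: cst_locp].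
  by move=> x xc; rewrite expr0 mul1r expr0 mul1r; apply: Dtop => //; lia.
have IHi i : exists2 P, locp k a j (taylor_cst m k K j) P & forall x, cube m x ->
    `|Df (mi_incr al i) x - P x| <= m%:R ^+ j * K * (`|x - a| ^+ j * `|x - a| `^ s).
  by apply: IH; rewrite mi_order_incr; lia.
have IHc i : exists c : {ffun 'I_m -> 'I_k.+1} -> R, [/\ forall g, `|c g| <= taylor_cst m k K j,
   forall g, (j < mi_order (mi_val g))%N -> c g = 0 & forall x, cube m x ->
    `|Df (mi_incr al i) x - \sum_g c g * \prod_l (x l 0 - a l 0) ^+ g l|
      <= m%:R ^+ j * K * (`|x - a| ^+ j * `|x - a| `^ s)].
  have [P [c [cB cj cE]] h] := IHi i; exists c; split => // x xc.
  by rewrite -cE; exact: h.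
have [c cP] := boolp.choice IHc.
exists (fun x => Df al a + \sum_i integ a i (c i) x).
  apply: locpD.
    by apply: (@locp_le _ _ _ _ `|Df al a|); [apply: DK; lia|apply: cst_locp; lia].
  have -> : m%:R = #|'I_m|%:R :> R by rewrite card_ord.
  apply: locp_sum => i; have [cB cj _] := cP i; apply: integ_locp => //; lia.
move=> x xc; rewrite opprD addrA.
apply: (le_trans (@path_le _ (Df al) (fun i => Df (mi_incr al i))
   (fun i x => \sum_g c i g * \prod_l (x l 0 - a l 0) ^+ g l) (fun i => integ a i (c i)) a x
   (m%:R ^+ j * K * (`|x - a| ^+ j * `|x - a| `^ s)) ac xc _ _ _ _ _)).
- by move=> i y yc; apply: is_partial_on_pdiff; apply: Dpart => //; lia.
- by move=> i y yc ya; exact: pdiff_integ.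
- by move=> i y; exact: integ0.
- by move=> i y z; exact: integ_eq.
- move=> i y yc yx; have [_ _ h] := cP i; apply: (le_trans (h y yc)).
  rewrite ler_wpM2l//; first by rewrite mulr_ge0// exprn_ge0.
  rewrite ler_pM ?exprn_ge0 ?powR_ge0//; first by rewrite lerXn2r ?nnegrE.
  by rewrite ge0_ler_powR ?nnegrE.
rewrite le_eqVlt; apply/orP; left; apply/eqP; rewrite !exprS; ring.
Qed.

Lemma sup_set_ge0 (A : set (\bar R)) : A !=set0 -> (forall y, A y -> (0 <= y)%E) -> (0 <= ereal_sup A)%E.
Proof. by move=> [y Ay] A0; apply: (le_trans (A0 _ Ay)); exact: ereal_sup_ubound. Qed.

Lemma cube0 m : cube m (0 : 'cV[R]_m).
Proof. by move=> j; rewrite mxE lexx ler01. Qed.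

Lemma holder_norm_bounds m (b K : R) (Df : {ffun 'I_m -> nat} -> 'cV[R]_m -> R) :
  (0 < m)%N -> 0 < b -> (holder_norm (cube m) b Df <= K%:E)%E ->
  (forall al x, (mi_order al <= hfloor b)%N -> cube m x -> `|Df al x| <= K) /\
  (forall al x y, mi_order al = hfloor b -> cube m x -> cube m y ->
     `|Df al x - Df al y| <= K * `|x - y| `^ (b - (hfloor b)%:R)).
Proof.
move=> m0 b0; have /andP[kb _] := hfloor_bounds b0.
rewrite /holder_norm; set k := hfloor b in kb *; set S1 := (\sum_(_ | _) _)%E; set S2 := (\sum_(_ | mi_order _ == _) _)%E.
pose t1 (al : {ffun 'I_m -> nat}) := ereal_sup [set `|Df al x|%:E | x in cube m].
pose t2 (al : {ffun 'I_m -> nat}) := ereal_sup [set (`|Df al x.1 - Df al x.2|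
    / `|x.1 - x.2| `^ (b - k%:R))%:E | x in [set x | [/\ cube m x.1, cube m x.2 & x.1 != x.2]]].
have t10 al : (0 <= t1 al)%E.
  apply: sup_set_ge0; first by exists `|Df al 0|%:E; exists 0 => //; exact: cube0.
  by move=> _ [x _ <-]; rewrite lee_fin.
(* A point other than 0: the supremum over pairs is then nonnegative instead of [-oo], and each
   summand of the norm is bounded by the whole. *)
have c1 : cube m (const_mx 1 : 'cV[R]_m) by move=> j; rewrite mxE lexx ler01.
have t20 al : (0 <= t2 al)%E.
  apply: sup_set_ge0; last by move=> _ [x _ <-]; rewrite lee_fin divr_ge0// powR_ge0.
  eexists; exists (const_mx 1, 0); last by reflexivity.
  split => //=; first exact: cube0.
  by apply/eqP => /colP /(_ (Ordinal m0)); rewrite !mxE => /eqP; rewrite oner_eq0.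
have S10 : (0 <= S1)%E by apply: sume_ge0 => g _; exact: t10.
have S20 : (0 <= S2)%E by apply: sume_ge0 => g _; exact: t20.
move=> SK; have idxE (al : {ffun 'I_m -> nat}) : (mi_order al <= k)%N -> exists g : {ffun 'I_m -> 'I_k.+1}, mi_val g = al.
  move=> alk; have ek l : (al l < k.+1)%N.
    by rewrite ltnS (leq_trans _ alk)// /mi_order (bigD1 l)//= leq_addr.
  by exists [ffun l => Ordinal (ek l)]; apply/ffunP => l; rewrite !ffunE.
split.
  move=> al x alk xc; have [g gE] := idxE al alk.
  rewrite -lee_fin; apply: le_trans SK; apply: (@le_trans _ _ S1); last by rewrite leeDl.
  apply: (@le_trans _ _ (t1 al)); first by apply: ereal_sup_ubound; exists x.
  rewrite /S1 (bigD1 g)/=; last by rewrite gE (le_lt_trans _ kb)// ler_nat.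
  by rewrite gE leeDl//; apply: sume_ge0 => h _; exact: t10.
move=> al x y alk xc yc; have [<-|xy] := eqVneq x y.
  by rewrite !subrr normr0 mulr_ge0 ?powR_ge0// -lee_fin (le_trans _ SK)// adde_ge0.
have [g gE] := idxE al (eq_leq alk).
rewrite -ler_pdivrMr; last by rewrite powR_gt0// normr_gt0 subr_eq0.
rewrite -lee_fin; apply: le_trans SK; apply: (@le_trans _ _ S2); last by rewrite leeDr.
apply: (@le_trans _ _ (t2 al)); first by apply: ereal_sup_ubound; exists (x, y).
rewrite /S2 (bigD1 g)/=; last by rewrite gE alk.
by rewrite gE leeDl//; apply: sume_ge0 => h _; exact: t20.
Qed.

(* What the approximation argument uses of a Hoelder ball. *)
Definition local_approx m (k : nat) (C b : R) (g : 'cV[R]_m -> R) :=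
  (forall x y, cube m x -> cube m y -> `|g x - g y| <= C * `|x - y|) /\
  forall a, cube m a -> exists c : {ffun 'I_m -> 'I_k.+1} -> R,
    [/\ forall al, `|c al| <= C, forall al, (k < mi_order (mi_val al))%N -> c al = 0 &
      forall x, cube m x -> `|g x - \sum_al c al * \prod_l (x l 0 - a l 0) ^+ al l| <= C * `|x - a| `^ b].

Lemma holder_local_approx m (b K : R) : (0 < m)%N -> 1 <= b -> 0 <= K ->
  exists2 C, 1 <= C & forall g, holder_ball (cube m) b K g -> local_approx (hfloor b) C b g.
Proof.
move=> m0 b1 K0; have b0 : 0 < b by lra.
have /andP[kb bk] := hfloor_bounds b0; set k := hfloor b in kb bk *.
pose B := taylor_cst m k K k.
have B0 : 0 <= B by exact: taylor_cst_ge0.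
pose C := 1 + B + m%:R ^+ k * K + m%:R * K + K.
have mk0 : 0 <= m%:R ^+ k * K by rewrite mulr_ge0// exprn_ge0.
have mK0 : 0 <= m%:R * K by rewrite mulr_ge0.
have C1 : 1 <= C by rewrite /C; lra.
exists C => // g [Df [Df0 Dpart] /(holder_norm_bounds m0 b0)[DK Dtop]].
have zE : @mi_order m [ffun=> 0%N] = 0%N by apply: big1 => l _; rewrite ffunE.
split.
  move=> x y xc yc; have := Df0 x xc; have := Df0 y yc => <- <-.
  (* If [hfloor b = 0] then [b = 1], and the Hoelder seminorm is itself a Lipschitz constant.
     Otherwise the first derivatives are bounded and the staircase gives the bound [m K]. *)
  have [k0|k0] := posnP k.
    have := Dtop [ffun=> 0%N] x y; rewrite zE -/k k0 => /(_ erefl xc yc) h.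
    have b1E : b - 0 = 1 by rewrite k0 in bk; lra.
    by move: h; rewrite b1E powRr1// => h; apply: (le_trans h); rewrite ler_wpM2r// /C; lra.
  have -> : Df [ffun=> 0%N] x - Df [ffun=> 0%N] y = Df [ffun=> 0%N] x - Df [ffun=> 0%N] y - \sum_(j < m) 0.
    by rewrite big1 ?subr0.
  apply: (le_trans (@path_le _ (Df [ffun=> 0%N]) (fun i => Df (mi_incr [ffun=> 0%N] i))
    (fun _ _ => 0) (fun _ _ => 0) y x K yc xc _ _ _ _ _)) => //.
  - by move=> i z zc; apply: is_partial_on_pdiff; apply: Dpart => //; rewrite zE.
  - move=> i z zc _ eps eps0; exists 1 => // h _ _.
    by rewrite mulr0 !subr0 normr0 mulr_ge0// ltW.
  - by move=> i z zc _; rewrite subr0; apply: DK => //; rewrite mi_order_incr zE.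
  - by rewrite ler_wpM2r// /C; lra.
move=> a ac; have [|||||P [c [cB cj cE]] h] := @taylor m k a Df K (b - k%:R) ac _ K0 _ _ _ k [ffun=> 0%N].
- lra.
- by [].
- by move=> al alk; apply: DK.
- by move=> al x alk xc; apply: Dtop.
- by rewrite zE.
exists c; split => //.
  by move=> al; apply: (le_trans (cB al)); rewrite -/B /C; lra.
move=> x xc; rewrite -(Df0 x xc) -cE; apply: (le_trans (h x xc)).
have -> : `|x - a| ^+ k * `|x - a| `^ (b - k%:R) = `|x - a| `^ b.
  rewrite -powR_mulrn// -powRD; first by congr (_ `^ _); ring.
  by apply/implyP; rewrite (_ : _ + _ = b) ?(gt_eqF b0)//; ring.
by rewrite ler_wpM2r ?powR_ge0// /C; lra.
Qed.

(** The decoder has values in [[-K, K]], but hidden units are nonnegative; it is approximated after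
    this normalization to [[0, 1]], which the output layer undoes. *)
Lemma local_approx_affine m k (C b K : R) (g : 'cV[R]_m -> R) : 1 <= K -> 1 <= C ->
  local_approx k C b g -> local_approx k (C + K) b (fun x => (g x + K) / (2 * K)).
Proof.
move=> K1 C1 [gL gT]; have K0 : 0 < K by lra.
have iK : 0 <= (2 * K)^-1 <= 1.
  by rewrite invr_ge0 invf_le1; lra.
have shr (t : R) : 0 <= t -> t / (2 * K) <= t by move=> t0; rewrite ler_piMr//; lra.
split.
  move=> x y xc yc; rewrite -mulrBl normrM (ger0_norm (proj1 (andP iK))).
  apply: (le_trans (shr _ (normr_ge0 _))); rewrite (_ : _ + K - _ = g x - g y); last by ring.
  by apply: (le_trans (gL x y xc yc)); rewrite ler_wpM2r//; lra.
move=> a ac; have [c [cC cj cE]] := gT a ac.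
pose z : {ffun 'I_m -> 'I_k.+1} := [ffun=> ord0].
exists (fun al => (c al + (if al == z then K else 0)) / (2 * K)); split.
- move=> al; rewrite normrM [X in _ * X]ger0_norm; last by lra.
  apply: (le_trans (shr _ (normr_ge0 _))); apply: (le_trans (ler_normD _ _)).
  by rewrite lerD//; case: ifP => _; rewrite ?normr0 ?ger0_norm; lra.
- move=> al h; rewrite cj// add0r; case: eqP => [E|]; last by rewrite mul0r.
  move: h; rewrite E /mi_order big1// => l _; by rewrite !ffunE.
- move=> x xc; under eq_bigr do rewrite mulrAC.
  rewrite -mulr_suml; under eq_bigr do rewrite mulrDl.
  rewrite big_split/= (_ : \sum_i (if i == z then K else 0) * _ = K); last first.
    rewrite (bigD1 z)//= eqxx [X in _ * X]big1 ?mulr1 => [|l _]; last by rewrite ffunE expr0.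
    by rewrite big1 ?addr0// => l /negbTE ->; rewrite mul0r.
  rewrite -mulrBl normrM (ger0_norm (proj1 (andP iK))).
  apply: (le_trans (shr _ (normr_ge0 _))); rewrite opprD addrACA subrr addr0.
  by apply: (le_trans (cE x xc)); rewrite ler_wpM2r ?powR_ge0//; lra.
Qed.

End holder_taylor.

(** * Approximation of one stage *)

Section stage.
Context {R : realType}.

Lemma log2_lt_expn (q : nat) (y : R) : (2 ^ q)%:R < y -> q%:R < log2 y.
Proof.
move=> h; rewrite /log2 ltr_pdivlMr ?ln_gt0 ?ltr1n// mulr_natl -lnXn; last by [].
by rewrite ltr_ln ?posrE ?exprn_gt0//; [rewrite -natrX|apply: le_lt_trans h].
Qed.

(** By minimality [2 ^ q] is below twice [t + hfloor b], hence below [4 max (t, b)]. The strict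
    inequality matters: its gap, multiplied by [log2 n], pays for the bounded number of extra layers
    once [n] is large. *)
Lemma depth_log (t : nat) (b : R) : (0 < t)%N -> 1 <= b -> exists2 q : nat,
  (t + hfloor b <= 2 ^ q)%N & q%:R < log2 (4 * Num.max t%:R b).
Proof.
move=> t0 b1; have b0 : 0 < b by lra.
have /andP[kb _] := hfloor_bounds b0; set k := hfloor b in kb *.
set mx := Num.max _ _.
have tm : t%:R <= mx by rewrite le_max lexx.
have bm : b <= mx by rewrite le_max lexx orbT.
have ex : exists q, (t + k <= 2 ^ q)%N by exists (t + k)%N; apply/ltnW/ltn_expl.
exists (ex_minn ex); case: ex_minnP => q hq qmin //.
apply: log2_lt_expn; case: q hq qmin => [|q] hq qmin.
  have : 1 <= t%:R :> R by rewrite ler1n.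
  by rewrite expn0; lra.
have : (2 ^ q < t + k)%N by rewrite ltnNge; apply/negP => /qmin; rewrite ltnn.
rewrite -(ltr_nat R) natrD expnS natrM; lra.
Qed.

Lemma depends_nonempty m t (g : 'cV[R]_m -> R) : (0 < m)%N -> (0 < t)%N ->
  depends_on_at_most t g -> exists S : {set 'I_m}, [/\ (0 < #|S|)%N, (#|S| <= t)%N &
    forall x y : 'cV[R]_m, (forall i, i \in S -> x i 0 = y i 0) -> g x = g y].
Proof.
move=> m0 t0 [S St gS]; have [S0|S0] := posnP #|S|; last by exists S.
exists [set Ordinal m0]%SET; rewrite cards1; split => // x y _.
by apply: gS => i; rewrite (cards0_eq S0) inE.
Qed.

Lemma stage_approx (m t : nat) (b C : R) (q : nat) : (0 < m)%N -> (0 < t)%N -> 1 <= b -> 1 <= C ->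
  (t + hfloor b <= 2 ^ q)%N ->
  exists CB : nat, exists2 CE : R, 0 < CE & forall g : 'cV[R]_m -> R,
  depends_on_at_most t g -> local_approx (hfloor b) C b g -> (forall x, cube m x -> 0 <= g x) ->
  forall M mm, (0 < M)%N -> (M <= 2 ^ mm)%N -> exists h : 'cV[R]_m -> R,
  [/\ forall V (xs : V -> 'cV[R]_m), net (q * (mm + 3) + 9) (CB * M ^ t)
        [seq (fun v => xs v j 0) | j <- enum 'I_m] [:: fun v => h (xs v)],
      forall x, 0 <= h x,
      forall x y, `|h x - h y| <= CE * `|x - y| &
      forall x, cube m x -> `|h x - g x| <= CE * (M%:R `^ (- b) + (4 ^+ mm)^-1)].
Proof.
move=> m0 t0 b1 C1 tq; set k := hfloor b in tq *.
pose nC := (Num.truncn C).+1.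
have CnC : C <= nC%:R by rewrite ltW//; have /andP[] := truncn_itv (le_trans ler01 C1).
exists ((50 * m + 42 * 2 ^ q * k.+1 ^ m * nC.+1) * 2 ^ t + 3 * nC + 2)%N.
have [cq cq0 cqP] := @prodt_err_lip R q.
pose G : R := #|{ffun 'I_m -> 'I_k.+1}|%:R.
pose C2 := C * 2 `^ b.
have C20 : 0 <= C2 by rewrite mulr_ge0 ?powR_ge0//; lra.
have C00 : 0 <= C by lra.
pose Cl := 2 * 2 ^+ m * (G * (C * cq)) + 2 * 2 ^+ m * (G * (C * k%:R) + C2 * m%:R + C).
pose Ce := 2 ^+ m * (G * (C * 2 ^+ q)).
have G0 : 0 <= G by [].
have Cl0 : 0 <= Cl.
  by rewrite /Cl addr_ge0// mulr_ge0 ?mulr_ge0 ?addr_ge0 ?mulr_ge0 ?exprn_ge0.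
have Ce0 : 0 <= Ce by rewrite /Ce !mulr_ge0 ?exprn_ge0.
exists (1 + Cl + Ce + C2); first by lra.
move=> g /(depends_nonempty m0 t0)[S [S0 St gS]] [gL gT] g0 M mm M0 Mmm.
have MR : 0 < M%:R :> R by rewrite ltr0n.
have Sq : (#|S| + k <= 2 ^ q)%N by apply: leq_trans tq; rewrite leq_add2r.
pose al (l : {ffun 'I_m -> 'I_M.+1}) : 'cV[R]_m := \col_j (if j \in S then (l j).-1%:R / M%:R else 0).
have alc l : cube m (al l).
  move=> j; rewrite mxE; case: ifP => _; last by rewrite lexx ler01.
  rewrite divr_ge0//= ler_pdivrMr// mul1r ler_nat.
  by apply: leq_trans (leq_pred _) _; rewrite -ltnS.
have [c cP] := boolp.choice (fun l => gT (al l) (alc l)).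
have cC l a : `|c l a| <= C by have [h _ _] := cP l.
pose e := C * (2 / M%:R) `^ b.
have eE : e = C2 * M%:R `^ (- b).
  by rewrite /e powRM ?invr_ge0// /C2 -mulrA -(powR_inv1 (ltW MR)) -powRrM mulN1r.
have e0 : 0 <= e by rewrite mulr_ge0 ?powR_ge0.
(* Here [1 <= b] enters: the local error [M^(-b)] times the slope [M] of the hats stays bounded. *)
have eM : e * M%:R <= C2.
  rewrite eE -mulrA -[X in _ * (_ * X)](@powRr1 _ M%:R)// -powRD; last first.
    by apply/implyP => _; rewrite gt_eqF.
  rewrite ler_piMr// -[leRHS](powRr0 M%:R) ler_powR ?ler1n//; lra.
have gloc l x : l \in nodes S -> cube m x -> phi S l x != 0 -> `|locpoly S (c) l x - g x| <= e.
  move=> ln xc /prodf_neq0 hx.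
  (* As [g] depends on the coordinates in [S] only, the others may be set to zero, as they are in
     the centre [al l]; the distance to the centre is then at most [2 / M]. *)
  pose y : 'cV[R]_m := \col_j (if j \in S then x j 0 else 0).
  have yc : cube m y by move=> j; rewrite mxE; case: ifP => _; rewrite ?lexx ?ler01//; exact: xc.
  have -> : g x = g y by apply: gS => i iS; rewrite mxE iS.
  have yal j : wfac S l j x = y j 0 - al l j 0 /\ `|y j 0 - al l j 0| <= 2 / M%:R.
    rewrite /wfac !mxE; case: ifP => jS; last by rewrite subrr normr0 divr_ge0.
    have /andP[x0 _] := xc j; have /andP[h1 h2] := hat_supp M0 x0 (hx j jS).
    by rewrite relu_id// ger0_norm.
  have [_ c0 cE] := cP l.
  have -> : locpoly S c l x = \sum_a c l a * \prod_j (y j 0 - al l j 0) ^+ a j.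
    rewrite /locpoly [RHS](bigID (@lowdeg m k))/= [X in _ = _ + X]big1 ?addr0; last first.
      by move=> a; rewrite /lowdeg/= -ltnNge => /c0 ->; rewrite mul0r.
    apply: eq_bigr => a _; congr (_ * _); apply: eq_bigr => j _.
    by rewrite (proj1 (yal j)).
  rewrite distrC; apply: (le_trans (cE y yc)); rewrite ler_wpM2l//.
  have h2M : 0 <= 2 / M%:R :> R by rewrite divr_ge0.
  rewrite ge0_ler_powR ?nnegrE//; first by lra.
  by apply: mx_norm_le => // i j; rewrite (ord1 j) mxE [X in _ + X]mxE; exact: (proj2 (yal i)).
exists (fun x => relu (netpoly q mm S c (cvec x))); split.
- move=> V xs; apply: net_le (stage_net mm M0 S0 (lt_le_trans ltr01 C1) CnC Sq cC xs).
  have ME : (M.+1 ^ #|S| <= 2 ^ t * M ^ t)%N.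
    rewrite -expnMn; apply: (@leq_trans (M.+1 ^ t)); first by rewrite leq_pexp2l.
    by rewrite leq_exp2r// mul2n -addnn -addn1 leq_add2l.
  have M1 : (1 <= M ^ t)%N by rewrite expn_gt0 M0.
  move: ME M1; set X := (M.+1 ^ _)%N; set Y := (M ^ t)%N; set Z := (2 ^ t)%N.
  move: (50 * m + _)%N (3 * nC)%N => U W XY Y1; clear - XY Y1.
  rewrite !mulnDl -mulnA; apply: leq_add; last exact: leq_pmulr.
  by apply: leq_add; [rewrite leq_mul2l XY orbT|exact: leq_pmulr].
- by move=> x; exact: relu_ge0.
- move=> x y; apply: (le_trans (relu_lip _ _)).
  apply: (le_trans (netpoly_lip C00 C20 M0 Mmm Sq cC eM gL gloc cq0 cqP (cvec_cube x) (cvec_cube y))).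
  apply: (@le_trans _ _ (Cl * `|cvec x - cvec y|)) => //.
  by rewrite ler_pM// ?cvec_lip//; lra.
- move=> x xc; rewrite (cvec_id xc) -[X in _ - X]relu_id ?g0//.
  apply: (le_trans (relu_lip _ _)).
  apply: (le_trans (netpoly_err C00 mm Sq cC gloc xc)).
  have -> : 2 ^+ m * (#|{ffun 'I_m -> 'I_k.+1}|%:R * (C * (2 ^+ q / 4 ^+ mm))) = Ce * (4 ^+ mm)^-1.
    by rewrite /Ce /G; ring.
  have : 0 <= (4 ^+ mm)^-1 :> R by rewrite invr_ge0 exprn_ge0.
  have : 0 <= M%:R `^ (- b) :> R by rewrite powR_ge0.
  rewrite eE; move: ((4 ^+ mm)^-1) (M%:R `^ (- b)) => u v v0 u0; nra.
Qed.

End stage.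

(** * The encoder-decoder network *)

Section realization.
Context {R : realType}.

Lemma net_layers (V : Type) k B (hs gs : seq (V -> R)) : net k B hs gs ->
  exists lay : nat -> seq (V -> R),
  [/\ lay 0%N = hs, lay k = gs & forall i, (i < k)%N -> layer B (lay i) (lay i.+1)].
Proof.
elim: k gs => [|k IH] gs /=; first by move=> ->; exists (fun=> hs).
move=> [ms /IH[lay [l0 lk layP]] l]; exists (fun i => if (i <= k)%N then lay i else gs).
split; [by []|by rewrite ltnn|move=> i].
move=> ik1; have : (i == k) || (i < k)%N by rewrite -leq_eqVlt.
move=> /orP[/eqP ->|ik]; first by rewrite leqnn ltnn lk.
by rewrite ltnW// ik; exact: layP.
Qed.

Lemma norm0E m n (A : 'M[R]_(m, n)) : norm0 A = (\sum_(i < m) \sum_(j < n) (A i j != 0%R))%N.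
Proof.
rewrite /norm0 -sum1_card big_mkcond pair_bigA/=; apply: eq_bigr => ij _.
by rewrite inE; case: (_ != _).
Qed.

Lemma sum_trunc (V : nmodType) (a b : nat) (F : nat -> V) : (a <= b)%N ->
  \sum_(i < b) (if (i < a)%N then F i else 0) = \sum_(i < a) F i.
Proof. by move=> ab; rewrite (big_ord_widen b F ab) [RHS]big_mkcond. Qed.

Lemma leq_sum_trunc (a b : nat) (F : nat -> nat) : (a <= b)%N ->
  (\sum_(i < b) (if (i < a)%N then F i else 0) = \sum_(i < a) F i)%N.
Proof. by move=> ab; rewrite (big_ord_widen b F ab) [RHS]big_mkcond. Qed.

Lemma mx_norm_le1 m n (A : 'M[R]_(m, n)) : (forall i j, `|A i j| <= 1) -> `|A| <= 1.
Proof.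
by move=> h; apply: mx_norm_le.
Qed.

(** The layers occupy the leading blocks of matrices of the prescribed widths; the remaining entries
    are zero and do not count for the sparsity. *)
Lemma layers_network_class m n dt L L1 (p : nat -> nat) s (F : R)
    (lay : nat -> seq ('cV[R]_m -> R)) B (Wo : nat -> nat -> R) (f : 'cV[R]_m -> 'cV[R]_n) :
  m = p 0%N -> p L.+1 = n -> p L1 = dt -> (0 < L)%N ->
  lay 0%N = [seq (fun x : 'cV[R]_m => x j 0) | j <- enum 'I_m] ->
  (forall i, (i < L)%N -> layer B (lay i) (lay i.+1)) ->
  (forall i, (0 < i <= L)%N -> (size (lay i) <= p i)%N) ->
  (forall i j, `|Wo i j| <= 1) ->
  (forall x i, f x i 0 = \sum_(j < size (lay L)) Wo i j * nth (fun=> 0) (lay L) j x) ->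
  (L * B + n * size (lay L) <= s)%N ->
  (sup_norm f <= F%:E)%E ->
  network_class dt L L1 p s F f.
Proof.
move=> em en pL1 L0 lay0 layP lsize Wo1 fE cs fF.
have lsz0 : size (lay 0%N) = p 0%N by rewrite lay0 size_map size_enum_ord.
have lsz i : (i <= L)%N -> (size (lay i) <= p i)%N.
  by case: i => [|i] iL; [rewrite lsz0|apply: lsize; rewrite iL].
have /boolp.choice[W0 HW] : forall i, exists W : (nat -> nat -> R) * (nat -> R), (i < L)%N ->
   [/\ forall a b, `|W.1 a b| <= 1, forall a, `|W.2 a| <= 1,
    (\sum_(a < size (lay i.+1)) ((\sum_(b < size (lay i)) (W.1 a b != 0%R)) + 2) <= B)%N &
    forall a, (a < size (lay i.+1))%N -> forall x,
      nth (fun=> 0) (lay i.+1) a x = relu (\sum_(b < size (lay i)) W.1 a b * nth (fun=> 0) (lay i) b x - W.2 a)].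
  move=> i; have [iL|iL] := ltnP i L; last by exists ((fun _ _ => 0), (fun=> 0)).
  by have [W [v h]] := layP i iL; exists (W, v).
pose Wt i : 'M[R]_(p i.+1, p i) := \matrix_(a, b)
  if (b < size (lay i))%N then
    if (i < L)%N then (if (a < size (lay i.+1))%N then (W0 i).1 a b else 0) else Wo a b
  else 0.
(* [W0 i] leads from layer [i] to layer [i.+1], so the shift applied at layer [i] belongs to
   [W0 i.-1]; at [i = 0] the class requires it to vanish. *)
pose v i : 'cV[R]_(p i) := \col_a (if (0 < i <= L)%N && (a < size (lay i))%N then (W0 i.-1).2 a else 0).
have Wt1 i : `|Wt i| <= 1.
  apply: mx_norm_le1 => a b; rewrite mxE; case: ifP => _; last by rewrite normr0.
  case: ifP => [iL|_]; last exact: Wo1.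
  by case: ifP => _; rewrite ?normr0//; have [h _ _ _] := HW i iL; exact: h.
have v1 i : `|v i| <= 1.
  apply: mx_norm_le1 => a b; rewrite mxE; case: ifP => [/andP[/andP[i0 iL] _]|_]; last by rewrite normr0.
  by case: i i0 iL a => // i _ iL a; have [_ h _ _] := HW i iL; exact: h.
have evalE x k : (k <= L)%N -> forall (z : 'cV[R]_(p k)),
   (forall a : 'I_(p k), z a 0 = nth (fun=> 0) (lay k) a x) ->
   forall a : 'I_(p k.+1), (Wt k *m z) a 0 = \sum_(b < size (lay k))
     (if (k < L)%N then (if (a < size (lay k.+1))%N then (W0 k).1 a b else 0) else Wo a b)
     * nth (fun=> 0) (lay k) b x.
  move=> kL z zE a; rewrite mxE -(@sum_trunc _ _ (p k) (fun b => 
     (if (k < L)%N then (if (a < size (lay k.+1))%N then (W0 k).1 a b else 0) else Wo a b)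
     * nth (fun=> 0) (lay k) b x)) ?lsz//.
  apply: eq_bigr => b _; rewrite mxE zE; case: ifP => // _; by rewrite mul0r.
move: em en (em) (en) => _ _ em en.
move: (erefl m); rewrite {2}em => em'.
exists em, en, Wt, v; split.
  move=> x; set x0 := castmx _ x.
  have x0E (a : 'I_(p 0%N)) : x0 a 0 = nth (fun=> 0) (lay 0%N) a x.
    rewrite lay0 castmxE/= (nth_map (cast_ord (esym em) a)); last by rewrite size_enum_ord/= em.
    rewrite (_ : nth _ _ _ = cast_ord (esym em) a); first by congr (x _ _); exact: val_inj.
    by apply: val_inj; rewrite /= nth_enum_ord// em.
  have act k : (k <= L)%N -> exists z : 'cV[R]_(p k), net_eval Wt v x0 k = Wt k *m z /\
      forall a : 'I_(p k), z a 0 = nth (fun=> 0) (lay k) a x.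
    elim: k => [|k IH] kL; first by exists x0.
    have [z [zE zP]] := IH (ltnW kL).
    exists (shift_relu (v k.+1) (net_eval Wt v x0 k)); split => // a.
    rewrite mxE zE (evalE x k (ltnW kL) z zP) kL [v _ _ _]mxE kL/=.
    have [_ _ _ h] := HW k kL.
    have [al|al] := ltnP a (size (lay k.+1)); first by rewrite h.
    rewrite nth_default// big1; last by move=> b _; rewrite mul0r.
    by rewrite subr0 maxxx.
  have [z [-> zP]] := act L (leqnn L).
  apply/colP => i; rewrite castmxE/= fE (_ : cast_ord _ _ = 0); last by exact: val_inj.
  by rewrite (evalE x L (leqnn L) z zP) ltnn.
split => //.
- by apply/colP => a; rewrite !mxE.
- by move=> j _; rewrite ge_max Wt1 v1.
apply: leq_trans cs.
(* Pair [Wt i] with [v i.+1]: each such pair costs at most [B], and the output matrix [Wt L] is left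
   over. *)
rewrite big_split/= big_ord_recr/= [X in (_ + X)%N]big_ord_recl/=.
have -> : norm0 (v 0%N) = 0%N.
  by rewrite norm0E big1// => a _; rewrite big1// => b _; rewrite mxE/= eqxx.
rewrite add0n addnAC -big_split/=; apply: leq_add; last first.
  rewrite norm0E -en; apply: (@leq_trans (\sum_(a < p L.+1) size (lay L))%N); last first.
    by rewrite sum_nat_const card_ord.
  apply: leq_sum => a _.
  under eq_bigr => b _ do rewrite mxE ltnn.
  apply: (@leq_trans (\sum_(b < p L) (if (b < size (lay L))%N then (Wo a b != 0%R) : nat else 0)%N)).
    by apply: leq_sum => b _; case: ifP => // _; rewrite eqxx.
  rewrite (leq_sum_trunc (fun b => (Wo a b != 0%R) : nat) (lsz L (leqnn L))).
  apply: (@leq_trans (\sum_(b < size (lay L)) 1)%N).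
    by apply: leq_sum => b _; case: (_ != _).
  by rewrite sum_nat_const card_ord muln1.
apply: (@leq_trans (\sum_(i < L) B)%N); last by rewrite sum_nat_const card_ord.
apply: leq_sum => i _.
have [_ _ + _] := HW i (ltn_ord i); apply: leq_trans.
rewrite big_split/=; apply: leq_add.
  rewrite norm0E -(leq_sum_trunc (fun a => (\sum_(b < size (lay i)) ((W0 i).1 a b != 0%R))%N) (lsz i.+1 (ltn_ord i))).
  apply: leq_sum => a _; case: ifP => al; last first.
    by rewrite big1// => b _; rewrite mxE ltn_ord al if_same eqxx.
  rewrite -(leq_sum_trunc (fun b => ((W0 i).1 a b != 0%R) : nat) (lsz i (ltnW (ltn_ord i)))).
  by apply: leq_sum => b _; rewrite mxE ltn_ord al; case: ifP => //; rewrite eqxx.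
rewrite norm0E sum_nat_const card_ord mulnC.
apply: (@leq_trans (\sum_(a < p i.+1) (if (a < size (lay i.+1))%N then 1 else 0))%N).
  apply: leq_sum => a _; rewrite big_ord1 mxE ltn_ord/=; case: ifP => _; last by rewrite eqxx.
  by case: (_ != _).
rewrite (leq_sum_trunc (fun=> 1%N) (lsz i.+1 (ltn_ord i))) sum_nat_const card_ord muln1.
by rewrite leq_pmull.
Qed.

End realization.

Section readout.
Context {R : realType} {V : Type}.
Implicit Types (hs : seq (V -> R)) (f : V -> R).

Definition readout hs f := exists2 w : nat -> R, forall j, `|w j| <= 1 &
  forall x, f x = \sum_(j < size hs) w j * nth (fun=> 0) hs j x.

Lemma readout0 hs : readout hs (fun=> 0).
Proof.
exists (fun=> 0) => [j|x]; first by rewrite normr0.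
by rewrite big1// => j _; rewrite mul0r.
Qed.

Lemma readout_cat hs hs' f f' : readout hs f -> readout hs' f' ->
  readout (hs ++ hs') (fun x => f x + f' x).
Proof.
move=> [w w1 wE] [w' w1' wE'].
exists (fun j => if (j < size hs)%N then w j else w' (j - size hs)%N).
  by move=> j; case: ifP.
move=> x; rewrite wE wE' size_cat big_split_ord/=; congr (_ + _); apply: eq_bigr => j _.
  by rewrite nth_cat ltn_ord.
by rewrite nth_cat ltnNge leq_addr/= addKn.
Qed.

Lemma readout_nseq n (c : R) f : `|c| <= n%:R -> readout (nseq n f) (fun x => c * f x).
Proof.
move=> cn; exists (fun=> c / n%:R).
  move=> j; rewrite normrM normfV (ger0_norm (ler0n _ _)).
  by have [->|n0] := posnP n; [rewrite invr0 mulr0|rewrite ler_pdivrMr ?ltr0n// mul1r].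
move=> x; rewrite size_nseq; under eq_bigr => j _ do rewrite nth_nseq ltn_ord.
rewrite sumr_const card_ord -[RHS]mulr_natl mulrA; congr (_ * _).
have [n0|n0] := posnP n; last by field; rewrite pnatr_eq0 -lt0n.
by move: cn; rewrite n0 normr_le0 => /eqP ->; rewrite !mul0r.
Qed.

Lemma readout_flatten (T : eqType) (s : seq T) (h : T -> seq (V -> R)) t f :
  t \in s -> readout (h t) f -> readout (flatten (map h s)) f.
Proof.
elim: s => //= a s IH; rewrite inE => /orP[/eqP <- ft|ts ft].
  have := readout_cat ft (readout0 (flatten (map h s))).
  by under eq_fun do rewrite addr0.
have := readout_cat (readout0 (h a)) (IH ts ft).
by under eq_fun do rewrite add0r.
Qed.

(** Prepares the output [2 K clip - K] with weights at most one: enough copies of the clipped unit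
    for the factor and enough unit constants for the subtraction. *)
Lemma clip_net (I : finType) (y : I -> V -> R) (n2 nK : nat) :
  net 2 (6 * #|I| * n2.+1 + 2 * nK) [seq y i | i <- enum I]
    (flatten [seq nseq n2 (fun x => clip (y i x)) | i <- enum I] ++ nseq nK (fun=> 1)).
Proof.
exists (flatten [seq [:: (fun v => relu (y i v)); (fun v => relu (y i v - 1))] | i <- enum I]).
  apply: net1; apply: (@layer_le _ _ (6 * size (enum I))).
    by rewrite -cardE -mulnA; apply: leq_trans (leq_addr _ _); rewrite leq_mul2l leq_pmulr.
  apply: layer_flatten_same => i.
  have uj : unit_of (y i) [seq y i | i <- enum I] by apply: unit_of_map; rewrite mem_enum.
  apply: (@layer_cat _ _ 3 3 _ [:: _] [:: _]).
    have := @layer_unit _ _ _ _ 1 0 uj; rewrite normr1 normr0 => /(_ (lexx _) ler01).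
    by rewrite (_ : (fun x => _) = (fun v => relu (y i v)))//; apply/funext => v; rewrite mul1r subr0.
  have := @layer_unit _ _ _ _ 1 1 uj; rewrite normr1 => /(_ (lexx _) (lexx _)).
  by rewrite (_ : (fun x => _) = (fun v => relu (y i v - 1)))//; apply/funext => v; rewrite mul1r.
apply: (@layer_le _ _ ((4 * n2) * size (enum I) + 2 * nK)).
  by rewrite -cardE; move: #|I| => c; nia.
apply: layer_cat; last by apply: layer_nseq; apply: layer_cst; rewrite ler01 lexx.
apply: layer_flatten => i; apply: layer_nseq.
apply: (@layer1 _ _ _ (nth 0 [:: 1; - 1]) 0).
- by apply: seq_norm_le1; rewrite /= normrN !normr1 !lexx.
- by rewrite normr0.
- move=> v; rewrite big_ord_recl big_ord1/= subr0 mul1r mulN1r -/(clip _) relu_id//.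
  by case/andP: (clip01 (y i v)).
Qed.

Lemma clip_readout (I : finType) (y : I -> V -> R) (n2 nK : nat) (K : R) i :
  0 <= K -> 2 * K <= n2%:R -> K <= nK%:R ->
  readout (flatten [seq nseq n2 (fun x => clip (y i x)) | i <- enum I] ++ nseq nK (fun=> 1))
    (fun x => 2 * K * clip (y i x) - K).
Proof.
move=> K0 h2 hK.
have -> : (fun x => 2 * K * clip (y i x) - K) = (fun x => 2 * K * clip (y i x) + (- K) * (fun=> 1) x).
  by apply/funext => x; rewrite mulr1.
apply: readout_cat; last by apply: readout_nseq; rewrite normrN ger0_norm.
apply: (@readout_flatten I (enum I) (fun i => nseq n2 (fun x => clip (y i x))) i); first by rewrite mem_enum.
by apply: readout_nseq; rewrite ger0_norm// mulr_ge0.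
Qed.

Lemma net_map_ord n k c hs (g : 'I_n -> V -> R) : (0 < k)%N ->
  (forall j, net k c hs [:: g j]) -> net k (c * n) hs [seq g j | j <- enum 'I_n].
Proof.
case: k => // k _ hg; have := net_map (enum 'I_n) hg.
by rewrite size_enum_ord.
Qed.

End readout.

Section encoder_decoder_approximation.
Context {R : realType}.

Lemma up_log_log2 n : (0 < n)%N -> ((up_log 2 n)%:R <= log2 n%:R + 1 :> R).
Proof.
move=> n0; have [n1|n1] := leqP n 1.
  have -> : n = 1%N by lia.
  by rewrite /log2 ln1 mul0r add0r (_ : up_log 2 1 = 0%N)// ler01.
have := up_log_bounds (isT : (1 < 2)%N) n1; case: (up_log 2 n) => [|k] /=; first by rewrite expn0 [(n <= 1)%N]leqNgt n1 andbF.
move=> /andP[h _]; rewrite -natr1 lerD2r ltW//; apply: log2_lt_expn.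
by rewrite ltr_nat.
Qed.

(** The 11 is made of the 9 layers of a stage outside its product trees and the 2 of [clip_net]; the
    additive terms are absorbed by [(y - q) log2 n]. *)
Lemma depth_fits (q : nat) (y : R) : q%:R < y -> exists n0 : nat, forall n, (n0 <= n)%N ->
  (q * (up_log 2 n + 3) + 11)%:R <= y * log2 n%:R.
Proof.
move=> qy; pose z := (4 * q%:R + 11) / (y - q%:R).
pose e := (Num.truncn z).+1; exists (2 ^ e)%N => n en.
have ln20 : 0 < ln 2 :> R by rewrite ln_gt0// ltr1n.
have n0 : (0 < n)%N by apply: leq_trans en; rewrite expn_gt0.
have z0 : 0 <= z by rewrite divr_ge0//; lra.
have zn : z <= log2 n%:R.
  apply: (@le_trans _ _ e%:R); first by rewrite ltW//; have /andP[] := truncn_itv z0.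
  rewrite /log2 ler_pdivlMr// mulr_natl -lnXn// ler_ln ?posrE ?exprn_gt0 ?ltr0n//.
  by rewrite -natrX ler_nat.
have := up_log_log2 n0; set mm := (up_log 2 n)%:R; set l := log2 _ in zn * => ml.
have : 4 * q%:R + 11 <= l * (y - q%:R) by rewrite -ler_pdivrMr//; lra.
rewrite natrD natrM natrD -/mm.
have : q%:R * mm <= q%:R * (l + 1) by rewrite ler_wpM2l.
lra.
Qed.

Lemma holder_ball_bound m (b K : R) g x : (0 < m)%N -> 0 < b ->
  holder_ball (cube m) b K g -> cube m x -> `|g x| <= K.
Proof.
move=> m0 b0 [Df [Df0 _] /(holder_norm_bounds m0 b0)[DK _]] xc.
rewrite -(Df0 x xc); apply: DK => //.
by rewrite (_ : mi_order _ = 0%N)//; apply: big1 => l _; rewrite ffunE.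
Qed.

Lemma affine01 (K y : R) : 1 <= K -> `|y| <= K -> 0 <= (y + K) / (2 * K) <= 1.
Proof. by move=> K1; rewrite ler_norml => yK; rewrite divr_ge0 ?ler_pdivrMr; lra. Qed.

Lemma stage_errors (C0 C1 C2 a b c u v : R) : 0 < C0 -> 0 < C1 -> 0 < C2 ->
  0 <= a -> 0 <= b -> 0 <= c -> 0 <= u <= v ->
  C2 * (C1 * (C0 * (a + u)) + C1 * (b + u)) + C2 * (c + u) <=
  (C2 * C1 * C0 + C2 * C1 + C2) * 3 * (a + b + c + v).
Proof.
move=> C00 C10 C20 a0 b0 c0 uv.
have p1 : 0 < C2 * C1 * C0 by rewrite !mulr_gt0.
have p2 : 0 < C2 * C1 by rewrite mulr_gt0.
have ha : C2 * C1 * C0 * (a + u) <= C2 * C1 * C0 * (3 * (a + b + c + v)) by rewrite ler_wpM2l//; lra.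
have hb : C2 * C1 * (b + u) <= C2 * C1 * (3 * (a + b + c + v)) by rewrite ler_wpM2l//; lra.
have hc : C2 * (c + u) <= C2 * (3 * (a + b + c + v)) by rewrite ler_wpM2l//; lra.
lra.
Qed.

Lemma affine_clip_bound (K y : R) : 0 <= K -> `|2 * K * clip y - K| <= K.
Proof. by move=> K0; have := clip01 y; move: (clip _) => z z01; rewrite ler_norml; nra. Qed.

(* The components of all three stages run in parallel; the padding to depth L1
   makes the output of the encoder the layer L1. *)
Lemma encoder_decoder_network (d r dt D tdec tenc0 tenc1 : nat) (bdec benc0 benc1 K : R)
  (f0 : 'cV[R]_(r * d) -> 'cV[R]_d) (g0 : 'cV[R]_(r * d) -> 'cV[R]_D)
  (g1 : 'cV[R]_D -> 'cV[R]_dt) (fdec : 'cV[R]_dt -> 'cV[R]_d) :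
  (0 < d)%N -> (0 < r)%N -> 1 <= bdec -> 1 <= benc0 -> 1 <= benc1 -> 1 <= K ->
  encoder_decoder tdec tenc0 tenc1 bdec benc0 benc1 K f0 g0 g1 fdec ->
  exists CL, exists CE, exists CB, exists n0 : nat, [/\ 0 < CL, 0 < CE, (0 < CB)%N &
  forall n N' M0 M1 M2 L L1 p s (F Lip : R),
    [/\ (n0 <= n)%N, (0 < n)%N & (0 < N')%N] ->
    [/\ (0 < M0 <= n)%N, (0 < M1 <= n)%N & (0 < M2 <= n)%N] ->
    [/\ (M0 ^ tenc0 <= N')%N, (M1 ^ tenc1 <= N')%N & (M2 ^ tdec <= N')%N] ->
    (log2 (4 * Num.max tenc0%:R benc0) + log2 (4 * Num.max tenc1%:R benc1))
         * log2 n%:R <= (L1)%:R ->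
    L1%:R + log2 (4 * Num.max tdec%:R bdec) * log2 n%:R <= L%:R ->
    [/\ (r * d)%N = p 0%N, p L.+1 = d, p L1 = dt,
      forall i, (0 < i <= L)%N -> i != L1 -> (CB * N' <= p i)%N &
      ((L + d) * (CB * N') <= s)%N] ->
    K <= F -> CL <= Lip ->
    exists f, network_class_lip dt L L1 p s F Lip f /\
      forall x, cube (r * d) x -> `|f x - f0 x| <= CE *
        (M0%:R `^ (- benc0) + M1%:R `^ (- benc1) + M2%:R `^ (- bdec) + n%:R^-1)].
Proof.
move=> d0 r0 bd1 be01 be11 K1 [hdt ht0 ht1 ht2 f0E dep0 dep1 dep2 sm0 sm1 sm2 im0 im1].
have rd0 : (0 < r * d)%N by rewrite muln_gt0 r0.
have [t00 t10 t20] : [/\ (0 < tenc0)%N, (0 < tenc1)%N & (0 < tdec)%N] by split; lia.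
have [D0 dt0] : (0 < D)%N /\ (0 < dt)%N by split; lia.
have K0 : 0 <= K by lra.
have [Ch0 Ch01 lap0] := holder_local_approx rd0 be01 K0.
have [Ch1 Ch11 lap1] := holder_local_approx D0 be11 K0.
have [Ch2 Ch21 lap2] := holder_local_approx dt0 bd1 K0.
have [q0 q0t q0l] := depth_log t00 be01.
have [q1 q1t q1l] := depth_log t10 be11.
have [q2 q2t q2l] := depth_log t20 bd1.
have Ch2K : 1 <= Ch2 + K by lra.
have [CB0 [CE0 CE00 st0]] := stage_approx rd0 t00 be01 Ch01 q0t.
have [CB1 [CE1 CE10 st1]] := stage_approx D0 t10 be11 Ch11 q1t.
have [CB2 [CE2 CE20 st2]] := stage_approx dt0 t20 bd1 Ch2K q2t.
have [n00 dep_fit0] := depth_fits q0l.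
have [n01 dep_fit1] := depth_fits q1l.
have [n02 dep_fit2] := depth_fits q2l.
pose n2 := (Num.truncn (2 * K)).+1; pose nK := (Num.truncn K).+1.
have n2P : 2 * K <= n2%:R.
  have h : 0 <= 2 * K by rewrite mulr_ge0.
  by rewrite ltW//; have /andP[] := truncn_itv h.
have nKP : K <= nK%:R by rewrite ltW//; have /andP[] := truncn_itv K0.
pose CB := (CB0 * D + CB1 * dt + CB2 * d + 3 * dt + 6 * d * n2.+1 + 3 * nK)%N.
pose CL := 2 * K * (CE2 * (CE1 * CE0)).
pose CE := 2 * K * (CE2 * CE1 * CE0 + CE2 * CE1 + CE2) * 3.
have [cb0 cb1 cb2 cb3 cb4] : [/\ (CB0 * D <= CB)%N, (CB1 * dt <= CB)%N, (CB2 * d <= CB)%N,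
    (3 * dt <= CB)%N & (6 * d * n2.+1 + 3 * nK <= CB)%N].
  rewrite /CB; move: (CB0 * D)%N (CB1 * dt)%N (CB2 * d)%N (3 * dt)%N (6 * d * n2.+1)%N (3 * nK)%N => a b c e f g.
  by clear; split; lia.
have c10 : 0 < CE1 * CE0 by rewrite mulr_gt0.
have c210 : 0 < CE2 * (CE1 * CE0) by rewrite mulr_gt0.
have c21 : 0 < CE2 * CE1 by rewrite mulr_gt0.
have CEpos : 0 < CE.
  rewrite /CE -(mulrA (2 * K)) -(mulrA CE2); rewrite mulr_gt0 ?mulr_gt0 ?addr_gt0//; exact: lt_le_trans ltr01 K1.
exists CL, CE, CB, (n00 + n01 + n02)%N; split.
- by rewrite !mulr_gt0//; exact: lt_le_trans ltr01 K1.
- exact: CEpos.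
- by apply: leq_trans cb3; rewrite muln_gt0.
move=> n N' M0 M1 M2 L L1 p s F Lip [hn n0 N'0] [/andP[M00 M0n] /andP[M10 M1n] /andP[M20 M2n]]
  [MN0 MN1 MN2] hL1 hL [p0 pL pL1 hp hs] KF CLLip.
(* [2 ^ mm] is at least [n]: it dominates every grid size, and the multiplication error [4^-mm] is
   at most [1 / n]. *)
set mm := up_log 2 n.
have nmm : (n <= 2 ^ mm)%N by exact: up_logP.
have [h0 h0P] := boolp.choice (fun j => st0 _ (dep0 j) (lap0 _ (sm0 j))
   (fun x xc => proj1 (andP (im0 _ (imageP g0 xc) j))) M0 mm M00 (leq_trans M0n nmm)).
have [h1 h1P] := boolp.choice (fun j => st1 _ (dep1 j) (lap1 _ (sm1 j))
   (fun x xc => proj1 (andP (im1 _ (imageP g1 xc) j))) M1 mm M10 (leq_trans M1n nmm)).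
have fdecK j x : cube dt x -> `|fdec x j 0| <= K.
  by move=> xc; apply: (holder_ball_bound dt0 (lt_le_trans ltr01 bd1) (sm2 j) xc).
pose gd j (x : 'cV[R]_dt) := (fdec x j 0 + K) / (2 * K).
have gd01 j x : cube dt x -> 0 <= gd j x <= 1.
  by move=> /(fdecK j); exact: affine01.
have depd j : depends_on_at_most tdec (gd j).
  have [S St SP] := dep2 j; exists S => // x y /SP; by rewrite /gd => ->.
have [h2 h2P] := boolp.choice (fun j => st2 _ (depd j) (local_approx_affine K1 Ch21 (lap2 _ (sm2 j)))
   (fun x xc => proj1 (andP (gd01 j x xc))) M2 mm M20 (leq_trans M2n nmm)).
pose H0 (x : 'cV[R]_(r * d)) : 'cV[R]_D := \col_j h0 j x.
pose H1 (x : 'cV[R]_D) : 'cV[R]_dt := \col_j h1 j x.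
pose y j (x : 'cV[R]_(r * d)) := h2 j (H1 (H0 x)).
pose f (x : 'cV[R]_(r * d)) : 'cV[R]_d := \col_j (2 * K * clip (y j x) - K).
pose B := (CB * N')%N.
have B0 : (CB0 * M0 ^ tenc0 * D <= B)%N by rewrite mulnAC leq_mul.
have B1 : (CB1 * M1 ^ tenc1 * dt <= B)%N by rewrite mulnAC leq_mul.
have B2 : (CB2 * M2 ^ tdec * d <= B)%N by rewrite mulnAC leq_mul.
pose l0 : seq ('cV[R]_(r * d) -> R) := [seq (fun x : 'cV[R]_(r * d) => x j 0) | j <- enum 'I_(r * d)].
pose l1 : seq ('cV[R]_(r * d) -> R) := [seq (fun x => H1 (H0 x) j 0) | j <- enum 'I_dt].
pose l2 := flatten [seq nseq n2 (fun x => clip (y i x)) | i <- enum 'I_d] ++ nseq nK (fun=> 1).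
have [hn0 hn1 hn2] : [/\ (n00 <= n)%N, (n01 <= n)%N & (n02 <= n)%N].
  by clear - hn; split; lia.
have hLn : (L1 + (q2 * (mm + 3) + 11) <= L)%N.
  rewrite -(ler_nat R) natrD; apply: le_trans hL; rewrite lerD2l; exact: dep_fit2.
have N1 : net L1 B l0 l1.
  have a0 : net (q0 * (mm + 3) + 9) B l0 [seq (fun x => H0 x j 0) | j <- enum 'I_D].
    apply: (net_le B0).
    have -> : [seq (fun x => H0 x j 0) | j <- enum 'I_D] = [seq h0 j | j <- enum 'I_D].
      by apply: eq_map => j; apply/funext => x; rewrite mxE.
    by apply: net_map_ord => [|j]; [rewrite addn_gt0 orbT|have [hj _ _ _] := h0P j; exact: hj].
  have a1 : net (q1 * (mm + 3) + 9) B [seq (fun x => H0 x j 0) | j <- enum 'I_D] l1.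
    apply: (net_le B1).
    have -> : l1 = [seq (fun x => h1 j (H0 x)) | j <- enum 'I_dt].
      by apply: eq_map => j; apply/funext => x; rewrite mxE.
    by apply: net_map_ord => [|j]; [rewrite addn_gt0 orbT|have [hj _ _ _] := h1P j; exact: hj].
  apply: (net_pad _ _ _ (net_comp a0 a1)).
  - rewrite -(ler_nat R); apply: le_trans hL1; rewrite mulrDl natrD.
    apply: lerD; [apply: le_trans (dep_fit0 n hn0)|apply: le_trans (dep_fit1 n hn1)].
      by rewrite ler_nat leq_add2l.
    by rewrite ler_nat leq_add2l.
  - by rewrite size_map size_enum_ord; apply: leq_trans cb3 (leq_pmulr _ N'0).
  - move=> i x; have : all (fun h : 'cV[R]_(r * d) -> R => `[< 0 <= h x >]) l1.
      apply/allP => h' /mapP[j _ ->]; apply/asboolP; rewrite mxE.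
      by have [_ h _ _] := h1P j; exact: h.
    move=> /allP h; have [il|il] := ltnP i (size l1); last by rewrite nth_default.
    by apply/asboolP; apply: h; exact: mem_nth.
have N2 : net (L - L1) B l1 l2.
  have a2 : net (q2 * (mm + 3) + 9) B l1 [seq y j | j <- enum 'I_d].
    apply: (net_le B2).
    by apply: net_map_ord => [|j]; [rewrite addn_gt0 orbT|have [hj _ _ _] := h2P j; exact: (hj _ (fun x => H1 (H0 x)))].
  have a3 : net 2 B [seq y j | j <- enum 'I_d] l2.
    apply: net_le (clip_net y n2 nK); rewrite card_ord; apply: leq_trans (leq_pmulr _ N'0); apply: leq_trans cb4.
    by rewrite leq_add2l leq_mul2r orbT.
  apply: (net_pad _ _ _ (net_comp a2 a3)).
  - by clear - hLn; lia.
  - rewrite size_cat size_nseq size_flatten /shape -map_comp (eq_map (g := fun=> n2)); last first.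
      by move=> i /=; rewrite size_nseq.
    rewrite sumnE big_map big_enum/= sum_nat_const card_ord; apply: leq_trans (leq_pmulr _ N'0).
    apply: leq_trans cb4; rewrite mulnDr leq_add2r mulnA leq_mul// leq_mul2r orbT//.
  - move=> i x; have : all (fun h : 'cV[R]_(r * d) -> R => `[< 0 <= h x >]) l2.
      rewrite all_cat; apply/andP; split; last first.
        by apply/allP => _ /nseqP[-> _]; apply/asboolP; exact: ler01.
      apply/allP => h' /flattenP[_ /mapP[j _ ->] /nseqP[-> _]]; apply/asboolP.
      by case/andP: (clip01 (y j x)).
    move=> /allP h; have [il|il] := ltnP i (size l2); last by rewrite nth_default.
    by apply/asboolP; apply: h; exact: mem_nth.
have [la [la0 laL laP]] := net_layers N1; have [lb [lb0 lbL lbP]] := net_layers N2.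
pose lay i := if (i <= L1)%N then la i else lb (i - L1)%N.
have layP i : (i < L)%N -> layer B (lay i) (lay i.+1).
  move=> iL; rewrite /lay; have [iL1|iL1] := ltnP i L1; first by rewrite ltnW//; exact: laP.
  have -> : (if (i <= L1)%N then la i else lb (i - L1)%N) = lb (i - L1)%N.
    case: ifP => // iL1'; have -> : i = L1 by clear - iL1 iL1'; lia.
    by rewrite subnn lb0.
  by rewrite subSn//; apply: lbP; clear - iL iL1; lia.
have layL : lay L = l2.
  rewrite /lay; case: ifP => LL1; last by [].
  by move: LL1; rewrite leqNgt; case/negP; clear - hLn; lia.
have szl i : (0 < i <= L)%N -> (2 * size (lay i) <= B)%N.
  by case: i => // i iL; apply: layer_size (layP i iL).
have Lpos : (0 < L)%N by clear - hLn; lia.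
have /boolp.choice[w wP] : forall i : 'I_d, exists w : nat -> R, (forall j, `|w j| <= 1) /\
   forall x, f x i 0 = \sum_(j < size l2) w j * nth (fun=> 0) l2 j x.
  move=> i; have [w w1 wE] := clip_readout y i K0 n2P nKP; exists w; split => // x.
  by rewrite mxE wE.
pose Wo (i j : nat) : R := oapp (fun i' : 'I_d => w i' j) 0 (insub i).
have err x : cube (r * d) x -> forall j, `|f x j 0 - f0 x j 0| <= 2 * K *
   (CE2 * (CE1 * (CE0 * (M0%:R `^ (- benc0) + (4 ^+ mm)^-1)) + CE1 * (M1%:R `^ (- benc1) + (4 ^+ mm)^-1))
    + CE2 * (M2%:R `^ (- bdec) + (4 ^+ mm)^-1)).
  move=> xc j.
  have g0c : cube D (g0 x) by apply: im0; exists x.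
  have g1c : cube dt (g1 (g0 x)) by apply: im1; exists (g0 x).
  have i40 : 0 <= (4 ^+ mm)^-1 :> R by rewrite invr_ge0 exprn_ge0.
  have e0 : `|H0 x - g0 x| <= CE0 * (M0%:R `^ (- benc0) + (4 ^+ mm)^-1).
    apply: mx_norm_le => [|i u]; first by rewrite mulr_ge0 ?addr_ge0 ?powR_ge0// ltW.
    by rewrite (ord1 u) !mxE; have [_ _ _ h] := h0P i; exact: h.
  have e1 : `|H1 (H0 x) - g1 (g0 x)| <= CE1 * (CE0 * (M0%:R `^ (- benc0) + (4 ^+ mm)^-1)) + CE1 * (M1%:R `^ (- benc1) + (4 ^+ mm)^-1).
    apply: mx_norm_le => [|i u].
      by rewrite addr_ge0// !mulr_ge0 ?addr_ge0 ?powR_ge0// ltW.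
    rewrite (ord1 u) !mxE; have [_ _ hl he] := h1P i.
    rewrite (_ : _ - _ = (h1 i (H0 x) - h1 i (g0 x)) + (h1 i (g0 x) - g1 (g0 x) i 0)); last by ring.
    rewrite (le_trans (ler_normD _ _))// lerD ?he//.
    by apply: (le_trans (hl _ _)); rewrite ler_wpM2l// ltW.
  have e2 : `|y j x - gd j (g1 (g0 x))| <= CE2 * (CE1 * (CE0 * (M0%:R `^ (- benc0) + (4 ^+ mm)^-1)) + CE1 * (M1%:R `^ (- benc1) + (4 ^+ mm)^-1)) + CE2 * (M2%:R `^ (- bdec) + (4 ^+ mm)^-1).
    have [_ _ hl he] := h2P j; rewrite /y.
    rewrite (_ : _ - _ = (h2 j (H1 (H0 x)) - h2 j (g1 (g0 x))) + (h2 j (g1 (g0 x)) - gd j (g1 (g0 x)))); last by ring.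
    rewrite (le_trans (ler_normD _ _))// lerD ?he//.
    by apply: (le_trans (hl _ _)); rewrite ler_wpM2l// ltW.
  have -> : f x j 0 - f0 x j 0 = 2 * K * (clip (y j x) - clip (gd j (g1 (g0 x)))).
    rewrite mxE f0E /= (clip_id (gd01 j _ g1c)) /gd; field; clear - K1; lra.
  rewrite normrM (@ger0_norm _ (2 * K)); last by rewrite mulr_ge0.
  by rewrite ler_wpM2l ?mulr_ge0// (le_trans (clip_lip _ _)).
have flip x x' : `|f x - f x'| <= CL * `|x - x'|.
  have CL0 : 0 <= CL by rewrite /CL mulr_ge0 ?mulr_ge0// ltW.
  apply: mx_norm_le => [|j u]; first by rewrite mulr_ge0.
  rewrite (ord1 u) !mxE (_ : _ - _ = 2 * K * (clip (y j x) - clip (y j x'))); last by ring.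
  rewrite normrM (@ger0_norm _ (2 * K)); last by rewrite mulr_ge0.
  rewrite /CL -(mulrA (2 * K)) ler_wpM2l ?mulr_ge0//.
  apply: (le_trans (clip_lip _ _)); have [_ _ hl _] := h2P j; apply: (le_trans (hl _ _)).
  rewrite -mulrA; apply: ler_wpM2l; first exact: ltW.
  rewrite -mulrA.
  have n1 : `|H1 (H0 x) - H1 (H0 x')| <= CE1 * `|H0 x - H0 x'|.
    apply: mx_norm_le => [|i v]; first by rewrite mulr_ge0// ltW.
    by rewrite (ord1 v) !mxE; have [_ _ h _] := h1P i; exact: h.
  apply: (le_trans n1); apply: ler_wpM2l; first exact: ltW.
  apply: mx_norm_le => [|i v]; first by rewrite mulr_ge0// ltW.
  by rewrite (ord1 v) !mxE; have [_ _ h _] := h0P i; exact: h.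
exists f; split; last first.
  move=> x xc; apply: mx_norm_le => [|j u].
    by apply: mulr_ge0; [exact: ltW|rewrite !addr_ge0 ?powR_ge0 ?invr_ge0].
  rewrite (ord1 u) mxE [X in _ + X]mxE; apply: (le_trans (err x xc j)).
  have h4 : (4 ^+ mm)^-1 <= n%:R^-1 :> R.
    rewrite lef_pV2 ?posrE ?exprn_gt0 ?ltr0n// -natrX ler_nat (leq_trans nmm)//.
    by rewrite (_ : 4 = 2 ^ 2)%N// -expnM leq_exp2l// mul2n -addnn leq_addr.
  have i40 : 0 <= (4 ^+ mm)^-1 :> R by rewrite invr_ge0 exprn_ge0.
  rewrite /CE -!(mulrA (2 * K)); apply: ler_wpM2l; first by rewrite mulr_ge0.
  have u12 := introT andP (conj i40 h4).
  have := stage_errors CE00 CE10 CE20 (powR_ge0 M0%:R (- benc0)) (powR_ge0 M1%:R (- benc1)) (powR_ge0 M2%:R (- bdec)) u12.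
  by rewrite !mulrA => /le_trans; apply; rewrite le_eqVlt; apply/orP; left; apply/eqP; ring.
split; last first.
  apply: ge_ereal_sup => _ [[x x'] /= xx' <-]; rewrite lee_fin ler_pdivrMr ?normr_gt0 ?subr_eq0//.
  by apply: (le_trans (flip x x')); rewrite ler_wpM2r.
apply: (@layers_network_class _ _ _ _ _ _ _ _ _ lay B Wo) => //.
(* The bottleneck has no spare width: [p L1 = dt] is exactly the number of units of the padded
   encoder. *)
- move=> i iL; have [->|iL1] := eqVneq i L1.
    by rewrite /lay leqnn laL size_map size_enum_ord pL1.
  apply: leq_trans (hp i iL iL1); have := szl i iL; rewrite -/B; clear; lia.
- move=> i j; rewrite /Wo; case: insubP => [i' _ _|_] /=; last by rewrite normr0.
  by have [h _] := wP i'; exact: h.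
- by move=> x i; rewrite layL /Wo valK/=; have [_ h] := wP i; exact: h.
- apply: leq_trans hs; rewrite mulnDl leq_add2l leq_mul2l layL.
  by have := szl L; rewrite Lpos leqnn layL -/B => /(_ isT); clear; lia.
apply: ge_ereal_sup => _ [x _ <-]; rewrite lee_fin.
apply: mx_norm_le => [|j u]; first exact: le_trans KF.
rewrite (ord1 u) mxE; apply: le_trans KF; exact: affine_clip_bound.
Qed.

End encoder_decoder_approximation.

(** * Covering of the network class *)

Section covering.
Context {R : realType}.

(* A network of depth L whose layers have at most w active units, indexed by
   natural numbers; W k is the matrix of the layer k and b k its shift. *)
Fixpoint act (w : nat) (W : nat -> nat -> nat -> R) (b : nat -> nat -> R) (z : nat -> R)
    (k i : nat) : R :=
  if k is k'.+1 then relu (\sum_(j < w) W k' i j * act w W b z k' j - b k'.+1 i) else z i.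

(** With parameters in [[-1, 1]] a layer multiplies the bound on the activations by at most [w + 1].
    The perturbation obeys the same recursion with a source term of that size, whence the additional
    factor [k]. *)
Lemma act_perturb w W W' b b' (z : nat -> R) (de : R) L :
  (forall i, `|z i| <= 1) -> 0 <= de ->
  (forall k i j, (k <= L)%N -> `|W k i j| <= 1 /\ `|W' k i j| <= 1) ->
  (forall k i, (k <= L)%N -> `|b k i| <= 1 /\ `|b' k i| <= 1) ->
  (forall k i j, (k <= L)%N -> `|W k i j - W' k i j| <= de) ->
  (forall k i, (k <= L)%N -> `|b k i - b' k i| <= de) ->
  forall k, (k <= L)%N -> forall i, `|act w W b z k i| <= w.+1%:R ^+ k /\
    `|act w W b z k i - act w W' b' z k i| <= de * (k%:R * w.+1%:R ^+ k).
Proof.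
move=> z1 de0 W1 b1 dW db; elim=> [|k IH] kL i.
  by rewrite expr0 subrr normr0 mul0r mulr0.
have {}IH := IH (ltnW kL); set c : R := w.+1%:R in IH *.
have ck1 : 1 <= c ^+ k by rewrite exprn_ege1// ler1n.
have ck0 : 0 <= c ^+ k by apply: le_trans ck1.
have sumle (F : 'I_w -> R) B : (forall j, `|F j| <= B) -> `|\sum_j F j| <= w%:R * B.
  move=> FB; rewrite (le_trans (ler_norm_sum _ _ _))//.
  apply: (@le_trans _ _ (\sum_(j < w) B)); first by apply: ler_sum.
  by rewrite sumr_const card_ord -[leLHS]mulr_natl.
have cE : w%:R = c - 1 by rewrite /c -natr1 addrK.
split.
  rewrite /=; have rn (y : R) : `|relu y| <= `|y|.
    by have := relu_lip y 0; rewrite subr0 [relu 0]relu_0// subr0.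
  apply: (le_trans (rn _)).
  have [_ ] := W1 k 0%N 0%N (ltnW kL) => _; have [bk _] := b1 k.+1 i kL.
  apply: (le_trans (ler_normB _ _)); rewrite (_ : c ^+ k.+1 = w%:R * c ^+ k + c ^+ k); last by rewrite exprS cE; ring.
  rewrite lerD//; last exact: le_trans bk ck1.
  apply: sumle => j; rewrite normrM -[leRHS]mul1r ler_pM//; first by have [] := W1 k i j (ltnW kL).
  by have [] := IH j.
rewrite /= (le_trans (relu_lip _ _))//.
set s1 := \sum_j _; set s2 := \sum_j _.
rewrite (_ : _ - _ - _ = (s1 - s2) - (b k.+1 i - b' k.+1 i)); last by ring.
apply: (le_trans (ler_normB _ _)).
apply: (@le_trans _ _ (w%:R * (de * c ^+ k + de * (k%:R * c ^+ k)) + de)); last first.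
  rewrite exprS cE -natr1 -subr_ge0.
  rewrite (_ : _ - _ = de * ((k%:R + 1) * c ^+ k - 1)); last by ring.
  rewrite mulr_ge0// subr_ge0 -[leLHS]mul1r ler_pM// -[leLHS]add0r lerD//.
apply: lerD; last exact: db.
rewrite /s1 /s2 -sumrB; apply: sumle => j.
rewrite (_ : _ - _ = (W k i j - W' k i j) * act w W b z k j +
   W' k i j * (act w W b z k j - act w W' b' z k j)); last by ring.
have [h1 h2] := IH j; apply: (le_trans (ler_normD _ _)); rewrite !normrM lerD//.
  by rewrite ler_pM//; apply: dW; exact: ltnW.
by rewrite -[leRHS]mul1r ler_pM//; have [] := W1 k i j (ltnW kL).
Qed.

Definition out w (W : nat -> nat -> nat -> R) b (z : nat -> R) L i : R := \sum_(j < w) W L i j * act w W b z L j.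

Lemma out_perturb w W W' b b' (z : nat -> R) (de : R) L i :
  (forall i, `|z i| <= 1) -> 0 <= de ->
  (forall k i j, (k <= L)%N -> `|W k i j| <= 1 /\ `|W' k i j| <= 1) ->
  (forall k i, (k <= L)%N -> `|b k i| <= 1 /\ `|b' k i| <= 1) ->
  (forall k i j, (k <= L)%N -> `|W k i j - W' k i j| <= de) ->
  (forall k i, (k <= L)%N -> `|b k i - b' k i| <= de) ->
  `|out w W b z L i - out w W' b' z L i| <= de * (L.+1%:R * w.+1%:R ^+ L.+1).
Proof.
move=> z1 de0 W1 b1 dW db.
have h := act_perturb w z1 de0 W1 b1 dW db (leqnn L).
set c : R := w.+1%:R in h *.
have c1 : 0 <= c ^+ L by rewrite exprn_ge0.
rewrite /out -sumrB (le_trans (ler_norm_sum _ _ _))//.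
apply: (@le_trans _ _ (\sum_(j < w) (de * c ^+ L + de * (L%:R * c ^+ L)))).
  apply: ler_sum => j _.
  rewrite (_ : _ - _ = (W L i j - W' L i j) * act w W b z L j +
     W' L i j * (act w W b z L j - act w W' b' z L j)); last by ring.
  have [h1 h2] := h j; apply: (le_trans (ler_normD _ _)); rewrite !normrM lerD//.
    by rewrite ler_pM//; apply: dW.
  by rewrite -[leRHS]mul1r ler_pM//; have [] := W1 L i j (leqnn L).
rewrite sumr_const card_ord -[leLHS]mulr_natl -natr1 exprS.
rewrite (_ : _ * (_ + _) = de * ((L%:R + 1) * (w%:R * c ^+ L))); last by ring.
rewrite ler_wpM2l// ler_wpM2l ?addr_ge0// ler_wpM2r// /c ler_nat; exact: leqnSn.
Qed.

(* Only the hidden units with a nonzero outgoing weight matter, and there are at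
   most s of these in every layer, whatever the widths p are. *)
Lemma network_reduction m n dt L L1 (p : nat -> nat) s (F : R) f :
  network_class dt L L1 p s F f -> exists W : nat -> nat -> nat -> R, exists b : nat -> nat -> R,
  [/\ forall k i j, (k <= L)%N -> `|W k i j| <= 1,
      forall k i, (k <= L)%N -> `|b k i| <= 1,
      (\sum_(k < L.+1) (\sum_(i < s + m + n) \sum_(j < s + m + n) (W k i j != 0%R) +
        \sum_(i < s + m + n) (b k i != 0%R)) <= s)%N &
      forall (x : 'cV[R]_m) (i : 'I_n), f x i 0 =
        out (s + m + n) W b (fun j => oapp (fun j' : 'I_m => x j' 0) 0 (insub j)) L i].
Proof.
move=> [em [en [Wt [v [fE [v0 le1 _ cs _]]]]]].
set w := (s + m + n)%N.
pose V k i j : R := if @insub _ (fun i => i < p k.+1)%N 'I_(p k.+1) i is Some i' then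
  (if @insub _ (fun i => i < p k)%N 'I_(p k) j is Some j' then Wt k i' j' else 0) else 0.
pose vv k i : R := if @insub _ (fun i => i < p k)%N 'I_(p k) i is Some i' then v k i' 0 else 0.
(* The units that are kept, in increasing order. Input and output layers are kept completely, so
   that their numbering does not change. *)
pose U k := [seq j <- iota 0 (p k) | (k == 0%N) || (k == L.+1) || has (fun i => V k i j != 0) (iota 0 (p k.+1))].
pose W k i j : R := if (i < size (U k.+1))%N && (j < size (U k))%N then V k (nth 0%N (U k.+1) i) (nth 0%N (U k) j) else 0.
pose b k i : R := if (i < size (U k))%N then vv k (nth 0%N (U k) i) else 0.
have VE k (i : 'I_(p k.+1)) (j : 'I_(p k)) : V k i j = Wt k i j by rewrite /V !valK.
have vE k (i : 'I_(p k)) : vv k i = v k i 0 by rewrite /vv valK.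
have V1 k i j : (k <= L)%N -> `|V k i j| <= 1.
  move=> kL; rewrite /V; case: insubP => [i' _ _|_]; rewrite ?normr0//.
  case: insubP => [j' _ _|_]; rewrite ?normr0//.
  apply: le_trans (mx_entry_le _ _ _) _; apply: le_trans (le1 k kL); by rewrite le_max lexx.
have v1 k i : (k <= L)%N -> `|vv k i| <= 1.
  move=> kL; rewrite /vv; case: insubP => [i' _ _|_]; rewrite ?normr0//.
  apply: le_trans (mx_entry_le _ _ _) _; apply: le_trans (le1 k kL); by rewrite le_max lexx orbT.
have sumU k (G : nat -> nat) : (\sum_(i < size (U k)) G (nth 0%N (U k) i) <= \sum_(i < p k) G i)%N.
  rewrite -(big_mkord xpredT (fun i => G (nth 0%N (U k) i))) -(big_nth 0%N xpredT) big_filter.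
  by rewrite -(big_mkord xpredT) /index_iota subn0 [leqRHS](bigID (fun j => (k == 0%N) || (k == L.+1) || has (fun i => V k i j != 0) (iota 0 (p k.+1))))/= leq_addr.
have n0E k : norm0 (Wt k) = (\sum_(i < p k.+1) \sum_(j < p k) (V k i j != 0%R))%N.
  by rewrite norm0E; apply: eq_bigr => i _; apply: eq_bigr => j _; rewrite VE.
have n0v k : norm0 (v k) = (\sum_(i < p k) (vv k i != 0%R))%N.
  by rewrite norm0E; apply: eq_bigr => i _; rewrite big_ord1 vE.
have sW k : (k <= L)%N -> (norm0 (Wt k) <= s)%N.
  move=> kL; apply: leq_trans cs; rewrite (bigD1 (Ordinal (kL : (k < L.+1)%N)))//=.
  by rewrite -addnA leq_addr.
have sizeU k : (k <= L.+1)%N -> (size (U k) <= w)%N.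
  have [->|k0] := eqVneq k 0%N.
    move=> _; apply: leq_trans (_ : m <= w)%N; last by rewrite /w -addnA addnCA leq_addr.
    by rewrite size_filter (leq_trans (count_size _ _))// size_iota -em.
  have [->|kL1] := eqVneq k L.+1.
    move=> _; apply: leq_trans (_ : n <= w)%N; last by rewrite leq_addl.
    by rewrite size_filter (leq_trans (count_size _ _))// size_iota en.
  rewrite leq_eqVlt (negbTE kL1)/= ltnS => kL.
  apply: leq_trans (_ : s <= w)%N; last by rewrite /w -addnA leq_addr.
  apply: leq_trans (sW k kL); rewrite n0E exchange_big/=.
  rewrite /U (negbTE k0) (negbTE kL1)/= size_filter -sum1_count big_mkcond/=.
  rewrite (_ : iota 0 (p k) = index_iota 0 (p k)) ?big_mkord; last by rewrite /index_iota subn0.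
  apply: leq_sum => j _; case: ifP => // /hasP[i]; rewrite mem_iota/= add0n => ip Vi.
  by rewrite (bigD1 (Ordinal ip))//= Vi.
exists W, b; split.
- by move=> k i j kL; rewrite /W; case: ifP => _; rewrite ?normr0// V1.
- by move=> k i kL; rewrite /b; case: ifP => _; rewrite ?normr0// v1.
- apply: leq_trans cs; apply: leq_sum => k _; rewrite n0E n0v leq_add//.
    apply: (@leq_trans (\sum_(i < size (U k.+1)) \sum_(j < size (U k)) (V k (nth 0%N (U k.+1) i) (nth 0%N (U k) j) != 0%R))%N).
      rewrite -(leq_sum_trunc (fun i => \sum_(j < size (U k)) (V k (nth 0%N (U k.+1) i) (nth 0%N (U k) j) != 0%R))%N (sizeU k.+1 (ltn_ord k))).
      apply: leq_sum => i _; case: ifP => iU; last by rewrite big1// => j _; rewrite /W iU eqxx.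
      rewrite -(leq_sum_trunc (fun j => (V k (nth 0%N (U k.+1) i) (nth 0%N (U k) j) != 0%R) : nat) (sizeU k (ltnW (ltn_ord k)))).
      by apply: leq_sum => j _; rewrite /W iU/=; case: ifP => //; rewrite eqxx.
    apply: leq_trans (sumU k.+1 (fun i => \sum_(j < p k) (V k i j != 0%R))%N).
    by apply: leq_sum => i _; apply: (sumU k (fun j => (V k (nth 0%N (U k.+1) i) j != 0%R) : nat)).
  apply: leq_trans (sumU k (fun i => (vv k i != 0%R) : nat)).
  rewrite -(leq_sum_trunc (fun i => (vv k (nth 0%N (U k) i) != 0%R) : nat) (sizeU k (ltnW (ltn_ord k)))).
  by apply: leq_sum => i _; rewrite /b; case: ifP => //; rewrite eqxx.
move=> x i; set z := fun j => _; set x0 := castmx (em, erefl) x.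

have sumUR k (G H : nat -> R) i0 a0 : (k <= L)%N -> (i0 < p k.+1)%N ->
   (a0 < size (U k.+1))%N -> nth 0%N (U k.+1) a0 = i0 ->
   (forall a, (a < size (U k))%N -> H a = G (nth 0%N (U k) a)) ->
   \sum_(j < p k) V k i0 j * G j = \sum_(j < w) W k a0 j * H j.
  move=> kL i0p a0U a0E HG.
  have -> : \sum_(j < p k) V k i0 j * G j = \sum_(j <- U k) V k i0 j * G j.
    rewrite big_filter [RHS]big_mkcond -(big_mkord xpredT (fun j => V k i0 j * G j)) /index_iota subn0.
    apply: eq_bigr => j _; case: ifP => // /negbT; rewrite !negb_or => /andP[_ /hasPn h].
    have : i0 \in iota 0 (p k.+1) by rewrite mem_iota.
    by move=> /h; rewrite negbK => /eqP ->; rewrite mul0r.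
  rewrite (big_nth 0%N) big_mkord.
  rewrite -(sum_trunc (fun j => V k i0 (nth 0%N (U k) j) * G (nth 0%N (U k) j)) (sizeU k (leqW kL))).
  apply: eq_bigr => j _; rewrite /W a0U a0E /=; case: ifP => jU; last by rewrite mul0r.
  by rewrite HG.
have U_lt k a : (a < size (U k))%N -> (nth 0%N (U k) a < p k)%N.
  by move=> /(mem_nth 0%N); rewrite mem_filter mem_iota/= add0n => /andP[].
have actE k : (k <= L)%N -> exists G : nat -> R, exists u : 'cV[R]_(p k),
   [/\ net_eval Wt v x0 k = Wt k *m u, forall j : 'I_(p k), u j 0 = G j &
     forall a, (a < size (U k))%N -> act w W b z k a = G (nth 0%N (U k) a)].
  elim: k => [|k IH] kL.
    exists z, x0; split => //.
      move=> j; rewrite castmxE/= /z.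
      have jm : (j < m)%N by apply: leq_trans (ltn_ord j) _; rewrite em.
      rewrite (insubT (fun i => (i < m)%N) jm) /=; congr (x _ _); exact: val_inj.
    move=> a aU; congr z; rewrite /U eqxx /= filter_predT nth_iota//.
    by move: aU; rewrite /U eqxx/= filter_predT size_iota.
  have [G [u [uE uG aG]]] := IH (ltnW kL).
  exists (fun i => relu (\sum_(j < p k) V k i j * G j - vv k.+1 i)),
     (shift_relu (v k.+1) (net_eval Wt v x0 k)); split => //.
    move=> j; rewrite mxE uE mxE vE; congr (relu (_ - _)); apply: eq_bigr => l _.
    by rewrite VE uG.
  move=> a aU; rewrite /= (sumUR k G _ _ a (ltnW kL) (U_lt _ _ aU) aU erefl aG).
  by rewrite /b aU.
have [G [u [uE uG aG]]] := actE L (leqnn L).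
have UL : U L.+1 = iota 0 (p L.+1) by rewrite /U eqxx orbT /= filter_predT.
have ip : (i < p L.+1)%N by rewrite en.
rewrite fE -/x0 uE castmxE/= mxE /out.
rewrite -(sumUR L G _ i i (leqnn L) ip _ _ aG); last 2 first.
- by rewrite UL size_iota.
- by rewrite UL nth_iota.
apply: eq_bigr => j _; rewrite [X in u _ X](_ : _ = 0) ?uG -?VE//.
exact: val_inj.
Qed.

Definition quant (Q : nat) (t : R) : 'I_(2 * Q).+1 := inord (Num.truncn ((t + 1) * Q%:R)).

Lemma quant_close Q (t t' : R) : (0 < Q)%N -> `|t| <= 1 -> `|t'| <= 1 ->
  quant Q t = quant Q t' -> `|t - t'| <= Q%:R^-1.
Proof.
move=> Q0 t1 t1' /(congr1 val); have Q0' : 0 < Q%:R :> R by rewrite ltr0n.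
have tr (y : R) : `|y| <= 1 -> 0 <= (y + 1) * Q%:R /\ (Num.truncn ((y + 1) * Q%:R) < (2 * Q).+1)%N.
  rewrite ler_norml => /andP[y1 y2].
  have h : 0 <= (y + 1) * Q%:R by rewrite mulr_ge0//; lra.
  split => //; rewrite ltnS -(ler_nat R); have /andP[h1 _] := truncn_itv h; apply: (le_trans h1).
  by rewrite natrM ler_wpM2r//; lra.
have [h1 h2] := tr t t1; have [h1' h2'] := tr t' t1'.
rewrite /quant /= !inordK// => E.
have /andP[a1 a2] := truncn_itv h1; have /andP[a1' a2'] := truncn_itv h1'.
move: a1 a2 a1' a2'; rewrite E; move: (Num.truncn _) => k; rewrite -natr1 => a1 a2 a1' a2'.
rewrite -(ler_pM2r Q0') mulVf ?gt_eqF// -{1}(ger0_norm (ltW Q0')) -normrM.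
by rewrite ler_norml; lra.
Qed.

(** Networks are encoded by the positions and rounded values of their nonzero parameters; equal
    codes imply closeness on the cube. One centre is chosen inside [C] for every code that occurs,
    so the centres inherit the sup and Lipschitz bounds of the class. *)
Lemma network_cover m n dt L L1 (p : nat -> nat) s (F : R) (N : nat)
    (C : set ('cV[R]_m -> 'cV[R]_n)) : (0 < N)%N ->
  C `<=` network_class dt L L1 p s F ->
  let w := (s + m + n)%N in let Q := (N * (L.+1 * w.+1 ^ L.+1))%N in
  exists I : finType, exists G : I -> 'cV[R]_m -> 'cV[R]_n,
  [/\ forall i, C (G i),
     forall f, C f -> exists i, forall x, cube m x -> `|f x - G i x| <= N%:R^-1 &
     (#|I| <= ((L.+1 * w * w.+1 * (2 * Q).+1).+1) ^ s)%N].
Proof.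
move=> N0 Csub w Q.
have Q0 : (0 < Q)%N by rewrite !muln_gt0 N0/= expn_gt0.
pose pos := ('I_L.+1 * 'I_w * 'I_w.+1)%type.
(* The extra column index [w] stands for the shift. *)
pose ent (Wb : (nat -> nat -> nat -> R) * (nat -> nat -> R)) (q : pos) : R :=
  if (q.2 < w)%N then Wb.1 q.1.1 q.1.2 q.2 else Wb.2 q.1.1 q.1.2.
pose cs Wb := [seq (q, quant Q (ent Wb q)) | q <- enum [pred q | ent Wb q != 0]].
pose code Wb : {ffun 'I_s -> option (pos * 'I_(2 * Q).+1)} :=
  [ffun i : 'I_s => nth None (map some (cs Wb)) i].
pose params (f : 'cV[R]_m -> 'cV[R]_n) Wb := [/\ forall k i j, (k <= L)%N -> `|Wb.1 k i j| <= 1,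
      forall k i, (k <= L)%N -> `|Wb.2 k i| <= 1,
      (size (cs Wb) <= s)%N &
      forall (x : 'cV[R]_m) (i : 'I_n), f x i 0 =
        out w Wb.1 Wb.2 (fun j => oapp (fun j' : 'I_m => x j' 0) 0 (insub j)) L i].
have paramsP f : C f -> exists Wb, params f Wb.
  move=> /Csub/network_reduction[W [b [W1 b1 cWb fE]]]; exists (W, b); split => //.
  apply: leq_trans cWb; rewrite size_map -cardE -sum1_card big_mkcond/=.
  rewrite (eq_bigr (fun q : pos => (ent (W, b) q != 0%R) : nat)); last first.
    by move=> q _; rewrite inE; case: (_ != _).
  rewrite -(pair_bigA _ (fun ki j => (ent (W, b) (ki, j) != 0%R) : nat))/=.
  rewrite -(pair_bigA _ (fun k i => \sum_j (ent (W, b) (k, i, j) != 0%R))%N)/=.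
  apply: leq_sum => k _; rewrite -big_split/=; apply: leq_sum => i _.
  rewrite big_ord_recr/= {2}/ent/= ltnn leq_add2r; apply: leq_sum => j _.
  by rewrite /ent /= ltn_ord.
have code_close f f' Wb Wb' : params f Wb -> params f' Wb' -> code Wb = code Wb' ->
    forall x, cube m x -> `|f x - f' x| <= N%:R^-1.
  move=> [W1 b1 szc fE] [W1' b1' szc' fE'] /ffunP codeE x xc.
  have half U U' q : (size (cs U) <= s)%N -> (forall i, code U i = code U' i) -> ent U q != 0 ->
      ent U' q != 0 /\ quant Q (ent U q) = quant Q (ent U' q).
    move=> szU cE Uq; have inU : (q, quant Q (ent U q)) \in cs U.
      by apply/mapP; exists q; rewrite // mem_enum inE.
    have isz : (index (q, quant Q (ent U q)) (cs U) < s)%N by apply: leq_trans szU; rewrite index_mem.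
    have := cE (Ordinal isz); rewrite !ffunE /= (nth_map (q, quant Q (ent U q))) ?index_mem// nth_index//.
    have [il|il] := ltnP (index (q, quant Q (ent U q)) (cs U)) (size (cs U')); last first.
      have -> : nth None (map some (cs U')) (index (q, quant Q (ent U q)) (cs U)) = None.
        by apply: nth_default; rewrite size_map.
      by [].
    rewrite (nth_map (q, quant Q (ent U q)))// => -[E].
    have : nth (q, quant Q (ent U q)) (cs U') (index (q, quant Q (ent U q)) (cs U)) \in cs U' by exact: mem_nth.
    by rewrite -E => /mapP[q']; rewrite mem_enum inE => h [-> ->].
  have close (q : pos) : (q.1.1 <= L)%N -> `|ent Wb q - ent Wb' q| <= Q%:R^-1.
    move=> qL; have [e0|e0] := eqVneq (ent Wb q) 0.
      have [e0'|e0'] := eqVneq (ent Wb' q) 0; first by rewrite e0 e0' subrr normr0 invr_ge0.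
      have := half Wb' Wb q szc' (fun i => esym (codeE i)) e0'; by rewrite e0 eqxx => -[].
    have [_ qE] := half Wb Wb' q szc codeE e0.
    apply: quant_close qE => //; rewrite /ent; case: ifP => _; by [apply: W1|apply: b1|apply: W1'|apply: b1'].
  have QR : Q%:R^-1 * (L.+1%:R * w.+1%:R ^+ L.+1) = N%:R^-1 :> R.
    rewrite /Q natrM natrM natrX; set y := (L.+1%:R * _ : R).
    have y0 : y != 0 by rewrite /y mulf_neq0// ?expf_neq0 ?pnatr_eq0.
    by rewrite invfM -mulrA mulVf// mulr1.
  (* The code says nothing about parameters with an index beyond [w]. They are set to zero, which
     does not change the output, since [out] never reads them. *)
  pose trW (W : nat -> nat -> nat -> R) : nat -> nat -> nat -> R :=
     fun k i j => if (i < w)%N && (j < w)%N then W k i j else 0.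
  pose trb (b : nat -> nat -> R) : nat -> nat -> R := fun k i => if (i < w)%N then b k i else 0.
  have actE W b z k : forall i, (i < w)%N -> act w (trW W) (trb b) z k i = act w W b z k i.
    elim: k => [|k IH] i iw //=; rewrite /trb iw; congr (relu (_ - _)).
    by apply: eq_bigr => j _; rewrite IH// /trW iw ltn_ord.
  have outE W b z i : (i < w)%N -> out w (trW W) (trb b) z L i = out w W b z L i.
    by move=> iw; apply: eq_bigr => j _; rewrite actE// /trW iw ltn_ord.
  apply: mx_norm_le => [|i u]; first by rewrite invr_ge0.
  have iw : (i < w)%N by apply: leq_trans (ltn_ord i) _; rewrite leq_addl.
  rewrite (ord1 u) mxE [X in _ + X]mxE fE fE' -QR.
  rewrite -(outE Wb.1 Wb.2 _ i iw) -(outE Wb'.1 Wb'.2 _ i iw).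
  apply: out_perturb.
  - move=> j; case: insubP => [j' _ _|_] /=; last by rewrite normr0.
    by have /andP[x0 x1] := xc j'; rewrite ger0_norm.
  - by rewrite invr_ge0.
  - by move=> k i' j kL; rewrite /trW; case: ifP => _; rewrite ?normr0// W1// W1'.
  - by move=> k i' kL; rewrite /trb; case: ifP => _; rewrite ?normr0// b1// b1'.
  - move=> k i' j kL; rewrite /trW; case: ifP => [/andP[i'w jw]|_]; last by rewrite subrr normr0 invr_ge0.
    have jw' : (j < w.+1)%N by exact: ltnW.
    by have := close (Ordinal (kL : (k < L.+1)%N), Ordinal i'w, Ordinal jw') kL; rewrite /ent /= jw.
  - move=> k i' kL; rewrite /trb; case: ifP => i'w; last by rewrite subrr normr0 invr_ge0.
    by have := close (Ordinal (kL : (k < L.+1)%N), Ordinal i'w, ord_max) kL; rewrite /ent /= ltnn.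
pose good c := `[< exists2 f, C f & exists2 Wb, params f Wb & code Wb = c >].
pose I := {c : {ffun 'I_s -> option (pos * 'I_(2 * Q).+1)} | good c}.
have /boolp.choice[G GP] : forall i : I, exists f, C f /\ exists2 Wb, params f Wb & code Wb = val i.
  by move=> [c /= /asboolP[f Cf h]]; exists f.
exists I, G; split.
- by move=> i; have [] := GP i.
- move=> f Cf; have [Wb pWb] := paramsP f Cf.
  have gc : good (code Wb) by apply/asboolP; exists f => //; exists Wb.
  exists (exist _ (code Wb) gc); have [_ [Wb' pWb' cE]] := GP (exist _ (code Wb) gc).
  exact: code_close pWb pWb' (esym cE).
- rewrite card_sig (leq_trans (max_card _))// card_ffun card_option !card_prod !card_ord.
  by [].
Qed.

End covering.

(** * Exponential moments of the noise *)

Section lipschitz.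
Context {R : realType}.

(** Links the norm to the coordinate sigma-algebra: a sublevel set is the union of the countably
    many rational boxes on which the Lipschitz bound certifies [h < a]. *)
Lemma lipschitz_measurable m (h : 'cV[R]_m -> R) C :
  (forall x y, `|h x - h y| <= C * `|x - y|) ->
  measurable_fun [set: vecT R m] (h : vecT R m -> R).
Proof.
move=> hC; pose K := `|C|.
have K0 : 0 <= K by exact: normr_ge0.
have hK x y : `|h x - h y| <= K * `|x - y|.
  by rewrite (le_trans (hC x y))// ler_wpM2r// ler_norm.
apply: (measurability (@RGenInftyO.G R) (RGenInftyO.measurableE R)).
move=> _ [_ [a ->] <-]; rewrite setTI.
pose qv (q : {ffun 'I_m -> rat}) : 'cV[R]_m := \col_j ratr (q j).
pose S (z : {ffun 'I_m -> rat} * rat) : set 'cV[R]_m :=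
  if (0 < z.2) && (h (qv z.1) + K * ratr z.2 < a)
  then [set x | forall j, `|x j 0 - ratr (z.1 j)| < ratr z.2] else set0.
rewrite (_ : h @^-1` _ = \bigcup_z S z).
  apply: (@countable_bigcupT_measurable _ (vecT R m)); first exact: countableP.
  move=> z; rewrite /S; case: ifP => _; last exact: measurable0.
  suff : @measurable _ (vecT R m) (\bigcap_(j in [set: 'I_m]) [set x : 'cV[R]_m | `|x j 0 - ratr (z.1 j)| < ratr z.2]).
    congr (measurable _); apply/seteqP; split=> x /= H; [by move=> j; exact: H|by move=> j _; exact: H].
  apply: fin_bigcap_measurable => [|j _]; first exact: finite_finset.
  have mj : measurable_fun [set: vecT R m] (fun x : vecT R m => `|x j 0 - ratr (z.1 j)|).
    apply: measurableT_comp => //; apply: measurable_funB => //.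
    exact: (measurable_coord (c := @vec_coord R m) j).
  have := mj measurableT _ (measurable_itv `]-oo, (ratr z.2 : R)[).
  by rewrite setTI; congr (measurable _); apply/seteqP; split => x /=; rewrite in_itv.
apply/seteqP; split => x /=; rewrite in_itv/=.
  move=> hxa; pose e := (a - h x) / (2 * K + 1).
  have e0 : 0 < e by rewrite divr_gt0//; lra.
  have [e' ] := rat_in_itvoo e0; rewrite in_itv/= => /andP[e'0 e'e].
  have qe j : exists q : rat, `|x j 0 - ratr q| < ratr e'.
    have xe : x j 0 < x j 0 + ratr e' by rewrite ltrDl.
    have [q] := rat_in_itvoo xe; rewrite in_itv/= => /andP[q1 q2]; exists q.
    by rewrite ltr0_norm; lra.
  have [q qP] := boolp.choice qe.
  exists ([ffun j => q j], e') => //; rewrite /S /=.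
  have xq : `|qv [ffun j => q j] - x| <= ratr e'.
    apply: mx_norm_le => [|i j]; first exact: ltW.
    by rewrite (ord1 j) !mxE ffunE distrC ltW.
  rewrite ifT; first by move=> j; rewrite ffunE.
  rewrite -(ltr0q R) e'0/=.
  have h1 : h (qv [ffun j => q j]) <= h x + K * ratr e'.
    have := hK (qv [ffun j => q j]) x; rewrite ler_norml => /andP[_ h1].
    have := ler_wpM2l K0 xq; lra.
  have : ratr e' * (2 * K + 1) < a - h x by rewrite -ltr_pdivlMr//; lra.
  by move: e'0 h1; lra.
move=> [[q e'] _]; rewrite /S /=; case: ifP => // /andP[e'0 ha] H.
apply: le_lt_trans ha.
have xq : `|x - qv q| <= ratr e'.
  apply: mx_norm_le => [|i j]; first by rewrite ler0q ltW.
  by rewrite (ord1 j) !mxE ltW.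
have := hK x (qv q); rewrite ler_norml => /andP[_ h1].
have := ler_wpM2l K0 xq; lra.
Qed.

End lipschitz.

Section exponential_moments.
Context {R : realType} {disp : measure_display} {T : measurableType disp}.
Variable P : probability T R.

Lemma exprn_le_fact n : n%:R ^+ n <= expR 1 ^+ n * n`!%:R :> R.
Proof.
elim: n => [|n IH]; first by rewrite !expr0 fact0 mulr1.
have [->|n0] := posnP n; first by rewrite !expr1 (_ : 1`! = 1%N)// mulr1; have := expR_ge1Dx (1 : R); lra.
have nR : 0 < n%:R :> R by rewrite ltr0n.
have h : n.+1%:R ^+ n <= expR 1 * n%:R ^+ n :> R.
  have -> : n.+1%:R = n%:R * (1 + n%:R^-1) :> R by rewrite mulrDr mulfV ?gt_eqF// mulr1 natr1.
  rewrite exprMn mulrC ler_wpM2r ?exprn_ge0//.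
  apply: (@le_trans _ _ (expR n%:R^-1 ^+ n)).
    by rewrite lerXn2r ?nnegrE ?expR_ge0 ?expR_ge1Dx// addr_ge0// invr_ge0.
  by rewrite -expRM_natl mulfV// gt_eqF.
rewrite exprS factS natrM exprS.
apply: (@le_trans _ _ (n.+1%:R * (expR 1 * (expR 1 ^+ n * n`!%:R)))).
  by rewrite ler_wpM2l// (le_trans h)// ler_wpM2l// expR_ge0.
by rewrite le_eqVlt; apply/orP; left; apply/eqP; ring.
Qed.

Lemma expR_nneseries (y : R) : 0 <= y -> (expR y)%:E = (\sum_(0 <= n <oo) (exp_coeff y n)%:E)%E.
Proof.
move=> y0; rewrite /expR -EFin_lim; last exact: is_cvg_series_exp_coeff.
by congr (limn _); apply/funext => n /=; rewrite sumEFin.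
Qed.

(** Expand the exponential: the moment of order [2 k] is at most [(2 k C^2)^k], and [k^k <= e^k k!],
    so for [eta = 1 / (4 e C^2)] the term of order [k] is at most [2^-k]. *)
Lemma subgaussian_square (X : T -> R) (C : R) : 0 < C -> measurable_fun setT X ->
  (forall k : nat, (0 < k)%N -> (Lnorm P k%:R%:E (EFin \o X) <= (C * Num.sqrt k%:R)%:E)%E) ->
  exists2 eta : R, 0 < eta & (\int[P]_w (expR (eta * X w ^+ 2))%:E <= 2%:E)%E.
Proof.
move=> C0 mX XC; pose eta := (4 * (expR 1 * C ^+ 2))^-1.
have e1 : 0 < expR 1 :> R by exact: expR_gt0.
have eC : 0 < expR 1 * C ^+ 2 by rewrite mulr_gt0 ?exprn_gt0.
have eta0 : 0 < eta by rewrite invr_gt0; lra.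
exists eta => //.
have mom k : (\int[P]_w (X w ^+ (2 * k))%:E <= ((C * Num.sqrt (2 * k)%:R) ^+ (2 * k))%:E)%E.
  have [->|k0] := posnP k.
    rewrite muln0; under eq_integral do rewrite expr0.
    by rewrite integral_cst// [X in (_ * X)%E](probability_setT P) mule1.
  have k20 : (2 * k)%:R != 0 :> R by rewrite pnatr_eq0; lia.
  have E : (\int[P]_w (X w ^+ (2 * k))%:E = \int[P]_w (`|(X w)%:E| `^ (2 * k)%:R))%E.
    apply: eq_integral => w _; rewrite abse_EFin poweR_EFin powR_mulrn//; congr (_%:E).
    by rewrite -normrX ger0_norm// mulnC exprM sqr_ge0.
  rewrite E -(poweR_Lnorm P (EFin \o X) k20).
  apply: (@le_trans _ _ ((C * Num.sqrt (2 * k)%:R)%:E `^ (2 * k)%:R)%E).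
    apply: gt0_ler_poweR => //; first by rewrite in_itv/= Lnorm_ge0 leey.
      by rewrite in_itv/= leey andbT lee_fin mulr_ge0 ?sqrtr_ge0// ltW.
    by apply: XC; lia.
  by rewrite poweR_EFin powR_mulrn// mulr_ge0 ?sqrtr_ge0// ltW.
have -> : (\int[P]_w (expR (eta * X w ^+ 2))%:E = \int[P]_w (\sum_(0 <= n <oo) (exp_coeff (eta * X w ^+ 2) n)%:E))%E.
  by apply: eq_integral => w _; rewrite expR_nneseries// mulr_ge0 ?sqr_ge0// ltW.
have mc n : measurable_fun setT (fun w => (exp_coeff (eta * X w ^+ 2) n)%:E).
  apply/measurable_EFinP; apply: measurable_funM => //; apply: measurable_funX.
  by apply: measurable_funM => //; apply: measurable_funX.
have c0 n w : (0 <= (exp_coeff (eta * X w ^+ 2) n)%:E)%E.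
  by rewrite lee_fin exp_coeff_ge0// mulr_ge0 ?sqr_ge0// ltW.
rewrite integral_nneseries//.
have term n : (\int[P]_w (exp_coeff (eta * X w ^+ 2) n)%:E <= ((2 ^+ n)^-1)%:E)%E.
  under eq_integral => w _.
    rewrite (_ : exp_coeff _ n = (eta ^+ n / n`!%:R) * X w ^+ (2 * n)); last first.
      by rewrite /exp_coeff/= exprMn -exprM; ring.
    rewrite EFinM; over.
  have cn : 0 <= eta ^+ n / n`!%:R by rewrite divr_ge0// exprn_ge0// ltW.
  rewrite ge0_integralZl//; last 2 first.
  - by apply/measurable_EFinP; apply: measurable_funX.
  - by move=> w _; rewrite lee_fin exprM exprn_ge0// sqr_ge0.
  apply: (le_trans (lee_wpmul2l _ (mom n))); first by rewrite lee_fin.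
  have -> : (C * Num.sqrt (2 * n)%:R) ^+ (2 * n) = (C ^+ 2 * (2 * n%:R)) ^+ n.
    by rewrite exprM [(C * _) ^+ 2]exprMn sqr_sqrtr ?ler0n// natrM.
  rewrite -EFinM lee_fin.
  have := exprn_le_fact n; set f := (n`!%:R : R) => hf.
  have f0 : 0 < f by rewrite /f ltr0n fact_gt0.
  have -> : eta ^+ n / f * (C ^+ 2 * (2 * n%:R)) ^+ n = (eta * (C ^+ 2 * 2)) ^+ n * (n%:R ^+ n / f).
    have h1 : (C ^+ 2 * (2 * n%:R)) ^+ n = (C ^+ 2 * 2) ^+ n * n%:R ^+ n by rewrite -exprMn mulrA.
    by rewrite h1 [(eta * _) ^+ n]exprMn; ring.
  apply: (@le_trans _ _ ((eta * (C ^+ 2 * 2)) ^+ n * expR 1 ^+ n)).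
    apply: ler_wpM2l; last by rewrite ler_pdivrMr.
    by rewrite exprn_ge0// mulr_ge0 ?mulr_ge0 ?sqr_ge0// ltW.
  rewrite -exprMn (_ : _ * expR 1 = 2^-1) ?exprVn//.
  by rewrite /eta; field; rewrite !gt_eqF.
have c0' n : (0 <= \int[P]_w (exp_coeff (eta * X w ^+ 2) n)%:E)%E by apply: integral_ge0.
apply: lime_le; first by apply: is_cvg_nneseries.
apply: nearW => n.
apply: (@le_trans _ _ (\sum_(0 <= k < n) ((2 ^+ k)^-1)%:E)%E); first by apply: lee_sum => k _.
rewrite sumEFin lee_fin.
suff -> : \sum_(0 <= k < n) (2 ^+ k)^-1 = 2 - 2 / 2 ^+ n :> R.
  by rewrite gerBl divr_ge0// exprn_ge0.
elim: n => [|n IH]; first by rewrite big_nil expr0; field.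
by rewrite big_nat_recr//= IH exprS; field; rewrite expf_neq0.
Qed.

Lemma subgaussian_exp_abs (X : T -> R) (C b : R) : 0 < C -> measurable_fun setT X ->
  (forall k : nat, (0 < k)%N -> (Lnorm P k%:R%:E (EFin \o X) <= (C * Num.sqrt k%:R)%:E)%E) ->
  exists2 B : R, 0 <= B & (\int[P]_w (expR (b * `|X w|))%:E <= B%:E)%E.
Proof.
move=> C0 mX XC; have [eta eta0 h] := subgaussian_square C0 mX XC.
pose c := expR (b ^+ 2 / (4 * eta)).
exists (c * 2); first by rewrite mulr_ge0// expR_ge0.
apply: (@le_trans _ _ (\int[P]_w (c%:E * (expR (eta * X w ^+ 2))%:E))%E); last first.
  rewrite ge0_integralZl//; last 2 first.
  - apply/measurable_EFinP; apply: measurableT_comp => //; apply: measurable_funM => //; exact: measurable_funX.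
  - by rewrite lee_fin expR_ge0.
  by rewrite EFinM lee_wpmul2l// lee_fin expR_ge0.
apply: ge0_le_integral => //.
- apply/measurable_EFinP; apply: measurableT_comp => //; apply: measurable_funM => //; exact: measurableT_comp.
- apply/measurable_EFinP; apply: measurable_funM => //; apply: measurableT_comp => //; apply: measurable_funM => //; exact: measurable_funX.
move=> w _; rewrite -EFinM lee_fin /c -expRD ler_expR -(real_normK (num_real (X w))).
move: (normr_ge0 (X w)); set x := `|X w| => x0.
rewrite -subr_ge0 (_ : _ - _ = (b - 2 * eta * x) ^+ 2 / (4 * eta)); last first.
  by field; rewrite gt_eqF.
by rewrite divr_ge0 ?sqr_ge0//; lra.
Qed.

Lemma expR_quad (x : R) : expR x <= 1 + x + x ^+ 2 * expR `|x|.
Proof.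
have key (y : R) : 0 <= y -> expR y <= 1 + y * expR y.
  move=> y0; have := expR_ge1Dx (- y); rewrite expRN => h.
  have p := expR_gt0 y; have : (1 - y) * expR y <= 1 by rewrite -ler_pdivlMr// mul1r.
  lra.
have [x0|x0] := leP 0 x.
  by rewrite ger0_norm//; have := key x x0; have := ler_wpM2l x0 (key x x0); lra.
rewrite ltr0_norm//; set y := - x; have y0 : 0 < y by rewrite oppr_gt0.
have -> : x = - y by rewrite opprK.
have e1 := expR_ge1Dx y.
apply: (@le_trans _ _ (1 - y + y ^+ 2)).
  by rewrite expRN -div1r ler_pdivrMr ?expR_gt0//; have := ler_wpM2l (_ : 0 <= 1 - y + y ^+ 2) e1; nra.
have y2 : 0 <= y ^+ 2 by exact: sqr_ge0.
have h3 : y ^+ 2 <= y ^+ 2 * expR y by rewrite ler_peMr// (le_trans _ e1)// lerDl ltW.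
by rewrite (_ : (- y) ^+ 2 = y ^+ 2); [lra|exact: sqrrN].
Qed.

(** The linear term is centred. With [s] the sum of the [|e_j|] and [|a|^2] the sum of the [a_j^2],
    the remainder is at most [|a|^2 s^2 exp s], hence at most [4 |a|^2 exp (2 s)]. As the components
    of one innovation may be dependent, [exp (2 s)] is bounded through the largest component. *)
Lemma mgf_quadratic d (e : T -> 'cV[R]_d) (B : R) : (0 < d)%N -> 0 <= B ->
  (forall j, measurable_fun setT (fun w => e w j 0)) ->
  (forall j, P.-integrable setT (fun w => (e w j 0)%:E)) ->
  (forall j, (\int[P]_w (e w j 0)%:E = 0)%E) ->
  (forall j, (\int[P]_w (expR (2 * d%:R * `|e w j 0|))%:E <= B%:E)%E) ->
  forall a : 'I_d -> R, (forall j, `|a j| <= 1) ->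
  (\int[P]_w (expR (\sum_j a j * e w j 0))%:E <= (1 + 4 * d%:R * B * \sum_j a j ^+ 2)%:E)%E.
Proof.
move=> d0 B0 me ie e0 eB a a1.
pose A2 := \sum_j a j ^+ 2.
have A20 : 0 <= A2 by apply: sumr_ge0 => j _; exact: sqr_ge0.
pose x w := \sum_j a j * e w j 0.
pose E2 w := \sum_(j < d) expR (2 * d%:R * `|e w j 0|).
have E20 w : 0 <= E2 w by apply: sumr_ge0 => j _; exact: expR_ge0.
have mE2 : measurable_fun setT E2.
  apply: measurable_sum => j; apply: measurableT_comp => //; apply: measurable_funM => //; exact: measurableT_comp.
have mx : measurable_fun setT x by apply: measurable_sum => j; exact: measurable_funM.
have xle w : expR (x w) <= 1 + x w + 4 * A2 * E2 w.
  apply: (le_trans (expR_quad _)); rewrite lerD2l.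
  pose s := \sum_(j < d) `|e w j 0|.
  have s0 : 0 <= s by apply: sumr_ge0.
  have xs : `|x w| <= s.
    apply: (le_trans (ler_norm_sum _ _ _)); apply: ler_sum => j _.
    by rewrite normrM ler_piMl.
  have xA : x w ^+ 2 <= A2 * s ^+ 2.
    rewrite -(real_normK (num_real (x w))) -(sqr_sqrtr A20) -exprMn lerXn2r ?nnegrE ?mulr_ge0 ?sqrtr_ge0//.
    rewrite mulr_sumr; apply: (le_trans (ler_norm_sum _ _ _)); apply: ler_sum => j _.
    rewrite normrM ler_wpM2r// -sqrtr_sqr ler_wsqrtr// /A2 (bigD1 j)//= lerDl.
    by apply: sumr_ge0 => i _; exact: sqr_ge0.
  have ss : s ^+ 2 <= 4 * expR s.
    have h := expR_ge1Dx (s / 2).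
    have : (1 + s / 2) ^+ 2 <= expR (s / 2) ^+ 2 by rewrite lerXn2r ?nnegrE ?expR_ge0//; lra.
    by rewrite -expRM_natl (_ : 2 * (s / 2) = s); [nra|field].
  have es : expR s * expR s <= E2 w.
    rewrite -expRD.
    have [j0 _ jmax] := @arg_maxP _ _ _ (Ordinal d0) predT (fun j => `|e w j 0|) isT.
    apply: (@le_trans _ _ (expR (2 * d%:R * `|e w j0 0|))).
      rewrite ler_expR (_ : s + s = 2 * s); last by ring.
      rewrite -mulrA ler_wpM2l// /s.
      apply: (@le_trans _ _ (\sum_(j < d) `|e w j0 0|)); first by apply: ler_sum => j _; exact: jmax.
      by rewrite sumr_const card_ord mulr_natl.
    by rewrite /E2 (bigD1 j0)//= lerDl sumr_ge0// => j _; exact: expR_ge0.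
  apply: (@le_trans _ _ (A2 * s ^+ 2 * expR s)).
    by rewrite ler_pM ?sqr_ge0 ?expR_ge0// ler_expR.
  apply: (@le_trans _ _ (A2 * (4 * expR s) * expR s)).
    by rewrite ler_wpM2r ?expR_ge0// ler_wpM2l.
  rewrite (_ : _ * expR s = 4 * A2 * (expR s * expR s)); last by ring.
  by rewrite ler_wpM2l// mulr_ge0.
have ix : P.-integrable setT (fun w => (x w)%:E).
  rewrite (_ : (fun w => (x w)%:E) = (fun w => \sum_(j < d) ((a j)%:E * (e w j 0)%:E)%E)%E); last first.
    by apply/funext => w; rewrite /x -sumEFin; apply: eq_bigr.
  by apply: integrable_sum => // j _; apply: integrableZl.
have xi0 : (\int[P]_w (x w)%:E = 0)%E.
  rewrite (_ : (fun w => (x w)%:E) = (fun w => \sum_(j < d) ((a j)%:E * (e w j 0)%:E)%E)%E); last first.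
    by apply/funext => w; rewrite /x -sumEFin; apply: eq_bigr.
  rewrite integral_sum//; last by move=> j; apply: integrableZl.
  by rewrite big1// => j _; rewrite integralZl// e0 mule0.
have iE2 : (\int[P]_w (E2 w)%:E <= (d%:R * B)%:E)%E.
  under eq_integral do rewrite -sumEFin.
  rewrite ge0_integral_sum//; last first.
    by move=> j; apply/measurable_EFinP; apply: measurableT_comp => //; apply: measurable_funM => //; exact: measurableT_comp.
  apply: (@le_trans _ _ (\sum_(j < d) B%:E)%E); first by apply: lee_sum => j _; exact: eB.
  by rewrite sumEFin sumr_const card_ord mulr_natl.
have intE2 : P.-integrable setT (fun w => (E2 w)%:E).
  apply/integrableP; split; first exact/measurable_EFinP.
  under eq_integral do rewrite abse_EFin ger0_norm//.
  by apply: le_lt_trans iE2 _; rewrite ltry.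
have int1 : P.-integrable setT (fun w => (1 : R)%:E).
  exact: finite_measure_integrable_cst.
apply: (@le_trans _ _ (\int[P]_w (1 + x w + 4 * A2 * E2 w)%:E)%E).
  apply: ge0_le_integral => //.
  - by apply/measurable_EFinP; apply: measurableT_comp.
  - apply/measurable_EFinP; apply: measurable_funD; last exact: measurable_funM.
    exact: measurable_funD.
  by move=> w _; rewrite lee_fin; exact: xle.
have int1x : P.-integrable setT (fun w => (1 + x w)%:E).
  by under eq_fun do rewrite EFinD; apply: integrableD.
have intA : P.-integrable setT (fun w => (4 * A2 * E2 w)%:E).
  by under eq_fun do rewrite EFinM; apply: integrableZl.
under eq_integral do rewrite EFinD.
rewrite integralD//.
under eq_integral do rewrite EFinD.
rewrite integralD// xi0 adde0 integral_cst// [X in (_ * X)%E](probability_setT P) mule1.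
rewrite EFinD leeD2l//.
under eq_integral do rewrite EFinM.
rewrite integralZl//.
apply: (le_trans (lee_wpmul2l _ iE2)); first by rewrite lee_fin mulr_ge0.
by rewrite -EFinM lee_fin le_eqVlt; apply/orP; left; apply/eqP; rewrite -/A2; ring.
Qed.

End exponential_moments.

Lemma Rint_sum {R : realType} {disp} {T : measurableType disp} (mu : probability T R)
    (I : Type) (s : seq I) (f : I -> T -> R) : (forall i, bdm (f i)) ->
  \int[mu]_x (\sum_(i <- s) f i x) = \sum_(i <- s) \int[mu]_x f i x.
Proof.
move=> bf; elim: s => [|i s IH].
  by rewrite big_nil; under eq_Rintegral do rewrite big_nil; rewrite Rint_cst.
rewrite big_cons -IH -RintD//; last exact: bdm_sum.
by apply: eq_Rintegral => x _; rewrite big_cons.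
Qed.

(** * The process as a function of the innovations *)

Section density.
Context {R : realType} {d : nat}.
Local Notation seqT := (seqT R d).
Variables (mu : probability seqT R) (nu : set 'cV[R]_d -> \bar R).
Hypothesis muP : iid_law mu nu.
Variable c : int.

Let tail (J : nat) (l : int) : bool := c - J%:Z <= l.
Let nu2 := (mu \x mu)%E.
Let mx J (z : seqT * seqT) : seqT := mix (tail J) z.1 z.2.
Let S J (E : set seqT) : set (seqT * seqT) := (fst @^-1` E) `+` (mx J @^-1` E).

Let mfst E : measurable E -> measurable ((fst : seqT * seqT -> seqT) @^-1` E).
Proof. by move=> mE; rewrite -[X in measurable X]setTI; exact: measurable_fst. Qed.

Let mmx J E : measurable E -> measurable (mx J @^-1` E).
Proof. by move=> mE; rewrite -[X in measurable X]setTI; exact: (measurable_mix2 (tail J)). Qed.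

Let mS J E : measurable E -> measurable (S J E).
Proof.
by move=> mE; apply: measurableU; apply: measurableD; by [exact: mfst|exact: mmx].
Qed.

Let nu2fst E : measurable E -> nu2 ((fst : seqT * seqT -> seqT) @^-1` E) = mu E.
Proof.
move=> mE; rewrite (_ : _ @^-1` _ = E `*` setT); last by apply/seteqP; split=> z //= [].
transitivity (mu E * mu setT)%E; first exact: product_measure1E.
by rewrite [X in (_ * X)%E](probability_setT mu) mule1.
Qed.

Let nu2mx J E : measurable E -> nu2 (mx J @^-1` E) = mu E.
Proof. exact: (pushforward_mix muP (tail J)). Qed.

(** Events for which resampling the distant past rarely changes membership. That these form a
    sigma-algebra containing the cylinders takes the place of a martingale convergence theorem. *)
Let approx (E : set seqT) := measurable E /\ forall eps : R, 0 < eps ->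
  exists J0, forall J, (J0 <= J)%N -> (nu2 (S J E) <= eps%:E)%E.

Let nu2_le A B : measurable A -> measurable B -> A `<=` B -> (nu2 A <= nu2 B)%E.
Proof. by move=> mA mB AB; apply: le_measure => //; rewrite inE. Qed.

(** For a countable union, one third of [eps] goes to the first [N] events and one third to the
    remaining part for each of the two sequences that are compared. *)
Let approx_sigma : sigma_algebra setT approx.
Proof.
split.
- split; first exact: measurable0.
  move=> eps eps0; exists 0%N => J _; rewrite /S !preimage_set0 setYK [X in (X <= _)%E](measure0 nu2) lee_fin; exact: ltW.
- move=> A [mA hA]; split; first exact: measurableD.
  move=> eps /hA[J0 hJ]; exists J0 => J /hJ.
  rewrite (_ : S J (setT `\` A) = S J A)//.
  have -> : S J (setT `\` A) = (~` (fst @^-1` A)) `+` (~` (mx J @^-1` A)).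
    by rewrite /S setTD.
  have setYC' (X Y : set (seqT * seqT)) : (~` X) `+` (~` Y) = X `+` Y.
    by rewrite /setY !setDE !setCK setUC; congr (_ `|` _); exact: setIC.
  exact: setYC'.
move=> A hA; have mA n : measurable (A n) by case: (hA n).
split; first exact: bigcup_measurable.
move=> eps eps0; pose E := \bigcup_k A k; pose U N := \big[setU/set0]_(n < N) A n.
have mE : measurable E by exact: bigcup_measurable.
have mU N : measurable (U N) by apply: bigsetU_measurable.
pose Rm N := E `\` U N.
have mR N : measurable (Rm N) by exact: measurableD.
have Rcvg : (mu \o Rm) N @[N --> \oo] --> mu set0.
  have <- : \bigcap_N Rm N = set0.
    apply/seteqP; split => // u /= hu; have [[n _ An] _] := hu 0%N I.
    have [_] := hu n.+1 I; apply; rewrite /U big_ord_recr/=; by right.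
  apply: nonincreasing_cvg_mu => //.
  - by apply: (@le_lt_trans _ _ (mu setT)); [apply: le_measure; rewrite ?inE|rewrite [X in (X < _)%E](probability_setT mu) ltry].
  - exact: bigcapT_measurable.
  - move=> N M NM; apply/subsetPset => u [Eu nU]; split => // uN; apply: nU.
    move: uN; rewrite /U -!bigcup_mkord => -[n /= nN An]; exists n => //=; exact: leq_trans NM.

have [N _ hN] : \forall N \near \oo, (mu (Rm N) <= (eps / 3)%:E)%E.
  have e3 : 0 < eps / 3 by lra.
  move: Rcvg; rewrite measure0 => /fine_cvgP[_ /cvgr_lt h].
  have := h _ e3; apply: filterS => n /= hn.
  rewrite -[X in (X <= _)%E]fineK; first by rewrite lee_fin ltW.
  apply: fin_num_measure => //.
pose e' : R := eps / (3 * N.+1%:R).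
have e'0 : 0 < e' by rewrite divr_gt0// mulr_gt0.
have /boolp.choice[f hf] : forall n, exists J0, forall J, (J0 <= J)%N -> (nu2 (S J (A n)) <= e'%:E)%E.
  by move=> n; case: (hA n) => _; exact.
exists (\max_(n < N) f n) => J hJ.
pose B n := S J (A n).
have mB n : measurable (B n) by exact: mS.
have sub : S J E `<=` (\big[setU/set0]_(n < N) B n) `|` ((fst @^-1` Rm N) `|` (mx J @^-1` Rm N)).
  move=> z [[Ez nE]|[Ez nE]].
    have [[n /= nN Anz]|nU] := pselect ((\bigcup_(n < N) A n) z.1).
      left; rewrite -bigcup_mkord; exists n => //; left; split => // Am; apply: nE; by exists n.
    by right; left; split => //; rewrite /U -bigcup_mkord.
  have [[n /= nN Anz]|nU] := pselect ((\bigcup_(n < N) A n) (mx J z)).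
    left; rewrite -bigcup_mkord; exists n => //; right; split => // Am; apply: nE; by exists n.
  by right; right; split => //; rewrite /U -bigcup_mkord.
have mUB : measurable (\big[setU/set0]_(n < N) B n) by apply: bigsetU_measurable.
have mRR : measurable ((fst @^-1` Rm N) `|` (mx J @^-1` Rm N)).
  by apply: measurableU; [exact: mfst|exact: mmx].
apply: (le_trans (nu2_le (mS J mE) (measurableU _ _ mUB mRR) sub)).
apply: (le_trans (measureU2 nu2 mUB mRR)).
have h1 : (nu2 (\big[setU/set0]_(n < N) B n) <= (eps / 3)%:E)%E.
  apply: (le_trans (Boole_inequality nu2 (fun i _ => mB i))).
  apply: (@le_trans _ _ (\sum_(n < N) e'%:E)%E).
    by apply: lee_sum => n _; apply: hf; apply: leq_trans hJ; exact: (leq_bigmax n).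
  rewrite sumEFin lee_fin sumr_const card_ord -[leLHS]mulr_natl /e' mulrA ler_pdivrMr ?mulr_gt0//.
  have : N%:R <= N.+1%:R :> R by rewrite ler_nat.
  by have : 0 <= N%:R :> R by []; nra.
have h2 : (nu2 ((fst @^-1` Rm N) `|` (mx J @^-1` Rm N)) <= (eps / 3 + eps / 3)%:E)%E.
  apply: (le_trans (measureU2 nu2 (mfst (mR N)) (mmx J (mR N)))).
  have hRN := hN N (leqnn N).
  rewrite EFinD; apply: leeD; first by apply: le_trans hRN; rewrite -(nu2fst (mR N)).
  by apply: le_trans hRN; rewrite -(nu2mx J (mR N)).
apply: (le_trans (leeD h1 h2)); rewrite -EFinD lee_fin; lra.
Qed.

Let approx_all E : measurable E -> approx E.
Proof.
rewrite measurable_seqTE; apply: smallest_sub; first exact: approx_sigma.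
move=> _ [s [B [mB sB] ->]]; split.
  by apply: measurable_cyls; exists s, B.
move=> eps eps0; pose J0 : nat := \max_(l <- s) `|c - l|%N; exists J0 => J hJ.
rewrite (_ : S J (cyl B) = set0); first by rewrite [X in (X <= _)%E](measure0 nu2) lee_fin ltW.
have cE z : cyl B (mx J z) <-> cyl B z.1.
  have h l : B l (mx J z l) <-> B l (z.1 l).
    have [ls|/sB -> //] := boolP (l \in s).
    have : (`|c - l|%N <= J)%N.
      by apply: leq_trans hJ; rewrite /J0 (big_rem l)//= leq_maxl.
    by rewrite /mx /mix /tail => lJ; rewrite ifT//; lia.
  by split => H l; apply/h; exact: H.
apply/seteqP; split => z // [[a b]|[a b]]; by case: b; apply/cE.
Qed.

(** Layer-cake decomposition with step [h]; it reduces statements about functions to statements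
    about events. *)
Definition level (h y : R) (i : nat) : R := if i.+1%:R * h <= y then 1 else 0.

Lemma levels_approx (N : nat) (h y : R) : 0 < h -> 0 <= y ->
  let s := \sum_(i < N) level h y i in
  [/\ s <= N%:R, h * s <= y & (N%:R <= s) || (y - h <= h * s)].
Proof.
move=> h0 y0; elim: N => [|N] /=; first by rewrite big_ord0 mulr0; split; rewrite ?lexx.
move=> [h1 h2 /orP h3]; rewrite big_ord_recr/=; set s := \sum_(_ < _) _ in h1 h2 h3 *.
have nE : N.+1%:R = N%:R + 1 :> R by rewrite -natr1.
rewrite /level nE; case: ifP => [hy|/negbT]; rewrite ?addr0 ?mulrDr ?mulr1.
  have := ler_wpM2l (ltW h0) h1; split; [lra|lra|].
  by case: h3 => h3; apply/orP; [left|right]; lra.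
rewrite -ltNge => hy; split; [lra|lra|apply/orP; right].
by case: h3 => h3 //; have := ler_wpM2l (ltW h0) h3; lra.
Qed.

Lemma level_diff (N : nat) (M y y' : R) : (0 < N)%N -> 0 < M -> 0 <= y <= M -> 0 <= y' <= M ->
  `|y - y'| <= M / N%:R + M / N%:R * \sum_(i < N) `|level (M / N%:R) y i - level (M / N%:R) y' i|.
Proof.
move=> N0 M0 yM y'M; have NR : 0 < N%:R :> R by rewrite ltr0n.
set h := M / N%:R; have h0 : 0 < h by rewrite divr_gt0.
have hN : h * N%:R = M by rewrite /h mulfVK// gt_eqF.
have lev (z : R) : 0 <= z <= M -> let s := \sum_(i < N) level h z i in
    h * s <= z /\ z - h <= h * s.
  move=> /andP[z0 zM]; have := levels_approx N h0 z0 => /=.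
  move=> [? ? /orP[hs|//]]; split => //.
  by have := ler_wpM2l (ltW h0) hs; lra.
have [a1 a2] := lev y yM; have [b1 b2] := lev y' y'M.
set s := \sum_(i < N) _ in a1 a2; set s' := \sum_(i < N) _ in b1 b2.
have ss : `|s - s'| <= \sum_(i < N) `|level h y i - level h y' i|.
  by rewrite /s /s' -sumrB; exact: ler_norm_sum.
have := ler_wpM2l (ltW h0) ss; rewrite -[X in X * `|_|](gtr0_norm h0) -normrM mulrBr.
by rewrite !ler_norml; set t := \sum_(i < N) _; move: (h * s) (h * s') (h * t) a1 a2 b1 b2 => *; lra.
Qed.

(** Convergence in mean of the conditional expectations given more and more of the past; it closes
    the telescoping sum over truncation levels. *)
Lemma tail_density (F : seqT -> R) M eps : measurable_fun [set: seqT] F ->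
  (forall u, 0 <= F u <= M) -> 0 < M -> 0 < eps ->
  exists J0, forall J, (J0 <= J)%N -> \int[mu]_u `|F u - cexp mu (@mix R d) (tail J) F u| <= eps.
Proof.
move=> mF F0M M0 eps0.
(* One half of [eps] covers the step height [M / N]; the other half covers the [N] level events,
   each of weight [M / N] and probability at most [eps / (2 M)]. *)
pose N := (Num.truncn (2 * M / eps)).+1.
have NR : 0 < N%:R :> R by rewrite ltr0n.
have MN : M / N%:R <= eps / 2.
  have h : 0 <= 2 * M / eps by rewrite divr_ge0 ?mulr_ge0// ltW.
  have /andP[_ h2] := truncn_itv h; rewrite -/N in h2.
  have h3 : 2 * M < N%:R * eps by rewrite -ltr_pdivrMr.
  by rewrite ler_pdivrMr//; lra.
pose E (i : nat) := [set u : seqT | i.+1%:R * (M / N%:R) <= F u].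
have mE i : measurable (E i).
  have := mF measurableT _ (measurable_itv `[(i.+1%:R * (M / N%:R) : R), +oo[).
  by rewrite setTI; congr (measurable _); apply/seteqP; split => u /=; rewrite /E/= in_itv/= andbT.
have e2M : 0 < eps / (2 * M) by rewrite divr_gt0// mulr_gt0.
have /boolp.choice[f hf] : forall i, exists J0, forall J, (J0 <= J)%N -> (nu2 (S J (E i)) <= (eps / (2 * M))%:E)%E.
  by move=> i; have [_ h] := approx_all (mE i); exact: h.
exists (\max_(i < N) f i) => J hJ.
pose h (z : seqT * seqT) : R := M / N%:R + M / N%:R * \sum_(i < N) \1_(S J (E i)) z.
have bF : bdm F by split => //; exists M => u; have /andP[? ?] := F0M u; rewrite ger0_norm.
have b1 i : bdm (fun z => \1_(S J (E i)) z : R).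
  split; first by apply: measurable_indic; exact: mS.
  by exists 1 => z; rewrite indicE; case: (_ \in _); rewrite ?normr1 ?normr0.
have bS : bdm (fun z => \sum_(i < N) \1_(S J (E i)) z : R) by apply: bdm_sum.
have bh : bdm h by apply: bdmD; [exact: bdm_cst|exact: bdmZ].
have bc : bdm (cexp mu (@mix R d) (tail J) F).
  by apply: (@bdm_cexp _ _ _ mu _ (measurable_mix2 (R := R) (d := d))).
have hle u v : `|F u - F (mix (tail J) u v)| <= h (u, v).
  apply: (le_trans (@level_diff N M _ _ isT M0 (F0M _) (F0M _))).
  rewrite lerD2l ler_wpM2l//; first by rewrite divr_ge0// ltW.

  apply: ler_sum => i _; rewrite indicE /level.
  have Ei w : (if i.+1%:R * (M / N%:R) <= F w then 1 else 0 : R) = \1_(E i) w.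
    rewrite indicE; case: ifP => hw; first by rewrite mem_set.
    by rewrite memNset// /E/= hw.
  rewrite !Ei !indicE; have [hu|hu] := boolP (u \in E i); have [hv|hv] := boolP (mix (tail J) u v \in E i);
    rewrite ?subrr ?normr0//.
  - rewrite subr0 normr1 mem_set// /S/=; left; split; [exact: set_mem|].
    by move=> /mem_set h'; move: hv; rewrite -[mix _ _ _]/(mx J (u, v)) h'.
  - rewrite sub0r normrN1 mem_set// /S/=; right; split; [exact: set_mem|].
    by move=> /mem_set h'; move: hu; rewrite h'.
have bdif : bdm (fun u => F u - cexp mu (@mix R d) (tail J) F u) by exact: bdmB.
have bH : bdm (fun u => \int[mu]_v h (u, v)) by exact: bdm_Rint.
apply: (@le_trans _ _ (\int[mu]_u \int[mu]_v h (u, v))).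
  apply: Rint_le => //.
    case: bdif => mD [K hK]; split; first exact: measurableT_comp.
    by exists K => u; rewrite normr_id.
  move=> u; have bv : bdm (fun v : seqT => F (mix (tail J) u v)).
    by apply: (@bdm_mixr _ _ _ _ (measurable_mix2 (R := R) (d := d)) (tail J) u).
  have -> : F u - cexp mu (@mix R d) (tail J) F u = \int[mu]_v (F u - F (mix (tail J) u v)).
    by rewrite RintB ?Rint_cst//; exact: bdm_cst.
  have bsl : bdm (fun v : seqT => h (u, v)) by exact: bdm_slice.
  have bd' : bdm (fun v : seqT => F u - F (mix (tail J) u v)) by apply: bdmB => //; exact: bdm_cst.
  rewrite ler_norml; apply/andP; split.
    rewrite lerNl -[leLHS]mulN1r -RintZ//; apply: Rint_le => //; first exact: bdmZ.
    by move=> v; rewrite mulN1r; apply: le_trans (hle u v); rewrite -normrN ler_norm.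
  apply: Rint_le => // v; apply: le_trans (hle u v); exact: ler_norm.
have iS i : \int[mu]_u \int[mu]_v \1_(S J (E i)) (u, v) <= eps / (2 * M) \/ (N <= i)%N.
  have [iN|iN] := ltnP i N; last by right.
  left; rewrite -lee_fin EFin_Rint; last by apply: (bdm_Rint mu (b1 i)).
  under eq_integral => u _ do rewrite (EFin_Rint mu (bdm_slice u (b1 i))).
  have := @fubini_tonelli1 _ _ _ _ _ mu mu (fun z => (\1_(S J (E i)) z)%:E).
  rewrite /fubini_F => <-; last 2 first.
  - by apply/measurable_EFinP; apply: measurable_indic; exact: mS.
  - by move=> z; rewrite lee_fin.
  rewrite integral_indic//; last exact: mS.
  rewrite setIT; apply: hf; apply: leq_trans hJ; exact: (leq_bigmax (Ordinal iN)).

have bi i : bdm (fun u => \int[mu]_v \1_(S J (E i)) (u, v) : R) by exact: bdm_Rint (b1 i).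
have -> : \int[mu]_u \int[mu]_v h (u, v) =
    M / N%:R + M / N%:R * \sum_(i < N) \int[mu]_u \int[mu]_v \1_(S J (E i)) (u, v).
  rewrite -Rint_sum// -RintZ; last exact: bdm_sum.
  rewrite -[X in X + _](Rint_cst mu (M / N%:R)) -RintD; [|exact: bdm_cst|by apply: bdmZ; exact: bdm_sum].
  congr (Rintegral _ _ _); apply/funext => u; rewrite /h.
  rewrite RintD; [|exact: bdm_cst|by apply: bdmZ; apply: bdm_sum => i; exact: bdm_slice (b1 i)].
  rewrite Rint_cst RintZ; last by apply: bdm_sum => i; exact: bdm_slice (b1 i).
  by rewrite Rint_sum// => i; exact: bdm_slice (b1 i).
have : \sum_(i < N) \int[mu]_u \int[mu]_v \1_(S J (E i)) (u, v) <= N%:R * (eps / (2 * M)).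
  apply: (@le_trans _ _ (\sum_(i < N) eps / (2 * M))).
    by apply: ler_sum => i _; have [//|] := iS i; rewrite leqNgt ltn_ord.
  by rewrite sumr_const card_ord -[leLHS]mulr_natl.
move=> hs; have h0 : 0 <= M / N%:R by rewrite divr_ge0// ltW.
have := ler_wpM2l h0 hs.
have -> : M / N%:R * (N%:R * (eps / (2 * M))) = eps / 2 by field; rewrite !gt_eqF.
lra.
Qed.

End density.

Section sequence_model.
Context {R : realType} {d : nat}.
Local Notation seqT := (seqT R d).
Local Notation vecT := (vecT R d).
Variables (mu : probability seqT R) (nu : set 'cV[R]_d -> \bar R).
Hypothesis muP : iid_law mu nu.

Definition coordinate (u : seqT) (l : int) : 'cV[R]_d := u l.

Lemma coordinate_inj (u v : seqT) : (forall l, coordinate u l = coordinate v l) -> u = v.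
Proof. by move=> h; apply/funext. Qed.

Lemma coordinate_mix A (u v : seqT) l :
  coordinate (mix A u v) l = if A l then coordinate u l else coordinate v l.
Proof. by rewrite /coordinate /mix; case: ifP. Qed.

Lemma measurable_entry l j : measurable_fun [set: seqT] (fun u : seqT => u l j 0).
Proof. exact: (measurable_coord (c := @seq_coord R d) (l, j)). Qed.

(** [h t c] is fixed by the innovations up to [T0 + t] when the next one is integrated. The
    subtracted square is the compensator supplied by the moment bound together with
    [1 + x <= expR x]; [la * B <= 1] keeps the coefficients in its range. *)
Lemma noise_max (I : finType) (k : nat) (T0 : int) (h : nat -> I -> seqT -> 'cV[R]_d) (B ka la : R) :
  (0 < #|I|)%N -> 0 <= ka ->
  (forall t c j, measurable_fun [set: seqT] (fun u => h t c u j 0)) ->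
  (forall t c, dep_on coordinate (fun l => l <= T0 + t%:Z) (h t c)) ->
  (forall t c u j, `|h t c u j 0| <= B) -> 0 <= la -> la * B <= 1 ->
  (forall l (a : 'I_d -> R), (forall j, `|a j| <= 1) ->
     (\int[mu]_v (expR (\sum_j a j * v l j 0))%:E <= (1 + ka * \sum_j a j ^+ 2)%:E)%E) ->
  max_bound mu (fun c u => \sum_(t < k) (la * (\sum_j h t c u j 0 * u (T0 + t%:Z + 1) j 0)
     - ka * la ^+ 2 * \sum_j h t c u j 0 ^+ 2)) (1 + ln #|I|%:R).
Proof.
move=> I0 ka0 mh dh hB la0 laB mgf.
pose Z c t (u : seqT) := la * (\sum_j h t c u j 0 * u (T0 + t%:Z + 1) j 0)
     - ka * la ^+ 2 * \sum_j h t c u j 0 ^+ 2.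
have mZ c t : measurable_fun setT (Z c t).
  apply: measurable_funB; apply: measurable_funM => //; apply: measurable_sum => j.
    by apply: measurable_funM => //; exact: measurable_entry.
  exact: measurable_funX.
apply: (@max_bound_exp _ _ _ mu I (fun c u => \sum_(t < k) Z c t u)) => // c.
  by apply: measurable_sum => t.
apply: (exp_chain coordinate_mix (measurable_mix2 (R := R) (d := d)) (integral_mix muP)
  (A := fun m l => l <= T0 + m%:Z)) => //.
- move=> m m' /andP[m'm mk] u v uv; rewrite /Z.
  have -> : h m' c u = h m' c v by apply: dh => l lm; apply: uv; lia.
  by have -> : u (T0 + m'%:Z + 1) = v (T0 + m'%:Z + 1) by apply: uv; lia.
move=> m u mk.
pose a j := la * h m c u j 0.
have a1 j : `|a j| <= 1.
  rewrite normrM ger0_norm//; apply: le_trans laB; exact: ler_wpM2l.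
pose Q := ka * \sum_j a j ^+ 2.
have Q0 : 0 <= Q by rewrite mulr_ge0// sumr_ge0// => j _; exact: sqr_ge0.
have ZE v : Z c m (mix (fun l => l <= T0 + m%:Z) u v) = - Q + \sum_j a j * v (T0 + m%:Z + 1) j 0.
  rewrite /Z (dep_on_mix coordinate_mix u v (dh m c)).
  rewrite (_ : mix _ u v (T0 + m%:Z + 1) = v (T0 + m%:Z + 1)); last first.
    by rewrite /mix ifF//; apply/negbTE; rewrite -ltNge; lia.
  rewrite addrC /Q /a !mulr_sumr; congr (_ + _); last first.
    by apply: eq_bigr => j _; rewrite mulrA.
  by rewrite -sumrN; apply/esym; rewrite -sumrN; apply: eq_bigr => j _; rewrite exprMn; ring.
under eq_integral do rewrite ZE expRD EFinM.
rewrite ge0_integralZl//; last first.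
  apply/measurable_EFinP; apply: measurableT_comp => //; apply: measurable_sum => j.
  by apply: measurable_funM => //; exact: measurable_entry.
apply: (le_trans (lee_wpmul2l _ (mgf _ _ a1))); first by rewrite lee_fin expR_ge0.
rewrite -EFinM lee_fin expRN mulrC ler_pdivrMr ?expR_gt0// mul1r; exact: expR_ge1Dx.
Qed.

End sequence_model.

Section coupling.
Context {R : realType} {d : nat} {disp : measure_display} {T : measurableType disp}.
Local Notation seqT := (seqT R d).
Local Notation vecT := (vecT R d).
Variables (P : probability T R) (eps eps' : int -> T -> 'cV[R]_d).
Hypothesis eps_meas : forall i, random_vector (eps i).
Hypothesis eps_ident : forall i, same_law P (vec_sigma d) (eps i) (eps 0).
Hypothesis eps_indep : mutually_independent P (fun i => sigma_gen (vec_sigma d) (eps i)).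

Definition innovations (w : T) : seqT := fun i => eps i w.

Lemma measurable_random_vector (Y : T -> 'cV[R]_d) : random_vector Y ->
  measurable_fun setT (Y : T -> vecT).
Proof. by move=> rY; apply: measurable_into_coord => j; exact: rY. Qed.

Lemma measurable_innovations : measurable_fun setT innovations.
Proof. by apply: measurable_into_seq => l; exact: (measurable_random_vector (eps_meas l)). Qed.

Definition innovation_law : probability seqT R := distribution P (mfun_of measurable_innovations).

Lemma innovation_law_iid : iid_law innovation_law (fun B => P (eps 0 @^-1` B)).
Proof.
split; first by rewrite preimage_setT [LHS](probability_setT P).
move=> s B mB sB us; rewrite (cyl_bigcap sB).
rewrite -[LHS]/(P (innovations @^-1` _)) preimage_bigcap.
have := eps_indep us (A := fun l => eps l @^-1` B l); rewrite /sigma_gen.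
have -> : \bigcap_(i in [set` s]) (innovations @^-1` ((fun u : int -> 'cV[R]_d => u i) @^-1` B i)) =
   \bigcap_(i in [set` s]) (eps i @^-1` B i) by [].
move=> ->; last by move=> l _; exists (B l) => //; rewrite setTI.
by apply: eq_bigr => l _; apply: eps_ident.
Qed.

Hypothesis copy : innovation_copy P eps eps'.

(** Both pairs have the same product law, by shift invariance and by independence of the copy. The
    coefficients, defined at time 0 with [eps'], thereby control resampling at every time. *)
Lemma coupling_law (b : int) (ka : nat) (Phi : seqT * vecT -> \bar R) :
  measurable_fun [set: seqT * vecT] Phi -> (forall z, 0 <= Phi z)%E ->
  (\int[innovation_law]_u \int[innovation_law]_v Phi (shift b u, v (b - ka%:Z)%R) =
   \int[P]_w Phi (innovations w, eps' (0 - ka%:Z)%R w))%E.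
Proof.
move=> mPhi Phi0; set mu := innovation_law.
have [rY lY iY] := copy (0 - ka%:Z).
have mY := measurable_random_vector rY.
pose nuY : probability vecT R := distribution P (mfun_of mY).
pose ze (z : seqT * seqT) : seqT * vecT := (shift b z.1, z.2 (b - ka%:Z)).
have mze : measurable_fun setT ze.
  apply: measurable_fun_pair.
    by apply: (measurableT_comp (measurable_shift (R := R) (d := d) b)); exact: measurable_fst.
  by apply: (measurableT_comp (measurable_proj (R := R) (d := d) (b - ka%:Z))); exact: measurable_snd.
pose xi (w : T) : seqT * vecT := (innovations w, eps' (0 - ka%:Z) w).
have mxi : measurable_fun setT xi by apply: measurable_fun_pair => //; exact: measurable_innovations.
have E1 E : measurable E -> (mu \x mu)%E (ze @^-1` E) = (mu \x nuY)%E E.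
  move=> mE; pose zeM : {mfun (seqT * seqT)%type >-> (seqT * vecT)%type} := mfun_of mze.
  apply/esym; apply: (@product_measure_unique _ _ seqT vecT R mu nuY (pushforward (mu \x mu)%E zeM)) => // A B mA mB.
  transitivity ((mu \x mu)%E ((shift b @^-1` A) `*` ((fun u : seqT => u (b - ka%:Z) : vecT) @^-1` B))); first by [].
  have mA' : measurable ((shift b : seqT -> seqT) @^-1` A).
    by rewrite -[X in measurable X]setTI; exact: (measurable_shift (R := R) (d := d) b).
  have mB' : measurable ((fun u : seqT => u (b - ka%:Z) : vecT) @^-1` B).
    by rewrite -[X in measurable X]setTI; exact: (measurable_proj (R := R) (d := d) (b - ka%:Z)).
  transitivity (mu (shift b @^-1` A) * mu ((fun u : seqT => u (b - ka%:Z)%R : vecT) @^-1` B))%E.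
    exact: product_measure1E.
  congr (_ * _)%E; first exact: (pushforward_shift innovation_law_iid b mA).
  transitivity (P (eps (b - ka%:Z) @^-1` B)); first by [].
  transitivity (P (eps' (0 - ka%:Z) @^-1` B)); last by [].
  by rewrite lY// !eps_ident.
have E2 E : measurable E -> P (xi @^-1` E) = (mu \x nuY)%E E.
  move=> mE; pose xiM : {mfun T >-> (seqT * vecT)%type} := mfun_of mxi.
  apply/esym; apply: (@product_measure_unique _ _ seqT vecT R mu nuY (pushforward P xiM)) => // A B mA mB.
  transitivity (P ((eps' (0 - ka%:Z) @^-1` B) `&` (innovations @^-1` A))).
    by rewrite setIC.
  rewrite iY; first by rewrite muleC.
    by exists B => //; rewrite setTI.
  by exists A => //; rewrite setTI.
have I1 := ge0_integral_image mze E1 mPhi Phi0.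
have I2 := ge0_integral_image mxi E2 mPhi Phi0.
rewrite -[RHS]I2 I1 fubini_tonelli1//; first exact: (measurableT_comp mPhi mze).
Qed.

End coupling.

Section process.
Context {R : realType} {d r : nat}.
Local Notation seqT := (seqT R d).
Local Notation vecT := (vecT R).
Variable J : (nat -> 'cV[R]_d) -> 'cV[R]_d.
Hypothesis mJ : measurable_to_vec (fam_sigma nat d) J.

Definition process (u : seqT) (i : int) : 'cV[R]_d := J (fun l => u (i - l%:Z)).

Definition lagged (i : int) (u : seqT) : 'cV[R]_(r * d) := lag r (process u) i.

Lemma lagP (x : int -> 'cV[R]_d) i (m : 'I_(r * d)) :
  exists lj : 'I_r * 'I_d, lag r x i m 0 = x (i - (lj.1)%:Z) lj.2 0.
Proof. by case/mxvec_indexP: m => l j; exists (l, j); rewrite !mxE mxvecE mxE. Qed.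

Let seqN := g_sigma_algebraType (coord_gen (fun (kj : nat * 'I_d) (u : nat -> 'cV[R]_d) => u kj.1 kj.2 0)).

Lemma measurable_J disp (T : measurableType disp) (f : T -> nat -> 'cV[R]_d) :
  (forall l j, measurable_fun setT (fun x => f x l j 0)) ->
  measurable_fun setT (fun x => J (f x) : vecT d).
Proof.
move=> mf; have mf' : measurable_fun setT (f : T -> seqN) by apply: measurable_into_coord => -[l j]; exact: mf.
have mJ' : measurable_fun setT (J : seqN -> vecT d) by move=> _ B mB; rewrite setTI; exact: mJ.
exact: (measurableT_comp mJ' mf').
Qed.

Lemma measurable_process i : measurable_fun setT (fun u : seqT => process u i : vecT d).
Proof. by apply: measurable_J => l j; exact: measurable_entry. Qed.

Lemma measurable_vec_entry m (j : 'I_m) : measurable_fun setT (fun x : vecT m => x j 0).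
Proof. exact: (measurable_coord (c := @vec_coord R m) j). Qed.

Lemma measurable_lagged i : measurable_fun setT (lagged i : seqT -> vecT (r * d)).
Proof.
apply: measurable_into_coord => m; rewrite /vec_coord /=.
have [lj E] := @lagP (fun=> 0) i m.
case/mxvec_indexP: m {lj E} => l j.
rewrite (_ : (fun x => _) = (fun u => process u (i - l%:Z) j 0)); last first.
  by apply/funext => u; rewrite /lagged !mxE mxvecE mxE.
exact: (measurableT_comp (measurable_vec_entry j) (measurable_process _)).
Qed.

Lemma lagged_shift h i u : lagged i (shift h u) = lagged (i + h) u.
Proof.
rewrite /lagged /lag; congr ((mxvec _)^T); apply/matrixP => l j; rewrite !mxE.
by congr (J _ _ _); apply/funext => k; rewrite /shift; congr (u _); ring.
Qed.

Lemma process_dep i : dep_on (@coordinate R d) (fun l => l <= i) (fun u => process u i).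
Proof. by move=> u v uv; congr J; apply/funext => l; apply: uv; lia. Qed.

Lemma lagged_dep i : dep_on (@coordinate R d) (fun l => l <= i) (lagged i).
Proof.
move=> u v uv; congr ((mxvec _)^T); apply/matrixP => l j; rewrite !mxE.
by congr (fun_of_matrix _ _ _); apply: process_dep => k kl; apply: uv; lia.
Qed.

Section distance.
Variables (M CG theta : R).
Hypothesis M0 : 0 < M.
Hypothesis CG0 : 0 <= CG.
Hypothesis th : 0 < theta <= 1.

Definition trunc_dist (x y : 'cV[R]_(r * d)) : R := Num.min M (CG * `|x - y|).

(** Write the square as the product of the powers [2 - 2 theta] and [2 theta], bound the first by
    [M] and the second by the Lipschitz estimate: boundedness is traded for moments, so order
    [2 theta] suffices for a second moment. *)
Lemma trunc_dist_sqr x y : trunc_dist x y ^+ 2 <=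
  (M `^ (2 - 2 * theta) * CG `^ (2 * theta)) * \sum_m `|x m 0 - y m 0| `^ (2 * theta).
Proof.
have /andP[th0 th1] := th; have t20 : 0 < 2 * theta by lra.
set D := `|x - y|; have D0 : 0 <= D by exact: normr_ge0.
set m := trunc_dist x y.
have m0 : 0 <= m by rewrite /m /trunc_dist le_min ltW//= mulr_ge0.
have mM : m <= M by rewrite /m /trunc_dist ge_min lexx.
have mD : m <= CG * D by rewrite /m /trunc_dist ge_min lexx orbT.
have -> : m ^+ 2 = m `^ (2 - 2 * theta) * m `^ (2 * theta).
  rewrite -powR_mulrn// -powRD; first by congr (_ `^ _); ring.
  have -> : 2 - 2 * theta + 2 * theta = 2 by ring.
  by rewrite pnatr_eq0.
have sum0 : 0 <= \sum_m `|x m 0 - y m 0| `^ (2 * theta) by apply: sumr_ge0 => i _; exact: powR_ge0.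
have DS : D `^ (2 * theta) <= \sum_m `|x m 0 - y m 0| `^ (2 * theta).
  set S := \sum_m _ in sum0 *.
  have Dle : D <= S `^ (2 * theta)^-1.
    apply: mx_norm_le => [|i j]; first exact: powR_ge0.
    rewrite (ord1 j) mxE [X in _ + X]mxE.
    have -> : `|x i 0 - y i 0| = (`|x i 0 - y i 0| `^ (2 * theta)) `^ (2 * theta)^-1.
      by rewrite -powRrM mulfV ?gt_eqF// powRr1.
    rewrite ge0_ler_powR ?nnegrE ?powR_ge0//; first by rewrite invr_ge0 ltW.
    by rewrite /S (bigD1 i)//= lerDl; apply: sumr_ge0 => l _; exact: powR_ge0.
  have -> : S = (S `^ (2 * theta)^-1) `^ (2 * theta) by rewrite -powRrM mulVf ?gt_eqF// powRr1.
  by rewrite ge0_ler_powR ?nnegrE ?powR_ge0// ltW.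
rewrite -mulrA; apply: ler_pM; rewrite ?powR_ge0//.
  by rewrite ge0_ler_powR ?nnegrE//; [lra|exact: ltW].
apply: (@le_trans _ _ ((CG * D) `^ (2 * theta))).
  by rewrite ge0_ler_powR ?nnegrE ?mulr_ge0// ltW.
by rewrite powRM// ler_wpM2l// powR_ge0.
Qed.

Lemma measurable_trunc_dist i : measurable_fun setT
  (fun z : seqT * seqT => trunc_dist (lagged i z.1) (lagged i z.2)).
Proof.
apply: measurable_minr => //; apply: measurable_funM => //.
have mn : measurable_fun [set: vecT (r * d)] (fun x : vecT (r * d) => `|(x : 'cV[R]_(r * d))|).
  apply: (@lipschitz_measurable R (r * d) (fun x => `|x|) 1) => x y.
  by rewrite mul1r; exact: ler_dist_dist.
apply: (measurableT_comp (f := fun x : vecT (r * d) => `|(x : 'cV[R]_(r * d))|)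
  (g := fun z : seqT * seqT => (lagged i z.1 - lagged i z.2 : vecT (r * d)))) => //.
apply: measurable_into_coord => m; rewrite /vec_coord /=.
rewrite (_ : (fun x => _) = (fun z => lagged i z.1 m 0 - lagged i z.2 m 0)); last first.
  by apply/funext => z; rewrite !mxE.
apply: measurable_funB.
  apply: (measurableT_comp (f := fun u : seqT => lagged i u m 0) (g := fst)) => //.
  exact: (measurableT_comp (measurable_vec_entry m) (measurable_lagged i)).
apply: (measurableT_comp (f := fun u : seqT => lagged i u m 0) (g := snd)) => //.
exact: (measurableT_comp (measurable_vec_entry m) (measurable_lagged i)).
Qed.

Lemma bdm_trunc_dist i : bdm (fun z : seqT * seqT => trunc_dist (lagged i z.1) (lagged i z.2)).
Proof.
split; first exact: measurable_trunc_dist.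
exists M => z; rewrite ger0_norm /trunc_dist ?ge_min ?lexx// le_min ltW//=.
by rewrite mulr_ge0.
Qed.

Section law.
Context {disp : measure_display} {T : measurableType disp}.
Variables (P : probability T R) (eps eps' : int -> T -> 'cV[R]_d).
Hypothesis eps_meas : forall i, random_vector (eps i).
Hypothesis eps_ident : forall i, same_law P (vec_sigma d) (eps i) (eps 0).
Hypothesis eps_indep : mutually_independent P (fun i => sigma_gen (vec_sigma d) (eps i)).
Hypothesis copy : innovation_copy P eps eps'.
Variable eta : nat -> R.
Hypothesis eta0 : forall j, 0 <= eta j.
Hypothesis dep_eta : forall (j l : nat) (m : 'I_d), (l < r)%N -> (l <= j)%N ->
  (\int[P]_w (`|J (fun i => eps (0 - i%:Z) w) m 0 - coupled J eps eps' 0 (j - l) w m 0| `^ (2 * theta))%:E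
   <= (eta j ^+ 2)%:E)%E.

Let mu := innovation_law P eps_meas.
Let muP := innovation_law_iid eps_meas eps_ident eps_indep.

Lemma resample_entry (i : int) (j : nat) (m : 'I_(r * d)) :
  (\int[mu]_u \int[mu]_v (`|lagged i u m 0 - lagged i (resample (Om := seqT) (@mix R d) (i - j%:Z)%R u v) m 0| `^ (2 * theta))%:E
   <= (eta j ^+ 2)%:E)%E.
Proof.
have /andP[th0 th1] := th; have t20 : 2 * theta != 0 by rewrite gt_eqF//; lra.
case/mxvec_indexP: m => l m.
pose b := i - l%:Z.
have E u v : `|lagged i u (mxvec_index l m) 0 - lagged i (resample (Om := seqT) (@mix R d) (i - j%:Z) u v) (mxvec_index l m) 0| =
    `|process u b m 0 - process (resample (Om := seqT) (@mix R d) (i - j%:Z) u v) b m 0|.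
  by rewrite /lagged !mxE !mxvecE !mxE.
under eq_integral => u _ do under eq_integral => v _ do rewrite E.
(* If [j < l] the entry belongs to time [i - l], before the resampled innovation [i - j], and does
   not change. *)
have [lj|lj] := leqP l j; last first.
  have E0 u v : process (resample (Om := seqT) (@mix R d) (i - j%:Z) u v) b = process u b.
    apply: process_dep => l' l'b; rewrite /coordinate /resample /mix ifT//.
    by rewrite /b in l'b; lia.
  under eq_integral => u _ do under eq_integral => v _ do rewrite E0 subrr normr0 powR0//.
  by under eq_integral do rewrite integral0; rewrite integral0 lee_fin sqr_ge0.
pose Phi (z : seqT * vecT d) : \bar R := (`|J (fun k => z.1 (0 - k%:Z)) m 0
   - J (fun k => if k == (j - l)%N then z.2 else z.1 (0 - k%:Z)) m 0| `^ (2 * theta))%:E.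
have mPhi : measurable_fun setT Phi.
  apply/measurable_EFinP; apply: (measurableT_comp (measurable_powR _)).
  apply: measurableT_comp => //; apply: measurable_funB.
    apply: (measurableT_comp (measurable_vec_entry m)).
    apply: measurable_J => k j'; apply: (measurableT_comp (measurable_entry _ _)); exact: measurable_fst.
  apply: (measurableT_comp (measurable_vec_entry m)).
  apply: measurable_J => k j'; case: (k == _).
    by apply: (measurableT_comp (measurable_vec_entry j')); exact: measurable_snd.
  by apply: (measurableT_comp (measurable_entry _ _)); exact: measurable_fst.
have := coupling_law eps_meas eps_ident eps_indep copy b (j - l) mPhi.
move=> /(_ (fun z => _)) h.
rewrite (_ : (\int[mu]_u _)%E = (\int[mu]_u \int[mu]_v Phi (shift b u, v (b - (j - l)%N%:Z)%R))%E); last first.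
  apply: eq_integral => u _; apply: eq_integral => v _; rewrite /Phi/=.
  congr ((`| _ - _ | `^ _)%:E); congr (J _ _ _); apply/funext => k; rewrite /shift.
    by congr (u _); rewrite add0r addrC.
  rewrite /resample /mix; have [->|kj] := eqVneq k (j - l)%N.
    by rewrite ifF//; apply/negbTE; rewrite negbK; apply/eqP; rewrite /b; lia.
  rewrite ifT; first by congr (u _); rewrite add0r addrC.
  by apply/eqP => h'; move/eqP: kj; apply; rewrite /b in h'; lia.
rewrite h; last by move=> z; rewrite lee_fin powR_ge0.
apply: le_trans (dep_eta m (ltn_ord l) lj).
rewrite le_eqVlt; apply/orP; left; apply/eqP; apply: eq_integral => w _; rewrite /Phi /=.
congr ((`| _ - _ | `^ _)%:E); rewrite /coupled; congr (J _ _ _); apply/funext => k.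
by case: eqVneq => // ->.
Qed.

Definition coupling_cst : R := Num.sqrt (M `^ (2 - 2 * theta) * CG `^ (2 * theta) * (r * d)%:R).

Lemma step_var_bound (i : int) (j : nat) :
  \int[mu]_u step_var mu (@mix R d) (i - j%:Z) (fun u v => trunc_dist (lagged i u) (lagged i v)) u
    <= (coupling_cst * eta j) ^+ 2.
Proof.
pose Bf (u v : seqT) := trunc_dist (lagged i u) (lagged i v); pose a := i - j%:Z.
rewrite -/a -/Bf.
have bB : bdm (fun z : seqT * seqT => Bf z.1 z.2) by exact: bdm_trunc_dist.
have mm := measurable_mix2 (R := R) (d := d).
have bs := bdm_resample mm a bB.
set Ct := M `^ (2 - 2 * theta) * CG `^ (2 * theta).
have Ct0 : 0 <= Ct by rewrite mulr_ge0 ?powR_ge0.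
pose F m (z : seqT * seqT) := `|lagged i z.1 m 0 - lagged i (resample (Om := seqT) (@mix R d) a z.1 z.2) m 0| `^ (2 * theta).
have F0 m z : 0 <= F m z by exact: powR_ge0.
have mF m : measurable_fun setT (F m).
  apply: (measurableT_comp (measurable_powR _)); apply: measurableT_comp => //; apply: measurable_funB.
    apply: (measurableT_comp (f := fun u : seqT => lagged i u m 0) (g := fst)) => //.
    exact: (measurableT_comp (measurable_vec_entry m) (measurable_lagged i)).
  apply: (measurableT_comp (f := fun u : seqT => lagged i u m 0)
     (g := fun z : seqT * seqT => resample (Om := seqT) (@mix R d) a z.1 z.2)); last exact: mm.
  exact: (measurableT_comp (measurable_vec_entry m) (measurable_lagged i)).
have iF m : (\int[(mu \x mu)%E]_z (F m z)%:E <= (eta j ^+ 2)%:E)%E.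
  rewrite fubini_tonelli1; last 2 first.
  - exact/measurable_EFinP.
  - by move=> z; rewrite lee_fin.
  exact: resample_entry.
rewrite -lee_fin EFin_Rint; last exact: bdm_step_var.
have bsl u : bdm (fun v : seqT => Bf u (resample (Om := seqT) (@mix R d) a u v) ^+ 2) by exact: (bdm_slice u bs).
under eq_integral => u _ do rewrite /step_var (EFin_Rint mu (bsl u)).
have := @fubini_tonelli1 _ _ _ _ _ mu mu (fun z => (Bf z.1 (resample (Om := seqT) (@mix R d) a z.1 z.2) ^+ 2)%:E).
rewrite /fubini_F /= => <-; last 2 first.
- by apply/measurable_EFinP; case: bs.
- by move=> z; rewrite lee_fin sqr_ge0.
apply: (@le_trans _ _ (\int[(mu \x mu)%E]_z (Ct%:E * \sum_m (F m z)%:E))%E).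
  apply: ge0_le_integral => //.
  - by move=> z _; rewrite lee_fin sqr_ge0.
  - by apply/measurable_EFinP; case: bs.
  - apply: measurable_funeM; apply: emeasurable_sum => m; exact/measurable_EFinP.
  by move=> z _; rewrite sumEFin -EFinM lee_fin; exact: trunc_dist_sqr.
rewrite ge0_integralZl//; last 2 first.
- by apply: emeasurable_sum => m; exact/measurable_EFinP.
- by move=> z _; apply: sume_ge0 => m _; rewrite lee_fin.
rewrite ge0_integral_sum//; last 2 first.
- by move=> m; exact/measurable_EFinP.
- by move=> m z _; rewrite lee_fin.
apply: (@le_trans _ _ (Ct%:E * \sum_(m < r * d) (eta j ^+ 2)%:E)%E).
  by apply: lee_wpmul2l; [rewrite lee_fin|apply: lee_sum => m _; exact: iF].
rewrite sumEFin -EFinM lee_fin sumr_const card_ord exprMn sqr_sqrtr; last by rewrite mulr_ge0.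
by rewrite -[eta j ^+ 2 *+ _]mulr_natl mulrA.
Qed.

Lemma dependence_max (I : finType) (k : nat) (T0 : int) (g : I -> 'cV[R]_(r * d) -> R) q S :
  (0 < #|I|)%N -> (0 < k)%N -> (0 < q)%N ->
  (forall c, measurable_fun [set: vecT (r * d)] (g c)) ->
  (forall c x, 0 <= g c x <= M) ->
  (forall c x y, `|g c x - g c y| <= CG * `|x - y|) ->
  (forall n, \sum_(j < n) coupling_cst * eta (q + j)%N <= S) ->
  max_bound mu (fun c u => \sum_(t < k) ((\int[mu]_u' g c (lagged 0 u')) / 2 - g c (lagged (T0 + t%:Z) u)))
    (q%:R * (M * (1 + ln #|I|%:R)) + 3 * Num.sqrt (k%:R * (1 + ln #|I|%:R)) * S + 2).
Proof.
move=> I0 k0 q0 mg g0M gL hS.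
have mG t c : measurable_fun setT (fun u : seqT => g c (lagged (T0 + t%:Z) u)).
  exact: (measurableT_comp (mg c) (measurable_lagged _)).
apply: (coupling_max (@coordinate_inj R d) (@coordinate_mix R d) (measurable_mix2 (R := R) (d := d))
   (integral_mix muP) (G := fun t c u => g c (lagged (T0 + t%:Z) u)) (T0 := T0) I0 M0 mG
   (fun t c u => g0M c _) _ _ (Bf := fun t u v => trunc_dist (lagged (T0 + t%:Z) u) (lagged (T0 + t%:Z) v))
   _ _ (s := fun j => coupling_cst * eta j)) => //.
- by move=> t c u v uv; rewrite (lagged_dep uv).
- move=> t c.
  have bg i : bdm (fun u : seqT => g c (lagged i u)).
    split; first exact: (measurableT_comp (mg c) (measurable_lagged _)).
    by exists M => u; have /andP[? ?] := g0M c (lagged i u); rewrite ger0_norm.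
  apply: EFin_inj; rewrite !EFin_Rint//.
  rewrite [RHS](integral_shift muP (T0 + t%:Z)).
  + by apply: eq_integral => u _; rewrite lagged_shift add0r.
  + by apply/measurable_EFinP; case: (bg 0).
  + by move=> u; rewrite lee_fin; case/andP: (g0M c (lagged 0 u)).
- by move=> t; exact: bdm_trunc_dist.
- move=> t c u v; rewrite /trunc_dist le_min gL andbT ler_norml.
  by have := g0M c (lagged (T0 + t%:Z) u); have := g0M c (lagged (T0 + t%:Z) v); lra.
- by move=> j; rewrite mulr_ge0// sqrtr_ge0.
- by move=> t j; exact: step_var_bound.
- move=> t c e e0; rewrite /trunc_cexp.
  have [J0 hJ] := tail_density muP (T0 + t%:Z + 1) (mG t c) (fun u => g0M c _) M0 e0.
  by exists J0.
Qed.

End law.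
End distance.
End process.

(** * The oracle inequality *)

(** The compensator returns [SA] with the coefficient [2 * 2 * 2 / 16 = 1 / 2]. Absorbing it on the
    left doubles the other constants. *)
Lemma erm_arith {R : realType} (la ka W2 de c Se SA Ss Sh Sf Nz Q k : R) :
  0 < la -> 0 <= ka -> 16 * (ka * la) <= 1 ->
  Sh <= Ss + 2 * Sf -> Sf <= Nz + de * Se -> la * Nz - ka * la ^+ 2 * Q <= W2 ->
  Q <= 2 * SA + 2 * Ss -> SA <= 2 * Sh + k * (2 * c) -> 0 <= Ss -> 0 <= SA ->
  SA <= 5 * Ss + 8 / la * W2 + 8 * de * Se + 4 * k * c.
Proof.
move=> la0 ka0 kala h1 h2 h3 h4 h5 h6 h7.
have h8 : ka * la * Q <= 16^-1 * (2 * SA + 2 * Ss).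
  apply: (@le_trans _ _ (ka * la * (2 * SA + 2 * Ss))).
    by apply: ler_wpM2l => //; apply: mulr_ge0 => //; exact: ltW.
  by apply: ler_wpM2r; lra.
have h9 : Nz <= la^-1 * W2 + ka * la * Q.
  have -> : Nz = la^-1 * (la * Nz - ka * la ^+ 2 * Q) + ka * la * Q.
    by field; rewrite gt_eqF.
  by rewrite lerD2r ler_wpM2l// invr_ge0 ltW.
have -> : 8 / la * W2 = 8 * (la^-1 * W2) by ring.
lra.
Qed.

Section empirical_risk.
Context {R : realType} {d r : nat}.
Variable (f0 : 'cV[R]_(r * d) -> 'cV[R]_d) (Wf : 'cV[R]_(r * d) -> R).
Hypothesis d0 : (0 < d)%N.
Hypothesis W01 : forall x, 0 <= Wf x <= 1.
Hypothesis Wcube : forall x, Wf x != 0 -> cube (r * d) x.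

Definition sqdist (f g : 'cV[R]_(r * d) -> 'cV[R]_d) (y : 'cV[R]_(r * d)) : R :=
  \sum_j (f y j 0 - g y j 0) ^+ 2 * Wf y.

Definition loss (f : 'cV[R]_(r * d) -> 'cV[R]_d) (y : 'cV[R]_(r * d)) : R :=
  d%:R^-1 * sqdist f f0 y.

Lemma norm2_sqr m (x : 'cV[R]_m) : norm2 x ^+ 2 = \sum_j x j 0 ^+ 2.
Proof. by rewrite /norm2 sqr_sqrtr// sumr_ge0// => j _; exact: sqr_ge0. Qed.

Lemma lossE f y : d%:R^-1 * (norm2 (f y - f0 y) ^+ 2 * Wf y) = loss f y.
Proof.
rewrite /loss /sqdist norm2_sqr mulr_suml; congr (_ * _).
by apply: eq_bigr => j _; rewrite !mxE.
Qed.

Lemma sqdist_ge0 f g y : 0 <= sqdist f g y.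
Proof. by apply: sumr_ge0 => j _; rewrite mulr_ge0 ?sqr_ge0//; case/andP: (W01 y). Qed.

Lemma sqdist_tri f g h y : sqdist f h y <= 2 * sqdist f g y + 2 * sqdist g h y.
Proof.
rewrite /sqdist !mulr_sumr -big_split/=; apply: ler_sum => j _.
have /andP[W0 _] := W01 y; rewrite !mulrA -mulrDl ler_wpM2r//.
have := sqr_ge0 (f y j 0 - g y j 0 - (g y j 0 - h y j 0)); lra.
Qed.

Lemma sqdist_le f g y de : 0 <= de -> (cube (r * d) y -> `|f y - g y| <= de) ->
  sqdist f g y <= d%:R * de ^+ 2.
Proof.
move=> de0 h; have [W0|W0] := eqVneq (Wf y) 0.
  by rewrite /sqdist big1 ?mulr_ge0 ?sqr_ge0// => j _; rewrite W0 mulr0.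
have {}h := h (Wcube W0); rewrite mulr_natl -[X in _ *+ X]card_ord -sumr_const.
apply: ler_sum => j _; have /andP[W00 W1] := W01 y.
rewrite -[leRHS]mulr1 ler_pM ?sqr_ge0// -(real_normK (num_real (_ - _))) lerXn2r ?nnegrE//.
by apply: le_trans h; exact: cV_entry_le.
Qed.

(* The basic inequality for a minimizer fh of the empirical risk, compared with
   the member fs of the class; fc is the element of the covering close to fh,
   and the noise term is absorbed in the quadratic one (la is small). *)
Lemma erm_path (n : nat) (x e : int -> 'cV[R]_d) fh fs fc (de la ka W2 : R) : (r < n)%N ->
  (forall i, x i = f0 (lag r x (i - 1)) + e i) ->
  emp_risk Wf n x fh <= emp_risk Wf n x fs ->
  0 <= de -> (forall y, cube (r * d) y -> `|fh y - fc y| <= de) ->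
  0 < la -> 0 <= ka -> 16 * (ka * la) <= 1 ->
  \sum_(t < n - r) (la * (\sum_j ((fc (lag r x (r%:Z + t%:Z)) - fs (lag r x (r%:Z + t%:Z))) j 0 * Wf (lag r x (r%:Z + t%:Z))) * e (r%:Z + t%:Z + 1) j 0)
     - ka * la ^+ 2 * \sum_j ((fc (lag r x (r%:Z + t%:Z)) - fs (lag r x (r%:Z + t%:Z))) j 0 * Wf (lag r x (r%:Z + t%:Z))) ^+ 2) <= W2 ->
  \sum_(t < n - r) sqdist fc f0 (lag r x (r%:Z + t%:Z)) <=
    5 * (\sum_(t < n - r) sqdist fs f0 (lag r x (r%:Z + t%:Z))) + 8 / la * W2
    + 8 * de * (\sum_(t < n - r) \sum_j `|e (r%:Z + t%:Z + 1) j 0|) + 4 * (n - r)%:R * (d%:R * de ^+ 2).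
Proof.
move=> rn xE hrisk de0 hde la0 ka0 kala hW2.
pose y t := lag r x (r%:Z + t%:Z); pose ee t := e (r%:Z + t%:Z + 1).
have riskE f : emp_risk Wf n x f = n%:R^-1 * (d%:R^-1 *
    \sum_(t < n - r) \sum_j (f0 (y t) j 0 + ee t j 0 - f (y t) j 0) ^+ 2 * Wf (y t)).
  rewrite /emp_risk; congr (_ * _); rewrite mulr_sumr -{1}[r.+1]add0n big_addn subSS big_mkord.
  apply: eq_bigr => t _.
  have iE : (t + r.+1)%:Z - 1 = r%:Z + t%:Z by lia.
  have iE' : (t + r.+1)%:Z = r%:Z + t%:Z + 1 by lia.
  rewrite iE norm2_sqr -mulrA mulr_suml; congr (_ * _); apply: eq_bigr => j _.
  by rewrite iE' (xE (r%:Z + t%:Z + 1)) addrK !mxE.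
have nR : 0 < n%:R^-1 :> R by rewrite invr_gt0 ltr0n (leq_ltn_trans _ rn).
have dR : 0 < d%:R^-1 :> R by rewrite invr_gt0 ltr0n.
move: hrisk; rewrite !riskE (ler_pM2l nR) (ler_pM2l dR) => hrisk.
pose Ah t := sqdist fh f0 (y t); pose As t := sqdist fs f0 (y t); pose Ac t := sqdist fc f0 (y t).
pose hh t j := (fc (y t) - fs (y t)) j 0 * Wf (y t).
have basic : \sum_(t < n - r) Ah t <= \sum_(t < n - r) As t
    + 2 * \sum_(t < n - r) \sum_j (ee t j 0 * (fh (y t) j 0 - fs (y t) j 0) * Wf (y t)).
  rewrite -subr_ge0; move: hrisk; rewrite -subr_ge0; congr (0 <= _).
  rewrite mulr_sumr -big_split/= -!sumrB; apply: eq_bigr => t _.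
  rewrite /Ah /As /sqdist mulr_sumr -big_split/= -!sumrB; apply: eq_bigr => j _.
  ring.
have noise : \sum_(t < n - r) \sum_j (ee t j 0 * (fh (y t) j 0 - fs (y t) j 0) * Wf (y t)) <=
    \sum_(t < n - r) \sum_j (hh t j * ee t j 0) + de * \sum_(t < n - r) \sum_j `|ee t j 0|.
  rewrite mulr_sumr -big_split/=; apply: ler_sum => t _.
  rewrite mulr_sumr -big_split/=; apply: ler_sum => j _.
  rewrite /hh !mxE; have /andP[W0 W1] := W01 (y t).
  rewrite (_ : _ * _ * Wf (y t) = (fc (y t) j 0 - fs (y t) j 0) * Wf (y t) * ee t j 0
    + ee t j 0 * ((fh (y t) j 0 - fc (y t) j 0) * Wf (y t))); last by ring.
  rewrite lerD2l (le_trans (ler_norm _))// normrM mulrC ler_wpM2r// normrM (ger0_norm W0).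
  have [Wz|Wz] := eqVneq (Wf (y t)) 0; first by rewrite Wz mulr0.
  rewrite -[leRHS]mulr1 ler_pM//; apply: le_trans (hde _ (Wcube Wz)); exact: cV_entry_le.
have quad t : \sum_j hh t j ^+ 2 <= 2 * Ac t + 2 * As t.
  apply: (@le_trans _ _ (sqdist fc fs (y t))).
    apply: ler_sum => j _; rewrite /hh !mxE exprMn ler_wpM2l ?sqr_ge0//.
    by have /andP[W0 W1] := W01 (y t); rewrite expr2 ler_piMl.
  apply: (le_trans (sqdist_tri fc f0 fs _)); rewrite lerD2l.
  by rewrite /As /sqdist; apply: ler_wpM2l => //; apply: ler_sum => j _; rewrite -sqrrN opprB.
have close t : Ac t <= 2 * Ah t + 2 * (d%:R * de ^+ 2).
  apply: (le_trans (sqdist_tri fc fh f0 _)); rewrite addrC lerD2l ler_wpM2l//.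
  by apply: sqdist_le => // yc; rewrite distrC; exact: hde.
move: hW2; rewrite -[X in X <= W2]/(\sum_(t < n - r) (la * (\sum_j hh t j * ee t j 0) - ka * la ^+ 2 * \sum_j hh t j ^+ 2)).
rewrite sumrB -!mulr_sumr => hW2.
have Sq : \sum_(t < n - r) \sum_j hh t j ^+ 2 <= 2 * \sum_(t < n - r) Ac t + 2 * \sum_(t < n - r) As t.
  by rewrite !mulr_sumr -big_split/=; apply: ler_sum => t _; exact: quad.
have Sc : \sum_(t < n - r) Ac t <= 2 * \sum_(t < n - r) Ah t + (n - r)%:R * (2 * (d%:R * de ^+ 2)).
  rewrite mulr_sumr (_ : (n - r)%:R * _ = \sum_(t < n - r) 2 * (d%:R * de ^+ 2)); last first.
    by rewrite sumr_const card_ord mulr_natl.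
  rewrite -big_split/=.
  by apply: ler_sum => t _; exact: close.
have Ss0 : 0 <= \sum_(t < n - r) As t by apply: sumr_ge0 => t _; exact: sqdist_ge0.
have Sc0 : 0 <= \sum_(t < n - r) Ac t by apply: sumr_ge0 => t _; exact: sqdist_ge0.
exact: (erm_arith la0 ka0 kala basic noise hW2 Sq Sc Ss0 Sc0).
Qed.

End empirical_risk.

Section class_loss.
Context {R : realType} {d r : nat}.
Variable (f0 : 'cV[R]_(r * d) -> 'cV[R]_d) (Wf : 'cV[R]_(r * d) -> R) (wi KL F Lip : R).
Hypothesis d0 : (0 < d)%N.
Hypothesis W01 : forall x, 0 <= Wf x <= 1.
Hypothesis Wcube : forall x, Wf x != 0 -> cube (r * d) x.
Hypothesis WL : forall x y, `|Wf x - Wf y| <= wi * `|x - y|.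
Hypothesis f0F : forall x, cube (r * d) x -> `|f0 x| <= F.
Hypothesis f0L : forall x y, cube (r * d) x -> cube (r * d) y -> `|f0 x - f0 y| <= KL * `|x - y|.
Variable f : 'cV[R]_(r * d) -> 'cV[R]_d.
Hypothesis fF : forall x, `|f x| <= F.
Hypothesis fL : forall x y, `|f x - f y| <= Lip * `|x - y|.

Lemma loss_entry_norm x j : Wf x != 0 -> `|f x j 0 - f0 x j 0| <= 2 * F.
Proof.
move=> /Wcube xc; apply: (le_trans (ler_normB _ _)).
have := mx_entry_le (f x) j 0; have := mx_entry_le (f0 x) j 0; have := fF x; have := f0F xc; lra.
Qed.

Lemma loss_entry_sqr x j : Wf x != 0 -> (f x j 0 - f0 x j 0) ^+ 2 <= 4 * F ^+ 2.
Proof.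
move=> xW; rewrite -(real_normK (num_real (_ - _))) (_ : 4 * F ^+ 2 = (2 * F) ^+ 2); last by ring.
by have h := loss_entry_norm j xW; rewrite lerXn2r ?nnegrE// (le_trans _ h).
Qed.

Lemma loss_ge0 x : 0 <= loss f0 Wf f x.
Proof. by rewrite mulr_ge0 ?invr_ge0// sqdist_ge0. Qed.

Lemma avg_le (a : 'I_d -> R) c : (forall j, a j <= c) -> d%:R^-1 * (\sum_j a j) <= c.
Proof.
move=> ac; have dR : 0 < d%:R :> R by rewrite ltr0n.
rewrite mulrC ler_pdivrMr// mulr_natr -[X in _ *+ X]card_ord -sumr_const.
by apply: ler_sum => j _; exact: ac.
Qed.

Lemma loss_le x : loss f0 Wf f x <= 4 * F ^+ 2.
Proof.
apply: avg_le => j; have [->|W0] := eqVneq (Wf x) 0; first by rewrite mulr0 mulr_ge0 ?sqr_ge0.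
have /andP[W00 W1] := W01 x.
by apply: (le_trans _ (loss_entry_sqr j W0)); rewrite ler_piMr ?sqr_ge0.
Qed.

Let CG := 4 * F * (Lip + KL) + 4 * F ^+ 2 * wi.

(** [f0] is controlled on the cube only. Where both weights are nonzero both points lie in it; if
    one weight vanishes, the Lipschitz bound of [Wf] alone carries the estimate. *)
Lemma loss_entry_lip x y j : 0 <= F -> 0 <= Lip + KL ->
  `|(f x j 0 - f0 x j 0) ^+ 2 * Wf x - (f y j 0 - f0 y j 0) ^+ 2 * Wf y| <= CG * `|x - y|.
Proof.
move=> F0 LK0.
have D0 : 0 <= `|x - y| by exact: normr_ge0.
have FL0 : 0 <= 4 * F * (Lip + KL) * `|x - y| by rewrite !mulr_ge0.
rewrite /CG mulrDl.
have one u v : Wf v = 0 -> `|u - v| = `|x - y| ->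
    `|(f u j 0 - f0 u j 0) ^+ 2 * Wf u - (f v j 0 - f0 v j 0) ^+ 2 * Wf v| <=
    4 * F * (Lip + KL) * `|x - y| + 4 * F ^+ 2 * wi * `|x - y|.
  move=> Wv uv; rewrite Wv mulr0 subr0; have [Wu|Wu] := eqVneq (Wf u) 0.
    rewrite Wu mulr0 normr0 addr_ge0//.
    have := WL u v; rewrite Wu Wv subrr normr0 uv -mulrA => h; rewrite mulr_ge0//.
    by rewrite mulr_ge0 ?sqr_ge0.
  apply: (@le_trans _ _ (4 * F ^+ 2 * wi * `|x - y|)); last by rewrite lerDr.
  rewrite normrM ger0_norm ?sqr_ge0// -mulrA ler_pM ?sqr_ge0//; first exact: loss_entry_sqr.
  by have := WL u v; rewrite Wv subr0 uv.
have [Wy|Wy] := eqVneq (Wf y) 0; first exact: one.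
have [Wx|Wx] := eqVneq (Wf x) 0; first by rewrite distrC; apply: one => //; rewrite distrC.
rewrite (_ : _ - _ = (f x j 0 - f0 x j 0 + (f y j 0 - f0 y j 0)) *
   ((f x j 0 - f y j 0) - (f0 x j 0 - f0 y j 0)) * Wf x + (f y j 0 - f0 y j 0) ^+ 2 * (Wf x - Wf y)); last by ring.
apply: (le_trans (ler_normD _ _)); apply: lerD; last first.
  rewrite normrM [`|_ ^+ 2|]ger0_norm ?sqr_ge0// -mulrA ler_pM ?sqr_ge0//.
  exact: loss_entry_sqr.
rewrite !normrM; have /andP[W0 W1] := W01 x.
rewrite -[leRHS]mulr1; apply: ler_pM; rewrite ?mulr_ge0//; last by rewrite ger0_norm.
rewrite -mulrA; apply: ler_pM => //.
  apply: (le_trans (ler_normD _ _)).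
  by have := loss_entry_norm j Wx; have := loss_entry_norm j Wy; lra.
apply: (le_trans (ler_normB _ _)); rewrite mulrDl; apply: lerD.
  exact: (le_trans (cV_entry_le _ _ _)).
by apply: (le_trans (cV_entry_le _ _ _)); apply: f0L; exact: Wcube.
Qed.

Lemma loss_lip x y : 0 <= F -> 0 <= Lip + KL ->
  `|loss f0 Wf f x - loss f0 Wf f y| <= CG * `|x - y|.
Proof.
move=> F0 LK0; rewrite /loss -mulrBr normrM ger0_norm ?invr_ge0//.
apply: (@le_trans _ _ (d%:R^-1 * (\sum_j `|(f x j 0 - f0 x j 0) ^+ 2 * Wf x - (f y j 0 - f0 y j 0) ^+ 2 * Wf y|))).
  by rewrite ler_wpM2l ?invr_ge0// /sqdist -sumrB ler_norm_sum.
by apply: avg_le => j; exact: loss_entry_lip.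
Qed.

Lemma lip_entry_measurable j : measurable_fun [set: vecT R (r * d)] (fun y => f y j 0).
Proof.
apply: (@lipschitz_measurable R (r * d) (fun x => f x j 0) Lip) => x y.
exact: (le_trans (cV_entry_le _ _ _)).
Qed.

Lemma weight_measurable : measurable_fun [set: vecT R (r * d)] Wf.
Proof. exact: (@lipschitz_measurable R (r * d) Wf wi). Qed.

Lemma loss_measurable :
  (forall j, measurable_fun [set: vecT R (r * d)] (fun y => f0 y j 0)) ->
  measurable_fun [set: vecT R (r * d)] (loss f0 Wf f).
Proof.
move=> mf0; apply: measurable_funM => //; apply: measurable_sum => j.
apply: measurable_funM; last exact: weight_measurable.
by apply: measurable_funX; apply: measurable_funB => //; exact: lip_entry_measurable.
Qed.

End class_loss.

(** Here [w] is the square root of [Lambda_dep ybar x], and [q] is one more than the first index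
    where [Delta] drops below [w]. The leading term of [Vtilde] and the [q0] minima equal to [w]
    give [q w <= ybar x]; squared, this is even [q^2 x <= Lambda_dep ybar x]. From there on the
    minima are the [Delta] themselves. *)
Lemma dep_split {R : realType} (Delta : nat -> R) (ybar : R -> R) x : 0 < x ->
  (forall k, 0 <= Delta k) -> (forall k l, (k <= l)%N -> Delta l <= Delta k) ->
  dep_solution Delta ybar ->
  exists q, [/\ (0 < q)%N, q%:R * x <= Lambda_dep ybar x &
     forall n, \sum_(j < n) Delta (q + j)%N <= ybar x].
Proof.
move=> x0 D0 Dmon hy; have [_ /(_ x0) y0 hV] := hy x (ltW x0).
set y := ybar x in y0 hV *; pose z := Num.sqrt x * y; pose w := Num.sqrt z.
have sx0 : 0 < Num.sqrt x by rewrite sqrtr_gt0.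
have z0 : 0 < z by rewrite mulr_gt0.
have w0 : 0 < w by rewrite sqrtr_gt0.
have ps n : w + \sum_(j < n) Num.min w (Delta j) <= y.
  rewrite -lee_fin; apply: le_trans hV; rewrite /Vtilde EFinD leeD2l// -sumEFin.
  rewrite -(big_mkord xpredT (fun j => (Num.min w (Delta j))%:E)).
  by apply: nneseries_lim_ge => k _ _; rewrite lee_fin le_min D0 ltW.
(* Otherwise all minima would equal [w > 0], and enough of them would exceed [y]. *)
have exq : exists q, Delta q < w.
  apply: contrapT => /forallNP nq.
  have := ps (Num.truncn (y / w)); rewrite (eq_bigr (fun=> w)); last first.
    by move=> j _; apply/min_idPl; rewrite leNgt; apply/negP; exact: nq.
  rewrite sumr_const card_ord -mulrS -[w *+ _]mulr_natl.
  have := truncnS_gt (y / w); rewrite ltr_pdivrMr// => h1 h2.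
  by have := lt_le_trans h1 h2; rewrite ltxx.
pose q0 := ex_minn exq; have q0P : Delta q0 < w by rewrite /q0; case: ex_minnP.
have q0m j : (j < q0)%N -> w <= Delta j.
  by rewrite /q0; case: ex_minnP => m _ hm jm; rewrite leNgt; apply/negP => /hm; rewrite leqNgt jm.
have wq : q0.+1%:R * w <= y.
  apply: le_trans (ps q0); rewrite (eq_bigr (fun=> w)); last first.
    by move=> j _; apply/min_idPl; exact: q0m.
  by rewrite sumr_const card_ord -mulrS mulr_natl.
exists q0.+1; split => // [|n].
  rewrite /Lambda_dep -/y -/z.
  have qw0 : 0 <= q0.+1%:R * w by rewrite mulr_ge0// ltW.
  have h1 : (q0.+1%:R * w) ^+ 2 <= y ^+ 2 by rewrite lerXn2r ?nnegrE// ltW.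
  have w2 : w * w = Num.sqrt x * y by rewrite -expr2 [LHS]sqr_sqrtr// ltW.
  have x2 : Num.sqrt x * Num.sqrt x = x by rewrite -expr2 sqr_sqrtr// ltW.
  have h2 : q0.+1%:R * q0.+1%:R * Num.sqrt x <= y.
    rewrite -(ler_pM2r y0) (_ : _ * y = (q0.+1%:R * w) ^+ 2) ?expr2// mulrACA w2; ring.
  rewrite -{1}x2 /z mulrCA ler_pM2l//; apply: le_trans h2.
  by rewrite -mulrA ler_peMl ?mulr_ge0 ?sqrtr_ge0// ler1n.
apply: le_trans (ps (q0.+1 + n)%N).
rewrite big_split_ord/= addrA -[leLHS]add0r; apply: lerD.
  apply: addr_ge0; [exact: ltW|apply: sumr_ge0 => j _; by rewrite le_min D0 ltW].
apply: ler_sum => j _; rewrite le_min lexx andbT (le_trans _ (ltW q0P))//.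
by apply: Dmon; rewrite addSnnS leq_addr.
Qed.

(** Made for the risk of the estimator, whose measurability in the sample is not at hand. The
    integral is a supremum over simple functions below; adding [+oo] to [U] on the null set makes
    the comparison hold everywhere without changing the integral of [U]. *)
Lemma ge0_integral_ae_le {R : realType} {disp} {T : measurableType disp} (P : {measure set T -> \bar R})
    (h U : T -> \bar R) : (forall w, 0 <= h w)%E -> measurable_fun setT U ->
  (forall w, 0 <= U w)%E -> {ae P, forall w, (h w <= U w)%E} ->
  (\int[P]_w h w <= \int[P]_w U w)%E.
Proof.
move=> h0 mU U0 [N [mN PN hN]].
pose V w := (U w + +oo * (\1_N w : R)%:E)%E.
have V0 w : (0 <= V w)%E by rewrite /V adde_ge0// mule_ge0// lee_fin.
have mV : measurable_fun setT V.
  apply: emeasurable_funD => //; apply: measurable_funeM; apply/measurable_EFinP.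
  exact: measurable_indic.
have VN w : ~ N w -> V w = U w by move=> wN; rewrite /V indicE memNset// mule0 adde0.
have -> : (\int[P]_w U w = \int[P]_w V w)%E.
  apply: ge0_ae_eq_integral => //; exists N; split => // w /= /not_implyP[_ UV].
  by apply: contrapT => wN; apply: UV; rewrite VN.
rewrite (ge0_integralTE _ h0) (ge0_integralTE _ V0); apply: ereal_sup_le => _ /= [g hg <-].
exists g => // x; apply: (le_trans (hg x)).
have [xN|xN] := pselect (N x).
  by rewrite /V indicE mem_set// mule1 addey ?leey// gt_eqF// (lt_le_trans _ (U0 x))// ltNye.
by rewrite VN//; apply: contrapT => hU; apply: xN; exact: hN.
Qed.

(** * Transfer from the model to the sequence space *)

Section model.
Context {R : realType} {disp : measure_display} {T : measurableType disp}.
Variable P : probability T R.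
Context {d r : nat}.
Variables (X eps : int -> T -> 'cV[R]_d) (f0 : 'cV[R]_(r * d) -> 'cV[R]_d).
Hypothesis d0 : (0 < d)%N.
Hypothesis model : ar_model P X eps f0.
Variable J : (nat -> 'cV[R]_d) -> 'cV[R]_d.
Hypothesis causal : causal_representation P J X eps.

Let mu := innovation_law P (ar_eps_meas model).
Let muP := innovation_law_iid (ar_eps_meas model) (ar_eps_ident model) (ar_eps_indep model).

Lemma ae_forall_int (Q : int -> T -> Prop) : (forall i, {ae P, forall w, Q i w}) ->
  {ae P, forall w, forall i, Q i w}.
Proof.
move=> hQ.
have h1 := ae_foralln (fun n => hQ (Posz n)); have h2 := ae_foralln (fun n => hQ (Negz n)).
by apply: filterS2 h1 h2 => w h1 h2 [] n.
Qed.

Lemma ae_model : {ae P, forall w,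
  (X ^~ w = process J (innovations eps w)) /\
  forall i, X i w = f0 (lag r (X ^~ w) (i - 1)) + eps i w}.
Proof.
have h1 := ae_forall_int causal.2; have h2 := ae_forall_int (ar_recursion model).
by apply: filterS2 h1 h2 => w h1 h2; split => //; apply/funext => i; rewrite h1.
Qed.

Lemma integral_innovations (F : seqT R d -> \bar R) : measurable_fun [set: seqT R d] F ->
  (forall u, 0 <= F u)%E -> (\int[mu]_u F u = \int[P]_w F (innovations eps w))%E.
Proof.
exact: (ge0_integral_image (measurable_innovations (ar_eps_meas model))).
Qed.

(** Shift invariance moves the time [r] of the definition to 0, the time at which the deviation
    bounds compute the mean of the loss. *)
Lemma pred_error_law (Wf : 'cV[R]_(r * d) -> R) (f : 'cV[R]_(r * d) -> 'cV[R]_d) : (forall x, 0 <= Wf x <= 1) ->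
  (forall j, measurable_fun [set: vecT R (r * d)] (fun y => f y j 0)) ->
  measurable_fun [set: vecT R (r * d)] Wf ->
  pred_error P X f0 Wf f = (\int[mu]_u (loss f0 Wf f (lagged J 0 u))%:E)%E.
Proof.
move=> W01 mf mW.
have mf0 j : measurable_fun [set: vecT R (r * d)] (fun y => f0 y j 0).
  apply: (measurableT_comp (measurable_vec_entry j)) => _ B mB; rewrite setTI.
  exact: (ar_f0_meas model).
have mloss : measurable_fun [set: vecT R (r * d)] (loss f0 Wf f).
  apply: measurable_funM => //; apply: measurable_sum => j; apply: measurable_funM => //.
  by apply: measurable_funX; exact: measurable_funB.
have l0 y : 0 <= loss f0 Wf f y by exact: loss_ge0.
have mlag : measurable_fun setT (fun w => lag r (X ^~ w) r%:Z : vecT R (r * d)).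
  apply: measurable_into_coord => m; rewrite /vec_coord /=.
  case/mxvec_indexP: m => l j.
  rewrite (_ : (fun x => _) = (fun w => X (r%:Z - l%:Z) w j 0)); first exact: (ar_X_meas model).
  by apply/funext => w; rewrite !mxE mxvecE mxE.
have mJ := causal.1.
have mL i : measurable_fun setT (fun u : seqT R d => loss f0 Wf f (lagged J i u)).
  exact: (measurableT_comp mloss (measurable_lagged mJ i)).
transitivity (\int[P]_w (loss f0 Wf f (lag r (X ^~ w) r%:Z))%:E)%E.
  rewrite /pred_error unlock -ge0_integralZl//.
  - by apply: eq_integral => w _; rewrite -EFinM lossE.
  - apply/measurable_EFinP.
    rewrite (_ : (fun w => _) = (fun w => d%:R * loss f0 Wf f (lag r (X ^~ w) r%:Z))).
      by apply: measurable_funM => //; exact: (measurableT_comp mloss mlag).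
    by apply/funext => w; rewrite -lossE mulrA mulfV ?mul1r// pnatr_eq0 -lt0n.
  - by move=> w _; rewrite lee_fin mulr_ge0 ?sqr_ge0//; case/andP: (W01 (lag r (X ^~ w) r%:Z)).
transitivity (\int[P]_w (loss f0 Wf f (lagged J r%:Z (innovations eps w)))%:E)%E.
  apply: ge0_ae_eq_integral => //.
  - by apply/measurable_EFinP; exact: (measurableT_comp mloss mlag).
  - apply/measurable_EFinP; apply: (measurableT_comp (mL r%:Z)).
    exact: (measurable_innovations (ar_eps_meas model)).
  - by move=> w _; rewrite lee_fin.
  - by move=> w _; rewrite lee_fin.
  - by have := ae_model; apply: filterS => w [h _] _; rewrite /lagged h.
rewrite -(integral_innovations (F := fun u => (loss f0 Wf f (lagged J r%:Z u))%:E)); last 2 first.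
- by apply/measurable_EFinP.
- by move=> u; rewrite lee_fin.
rewrite [RHS](integral_shift muP r%:Z); last 2 first.
- by apply/measurable_EFinP.
- by move=> u; rewrite lee_fin.
by apply: eq_integral => u _; rewrite lagged_shift add0r.
Qed.

Lemma integral_innovation_entry (i : int) (G : 'cV[R]_d -> \bar R) :
  measurable_fun [set: vecT R d] G -> (forall x, 0 <= G x)%E ->
  (\int[P]_w G (eps i w) = \int[P]_w G (eps 1 w))%E.
Proof.
move=> mG G0.
have me := measurable_random_vector (ar_eps_meas model i).
have me1 := measurable_random_vector (ar_eps_meas model 1).
rewrite -(ge0_integral_image (m2 := distribution P (mfun_of me1)) me)//.
  exact: (ge0_integral_image (m1 := P) (m2 := distribution P (mfun_of me1)) me1).
move=> E mE; rewrite /= /distribution /pushforward/=.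
by transitivity (P (eps 0 @^-1` E)); rewrite (ar_eps_ident model).
Qed.

End model.

Section oracle.
Context {R : realType} {disp : measure_display} {T : measurableType disp}.
Variable P : probability T R.
Context {d r : nat}.
Variables (X eps : int -> T -> 'cV[R]_d) (f0 : 'cV[R]_(r * d) -> 'cV[R]_d).
Hypothesis d0 : (0 < d)%N.
Hypothesis model : ar_model P X eps f0.
Variable J : (nat -> 'cV[R]_d) -> 'cV[R]_d.
Hypothesis causal : causal_representation P J X eps.

Let mu := innovation_law P (ar_eps_meas model).
Let muP := innovation_law_iid (ar_eps_meas model) (ar_eps_ident model) (ar_eps_indep model).

Lemma innovation_moments Ce : 0 < Ce -> sub_gaussian P eps Ce ->
  exists ka : R, exists ce : R, [/\ 0 <= ka, 0 <= ce,
   forall l (a : 'I_d -> R), (forall j, `|a j| <= 1) ->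
     (\int[mu]_v (expR (\sum_j a j * v l j 0))%:E <= (1 + ka * \sum_j a j ^+ 2)%:E)%E &
   forall l, (\int[mu]_v (\sum_j `|v l j 0|)%:E <= ce%:E)%E].
Proof.
move=> Ce0 sg.
have mX l j : measurable_fun setT (fun w => eps l w j 0) by exact: (ar_eps_meas model).
have ment j : measurable_fun [set: vecT R d] (fun x : vecT R d => x j 0) by exact: measurable_vec_entry.
have hB j : exists B, 0 <= B /\ (\int[P]_w (expR (2 * d%:R * `|eps 1 w j 0|))%:E <= B%:E)%E.
  have [B B0 hB] := subgaussian_exp_abs (2 * d%:R) Ce0 (mX 1 j) (fun k => @sg k j).
  by exists B.
have [Bj hBj] := boolp.choice hB.
pose B := \sum_j Bj j; have B0 : 0 <= B by apply: sumr_ge0 => j _; case: (hBj j).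
have expB l j : (\int[P]_w (expR (2 * d%:R * `|eps l w j 0|))%:E <= B%:E)%E.
  rewrite (integral_innovation_entry model l (G := fun x => (expR (2 * d%:R * `|x j 0|))%:E)); last 2 first.
  - apply/measurable_EFinP; apply: measurableT_comp => //; apply: measurable_funM => //.
    by apply: measurableT_comp.
  - by move=> x; rewrite lee_fin expR_ge0.
  apply: (le_trans (hBj j).2); rewrite lee_fin /B (bigD1 j)//= lerDl.
  by apply: sumr_ge0 => i _; case: (hBj i).
have mseq l j : measurable_fun [set: seqT R d] (fun v : seqT R d => v l j 0) by exact: measurable_entry.
exists (4 * d%:R * B), (d%:R * B); split.
- by rewrite !mulr_ge0.
- by rewrite mulr_ge0.
- move=> l a a1.
  rewrite (integral_innovations model (F := fun v => (expR (\sum_j a j * v l j 0))%:E)); last 2 first.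
  + apply/measurable_EFinP; apply: measurableT_comp => //; apply: measurable_sum => j.
    exact: measurable_funM.
  + by move=> u; rewrite lee_fin expR_ge0.
  apply: (mgf_quadratic (e := eps l)) => // j; first exact: (ar_eps_int model).
  by have := ar_eps_mean model l j; rewrite unlock.
- move=> l.
  rewrite (integral_innovations model (F := fun v => (\sum_j `|v l j 0|)%:E)); last 2 first.
  + by apply/measurable_EFinP; apply: measurable_sum => j; apply: measurableT_comp.
  + by move=> u; rewrite lee_fin sumr_ge0.
  under eq_integral => w _ do rewrite -sumEFin.
  rewrite ge0_integral_sum//; last first.
    by move=> j; apply/measurable_EFinP; apply: measurableT_comp => //; exact: mX.
  apply: (@le_trans _ _ (\sum_(j < d) B%:E)%E); last first.
    by rewrite sumEFin sumr_const card_ord mulr_natl.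
  apply: lee_sum => j _; apply: le_trans (expB l j); apply: ge0_le_integral => //.
  + by apply/measurable_EFinP; apply: measurableT_comp => //; exact: mX.
  + by apply/measurable_EFinP; apply: measurableT_comp => //; apply: measurable_funM => //; apply: measurableT_comp.
  move=> w _; rewrite lee_fin; set y := `|_|; have y0 : 0 <= y by exact: normr_ge0.
  apply: le_trans (expR_ge1Dx _); have : y <= d%:R * y by rewrite ler_peMl// ler1n.
  lra.
Qed.

Variable (Wf : 'cV[R]_(r * d) -> R) (wi KL F Lip : R).
Hypothesis W01 : forall x, 0 <= Wf x <= 1.
Hypothesis Wcube : forall x, Wf x != 0 -> cube (r * d) x.
Hypothesis WL : forall x y, `|Wf x - Wf y| <= wi * `|x - y|.
Hypothesis f0F : forall x, cube (r * d) x -> `|f0 x| <= F.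
Hypothesis f0L : forall x y, cube (r * d) x -> cube (r * d) y -> `|f0 x - f0 y| <= KL * `|x - y|.
Hypothesis F0 : 0 <= F.
Variable C : set ('cV[R]_(r * d) -> 'cV[R]_d).
Hypothesis CF : forall f, C f -> forall x, `|f x| <= F.
Hypothesis CL : forall f, C f -> forall x y, `|f x - f y| <= Lip * `|x - y|.

Let l f := loss f0 Wf f.
Let Er f : R := \int[mu]_u l f (lagged J 0 u).

Lemma loss_bdm f i : C f -> bdm (fun u : seqT R d => l f (lagged J i u)).
Proof.
move=> Cf; split.
  apply: (measurableT_comp _ (measurable_lagged (causal.1) i)).
  apply: (loss_measurable WL (CL Cf)) => j.
  apply: (measurableT_comp (measurable_vec_entry j)) => _ B mB; rewrite setTI.
  exact: (ar_f0_meas model).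
exists (4 * F ^+ 2) => u; rewrite ger0_norm ?loss_ge0//.
exact: (loss_le d0 W01 Wcube f0F (CF Cf)).
Qed.

Lemma pred_errorE f : C f -> pred_error P X f0 Wf f = (Er f)%:E.
Proof.
move=> Cf; rewrite (pred_error_law d0 model causal W01); last 2 first.
- by move=> j; exact: (lip_entry_measurable (CL Cf)).
- exact: weight_measurable WL.
by rewrite EFin_Rint//; exact: loss_bdm.
Qed.

Lemma Er_close f g de : C f -> C g -> 0 <= de ->
  (forall x, cube (r * d) x -> `|f x - g x| <= de) -> Er f <= 2 * Er g + 2 * de ^+ 2.
Proof.
move=> Cf Cg de0 fg; rewrite -RintZ; last exact: loss_bdm.
rewrite -[X in _ + X](Rint_cst mu) -RintD; last 2 first.
- by apply: bdmZ; exact: loss_bdm.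
- exact: bdm_cst.
apply: Rint_le => [||u]; first exact: loss_bdm.
  by apply: bdmD; [apply: bdmZ; exact: loss_bdm|exact: bdm_cst].
have dR : 0 < d%:R :> R by rewrite ltr0n.
rewrite /l /loss mulrCA -(ler_pM2l dR) mulrDr !mulrA mulfV ?gt_eqF// !mul1r.
rewrite [d%:R * 2]mulrC -!mulrA.
apply: (le_trans (sqdist_tri W01 f g f0 _)); rewrite addrC lerD2l ler_wpM2l//.
by apply: sqdist_le => //; exact: fg.
Qed.

Lemma noise_class (I : finType) (G : I -> 'cV[R]_(r * d) -> 'cV[R]_d) fs (ka la : R) k :
  (0 < #|I|)%N -> (forall c, C (G c)) -> C fs -> 0 <= ka -> 0 <= la -> la * (2 * F) <= 1 ->
  (forall l (a : 'I_d -> R), (forall j, `|a j| <= 1) ->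
     (\int[mu]_v (expR (\sum_j a j * v l j 0))%:E <= (1 + ka * \sum_j a j ^+ 2)%:E)%E) ->
  max_bound mu (fun c (u : seqT R d) => \sum_(t < k)
    (la * (\sum_j ((G c (lagged J (r%:Z + t%:Z) u) - fs (lagged J (r%:Z + t%:Z) u)) j 0 * Wf (lagged J (r%:Z + t%:Z) u)) * u (r%:Z + t%:Z + 1) j 0)
     - ka * la ^+ 2 * \sum_j ((G c (lagged J (r%:Z + t%:Z) u) - fs (lagged J (r%:Z + t%:Z) u)) j 0 * Wf (lagged J (r%:Z + t%:Z) u)) ^+ 2))
    (1 + ln #|I|%:R).
Proof.
move=> I0 CG Cs ka0 la0 laF mgf.
pose h (t : nat) c (u : seqT R d) : 'cV[R]_d :=
  Wf (lagged J (r%:Z + t%:Z) u) *: (G c (lagged J (r%:Z + t%:Z) u) - fs (lagged J (r%:Z + t%:Z) u)).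
have mJ := causal.1.
have mf f i j : C f -> measurable_fun setT (fun u : seqT R d => f (lagged J i u) j 0).
  by move=> Cf; apply: (measurableT_comp (lip_entry_measurable (CL Cf) j) (measurable_lagged mJ i)).
apply: (max_bound_le (@noise_max _ _ mu _ muP I k r%:Z h (2 * F) ka la _ _ _ _ _ _ _ _)) => //.
- move=> t c j; rewrite /h.
  rewrite (_ : (fun u => _) = (fun u : seqT R d => Wf (lagged J (r%:Z + t%:Z) u) *
    (G c (lagged J (r%:Z + t%:Z) u) j 0 - fs (lagged J (r%:Z + t%:Z) u) j 0))); last first.
    by apply/funext => u; rewrite !mxE.
  apply: measurable_funM; last by apply: measurable_funB; exact: mf.
  exact: (measurableT_comp (weight_measurable WL) (measurable_lagged mJ _)).
- by move=> t c u v uv; rewrite /h (lagged_dep _ uv).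
- move=> t c u j; rewrite /h !mxE normrM -[leRHS]mul1r; set y := lagged _ _ _.
  have /andP[w0 w1] := W01 y; rewrite ger0_norm//; apply: ler_pM => //.
  apply: (le_trans (ler_normB _ _)).
  have := mx_entry_le (G c y) j 0; have := mx_entry_le (fs y) j 0.
  have := CF (CG c) y; have := CF Cs y; lra.
- move=> c u; rewrite le_eqVlt; apply/orP; left; apply/eqP; apply: eq_bigr => t _.
  congr (_ * _ - _ * _); apply: eq_bigr => j _; rewrite /h !mxE; first by congr (_ * _); rewrite mulrC.
  by congr (_ ^+ 2); rewrite mulrC.
Qed.

Lemma oracle_arith (k d' n e SA Ss Nz Se F1 la al eh : R) : 0 < k -> 0 < d' -> 0 < n -> 0 < la ->
  k * (e / 2) = F1 + d'^-1 * SA ->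
  SA <= 5 * Ss + 8 / la * Nz + 8 * n^-1 * Se + 4 * k * (d' * n^-1 ^+ 2) ->
  Ss <= k * (d' * al ^+ 2) -> eh <= 2 * e + 2 * n^-1 ^+ 2 ->
  eh <= 4 / k * (F1 + (d'^-1 * (8 / la) * Nz + d'^-1 * (8 * n^-1) * Se)) + (20 * al ^+ 2 + 18 * n^-1 ^+ 2).
Proof.
move=> k0 dp n0 la0 hF hS hs he.
have {}hs : d'^-1 * (5 * Ss) <= 5 * k * al ^+ 2.
  by rewrite ler_pdivrMl//; move: hs; lra.
have hS2 : d'^-1 * SA <= 5 * k * al ^+ 2 + d'^-1 * (8 / la) * Nz + d'^-1 * (8 * n^-1) * Se + 4 * k * n^-1 ^+ 2.
  have di : 0 <= d'^-1 by rewrite invr_ge0 ltW.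
  apply: (le_trans (ler_wpM2l di hS)); rewrite !mulrDr -!addrA; apply: lerD => //.
  rewrite !mulrA lerD2l// lerD2l.
  by rewrite (_ : d'^-1 * 4 * k * d' = 4 * k)//; field; rewrite gt_eqF.
have E : 2 * e = 4 / k * (F1 + d'^-1 * SA) by rewrite -hF; field; rewrite gt_eqF.
have h4 : 2 * e <= 4 / k * (F1 + (5 * k * al ^+ 2 + d'^-1 * (8 / la) * Nz + d'^-1 * (8 * n^-1) * Se + 4 * k * n^-1 ^+ 2)).
  by rewrite E; apply: ler_wpM2l; [rewrite divr_ge0// ltW|rewrite lerD2l].
have E2 : 4 / k * (F1 + (5 * k * al ^+ 2 + d'^-1 * (8 / la) * Nz + d'^-1 * (8 * n^-1) * Se + 4 * k * n^-1 ^+ 2)) =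
   4 / k * (F1 + (d'^-1 * (8 / la) * Nz + d'^-1 * (8 * n^-1) * Se)) + 20 * al ^+ 2 + 16 * n^-1 ^+ 2.
  by field; rewrite !gt_eqF.
lra.
Qed.

Lemma oracle_expectation (n : nat) (I : finType) (G : I -> 'cV[R]_(r * d) -> 'cV[R]_d) fs
    (fh : T -> 'cV[R]_(r * d) -> 'cV[R]_d) (ka la ce b1 al : R) :
  (r < n)%N -> (0 < #|I|)%N -> (forall c, C (G c)) -> C fs ->
  (forall f, C f -> exists i, forall x, cube (r * d) x -> `|f x - G i x| <= n%:R^-1) ->
  0 <= al -> (forall x, cube (r * d) x -> `|fs x - f0 x| <= al) ->
  (forall w, C (fh w) /\ emp_risk Wf n (X ^~ w) (fh w) <= emp_risk Wf n (X ^~ w) fs) ->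
  0 <= ka -> 0 < la -> la * (2 * F) <= 1 -> 16 * (ka * la) <= 1 ->
  (forall l (a : 'I_d -> R), (forall j, `|a j| <= 1) ->
     (\int[mu]_v (expR (\sum_j a j * v l j 0))%:E <= (1 + ka * \sum_j a j ^+ 2)%:E)%E) ->
  (forall l, (\int[mu]_v (\sum_j `|v l j 0|)%:E <= ce%:E)%E) ->
  max_bound mu (fun c u => \sum_(t < n - r)
     (Er (G c) / 2 - l (G c) (lagged J (r%:Z + t%:Z) u))) b1 ->
  (\int[P]_w pred_error P X f0 Wf (fh w) <=
     (4 / (n - r)%:R * (b1 + (d%:R^-1 * (8 / la) * (1 + ln #|I|%:R) + d%:R^-1 * (8 * n%:R^-1) * ((n - r)%:R * ce)))
      + (20 * al ^+ 2 + 18 * n%:R^-1 ^+ 2))%:E)%E.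
Proof.
move=> rn I0 CG Cs cov al0 fsal hfh ka0 la0 laF kala mgf hce hb1.
have hn := noise_class (n - r) I0 CG Cs ka0 (ltW la0) laF mgf.
have kR : 0 < (n - r)%:R :> R by rewrite ltr0n subn_gt0.
have nR : 0 < n%:R :> R by rewrite ltr0n (leq_ltn_trans _ rn).
have dR : 0 < d%:R :> R by rewrite ltr0n.
have di : 0 <= d%:R^-1 :> R by rewrite invr_ge0 ltW.
have ni : 0 <= n%:R^-1 :> R by rewrite invr_ge0 ltW.
have hS : max_bound mu (fun (_ : I) (u : seqT R d) => \sum_(t < n - r) \sum_j `|u (r%:Z + t%:Z + 1) j 0|) ((n - r)%:R * ce).
  have m1 t : measurable_fun [set: seqT R d] (fun u : seqT R d => \sum_j `|u (r%:Z + t%:Z + 1) j 0|).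
    by apply: measurable_sum => j; apply: measurableT_comp => //; exact: measurable_entry.
  exists (fun u : seqT R d => \sum_(t < n - r) \sum_j `|u (r%:Z + (t : nat)%:Z + 1) j 0|); split => //.
  - by apply: measurable_sum => t.
  - by move=> u; apply: sumr_ge0 => t _; apply: sumr_ge0.
  under eq_integral => w _ do rewrite -sumEFin.
  rewrite ge0_integral_sum//; last 2 first.
  - by move=> t; apply/measurable_EFinP.
  - by move=> t w _; rewrite lee_fin sumr_ge0.
  apply: (@le_trans _ _ (\sum_(t < n - r) ce%:E)%E); first by apply: lee_sum => t _; exact: hce.
  by rewrite sumEFin sumr_const card_ord mulr_natl.
have cb0 : 0 <= 4 / (n - r)%:R :> R by rewrite divr_ge0// ltW.
have c20 : 0 <= d%:R^-1 * (8 / la) by rewrite mulr_ge0// divr_ge0// ltW.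
have c30 : 0 <= d%:R^-1 * (8 * n%:R^-1) :> R by rewrite !mulr_ge0.
have e0 : 0 <= 20 * al ^+ 2 + 18 * n%:R^-1 ^+ 2 :> R by rewrite addr_ge0// mulr_ge0// sqr_ge0.
have hE : max_bound mu (fun (_ : I) (_ : seqT R d) => 20 * al ^+ 2 + 18 * n%:R^-1 ^+ 2) (20 * al ^+ 2 + 18 * n%:R^-1 ^+ 2).
  by apply: max_bound_fun => //; [exact: bdm_cst|rewrite Rint_cst].
have [U [mU U0 iU hU]] := max_boundD (max_boundZ cb0 (max_boundD hb1 (max_boundD (max_boundZ c20 hn) (max_boundZ c30 hS)))) hE.
apply: le_trans iU.
rewrite (integral_innovations model (F := fun u => (U u)%:E)); last 2 first.
- exact/measurable_EFinP.
- by move=> u; rewrite lee_fin.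
apply: ge0_integral_ae_le.
- move=> w; rewrite pred_errorE ?lee_fin; last by case: (hfh w).
  by apply: fine_ge0; apply: integral_ge0 => u _; rewrite lee_fin loss_ge0.
- by apply/measurable_EFinP; apply: (measurableT_comp mU (measurable_innovations (ar_eps_meas model))).
- by move=> w; rewrite lee_fin.
have := ae_model model causal; apply: filterS => w [XE Xrec].
have [Ch hrisk] := hfh w; rewrite (pred_errorE Ch) lee_fin.
(* The centre [c] is picked separately for each sample; the envelope [U] bounds all centres at once,
   so no measurable selection is involved. *)
have [c hc] := cov _ Ch.
apply: le_trans (hU c (innovations eps w)).
set u := innovations eps w.
have := erm_path d0 W01 Wcube rn Xrec hrisk ni hc la0 ka0 kala (lexx _).
rewrite XE => hpath.
apply: (oracle_arith (k := (n - r)%:R) kR dR nR la0 _ hpath (e := Er (G c))).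
- by rewrite mulr_sumr sumrB sumr_const card_ord mulr_natl subrK.
- apply: (@le_trans _ _ (\sum_(t < n - r) (d%:R * al ^+ 2))); last first.
    by rewrite sumr_const card_ord -[leLHS]mulr_natl.
  by apply: ler_sum => t _; apply: sqdist_le => // yc; exact: fsal.
- by apply: Er_close.
Qed.

(** Fallback for values of [N] or [n] that are too small for the network construction; there the
    power of [N] in the rate is bounded below. *)
Lemma expected_error_le (fh : T -> 'cV[R]_(r * d) -> 'cV[R]_d) : (forall w, C (fh w)) ->
  (\int[P]_w pred_error P X f0 Wf (fh w) <= (4 * F ^+ 2)%:E)%E.
Proof.
move=> Ch; have c0 : 0 <= 4 * F ^+ 2 by rewrite mulr_ge0 ?sqr_ge0.
have h0 w u : 0 <= l (fh w) u by exact: loss_ge0.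
apply: (@le_trans _ _ (\int[P]_w (4 * F ^+ 2)%:E)%E); last first.
  by rewrite integral_cst// [X in (_ * X)%E](probability_setT P) mule1.
apply: ge0_integral_ae_le => //.
- by move=> w; rewrite pred_errorE// lee_fin; apply: fine_ge0; apply: integral_ge0 => u _; rewrite lee_fin.
apply: aeW => w; rewrite pred_errorE// lee_fin.
apply: le_trans (ler_norm _) _; apply: Rint_norm_le => [|u]; first exact: loss_bdm.
by rewrite ger0_norm//; exact: (loss_le d0 W01 Wcube f0F (CF (Ch w))).
Qed.

End oracle.

Section dependence.
Context {R : realType} {disp : measure_display} {T : measurableType disp}.
Variable P : probability T R.
Context {d r : nat}.
Variables (X eps eps' : int -> T -> 'cV[R]_d) (f0 : 'cV[R]_(r * d) -> 'cV[R]_d).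
Hypothesis model : ar_model P X eps f0.
Variable J : (nat -> 'cV[R]_d) -> 'cV[R]_d.
Hypothesis causal : causal_representation P J X eps.
Hypothesis copy : innovation_copy P eps eps'.
Variables (LG theta : R) (Delta : nat -> R).
Hypothesis LG0 : 0 < LG.
Hypothesis th : 0 < theta <= 1.
Hypothesis Dmon : forall k l : nat, (k <= l)%N -> Delta l <= Delta k.
Hypothesis hdep : forall k : nat,
  (LG%:E * \big[maxe/0]_(1 <= l < r.+1)
     (fun_dep P J X eps eps' (2 * theta) (k%:Z - l%:Z)) `^ theta <= (Delta k)%:E)%E.

Lemma dep_coef_ge0 k : 0 <= Delta k.
Proof.
rewrite -lee_fin; apply: le_trans (hdep k); apply: mule_ge0; first by rewrite lee_fin ltW.
by elim/big_rec: _ => // i x _ x0; rewrite le_max x0 orbT.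
Qed.

Lemma coupling_moment (j l : nat) (m : 'I_d) : (l < r)%N -> (l <= j)%N ->
  (\int[P]_w (`|J (fun i => eps (0 - i%:Z) w) m 0 - coupled J eps eps' 0 (j - l) w m 0| `^ (2 * theta))%:E
   <= ((Delta j / LG) ^+ 2)%:E)%E.
Proof.
move=> lr lj; have /andP[th0 th1] := th; have t0 : 2 * theta != 0 by rewrite gt_eqF//; lra.
pose f w : \bar R := (X 0 w m 0 - coupled J eps eps' 0 (j - l) w m 0)%:E.
pose N := Lnorm P (2 * theta)%:E f.
have N0 : (0 <= N)%E by exact: Lnorm_ge0.
have -> : (\int[P]_w (`|J (fun i => eps (0 - i%:Z) w) m 0 - coupled J eps eps' 0 (j - l) w m 0| `^ (2 * theta))%:E
    = N `^ (2 * theta))%E.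
  rewrite [RHS](poweR_Lnorm P f t0); apply/esym.
  have mJ := causal.1.
  have mcp : measurable_fun setT (fun w => coupled J eps eps' 0 (j - l) w m 0).
    apply: (measurableT_comp (measurable_vec_entry m)).
    apply: (measurable_J mJ) => k j'; case: (k == _); first by have [+ _ _] := copy (0 - k%:Z); exact.
    exact: (ar_eps_meas model).
  have mJe : measurable_fun setT (fun w => J (fun i => eps (0 - i%:Z) w) m 0).
    apply: (measurableT_comp (measurable_vec_entry m)).
    apply: (measurable_J mJ) => k j'; exact: (ar_eps_meas model).
  apply: ge0_ae_eq_integral => //.
  - apply/measurable_EFinP; apply: (measurableT_comp (measurable_powR _)); apply: measurableT_comp => //.
    by apply: measurable_funB => //; exact: (ar_X_meas model).
  - apply/measurable_EFinP; apply: (measurableT_comp (measurable_powR _)); apply: measurableT_comp => //.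
    exact: measurable_funB.
  - by move=> w _; exact: poweR_ge0.
  - by have := causal.2 0; apply: filterS => w h _; rewrite /f /= h.
rewrite mulrC poweRrM -powR_mulrn; last by apply: divr_ge0; [exact: dep_coef_ge0|exact: ltW].
rewrite -poweR_EFin; apply: gt0_ler_poweR; rewrite ?in_itv/= ?leey ?andbT//.
- by rewrite poweR_ge0.
- by rewrite lee_fin; apply: divr_ge0; [exact: dep_coef_ge0|exact: ltW].
have key : (LG%:E * N `^ theta <= (Delta j)%:E)%E.
  (* The hypothesis on [Delta] counts lags from 1, the state vector from 0: lag [l] at distance [j]
     is read as lag [l.+1] at [j.+1], and monotonicity leads back to [Delta j]. *)
  apply: (@le_trans _ _ (Delta j.+1)%:E); last by rewrite lee_fin Dmon.
  apply: le_trans (hdep j.+1); apply: lee_wpmul2l; first by rewrite lee_fin ltW.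
  have lin : l.+1 \in index_iota 1 r.+1 by rewrite mem_index_iota; lia.
  apply: (bigmax_sup_seq _ _ _ _ _ lin) => //.
  rewrite (_ : j.+1%:Z - l.+1%:Z = (j - l)%N%:Z); last by lia.
  apply: (gt0_ler_poweR (ltW th0)); rewrite ?in_itv/= ?leey ?andbT//.
    by elim/big_rec: _ => // i x _ x0; rewrite le_max x0 orbT.
  exact: (le_bigmax _ (fun j0 => Lnorm P (2 * theta)%:E (fun w => (X 0 w j0 0 - coupled J eps eps' 0 (j - l) w j0 0)%:E)) m).
move: key (poweR_ge0 N theta); case: (N `^ theta)%E => [y| |] //=.
  by rewrite -EFinM !lee_fin => key _; rewrite ler_pdivlMr// mulrC.
by rewrite gt0_muley ?lte_fin.
Qed.

Lemma dependence_class (I : finType) (k : nat) (T0 : int) (g : I -> 'cV[R]_(r * d) -> R) M CG q S :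
  (0 < #|I|)%N -> (0 < k)%N -> (0 < q)%N -> 0 < M -> 0 <= CG ->
  (forall c, measurable_fun [set: vecT R (r * d)] (g c)) ->
  (forall c x, 0 <= g c x <= M) ->
  (forall c x y, `|g c x - g c y| <= CG * `|x - y|) ->
  (forall n, \sum_(j < n) Delta (q + j)%N <= S) ->
  let mu := innovation_law P (ar_eps_meas model) in
  max_bound mu (fun c u => \sum_(t < k) ((\int[mu]_u' g c (lagged J 0 u')) / 2 - g c (lagged J (T0 + t%:Z) u)))
    (q%:R * (M * (1 + ln #|I|%:R)) + 3 * Num.sqrt (k%:R * (1 + ln #|I|%:R)) *
      (coupling_cst (r := r) (d := d) M CG theta / LG * S) + 2).
Proof.
move=> I0 k0 q0 M0 CG0 mg g0M gL hS mu.
apply: (dependence_max causal.1 M0 CG0 th (ar_eps_meas model) (ar_eps_ident model) (ar_eps_indep model) copy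
  (eta := fun j => Delta j / LG)) => //.
- by move=> j; apply: divr_ge0; [exact: dep_coef_ge0|exact: ltW].
- exact: coupling_moment.
- move=> n; rewrite (eq_bigr (fun j : 'I_n => coupling_cst (r := r) (d := d) M CG theta / LG * Delta (q + j)%N)).
    rewrite -mulr_sumr; apply: ler_wpM2l; last exact: hS.
    by rewrite mulr_ge0 ?sqrtr_ge0// invr_ge0 ltW.
  by move=> j _; rewrite mulrAC mulrA.
Qed.

End dependence.

(** * Rate of convergence *)

Section constants.
Context {R : realType}.

(** Smoothness at least 1 makes all three stages Lipschitz on their cubes; [KL] is the product of
    the three constants. *)
Lemma encoder_decoder_regular (d r dt D tdec tenc0 tenc1 : nat) (bdec benc0 benc1 K : R)
  (f0 : 'cV[R]_(r * d) -> 'cV[R]_d) (g0 : 'cV[R]_(r * d) -> 'cV[R]_D)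
  (g1 : 'cV[R]_D -> 'cV[R]_dt) (fdec : 'cV[R]_dt -> 'cV[R]_d) :
  (0 < d)%N -> (0 < r)%N -> 1 <= bdec -> 1 <= benc0 -> 1 <= benc1 -> 1 <= K ->
  encoder_decoder tdec tenc0 tenc1 bdec benc0 benc1 K f0 g0 g1 fdec ->
  (forall x, cube (r * d) x -> `|f0 x| <= K) /\
  exists2 KL, 0 <= KL & forall x y, cube (r * d) x -> cube (r * d) y ->
    `|f0 x - f0 y| <= KL * `|x - y|.
Proof.
move=> d0 r0 bd1 be01 be11 K1 [hdt ht0 ht1 ht2 f0E dep0 dep1 dep2 sm0 sm1 sm2 im0 im1].
have rd0 : (0 < r * d)%N by rewrite muln_gt0 r0.
have [D0 dt0] : (0 < D)%N /\ (0 < dt)%N by split; lia.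
have K0 : 0 <= K by lra.
have c0 x : cube (r * d) x -> cube D (g0 x) by move=> xc; apply: im0; exists x.
have c1 x : cube D x -> cube dt (g1 x) by move=> xc; apply: im1; exists x.
split.
  move=> x xc; apply: mx_norm_le => // i j; rewrite (ord1 j) f0E.
  exact: (holder_ball_bound dt0 (lt_le_trans ltr01 bd1) (sm2 i) (c1 _ (c0 _ xc))).
have lipv m n (b : R) (g : 'cV[R]_m -> 'cV[R]_n) : (0 < m)%N -> 1 <= b ->
    holder_ball_vec (cube m) b K g -> exists2 C, 0 <= C &
    forall x y, cube m x -> cube m y -> `|g x - g y| <= C * `|x - y|.
  move=> m0 b1 hg; have [C C1 hC] := holder_local_approx m0 b1 K0.
  exists C => [|x y xc yc]; first by lra.
  apply: mx_norm_le => [|i j]; first by rewrite mulr_ge0//; lra.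
  by rewrite (ord1 j) !mxE; have [+ _] := hC _ (hg i); exact.
have [C0 C00 h0] := lipv _ _ _ _ rd0 be01 sm0.
have [C1 C10 h1] := lipv _ _ _ _ D0 be11 sm1.
have [C2 C20 h2] := lipv _ _ _ _ dt0 bd1 sm2.
exists (C2 * (C1 * C0)) => [|x y xc yc]; first by rewrite !mulr_ge0.
rewrite f0E /=; apply: (le_trans (h2 _ _ (c1 _ (c0 _ xc)) (c1 _ (c0 _ yc)))).
rewrite -!mulrA ler_wpM2l//; apply: (le_trans (h1 _ _ (c0 _ xc) (c0 _ yc))).
by rewrite ler_wpM2l// h0.
Qed.

Lemma ln_ge1_bound (n : nat) : (2 <= n)%N -> ln 2 <= ln n%:R :> R.
Proof. by move=> n2; rewrite ler_ln ?posrE ?ltr0n ?ler_nat//; lia. Qed.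

(** Origin of the third power: [s] is of order [N ln n], and the logarithm of the number of values
    of one code entry is of order [(ln n)^2], because the resolution contains [(s + c).+1 ^ L.+1]
    with [L] of order [ln n]. *)
Lemma cover_entropy (c : nat) (a b : R) : 0 <= a -> 0 <= b ->
  exists2 CH, 0 < CH & forall n N L s card : nat, (2 <= n)%N -> (0 < N <= n)%N ->
    L%:R <= a * log2 n%:R -> s%:R <= b * (N%:R * log2 n%:R) ->
    (card <= ((L.+1 * (s + c) * (s + c).+1 * (2 * (n * (L.+1 * (s + c).+1 ^ L.+1))).+1).+1) ^ s)%N ->
    1 + ln card%:R <= CH * (N%:R * ln n%:R ^+ 3) :> R.
Proof.
move=> a0 b0.
have l20 : 0 < ln 2 :> R by rewrite ln_gt0// ltr1n.
pose a1 := a / ln 2 + 3 / ln 2; pose b1 := b / ln 2.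
have a10 : 0 < a1 by rewrite ltr_wpDl ?divr_ge0 ?divr_gt0// ltW.
have b10 : 0 <= b1 by rewrite divr_ge0// ltW.
pose e1 := b1 + c%:R + 1; have e10 : 1 <= e1 by rewrite /e1; have := ler0n R c; lra.
pose w1 := ln e1 / ln 2 + 2.
have w10 : 0 <= w1 by apply: addr_ge0 => //; apply: divr_ge0; [exact: ln_ge0|exact: ltW].
pose t1 := ln 6 / (ln 2 * ln 2) + (ln 2)^-1 + 2 * a1 / ln 2 + a1 * w1.
have t10 : 0 <= t1.
  have l6 : 0 <= ln 6 :> R by rewrite ln_ge0// ler1n.
  by rewrite /t1 !addr_ge0 ?invr_ge0 ?divr_ge0 ?mulr_ge0// ltW.
exists (1 / ln 2 ^+ 3 + b1 * t1); first by apply: ltr_wpDr; [exact: mulr_ge0|exact: divr_gt0 (exprn_gt0 _ _)].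
move=> n N L s card n2 /andP[N0 Nn] hL hs hcard.
have n0 : (0 < n)%N by exact: ltnW.
set l := ln n%:R; have l2 : ln 2 <= l by exact: ln_ge1_bound.
have l0 : 0 < l by exact: lt_le_trans l2.
have nR : 0 < n%:R :> R by rewrite ltr0n.
have ln_n : l <= n%:R.
  by have := ln_sublinear nR; rewrite -/l => /ltW.
have NR : 1 <= N%:R :> R by rewrite ler1n.
have inv2 : 1 <= l / ln 2 by rewrite ler_pdivlMr// mul1r.
have hL3 : L%:R + 3 <= a1 * l.
  rewrite mulrDl; apply: lerD; first by rewrite mulrAC -mulrA.
  by rewrite mulrAC -mulrA; have := inv2; lra.
have hs1 : s%:R <= b1 * (N%:R * l).
  by rewrite (_ : b1 * (N%:R * l) = b * (N%:R * log2 n%:R))// /b1 /log2 -/l; ring.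
have lw : ln (s + c).+1%:R <= w1 * l.
  have se : (s + c).+1%:R <= e1 * n%:R ^+ 2.
    rewrite -natr1 natrD /e1.
    have n1 : 1 <= n%:R ^+ 2 :> R by rewrite exprn_ege1// ler1n.
    have : s%:R <= b1 * n%:R ^+ 2.
      apply: (le_trans hs1); rewrite ler_wpM2l// expr2 ler_pM ?ler_nat//; exact: ltW.
    have : c%:R <= c%:R * n%:R ^+ 2 :> R by rewrite ler_peMr.
    lra.
  have e0 : 0 < e1 by exact: lt_le_trans e10.
  have s0 : 0 < (s + c).+1%:R :> R by rewrite ltr0n.
  apply: (@le_trans _ _ (ln (e1 * n%:R ^+ 2))); first by rewrite ler_ln ?posrE ?mulr_gt0 ?exprn_gt0.
  rewrite lnM ?posrE ?exprn_gt0// lnXn// -/l /w1 mulrDl lerD ?mulr_natl//.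
  by rewrite mulrAC -mulrA ler_peMr// ln_ge0.
pose T := (6 * n * (L.+1 * L.+1) * (s + c).+1 ^ (L + 3))%N.
have hT : ((L.+1 * (s + c) * (s + c).+1 * (2 * (n * (L.+1 * (s + c).+1 ^ L.+1))).+1).+1 <= T)%N.
  rewrite /T -addn3 !expnD !expnS expn0 !muln1.
  move: (s + c)%N => z; have : (0 < z.+1 ^ L)%N by rewrite expn_gt0.
  move: (z.+1 ^ L)%N => y y0; clear -y0 n0.
  set A := (L.+1 * z * z.+1)%N; set B := (n * (L.+1 * (z.+1 * y)))%N.
  have B0 : (0 < B)%N by rewrite !muln_gt0 n0 y0.
  apply: (@leq_trans (2 * (L.+1 * z.+1 * z.+1) * (3 * B))%N); last by rewrite /B; nia.
  have AA : (A <= L.+1 * z.+1 * z.+1)%N by rewrite /A leq_mul// leq_mul.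
  have A0 : (0 < L.+1 * z.+1 * z.+1)%N by rewrite !muln_gt0.
  move: AA A0; move: (L.+1 * z.+1 * z.+1)%N => A'; clear -B0; move: A B B0 => A B B0 AA A0.
  apply: (@leq_trans (A' * (2 * B).+1).+1); first by rewrite ltnS leq_mul.
  by clear -A0 B0; nia.
have T0 : (0 < T)%N by rewrite /T !muln_gt0 expn_gt0 n0.
have lT : ln T%:R <= t1 * l ^+ 2 :> R.
  rewrite /T !natrM natrX !lnM ?posrE ?mulr_gt0 ?exprn_gt0 ?ltr0n//.
  rewrite lnXn ?ltr0n// -/l.
  have hL1 : ln L.+1%:R <= a1 * l.
    apply: le_trans hL3; have := @ln_sublinear R L.+1%:R (ltr0Sn _ _).
    by rewrite -natr1; lra.
  have x6 : ln 6 <= ln 6 / (ln 2 * ln 2) * l ^+ 2.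
    rewrite (_ : _ * l ^+ 2 = ln 6 * ((l / ln 2) * (l / ln 2))); last by field; rewrite gt_eqF.
    have l6 : 0 <= ln 6 :> R by rewrite ln_ge0// ler1n.
    by rewrite ler_peMr// -expr2 exprn_ege1.
  have xl : l <= (ln 2)^-1 * l ^+ 2.
    rewrite (_ : _ * l ^+ 2 = l * (l / ln 2)); last by field; rewrite gt_eqF.
    by rewrite ler_peMr// ltW.
  have xa : 2 * (a1 * l) <= 2 * a1 / ln 2 * l ^+ 2.
    rewrite (_ : _ * l ^+ 2 = 2 * (a1 * l) * (l / ln 2)); last by field; rewrite gt_eqF.
    by rewrite ler_peMr// !mulr_ge0// ltW.
  have xw : ln (s + c).+1%:R *+ (L + 3) <= a1 * w1 * l ^+ 2.
    rewrite -[leLHS]mulr_natl natrD (_ : a1 * w1 * l ^+ 2 = (a1 * l) * (w1 * l)); last by ring.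
    by apply: ler_pM => //; rewrite ?ln_ge0// ?ler1n.
  have -> : t1 * l ^+ 2 = ln 6 / (ln 2 * ln 2) * l ^+ 2 + (ln 2)^-1 * l ^+ 2 + 2 * a1 / ln 2 * l ^+ 2
      + a1 * w1 * l ^+ 2 by rewrite /t1; ring.
  apply: lerD xw; apply: lerD; first exact: lerD.
  by clear -hL1 xa; lra.
have lT0 : 0 <= ln T%:R :> R by rewrite ln_ge0// ler1n.
have lcard : ln card%:R <= s%:R * ln T%:R :> R.
  have [->|card0] := posnP card; first by rewrite ln0 ?mulr_ge0.
  rewrite mulr_natl -lnXn ?ltr0n// ler_ln ?posrE ?exprn_gt0 ?ltr0n// -natrX ler_nat.
  by apply: (leq_trans hcard); have [->//|s0] := posnP s; rewrite leq_exp2r.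
rewrite mulrDl; apply: lerD.
  rewrite [leRHS](_ : _ = N%:R * (l / ln 2) ^+ 3); last by field; rewrite gt_eqF.
  by rewrite -[leLHS]mulr1 ler_pM// exprn_ege1.
apply: (le_trans lcard).
rewrite (_ : b1 * t1 * (N%:R * l ^+ 3) = b1 * (N%:R * l) * (t1 * l ^+ 2)); last by ring.
by apply: ler_pM.
Qed.

Lemma rate_arith (k n r1 q M H CH x y cc c8 di ce al2 Ca A2 c1 : R) :
  0 < k -> 1 <= n -> n <= r1 * k -> 0 <= H -> H <= CH * (n * x) -> 0 < x -> 0 <= y ->
  0 <= q -> 0 <= M -> 0 <= cc -> 0 <= c8 -> 0 <= di -> 0 <= ce -> 0 <= CH -> 0 <= c1 ->
  0 <= Ca -> 0 <= A2 -> 0 <= r1 ->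
  q * x <= Num.sqrt x * y -> x <= Num.sqrt x * y -> n^-1 <= c1 * x ->
  al2 <= Ca * (A2 + n^-1) ->
  4 / k * (q * (M * H) + 3 * Num.sqrt (k * H) * (cc * y) + 2 + (c8 * H + di * (8 * n^-1) * (k * ce)))
    + (20 * al2 + 18 * n^-1 ^+ 2) <=
  (4 * r1 * M * CH + 12 * Num.sqrt (CH * r1) * cc + 8 * r1 * c1 + 4 * r1 * c8 * CH
    + 32 * di * ce * c1 + 20 * Ca * (1 + c1) + 18 * c1) * (Num.sqrt x * y + A2).
Proof.
move=> k0 n1 nk H0 hH x0 y0 q0 M0 cc0 c80 di0 ce0 CH0 c10 Ca0 A20 r10 hq hx hn hal.
have n0 : 0 < n by exact: lt_le_trans n1.
set Lam := Num.sqrt x * y in hq hx *.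
have L0 : 0 <= Lam by exact: le_trans (ltW x0) hx.
have Hk : H / k <= CH * r1 * x.
  rewrite ler_pdivrMr//; apply: (le_trans hH).
  rewrite (_ : CH * r1 * x * k = CH * (r1 * k * x)); last by ring.
  by apply: ler_wpM2l => //; apply: ler_wpM2r => //; exact: ltW.
have kn : k^-1 <= r1 * n^-1.
  by rewrite -[k^-1]mul1r ler_pdivrMr// mulrAC ler_pdivlMr// mul1r.
have nL : n^-1 <= c1 * Lam by apply: (le_trans hn); exact: ler_wpM2l.
have t1 : 4 / k * (q * (M * H)) <= 4 * r1 * M * CH * Lam.
  rewrite (_ : 4 / k * _ = 4 * q * M * (H / k)); last by ring.
  apply: (@le_trans _ _ (4 * q * M * (CH * r1 * x))).
    by apply: ler_wpM2l => //; rewrite !mulr_ge0.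
  rewrite (_ : 4 * q * M * _ = 4 * r1 * M * CH * (q * x)); last by ring.
  by apply: ler_wpM2l => //; rewrite !mulr_ge0.
have t2 : 4 / k * (3 * Num.sqrt (k * H) * (cc * y)) <= 12 * Num.sqrt (CH * r1) * cc * Lam.
  have -> : Num.sqrt (k * H) = k * Num.sqrt (H / k).
    rewrite (_ : k * H = k ^+ 2 * (H / k)); last by field; rewrite gt_eqF.
    by rewrite sqrtrM ?sqr_ge0// sqrtr_sqr gtr0_norm.
  rewrite (_ : 4 / k * _ = 12 * cc * y * Num.sqrt (H / k)); last by field; rewrite gt_eqF.
  apply: (@le_trans _ _ (12 * cc * y * (Num.sqrt (CH * r1) * Num.sqrt x))).
    apply: ler_wpM2l; first by rewrite !mulr_ge0.
    by rewrite -sqrtrM ?mulr_ge0// ler_wsqrtr.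
  by rewrite /Lam le_eqVlt; apply/orP; left; apply/eqP; ring.
have t3 : 4 / k * 2 <= 8 * r1 * c1 * Lam.
  rewrite (_ : 4 / k * 2 = 8 * k^-1); last by ring.
  rewrite -!mulrA ler_wpM2l//; apply: (le_trans kn).
  by apply: ler_wpM2l.
have t4 : 4 / k * (c8 * H) <= 4 * r1 * c8 * CH * Lam.
  rewrite (_ : 4 / k * _ = 4 * c8 * (H / k)); last by ring.
  apply: (@le_trans _ _ (4 * c8 * (CH * r1 * x))).
    by apply: ler_wpM2l => //; rewrite !mulr_ge0.
  rewrite (_ : 4 * c8 * _ = 4 * r1 * c8 * CH * x); last by ring.
  by apply: ler_wpM2l => //; rewrite !mulr_ge0.
have t5 : 4 / k * (di * (8 * n^-1) * (k * ce)) <= 32 * di * ce * c1 * Lam.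
  rewrite (_ : 4 / k * _ = 32 * di * ce * n^-1); last by field; rewrite !gt_eqF.
  by rewrite -[leRHS]mulrA; apply: ler_wpM2l => //; rewrite !mulr_ge0.
have t6 : 20 * al2 <= 20 * Ca * (1 + c1) * (Lam + A2).
  rewrite -!mulrA ler_wpM2l//; apply: (le_trans hal); apply: ler_wpM2l => //.
  have : 0 <= c1 * A2 by rewrite mulr_ge0.
  rewrite mulrDl mulrDr; lra.
have t7 : 18 * n^-1 ^+ 2 <= 18 * c1 * Lam.
  rewrite -mulrA ler_wpM2l// expr2; apply: le_trans nL.
  by apply: ler_piMl; [rewrite invr_ge0 ltW|rewrite invf_le1].
have up c : 0 <= c -> c * Lam <= c * (Lam + A2) by move=> c0; rewrite ler_wpM2l// lerDl.
have u1 := up _ (mulr_ge0 (mulr_ge0 (mulr_ge0 (ler0n R 4) r10) M0) CH0).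
have u2 := up _ (mulr_ge0 (mulr_ge0 (ler0n R 12) (sqrtr_ge0 (CH * r1))) cc0).
have u3 := up _ (mulr_ge0 (mulr_ge0 (ler0n R 8) r10) c10).
have u4 := up _ (mulr_ge0 (mulr_ge0 (mulr_ge0 (ler0n R 4) r10) c80) CH0).
have u5 := up _ (mulr_ge0 (mulr_ge0 (mulr_ge0 (ler0n R 32) di0) ce0) c10).
have u7 := up _ (mulr_ge0 (ler0n R 18) c10).
set S := Lam + A2 in t6 u1 u2 u3 u4 u5 u7 *.
have -> : (4 * r1 * M * CH + 12 * Num.sqrt (CH * r1) * cc + 8 * r1 * c1 + 4 * r1 * c8 * CH
    + 32 * di * ce * c1 + 20 * Ca * (1 + c1) + 18 * c1) * S =
  4 * r1 * M * CH * S + 12 * Num.sqrt (CH * r1) * cc * S + 8 * r1 * c1 * S + 4 * r1 * c8 * CH * S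
    + 32 * di * ce * c1 * S + 20 * Ca * (1 + c1) * S + 18 * c1 * S by rewrite !(mulrDl _ _ S).
have -> (u v w z : R) : 4 / k * (u + v + 2 + (w + z)) = 4 / k * u + 4 / k * v + 4 / k * 2 + 4 / k * w + 4 / k * z.
  by ring.
move: (le_trans t1 u1) (le_trans t2 u2) (le_trans t3 u3) (le_trans t4 u4) (le_trans t5 u5) t6 (le_trans t7 u7).
clear; lra.
Qed.

(** Take the largest grid that fits into [N %/ C]. By maximality [N < C 2^t M^t], and the power
    [b / t] of this inequality is the claim. *)
Lemma grid_size (C t : nat) (b : R) : (0 < C)%N -> (0 < t)%N -> 0 <= b ->
  exists2 c, 0 <= c & forall N : nat, (C <= N)%N -> exists M : nat,
    [/\ (0 < M <= N)%N, (M ^ t <= N %/ C)%N & M%:R `^ (- b) <= c * N%:R `^ (- (b / t%:R))].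
Proof.
move=> C0 t0 b0; pose c := (C * 2 ^ t)%N.
have c0 : (0 < c)%N by rewrite !muln_gt0 C0 expn_gt0.
exists (c%:R `^ (b / t%:R)) => [|N CN]; first exact: powR_ge0.
have N0 : (0 < N)%N by exact: leq_trans CN.
have N'0 : (0 < N %/ C)%N by rewrite divn_gt0.
have exM : exists M, (M ^ t <= N %/ C)%N by exists 1%N; rewrite exp1n.
have bM M : (M ^ t <= N %/ C)%N -> (M <= N %/ C)%N.
  by apply: leq_trans; case: M => // M; rewrite -{1}[M.+1]expn1 leq_pexp2l.
have [M hM Mmax] := ex_maxnP exM bM.
have M0 : (0 < M)%N by apply: Mmax; rewrite exp1n.
have Mn : (N < c * M ^ t)%N.
  have : (N %/ C < M.+1 ^ t)%N by rewrite ltnNge; apply/negP => /Mmax; rewrite ltnn.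
  have : (M.+1 ^ t <= (2 * M) ^ t)%N by rewrite leq_exp2r// mul2n -addnn -addn1 leq_add2l.
  move=> h2 h1; have h3 := leq_trans h1 h2.
  have := ltn_ceil N C0; rewrite mulSn; move/leq_trans; apply.
  by rewrite -mulSn mulnC /c -mulnA leq_mul// -expnMn.
exists M; split => //.
  by rewrite M0 (leq_trans (bM _ hM))// leq_div.
rewrite !powRN ler_pdivlMr ?powR_gt0 ?ltr0n// mulrC ler_pdivrMr ?powR_gt0 ?ltr0n//.
have tR : 0 < t%:R :> R by rewrite ltr0n.
have -> : M%:R `^ b = (M%:R ^+ t) `^ (b / t%:R).
  by rewrite -powR_mulrn// -powRrM mulrC divfK// gt_eqF.
rewrite -powRM ?exprn_ge0// ge0_ler_powR ?nnegrE ?mulr_ge0 ?exprn_ge0 ?invr_ge0//.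
by rewrite -natrX -natrM ler_nat ltnW.
Qed.

End constants.

Section class_bounds.
Context {R : realType}.

Lemma sup_norm_le m n (f : 'cV[R]_m -> 'cV[R]_n) (F : R) : (sup_norm f <= F%:E)%E ->
  forall x, `|f x| <= F.
Proof.
by move=> h x; rewrite -lee_fin; apply: le_trans h; apply: ereal_sup_ubound; exists x.
Qed.

Lemma lip_norm_le m n (f : 'cV[R]_m -> 'cV[R]_n) (Lip : R) : (lip_norm f <= Lip%:E)%E ->
  forall x y, `|f x - f y| <= Lip * `|x - y|.
Proof.
move=> h x y; have [->|xy] := eqVneq x y; first by rewrite !subrr !normr0 mulr0.
rewrite -ler_pdivrMr ?normr_gt0 ?subr_eq0// -lee_fin; apply: le_trans h.
by apply: ereal_sup_ubound; exists (x, y).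
Qed.

Lemma network_class_lip_bounds m n dt L L1 p s (F Lip : R) (f : 'cV[R]_m -> 'cV[R]_n) :
  network_class_lip dt L L1 p s F Lip f ->
  (forall x, `|f x| <= F) /\ (forall x y, `|f x - f y| <= Lip * `|x - y|).
Proof.
by move=> [[em [en [Wt [v [_ [_ _ _ _ fF]]]]]] fL]; split; [exact: sup_norm_le|exact: lip_norm_le].
Qed.

Lemma probability_inhabited disp (T : measurableType disp) (P : probability T R) : inhabited T.
Proof.
apply: contrapT => nT; have E : [set: T] = set0 by apply/seteqP; split => // w _; apply: nT.
have := @probability_setT _ _ _ P; rewrite E [X in (X = _)%E](measure0 P) => /esym/eqP.
by rewrite onee_eq0.
Qed.

Lemma widths_of_lesssim (N L1 L : nat) (p : nat -> nat) (cN : R) : 0 < cN ->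
  (N%:R%:E <= cN%:E * \big[mine/+oo]_(1 <= i < L.+1 | i != L1) (p i)%:R%:E)%E ->
  forall i, (0 < i <= L)%N -> i != L1 -> N%:R <= cN * (p i)%:R.
Proof.
move=> c0 h i /andP[i0 iL] iL1; rewrite -lee_fin EFinM; apply: (le_trans h).
apply: lee_wpmul2l; first by rewrite lee_fin ltW.
by apply: (bigmin_inf_seq _ i) => //; rewrite mem_index_iota i0.
Qed.

Lemma grid_exponents (N t : nat) (A b c : R) : (0 < N)%N -> A <= b / t%:R -> 0 <= c ->
  c * N%:R `^ (- (b / t%:R)) <= c * N%:R `^ (- A).
Proof. by move=> N0 Ab c0; apply: ler_wpM2l => //; rewrite ler_powR ?ler1n// lerN2. Qed.

Lemma approx_square (CE cg a n : R) (M0 M1 M2 : R) : 0 <= CE -> 0 <= cg -> 0 <= a -> 1 <= n ->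
  0 <= M0 -> 0 <= M1 -> 0 <= M2 -> M0 + M1 + M2 <= cg * a ->
  (CE * (M0 + M1 + M2 + n^-1)) ^+ 2 <= 2 * CE ^+ 2 * (cg ^+ 2 + 1) * (a ^+ 2 + n^-1).
Proof.
move=> CE0 cg0 a0 n1 M00 M10 M20 hM.
have n0 : 0 < n by exact: lt_le_trans n1.
have ni : 0 <= n^-1 by rewrite invr_ge0 ltW.
have ni1 : n^-1 <= 1 by rewrite invf_le1.
have h : (M0 + M1 + M2 + n^-1) ^+ 2 <= 2 * ((cg * a) ^+ 2 + n^-1 ^+ 2).
  apply: (@le_trans _ _ ((cg * a + n^-1) ^+ 2)).
    by rewrite lerXn2r ?nnegrE ?addr_ge0 ?mulr_ge0// lerD2r.
  have := sqr_ge0 (cg * a - n^-1); lra.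
have n2 : n^-1 ^+ 2 <= n^-1 by rewrite expr2 ler_piMl.
rewrite exprMn (_ : 2 * _ * _ * _ = CE ^+ 2 * (2 * ((cg ^+ 2 + 1) * (a ^+ 2 + n^-1)))); last by ring.
apply: ler_wpM2l; first exact: sqr_ge0.
apply: (le_trans h); apply: ler_wpM2l => //.
have c2 : 0 <= cg ^+ 2 * n^-1 by rewrite mulr_ge0 ?sqr_ge0.
have a2 : 0 <= a ^+ 2 by exact: sqr_ge0.
have -> : (cg * a) ^+ 2 = cg ^+ 2 * a ^+ 2 by ring.
lra.
Qed.

Lemma step_size (F ka : R) : 0 < F -> 0 <= ka ->
  exists la, [/\ 0 < la, la * (2 * F) <= 1 & 16 * (ka * la) <= 1].
Proof.
move=> F0 ka0; have s0 : 0 < 1 + 2 * F + 16 * ka by lra.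
exists (1 + 2 * F + 16 * ka)^-1; rewrite invr_gt0; split => //.
  by rewrite mulrC ler_pdivrMr// mul1r; lra.
by rewrite mulrA ler_pdivrMr// mul1r; lra.
Qed.

End class_bounds.

Section rate.
Context {R : realType} {disp : measure_display} {T : measurableType disp}.
Variable P : probability T R.
Context {d r : nat}.
Variables (X eps eps' : int -> T -> 'cV[R]_d) (f0 : 'cV[R]_(r * d) -> 'cV[R]_d).
Hypothesis d0 : (0 < d)%N.
Hypothesis model : ar_model P X eps f0.
Variable J : (nat -> 'cV[R]_d) -> 'cV[R]_d.
Hypothesis causal : causal_representation P J X eps.
Hypothesis copy : innovation_copy P eps eps'.
Variable (Wf : 'cV[R]_(r * d) -> R) (wi KL F Lip : R).
Hypothesis W01 : forall x, 0 <= Wf x <= 1.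
Hypothesis Wcube : forall x, Wf x != 0 -> cube (r * d) x.
Hypothesis wi0 : 0 <= wi.
Hypothesis WL : forall x y, `|Wf x - Wf y| <= wi * `|x - y|.
Hypothesis f0F : forall x, cube (r * d) x -> `|f0 x| <= F.
Hypothesis KL0 : 0 <= KL.
Hypothesis f0L : forall x y, cube (r * d) x -> cube (r * d) y -> `|f0 x - f0 y| <= KL * `|x - y|.
Hypothesis F0 : 0 < F.
Hypothesis Lip0 : 0 < Lip.
Variables (LG theta : R) (Delta : nat -> R) (ybar : R -> R).
Hypothesis LG0 : 0 < LG.
Hypothesis th : 0 < theta <= 1.
Hypothesis Dmon : forall k l : nat, (k <= l)%N -> Delta l <= Delta k.
Hypothesis hdep : forall k : nat,
  (LG%:E * \big[maxe/0]_(1 <= l < r.+1)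
     (fun_dep P J X eps eps' (2 * theta) (k%:Z - l%:Z)) `^ theta <= (Delta k)%:E)%E.
Hypothesis hy : dep_solution Delta ybar.
Variable Ce : R.
Hypothesis Ce0 : 0 < Ce.
Hypothesis sg : sub_gaussian P eps Ce.

Lemma rate_bound (a b Ca : R) : 0 <= a -> 0 <= b -> 0 <= Ca -> exists2 K1, 0 < K1 &
  forall (dt N n L L1 s : nat) (p : nat -> nat) fs (fh : T -> 'cV[R]_(r * d) -> 'cV[R]_d) (al A2 : R),
  let C := network_class_lip dt L L1 p s F Lip in
  (r < n)%N -> (2 <= n)%N -> (0 < N <= n)%N ->
  L%:R <= a * log2 n%:R -> s%:R <= b * (N%:R * log2 n%:R) ->
  (forall w, C (fh w) /\ emp_risk Wf n (X ^~ w) (fh w) <= emp_risk Wf n (X ^~ w) fs) ->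
  C fs -> 0 <= al -> (forall x, cube (r * d) x -> `|fs x - f0 x| <= al) ->
  0 <= A2 -> al ^+ 2 <= Ca * (A2 + n%:R^-1) ->
  (\int[P]_w pred_error P X f0 Wf (fh w) <=
    (K1 * (Lambda_dep ybar (N%:R * ln n%:R ^+ 3 / n%:R) + A2))%:E)%E.
Proof.
move=> a0 b0 Ca0.
have [ka [ce [ka0 ce0 mgf hce]]] := innovation_moments d0 model Ce0 sg.
have [CH CH0 entropy] := cover_entropy (r * d + d) a0 b0.
have [la [la0 laF kala]] := step_size F0 ka0.
pose M := 4 * F ^+ 2; have M0 : 0 < M by rewrite mulr_gt0 ?exprn_gt0.
pose CG := 4 * F * (Lip + KL) + 4 * F ^+ 2 * wi.
have LK0 : 0 <= Lip + KL by apply: addr_ge0 => //; exact: ltW.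
have CG0 : 0 <= CG by apply: addr_ge0; rewrite !mulr_ge0 ?sqr_ge0// ltW.
pose cc := coupling_cst (r := r) (d := d) M CG theta / LG.
have cc0 : 0 <= cc by rewrite mulr_ge0 ?sqrtr_ge0// invr_ge0 ltW.
(* As [N >= 1] and [n >= 2], the argument of [Lambda_dep] is at least [(ln 2)^3 / n]; hence terms of
   order [1 / n] are absorbed. *)
pose c1 := (ln 2 ^+ 3)^-1 : R; have l20 : 0 < ln 2 :> R by rewrite ln_gt0// ltr1n.
have c10 : 0 <= c1 by rewrite invr_ge0 exprn_ge0// ltW.
pose di := d%:R^-1 : R; have di0 : 0 <= di by rewrite invr_ge0.
pose c8 := di * (8 / la); have c80 : 0 <= c8 by rewrite mulr_ge0// divr_ge0// ltW.
pose r1 := r.+1%:R : R.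
pose K1 := 4 * r1 * M * CH + 12 * Num.sqrt (CH * r1) * cc + 8 * r1 * c1 + 4 * r1 * c8 * CH
    + 32 * di * ce * c1 + 20 * Ca * (1 + c1) + 18 * c1.
have K10 : 0 <= K1.
  have [CH00 M00] := (ltW CH0, ltW M0).
  rewrite /K1.
  by repeat first [assumption | exact: ler0n | exact: ler01 | exact: sqrtr_ge0
    | apply: addr_ge0 | apply: mulr_ge0].
exists (K1 + 1); first by rewrite ltr_wpDl.
move=> dt N n L L1 s p fs fh al A2 C rn n2 /andP[N0 Nn] hL hs hfh Cs al0 hal A20 hal2.
have CF f : C f -> forall x, `|f x| <= F by move=> /network_class_lip_bounds[].
have CLip f : C f -> forall x y, `|f x - f y| <= Lip * `|x - y| by move=> /network_class_lip_bounds[].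
have n0 : (0 < n)%N by exact: ltnW.
have [I [G [CG' cov card]]] := network_cover n0 (fun f (Cf : C f) => Cf.1).
have I0 : (0 < #|I|)%N.
  by have [i _] := cov _ Cs; apply/card_gt0P; exists i.
pose x := N%:R * ln n%:R ^+ 3 / n%:R : R.
have nR : 1 <= n%:R :> R by rewrite ler1n.
have nR0 : 0 < n%:R :> R by rewrite ltr0n.
have NR : 1 <= N%:R :> R by rewrite ler1n.
have ln2n : ln 2 <= ln n%:R :> R by exact: ln_ge1_bound.
have lnn0 : 0 < ln n%:R :> R by exact: lt_le_trans ln2n.
have x0 : 0 < x by rewrite divr_gt0// mulr_gt0 ?exprn_gt0// (lt_le_trans _ NR).
have D0 := dep_coef_ge0 LG0 hdep.
have [q [q0 qx hq]] := dep_split x0 D0 Dmon hy.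
have [y0 _ _] := hy (ltW x0).
pose H := 1 + ln #|I|%:R : R.
have H0 : 0 <= H by rewrite addr_ge0// ln_ge0// ler1n.
have hH : H <= CH * (n%:R * x).
  rewrite /x [n%:R * _]mulrC divfK ?gt_eqF//.
  by apply: (entropy n N L s #|I| n2 _ hL hs _); [rewrite N0|rewrite addnA].
have mf0 j : measurable_fun [set: vecT R (r * d)] (fun y => f0 y j 0).
  apply: (measurableT_comp (measurable_vec_entry j)) => _ B mB; rewrite setTI.
  exact: (ar_f0_meas model).
have k0 : (0 < n - r)%N by rewrite subn_gt0.
have hb := dependence_class model causal copy LG0 th Dmon hdep r%:Z (g := fun c => loss f0 Wf (G c))
  I0 k0 q0 M0 CG0 (fun c => loss_measurable WL (CLip _ (CG' c)) mf0)
  (fun c x => introT andP (conj (loss_ge0 f0 W01 (G c) x) (loss_le d0 W01 Wcube f0F (CF _ (CG' c)) x)))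
  (fun c x y => loss_lip d0 W01 Wcube WL f0F f0L (CF _ (CG' c)) (CLip _ (CG' c)) x y (ltW F0) LK0) hq.
have := oracle_expectation d0 causal W01 Wcube WL f0F CF CLip rn I0 CG' Cs cov al0 hal hfh ka0 la0 laF kala mgf hce hb.
move=> /le_trans; apply; rewrite lee_fin.
have kR : 0 < (n - r)%:R :> R by rewrite ltr0n.
(* Since [n - r >= 1], the number of summands is comparable to [n] for every admissible [n]. *)
have nk : n%:R <= r1 * (n - r)%:R.
  by rewrite /r1 -natrM ler_nat; clear -rn; nia.
have xL : x <= Num.sqrt x * ybar x.
  apply: le_trans qx; rewrite ler_peMl ?ler1n//; exact: ltW.
have nx : n%:R^-1 <= c1 * x.
  rewrite /c1 /x mulrA -[leLHS]mul1r ler_wpM2r ?invr_ge0// [c1 * _]mulrC ler_pdivlMr ?exprn_gt0// mul1r.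
  have h3 : ln 2 ^+ 3 <= ln n%:R ^+ 3 :> R.
    by rewrite lerXn2r ?nnegrE//; exact: ltW.
  by apply: (le_trans h3); rewrite ler_peMl// exprn_ge0// ltW.
have := rate_arith kR nR nk H0 hH x0 y0 (ler0n R q) (ltW M0) cc0 c80 di0 ce0 (ltW CH0) c10 Ca0 A20 (ler0n R r.+1) qx xL nx hal2.
move=> /le_trans; apply; rewrite -/K1; apply: ler_wpM2r; last by rewrite lerDl.
by rewrite addr_ge0// (le_trans (ltW x0) xL).
Qed.

End rate.

Lemma mul_div_fits {R : realType} (x N C p : nat) : (0 < C)%N -> x%:R * N%:R <= C%:R * p%:R :> R ->
  (x * (N %/ C) <= p)%N.
Proof.
rewrite -!natrM ler_nat => C0 h; rewrite -(leq_pmul2l C0) mulnCA; apply: leq_trans h.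
by rewrite leq_mul// mulnC leq_trunc_div.
Qed.

Lemma log2_ge1 {R : realType} n : (2 <= n)%N -> 1 <= log2 n%:R :> R.
Proof.
move=> n2; rewrite /log2 ler_pdivlMr ?ln_gt0 ?ltr1n// mul1r; exact: ln_ge1_bound.
Qed.

Theorem theorem3p8
  (R : realType) (disp : measure_display) (T : measurableType disp)
  (P : probability T R)
  (d r : nat) (hd : (0 < d)%N) (hr : (0 < r)%N)
  (X eps eps' : int -> T -> 'cV[R]_d)
  (f0 : 'cV[R]_(r * d) -> 'cV[R]_d)
  (hmodel : ar_model P X eps f0)
  (varsigma : R) (hvarsigma : 0 < varsigma)
  (Wf : 'cV[R]_(r * d) -> R)
  (hW01 : forall x, 0 <= Wf x <= 1)
  (hWsupp : closure [set x | Wf x != 0] `<=` cube (r * d))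
  (hWlip : forall x x', `|Wf x - Wf x'| <= varsigma^-1 * `|x - x'|)
  (Ce : R) (hCe : 0 < Ce) (hsubG : sub_gaussian P eps Ce)
  (dt D tdec tenc0 tenc1 : nat) (bdec benc0 benc1 K : R)
  (hbdec : 1 <= bdec) (hbenc0 : 1 <= benc0) (hbenc1 : 1 <= benc1)
  (hK : 1 <= K)
  (g0 : 'cV[R]_(r * d) -> 'cV[R]_D) (g1 : 'cV[R]_D -> 'cV[R]_dt)
  (fdec : 'cV[R]_dt -> 'cV[R]_d)
  (hed : encoder_decoder tdec tenc0 tenc1 bdec benc0 benc1 K f0 g0 g1 fdec)
  (J : (nat -> 'cV[R]_d) -> 'cV[R]_d)
  (hJ : causal_representation P J X eps)
  (hcopy : innovation_copy P eps eps') :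
  exists CL : R, 0 < CL /\
    forall (F Lip : R), 0 < F -> 0 < Lip ->
    let LG := 2 * (d * r)%:R * (2 / varsigma + (Lip + K) / F) in
    forall (theta : R) (Delta : nat -> R) (ybar : R -> R),
    0 < theta <= 1 ->
    (forall k l : nat, (k <= l)%N -> Delta l <= Delta k) ->
    (forall k : nat,
       (LG%:E * \big[maxe/0]_(1 <= l < r.+1)
          (fun_dep P J X eps eps' (2 * theta) (k%:Z - l%:Z)) `^ theta
        <= (Delta k)%:E)%E) ->
    dep_solution Delta ybar ->
    CL <= Lip ->
    forall (N L L1 : nat -> nat) (p : nat -> nat -> nat) (s : nat -> nat)
      (fhat : forall n, 'M[R]_(n, d) -> 'cV[R]_(r * d) -> 'cV[R]_d),
    (forall n, (r < n)%N ->
       [/\ (1 <= N n <= n)%N, (1 <= L1 n <= L n)%N &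
           forall i, (i <= (L n).+1)%N -> (0 < p n i)%N]) ->
    K <= F ->
    (forall n, (r < n)%N ->
       (log2 (4 * Num.max tenc0%:R benc0) + log2 (4 * Num.max tenc1%:R benc1))
         * log2 n%:R <= (L1 n)%:R) ->
    (forall n, (r < n)%N ->
       (L1 n)%:R + log2 (4 * Num.max tdec%:R bdec) * log2 n%:R <= (L n)%:R) ->
    lesssim r (fun n => ((L n)%:R)%:E) (fun n => (log2 (n%:R : R))%:E) ->
    lesssim r (fun n => ((N n)%:R)%:E : \bar R)
      (fun n => \big[mine/+oo%E]_(1 <= i < (L n).+1 | i != L1 n)
                  ((p n i)%:R)%:E) ->
    lesssim r (fun n => ((s n)%:R)%:E)
      (fun n => ((N n)%:R * log2 (n%:R : R))%:E) ->
    lesssim r (fun n => ((N n)%:R * log2 (n%:R : R))%:E)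
      (fun n => ((s n)%:R)%:E) ->
    erm_estimator X Wf
      (fun n => network_class_lip dt (L n) (L1 n) (p n) (s n) F Lip) fhat ->
    let A := Num.min (bdec / tdec%:R)
               (Num.min (benc0 / tenc0%:R) (benc1 / tenc1%:R)) in
    lesssim r
      (fun n => (\int[P]_w pred_error P X f0 Wf (fhat n (sample n (X ^~ w))))%E)
      (fun n => (Lambda_dep ybar ((N n)%:R * ln n%:R ^+ 3 / n%:R)
                 + (N n)%:R `^ (- (2 * A)))%:E).
Proof.
have [CL [CE [CB [n0 [CL0 CE0 CB0 approx]]]]] :=
  encoder_decoder_network hd hr hbdec hbenc0 hbenc1 hK hed.
have [f0K [KL KL0 f0L]] := encoder_decoder_regular hd hr hbdec hbenc0 hbenc1 hK hed.
exists CL; split => // F Lip F0 Lip0 LG theta Delta ybar th Dmon hdep hy CLip N L L1 p s fhat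
  hNL KF d1 d2 [a a0 hL] [cN cN0 hN] [b b0 hs1] [b' b'0 hs2] herm A.
have LG0 : 0 < LG.
  rewrite /LG mulr_gt0// ?mulr_gt0// ?ltr0n ?muln_gt0 ?hd ?hr//.
  by rewrite addr_gt0// divr_gt0// addr_gt0//; exact: lt_le_trans hK.
have wi0 : 0 <= varsigma^-1 by rewrite invr_ge0 ltW.
have Wcube x : Wf x != 0 -> cube (r * d) x.
  by move=> W0; apply: hWsupp; apply: subset_closure.
have f0F x : cube (r * d) x -> `|f0 x| <= F.
  by move=> /f0K h; exact: le_trans h KF.
have [w0] := probability_inhabited P.
have /andP[t00 _] := ed_tenc0 hed; have /andP[t10 _] := ed_tenc1 hed.
have /andP[t20 _] := ed_tdec hed.
have dR : 0 <= d%:R :> R by [].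
(* The network is built for [N %/ C0] instead of [N]: [z1] accounts for the implied constant of the
   widths, [z2] for those of the depth and of the lower bound on [s]. *)
pose z1 := CB%:R * cN : R; pose z2 := CB%:R * (a + d%:R) * b' : R.
have z10 : 0 <= z1 by rewrite mulr_ge0// ltW.
have z20 : 0 <= z2.
  by apply: mulr_ge0; [apply: mulr_ge0 => //; apply: addr_ge0 => //; exact: ltW|exact: ltW].
pose C0 := (Num.truncn (z1 + z2)).+1.
have C0P : z1 + z2 <= C0%:R by apply: ltW; exact: truncnS_gt.
have C00 : (0 < C0)%N by [].
have [c0 c00 grid0] := grid_size C00 t00 (le_trans ler01 hbenc0).
have [c1 c10 grid1] := grid_size C00 t10 (le_trans ler01 hbenc1).
have [c2 c20 grid2] := grid_size C00 t20 (le_trans ler01 hbdec).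
pose cg := c0 + c1 + c2; have cg0 : 0 <= cg by rewrite !addr_ge0.
pose Ca := 2 * CE ^+ 2 * (cg ^+ 2 + 1).
have Ca0 : 0 <= Ca.
  by apply: mulr_ge0; [apply: mulr_ge0 => //|apply: addr_ge0 => //]; exact: sqr_ge0.
have [K1 K10 rate] := rate_bound hd hmodel hJ hcopy hW01 Wcube wi0 hWlip f0F KL0 f0L F0 Lip0
  LG0 th Dmon hdep hy hCe hsubG (ltW a0) (ltW b0) Ca0.
have A0 : 0 <= A.
  by rewrite /A !le_min !divr_ge0//; [exact: le_trans hbenc1|exact: le_trans hbenc0|exact: le_trans hbdec].
have [Adec [Aenc0 Aenc1]] : A <= bdec / tdec%:R /\ A <= benc0 / tenc0%:R /\ A <= benc1 / tenc1%:R.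
  by rewrite /A !ge_min !lexx/= !orbT.
(* If [N] is below [C0], or [n] and hence [N] below [n0], then [N <= Ns], and the trivial bound
   [4 F^2] is at most [K2] times the power of [N] in the rate. *)
pose Ns := maxn C0 n0; pose K2 := 4 * F ^+ 2 * Ns%:R `^ (2 * A).
have F20 : 0 <= 4 * F ^+ 2 by apply: mulr_ge0 => //; exact: sqr_ge0.
have K20 : 0 <= K2 by apply: mulr_ge0 => //; exact: powR_ge0.
exists (K1 + K2) => [|n rn]; first by rewrite ltr_pwDl.
have n2 : (2 <= n)%N by apply: leq_trans rn; rewrite ltnS.
have [/andP[N0 Nn] /andP[L10 L1L] pn] := hNL n rn.
have [_ hfh] := herm n rn.
set C := network_class_lip dt (L n) (L1 n) (p n) (s n) F Lip in hfh.
have CF f : C f -> forall x, `|f x| <= F by move=> /network_class_lip_bounds[].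
have CLp f : C f -> forall x y, `|f x - f y| <= Lip * `|x - y| by move=> /network_class_lip_bounds[].
have n_gt0 : (0 < n)%N by exact: ltnW.
have x0 : 0 <= (N n)%:R * ln n%:R ^+ 3 / n%:R :> R.
  by rewrite divr_ge0// mulr_ge0// exprn_ge0// ln_ge0// ler1n.
have Lam0 : 0 <= Lambda_dep ybar ((N n)%:R * ln n%:R ^+ 3 / n%:R).
  by rewrite mulr_ge0 ?sqrtr_ge0//; have [] := hy _ x0.
have NR : 0 < (N n)%:R :> R by rewrite ltr0n.
have S0 : 0 <= Lambda_dep ybar ((N n)%:R * ln n%:R ^+ 3 / n%:R) + (N n)%:R `^ (- (2 * A)).
  by apply: addr_ge0 => //; exact: powR_ge0.
rewrite -EFinM mulrDl EFinD.
have [small|large] := boolP ((N n < C0)%N || (n < n0)%N).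
  have NNs : (N n <= Ns)%N.
    rewrite leq_max; case/orP: small => h; first by rewrite ltnW.
    by apply/orP; right; apply: (leq_trans Nn); exact: ltnW.
  apply: (le_trans (expected_error_le hd hmodel hJ hW01 Wcube hWlip f0F CF CLp (fun w => (hfh w).1))).
  rewrite -EFinD lee_fin -[leLHS]add0r; apply: lerD; first by apply: mulr_ge0 => //; exact: ltW.
  rewrite mulrDr -[leLHS]add0r; apply: lerD; first exact: mulr_ge0.
  rewrite /K2 powRN -[leRHS]mulrA ler_peMr// ler_pdivlMr ?powR_gt0// mul1r.
  by rewrite ge0_ler_powR ?nnegrE ?mulr_ge0// ler_nat.
rewrite negb_or -!leqNgt in large; have /andP[CN nn0] := large.
have lg1 : 1 <= log2 n%:R :> R by exact: log2_ge1.
have hLn := hL n rn; have hNn := hN n rn; have hs1n := hs1 n rn; have hs2n := hs2 n rn.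
rewrite -!EFinM !lee_fin in hLn hs1n hs2n.
have hw := widths_of_lesssim cN0 hNn.
have [M0 [M0n M0N M0b]] := grid0 _ CN.
have [M1 [M1n M1N M1b]] := grid1 _ CN.
have [M2 [M2n M2N M2b]] := grid2 _ CN.
have wid i : (0 < i <= L n)%N -> i != L1 n -> (CB * (N n %/ C0) <= p n i)%N.
  move=> iL iL1; apply: (@mul_div_fits R) => //.
  apply: (@le_trans _ _ (z1 * (p n i)%:R)).
    by rewrite /z1 -mulrA ler_wpM2l// hw.
  by rewrite ler_wpM2r//; apply: le_trans C0P; rewrite lerDl.
have spars : ((L n + d) * (CB * (N n %/ C0)) <= s n)%N.
  rewrite mulnA; apply: (@mul_div_fits R) => //.
  apply: (@le_trans _ _ (z2 * (s n)%:R)); last first.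
    by rewrite ler_wpM2r//; apply: le_trans C0P; rewrite lerDr.
  apply: (@le_trans _ _ (CB%:R * (a + d%:R) * ((N n)%:R * log2 n%:R))); last first.
    rewrite /z2 -[leRHS]mulrA ler_wpM2l// mulr_ge0// addr_ge0//; exact: ltW.
  rewrite natrM natrD (_ : CB%:R * _ * _ = ((a + d%:R) * log2 n%:R) * CB%:R * (N n)%:R); last by ring.
  by rewrite !ler_wpM2r// mulrDl lerD// ler_peMr.
have N'0 : (0 < N n %/ C0)%N by rewrite divn_gt0.
(* The value of the estimator at one sample point is a member of the class; it supplies the
   equations between [p] and the dimensions [r * d], [d] and [dt]. *)
have [[em [en [Wt [v [_ [_ _ pdt _ _]]]]]] _] := (hfh w0).1.
have leqn M : (0 < M <= N n)%N -> (0 < M <= n)%N.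
  by move=> /andP[-> h]; exact: leq_trans h Nn.
have [fs [Cs fsa]] := approx n (N n %/ C0)%N M0 M1 M2 (L n) (L1 n) (p n) (s n) F Lip
  (And3 nn0 n_gt0 N'0) (And3 (leqn _ M0n) (leqn _ M1n) (leqn _ M2n)) (And3 M0N M1N M2N)
  (d1 n rn) (d2 n rn) (And5 em en pdt wid spars) KF CLip.
pose a1 := (N n)%:R `^ (- A) : R.
have hM : M0%:R `^ (- benc0) + M1%:R `^ (- benc1) + M2%:R `^ (- bdec) <= cg * a1.
  rewrite /cg !mulrDl !lerD//.
  - by apply: (le_trans M0b); exact: grid_exponents.
  - by apply: (le_trans M1b); exact: grid_exponents.
  by apply: (le_trans M2b); exact: grid_exponents.
have nR : 1 <= n%:R :> R by rewrite ler1n.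
have hal := approx_square (ltW CE0) cg0 (powR_ge0 _ _) nR (powR_ge0 _ _) (powR_ge0 _ _) (powR_ge0 _ _) hM.
have a1E : a1 ^+ 2 = (N n)%:R `^ (- (2 * A)).
  by rewrite /a1 -powR_mulrn ?powR_ge0// -powRrM; congr (_ `^ _); ring.
rewrite a1E -/Ca in hal.
have := rate dt (N n) n (L n) (L1 n) (s n) (p n) fs (fun w => fhat n (sample n (X ^~ w))) _ _
  rn n2 _ hLn hs1n (fun w => conj (hfh w).1 ((hfh w).2 _ Cs)) Cs _ fsa (powR_ge0 _ _) hal.
rewrite N0 Nn => /(_ isT) h; apply: (le_trans (h _)).
  by rewrite mulr_ge0 ?addr_ge0 ?powR_ge0 ?invr_ge0// ltW.
by rewrite -EFinD lee_fin lerDl; exact: mulr_ge0.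
Qed.
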